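(* Let $m\ge1$ be an integer, $n=2m+1$, $b<0$, and let $\mathcal T=y\Delta_x+\dfrac{\partial^2}{\partial y^2}$ in $\mathbb R^{n+1}$, where $\Delta_x=\sum_{j=1}^n\partial^2/\partial x_j^2$. Put $a=\tfrac23(-b)^{3/2}$ and, for $y\le0$, $$u=9(|x|^2-a^2)+12a(-y)^{3/2}+4y^3,\qquad v=9(|x|^2-a^2)-12a(-y)^{3/2}+4y^3,$$ $$D^n_{b,-}=\{(x,y)\in\mathbb R^{n+1}:\ y<b,\ 9(|x|^2-a^2)+12a(-y)^{3/2}+4y^3<0\},$$ let $\chi_{D^n_{b,-}}$ be the characteristic function of $D^n_{b,-}$, and set $$A_m=\frac{1}{2^{1/3}3^{1/3}\pi^m},\qquad c_j=\frac{\Gamma(j+5/6)\,\Gamma(j+1/6)}{\Gamma(5/6)\,\Gamma(1/6)\,\Gamma(j+1)}\quad(0\le j\le m).$$ Then the distribution $$E_-(x,y;0,b)=A_m\sum_{j=0}^{m-1}(-1)^jc_j\left(\frac{u-v}{9}\right)^{-j-\frac16}\delta^{(m-j-1)}(u(\cdot))+(-1)^mA_mc_m\left(-\frac v9\right)^{-m-\frac16}F\!\left(\tfrac16,m+\tfrac16,m+1;\tfrac uv\right)\chi_{D^n_{b,-}}(x,y)$$ is a fundamental solution of $\mathcal T$ relative to $(0,b)$ supported by the closure of the set $D^n_{b,-}$. (The notation $\delta^{(q)}(u(\cdot))$ is defined in the context.)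
   Context: $F(\alpha,\beta,\gamma;\zeta)=\sum_{k\ge0}\frac{(\alpha)_k(\beta)_k}{(\gamma)_k\,k!}\zeta^k$ is the Gauss hypergeometric series, with $(\alpha)_0=1$, $(\alpha)_k=\alpha(\alpha+1)\cdots(\alpha+k-1)$. In $D^n_{b,-}$ one has $u<0$, $v<0$, $0<u/v<1$, and for $y<0$ one has $(u-v)/9=\tfrac83a(-y)^{3/2}>0$. Notation $\delta^{(q)}(u(\cdot))$, for an integer $0\le q\le m-1$: with $t=\tfrac23(-y)^{3/2}$ and $t_0=a$ one has $-u/9=(t-t_0)^2-|x|^2$, and $\delta^{(q)}(u(\cdot))$ denotes the distribution $\delta^{(q)}(k)$, $k=(t-t_0)^2-|x|^2$ in the forward cone $t-t_0>|x|$ (corresponding to $D^n_{b,-}$) and $k=0$ outside it, expressed in the variables $(x,y)$. That is, for $\phi\in C_c^\infty(\mathbb R^{n+1})$, $\langle\delta^{(q)}(u(\cdot)),\phi\rangle$ is the value at $\lambda=-q-1$ of the analytic continuation in $\lambda$ of $$\lambda\mapsto\frac{1}{\Gamma(\lambda+1)}\int_{D^n_{b,-}}\left(-\frac u9\right)^{\lambda}\phi(x,y)\,dx\,dy,$$ initially defined for $\operatorname{Re}\lambda>0$. This distribution is supported by the boundary of $D^n_{b,-}$, which is contained in $\{y\le b\}$, where $\left(\frac{u-v}{9}\right)^{-j-1/6}$ is smooth. A fundamental solution of $\mathcal T$ relative to $(0,b)$ is a distribution $E$ on $\mathbb R^{n+1}$ with $\mathcal T E=\delta(x,y-b)$, i.e.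 $\langle E,\mathcal T\phi\rangle=\phi(0,b)$ for all $\phi\in C_c^\infty(\mathbb R^{n+1})$. *)

(* Defs.v *)
From HB Require Import structures.
From mathcomp Require Import all_boot all_order all_algebra.
From mathcomp Require Import all_classical all_reals all_analysis.
From mathcomp Require Import complex.
Set Implicit Arguments. Unset Strict Implicit. Unset Printing Implicit Defensive.
Import Order.TTheory GRing.Theory Num.Theory numFieldNormedType.Exports.
Local Open Scope classical_set_scope.
Local Open Scope ring_scope.
Local Open Scope complex_scope.

Section cons_measure.
Local Open Scope ereal_scope.
Context d (T : measurableType d) (R : realType) (n : nat).
Variables (mu : {sigma_finite_measure set T -> \bar R})
  (nu : {sigma_finite_measure set (n.-tuple T) -> \bar R}).

Definition cons_measure : set (n.+1.-tuple T) -> \bar R :=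
  pushforward (mu \x nu) (fun z : T * n.-tuple T => [tuple of z.1 :: z.2]).

Let measurable_cons_tuple : measurable_fun [set: T * n.-tuple T]
  (fun z : T * n.-tuple T => [tuple of z.1 :: z.2]).
Proof. exact: measurable_cons. Qed.

Let cons_measure0 : cons_measure set0 = 0.
Proof. by rewrite /cons_measure /pushforward preimage_set0 measure0. Qed.

Let cons_measure_ge0 A : 0 <= cons_measure A.
Proof. exact: measure_ge0. Qed.

Let cons_measure_sigma_additive : semi_sigma_additive cons_measure.
Proof.
move=> F mF tF mUF; rewrite /cons_measure /pushforward preimage_bigcup.
apply: measure_semi_sigma_additive.
- by move=> k; rewrite -[X in measurable X]setTI; exact: measurable_cons_tuple.
- apply/trivIsetP => i j _ _ ij; rewrite -preimage_setI.
  by move/trivIsetP : tF => /(_ _ _ _ _ ij) ->//; rewrite preimage_set0.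
- rewrite -preimage_bigcup -[X in measurable X]setTI.
  exact: measurable_cons_tuple.
Qed.

HB.instance Definition _ := isMeasure.Build _ _ _ cons_measure
  cons_measure0 cons_measure_ge0 cons_measure_sigma_additive.

Let cons_measure_sigma_finite : sigma_finite setT cons_measure.
Proof.
have /sigma_finiteP[F [TF ndF Foo]] := sigma_finiteT mu.
have /sigma_finiteP[G [TG ndG Goo]] := sigma_finiteT nu.
pose f (t : n.+1.-tuple T) : T * n.-tuple T := (thead t, [tuple of behead t]).
have mf : measurable_fun setT f.
  by apply/measurable_fun_pair; [exact: measurable_tnth|exact: measurable_behead].
exists (fun k => f @^-1` (F k `*` G k)).
  rewrite -preimage_bigcup (_ : \bigcup_k _ = setT) ?preimage_setT//.
  apply/seteqP; split => // -[x t] _.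
  have [i _ Fix] : (\bigcup_k F k) x by rewrite -TF.
  have [j _ Gjt] : (\bigcup_k G k) t by rewrite -TG.
  exists (maxn i j) => //; split => /=.
  - by move: x Fix; exact/subsetPset/ndF/leq_maxl.
  - by move: t Gjt; exact/subsetPset/ndG/leq_maxr.
move=> k; have [mFk Fkoo] := Foo k; have [mGk Gkoo] := Goo k; split.
  by rewrite -[X in measurable X]setTI; apply: mf => //; exact: measurableX.
rewrite /cons_measure /pushforward -comp_preimage (_ : f \o _ = id).
  by rewrite preimage_id product_measure1E// lte_mul_pinfty// ge0_fin_numE.
apply/funext => -[x t]/=.
by rewrite /f theadE; congr pair; exact: val_inj.
Qed.

HB.instance Definition _ := Measure_isSigmaFinite.Build _ _ _ cons_measure
  cons_measure_sigma_finite.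

End cons_measure.

(* For mu the Lebesgue measure on R, this is the Lebesgue measure on R^n. *)
Section tuple_measure.
Context d (T : measurableType d) (R : realType).

Fixpoint tuple_measure (mu : {sigma_finite_measure set T -> \bar R}) n :
    {sigma_finite_measure set (n.-tuple T) -> \bar R} :=
  if n is n'.+1 then cons_measure mu (tuple_measure mu n')
  else (@dirac _ (0.-tuple T) [tuple] R).
End tuple_measure.

Section complex_analysis.
Variable R : realType.
Local Notation C := R[i].

Definition cintegral d (T : measurableType d) (mu : {measure set T -> \bar R})
    (D : set T) (f : T -> C) : C :=
  (\int[mu]_(x in D) complex.Re (f x)) +i* (\int[mu]_(x in D) complex.Im (f x)).

(* t ^ z = exp (z * ln t), meaningful for t > 0 only. *)
Definition cpow (t : R) (z : C) : C :=
  (expR (complex.Re z * ln t))%:C *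
  (cos (complex.Im z * ln t) +i* sin (complex.Im z * ln t)).

(* Euler's integral, convergent for Re z > 0; it is used only there. *)
Definition Gamma (z : C) : C :=
  cintegral (@lebesgue_measure R) `]0, +oo[
    (fun t : R => cpow t (z - 1) * (expR (- t))%:C).

Definition analytic_at (g : C -> C) (z : C) : Prop :=
  exists (r : R) (a : nat -> C), 0 < r /\
    forall w : C, `|w - z| < r%:C ->
      series (fun k => a k * (w - z) ^+ k : C^o) @ \oo --> (g w : C^o).

End complex_analysis.

Section hypergeometric.
Variable R : realType.

Definition pochhammer (s : R) (k : nat) : R := \prod_(i < k) (s + i%:R).

Definition hypergeometric (al be ga z : R) : R :=
  limn (series (fun k : nat =>
    pochhammer al k * pochhammer be k / (pochhammer ga k * k`!%:R) * z ^+ k)).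

End hypergeometric.

(* R^{n+1} is represented as the product of R^n (variable x) and R (variable
   y). Test functions are real-valued; a complex distribution is determined by
   its values on them, so distributions are functionals from real-valued
   functions to C. *)
Section distributions.
Variables (R : realType) (n : nat).
Local Notation V := ('rV[R]_n * R)%type.
Local Notation C := R[i].

(* Integral with respect to dx dy. *)
Definition vintegral (D : set V) (f : V -> C) : C :=
  let pt (z : n.-tuple (measurableTypeR R) * measurableTypeR R) : V :=
    (\row_i tnth z.1 i, z.2) in
  cintegral (tuple_measure (@lebesgue_measure R) n \x @lebesgue_measure R)%E
    (pt @^-1` D) (f \o pt).

(* Some i is the i-th x-direction and None is the y-direction. *)
Definition direction (o : option 'I_n) : V :=
  if o is Some i then (delta_mx 0 i, 0) else (0, 1).

Fixpoint pderiv (s : seq (option 'I_n)) (f : V -> R) : V -> R :=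
  if s is o :: s' then 'D_(direction o) (pderiv s' f) else f.

Definition smooth (f : V -> R) : Prop :=
  forall s, continuous (pderiv s f) /\
    forall o p, derivable (pderiv s f) p (direction o).

Definition fun_support (f : V -> R) : set V := closure [set p | f p != 0].

Definition test_function (f : V -> R) : Prop :=
  smooth f /\ compact (fun_support f).

Definition distribution_on (E : (V -> R) -> C) : Prop :=
  (forall (c : R) f g, test_function f -> test_function g ->
    E (fun p => c * f p + g p) = c%:C * E f + E g) /\
  (forall K : set V, compact K -> exists (N : nat) (M : R),
    forall f, test_function f -> fun_support f `<=` K ->
    forall B : R,
      (forall s p, (size s <= N)%N -> `|pderiv s f p| <= B) ->
      `|E f| <= (M * B)%:C).

Definition distribution_support (E : (V -> R) -> C) : set V :=
  [set p | forall U : set V, open U -> U p ->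
    exists f, [/\ test_function f, fun_support f `<=` U & E f != 0]].

Definition mul_distribution (h : V -> R) (E : (V -> R) -> C) : (V -> R) -> C :=
  fun f => E (fun p => h p * f p).

Definition regular_distribution (h : V -> R) : (V -> R) -> C :=
  fun f => vintegral setT (fun p => (h p * f p)%:C).

Definition Tricomi (f : V -> R) : V -> R := fun p =>
  p.2 * (\sum_(i < n) pderiv [:: Some i; Some i] f p) +
  pderiv [:: None; None] f p.

(* The Tricomi operator T is formally self-adjoint: T E is f |-> E (T f). *)
Definition fundamental_solution (b : R) (E : (V -> R) -> C) : Prop :=
  distribution_on E /\
  forall f, test_function f -> E (Tricomi f) = (f (0, b))%:C.

End distributions.

Section E_minus.
Variables (R : realType) (n : nat) (b : R).
Local Notation V := ('rV[R]_n * R)%type.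
Local Notation C := R[i].

Definition apar : R := 2 / 3 * (- b) `^ (3 / 2).

Definition sqnorm (x : 'rV[R]_n) : R := \sum_(i < n) x 0 i ^+ 2.

(* ufun, vfun and the powers below are only meaningful for y <= 0; everything they
   enter is integrated over Dminus, where y < b < 0. *)
Definition ufun (p : V) : R :=
  9 * (sqnorm p.1 - apar ^+ 2) + 12 * apar * (- p.2) `^ (3 / 2) + 4 * p.2 ^+ 3.

Definition vfun (p : V) : R :=
  9 * (sqnorm p.1 - apar ^+ 2) - 12 * apar * (- p.2) `^ (3 / 2) + 4 * p.2 ^+ 3.

Definition Dminus : set V := [set p | p.2 < b /\ ufun p < 0].

(* w is the value at -q-1 of the analytic continuation g, from Re > 0 to a
   half-plane containing -q-1 (hence unique), of
     lambda |-> Gamma(lambda + 1)^-1 * \int_Dminus (- u / 9)^lambda f dx dy. *)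
Definition is_delta_u (q : nat) (f : V -> R) (w : C) : Prop :=
  exists (c : R) (g : C -> C),
    [/\ c < - q.+1%:R,
        forall z : C, c < complex.Re z -> analytic_at g z,
        forall z : C, 0 < complex.Re z ->
          g z = (Gamma (z + 1))^-1 *
                vintegral Dminus (fun p => cpow (- ufun p / 9) z * (f p)%:C)
      & w = g (- q.+1%:R)].

(* As only the values of f on Dminus matter, delta_u also applies to products
   of a test function by a function that is smooth near y <= b only. *)
Definition delta_u (q : nat) (f : V -> R) : C := xget 0 [set w | is_delta_u q f w].

Definition Acoef (m : nat) : C :=
  (1 / (2 `^ (1 / 3) * 3 `^ (1 / 3) * pi ^+ m))%:C.

Definition ccoef (j : nat) : C :=
  Gamma (j%:R + 5 / 6) * Gamma (j%:R + 1 / 6) /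
  (Gamma (5 / 6) * Gamma (1 / 6) * Gamma (j%:R + 1)).

Definition Eminus (m : nat) (f : V -> R) : C :=
  Acoef m * (\sum_(j < m) (-1) ^+ j * ccoef j *
    mul_distribution (fun p => ((ufun p - vfun p) / 9) `^ (- j%:R - 1 / 6))
      (delta_u (m - j - 1)) f) +
  (-1) ^+ m * Acoef m * ccoef m *
    regular_distribution (fun p =>
      (- vfun p / 9) `^ (- m%:R - 1 / 6) *
      hypergeometric (1 / 6) (m%:R + 1 / 6) (m%:R + 1) (ufun p / vfun p) *
      \1_Dminus p) f.

End E_minus.

(* Main.v *)
(* On D put s = - y, kappa = (8/3) a and zeta = u / (v - u) > 0, so that
   k = - u / 9 = kappa s^(3/2) zeta.  For p_j = - 1/4 - 3j/2 the operator T maps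
   s^(p_j) k^l / Gamma(l+1) to p_j (p_j - 1) s^(p_j - 2) k^l / Gamma(l+1) plus a multiple of
   s^(p_j - 1/2) k^(l-1) / Gamma(l), the other term of order l - 1 vanishing when l = j - m.
   Hence the sum over j of d_j s^(p_j) delta^(m-j-1)(k), continued to the nonnegative powers
   l = j - m of k for j = m, m+1, m+2, telescopes: only the contribution of the tip (0, b) of
   the cone and one term of order k^2 survive.  These three extra terms are the Taylor
   polynomial of degree 2 of the regular part at the cone, because
   (1+zeta)^(-m-1/6) F(1/6, m+1/6, m+1; zeta/(1+zeta)) solves a hypergeometric equation in
   zeta; the remainder is C^2 across the cone, so that Green's formula applies to it and
   cancels the surviving term.  The tip contribution is invariant under rescaling a single
   coordinate x_i of the test function, so it depends only on the restriction of the test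
   function to the y-axis, where it reduces to a one-dimensional integral. *)
Require Import Defs.
From HB Require Import structures.
From mathcomp Require Import all_boot all_order all_algebra.
From mathcomp Require Import all_classical all_reals all_analysis.
From mathcomp Require Import measurable_realfun gauss_integral complex ring lra.
Import Order.TTheory GRing.Theory Num.Theory numFieldNormedType.Exports.
Set Implicit Arguments. Unset Strict Implicit. Unset Printing Implicit Defensive.
Local Open Scope classical_set_scope.
Local Open Scope ring_scope.

(** * Analytic functions of a complex variable *)

(** All constants come from one formula. With s = - y and k = - u / 9, T maps s^r k^x to r (r - 1)
    s^(r - 2) k^x plus x k^(x - 1) times a combination of s^(r - 1/2) and s^(r + 1), with
    coefficients - kappa (3 r / 2 + 3/8) and 8 r / 3 + 4 x + 2 n - 4/3. For r = - 1/4 the former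
    vanishes; after adjusting the weights one gets the operator [Sl], which trades k^x for 4 x (x +
    m) k^(x - 1). This continues k^z / Gamma(z + 1) to Re z > - m - 1, and the zero of the factor at
    x = - m is what isolates the tip. For r = p_j, n = 2 m + 1 and x = j - m the latter vanishes,
    and d_(j+1) (j + 1) kappa = - d_j (j + 1/6) (j + 5/6) is the condition for neighbouring terms to
    cancel: hence the Gamma quotients c_j. The obstacle is that [delta_u] selects the value of an
    unspecified analytic continuation. Identities are therefore proved for large real exponents,
    where the powers of k are regular enough to integrate by parts, and transported to negative
    integers by the identity theorem; dividing by Gamma requires it to be analytic and free of zeros
    for Re z > 1. *)

Section complex_series.
Variable R : realType.
Local Notation C := R[i].
Local Notation nc := (@Normc.normc R).
Implicit Types (u v a b : nat -> C) (z w l : C).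
Local Open Scope complex_scope.

Lemma normc_ge0 z : 0 <= nc z.
Proof. by case: z => x y /=; exact: sqrtr_ge0. Qed.

Lemma normE z : `|z| = (nc z)%:C. Proof. by []. Qed.

Lemma normc_gt0 z : z != 0 -> 0 < nc z.
Proof.
move=> z0; rewrite lt_def normc_ge0 andbT; apply: contra z0 => /eqP h.
by apply/eqP; exact: Normc.eq0_normc.
Qed.

Lemma normc0 : nc 0 = 0. Proof. exact: Normc.normc0. Qed.

Lemma normcX z k : nc (z ^+ k) = nc z ^+ k.
Proof.
elim: k => [|k ih]; first by rewrite !expr0 Normc.normc1.
by rewrite !exprS Normc.normcM ih.
Qed.

Lemma normcDl z w : nc (z + w) <= nc z + nc w. Proof. exact: le_normcD. Qed.

Lemma normcB z w : nc (z - w) = nc (w - z).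
Proof. by rewrite -normcN opprB. Qed.

Lemma normcR (x : R) : nc x%:C = `|x|.
Proof. by rewrite /= expr0n /= addr0 sqrtr_sqr. Qed.

Lemma normc_sum (I : Type) (r : seq I) (F : I -> C) :
  nc (\sum_(i <- r) F i) <= \sum_(i <- r) nc (F i).
Proof.
elim: r => [|i r ih]; first by rewrite !big_nil normc0.
by rewrite !big_cons (le_trans (normcDl _ _))// lerD2l.
Qed.

Lemma Re_le_normc z : `|complex.Re z| <= nc z.
Proof.
by case: z => x y /=; rewrite -sqrtr_sqr ler_wsqrtr// lerDl sqr_ge0.
Qed.

Lemma Im_le_normc z : `|complex.Im z| <= nc z.
Proof.
by case: z => x y /=; rewrite -sqrtr_sqr ler_wsqrtr// lerDr sqr_ge0.
Qed.

Lemma normc_le_ReIm z : nc z <= `|complex.Re z| + `|complex.Im z|.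
Proof.
case: z => x y /=; rewrite -[leRHS]ger0_norm ?addr_ge0//.
rewrite -sqrtr_sqr ler_wsqrtr// sqrrD !real_normK ?num_real//.
by rewrite lerD2r lerDl mulrn_wge0// mulr_ge0.
Qed.

(** Convergence with a real epsilon and the real-valued modulus, so that estimates take place in R
    and not in the partial order of C. *)
Definition cvgC u l := forall e : R, 0 < e ->
  exists N, forall n, (N <= n)%N -> nc (u n - l) < e.

Lemma cvgCP u l : u @ \oo --> (l : C^o) <-> cvgC u l.
Proof.
split => h.
  have {}h := (cvgrPdist_lt (V := C^o) _ _).1 h.
  move=> e e0; have [|N _ hN] := h _ e%:C; first by rewrite ltcR.
  exists N => n Nn; have := hN n Nn; rewrite normcB.
  by move=> /=; rewrite ltcR.
apply: ((cvgrPdist_lt (V := C^o) _ _).2 _) => e e0.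
have ee : e = (complex.Re e)%:C.
  by rewrite RRe_real// gtr0_real.
have [|N hN] := h (complex.Re e); first by rewrite -ltcR -ee.
exists N => // n Nn; rewrite ee normE ltcR normcB; exact: hN.
Qed.

Lemma cvgC_ReIm u l :
  (complex.Re (u n)) @[n --> \oo] --> complex.Re l ->
  (complex.Im (u n)) @[n --> \oo] --> complex.Im l -> cvgC u l.
Proof.
move=> /cvgrPdist_lt h1 /cvgrPdist_lt h2 e e0.
have e2 : 0 < e / 2 by rewrite divr_gt0.
have [N1 _ hN1] := h1 _ e2; have [N2 _ hN2] := h2 _ e2.
exists (maxn N1 N2) => n; rewrite geq_max => /andP[n1 n2].
rewrite normcB (le_lt_trans (normc_le_ReIm _))// (splitr e) ltrD//.
- by rewrite raddfB; exact: hN1.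
- by rewrite raddfB; exact: hN2.
Qed.

Lemma cvgC_Re u l : cvgC u l ->
  (complex.Re (u n)) @[n --> \oo] --> complex.Re l.
Proof.
move=> h; apply/cvgrPdist_lt => e e0; have [N hN] := h _ e0.
exists N => // n Nn; rewrite -raddfB (le_lt_trans (Re_le_normc _))// normcB.
exact: hN.
Qed.

Lemma cvgC_Im u l : cvgC u l ->
  (complex.Im (u n)) @[n --> \oo] --> complex.Im l.
Proof.
move=> h; apply/cvgrPdist_lt => e e0; have [N hN] := h _ e0.
exists N => // n Nn; rewrite -raddfB (le_lt_trans (Im_le_normc _))// normcB.
exact: hN.
Qed.

Lemma cvgC_unique u l1 l2 : cvgC u l1 -> cvgC u l2 -> l1 = l2.
Proof.
move=> /cvgCP h1 /cvgCP h2.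
exact: (cvg_unique (@norm_hausdorff _ C^o) h1 h2).
Qed.

Lemma cvgC_eq u v l : (forall n, u n = v n) -> cvgC u l -> cvgC v l.
Proof. by move=> uv; rewrite (_ : v = u)//; apply/funext => n; rewrite uv. Qed.

Lemma cvgC_cst l : cvgC (fun=> l) l.
Proof. by move=> e e0; exists 0%N => n _; rewrite subrr normc0. Qed.

Lemma cvgCD u v l1 l2 : cvgC u l1 -> cvgC v l2 ->
  cvgC (fun n => u n + v n) (l1 + l2).
Proof.
by move=> /cvgCP h1 /cvgCP h2; apply/cvgCP; exact: (@cvgD _ C^o _ _ _ _ _ _ _ h1 h2).
Qed.

Lemma cvgCM u v l1 l2 : cvgC u l1 -> cvgC v l2 ->
  cvgC (fun n => u n * v n) (l1 * l2).
Proof.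
by move=> /cvgCP h1 /cvgCP h2; apply/cvgCP; exact: cvgM h1 h2.
Qed.

Lemma cvgC_squeeze u l (f : nat -> R) : (forall n, nc (u n - l) <= f n) ->
  f @ \oo --> (0 : R) -> cvgC u l.
Proof.
move=> uf /cvgrPdist_lt h e e0; have [N _ hN] := h _ e0.
exists N => n Nn; rewrite (le_lt_trans (uf n))//.
have := hN n Nn; rewrite /= sub0r normrN; exact/le_lt_trans/ler_norm.
Qed.

Lemma cvgC_shift u l : cvgC (fun n => u n.+1) l <-> cvgC u l.
Proof.
split => h e e0; have [N hN] := h _ e0.
  by exists N.+1 => -[//|n]; rewrite ltnS; exact: hN.
by exists N => n Nn; apply: hN; exact: leqW.
Qed.

Lemma cvgC_bounded u l : cvgC u l -> exists M, forall n, nc (u n) <= M.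
Proof.
move=> h; have [N hN] := h 1 ltr01.
exists (nc l + 1 + \sum_(i < N) nc (u i)) => n.
have [nN|Nn] := ltnP n N.
  rewrite (bigD1 (Ordinal nN))//= addrCA lerDl.
  by rewrite !addr_ge0 ?normc_ge0// sumr_ge0// => i _; exact: normc_ge0.
rewrite (@le_trans _ _ (nc l + 1))//; last first.
  by rewrite lerDl sumr_ge0// => i _; exact: normc_ge0.
by rewrite -[u n](subrK l) (le_trans (normcDl _ _))// addrC lerD2l ltW// hN.
Qed.

Definition csum a l := cvgC (fun n => \sum_(k < n) a k) l.

Lemma csum_bounded a l : csum a l -> exists M, forall k, nc (a k) <= M.
Proof.
move=> /cvgC_bounded[M hM]; exists (M + M) => k.
have -> : a k = (\sum_(i < k.+1) a i) - \sum_(i < k) a i.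
  by rewrite big_ord_recr/= addrC addrK.
by rewrite (le_trans (normcDl _ _))// lerD// normcN.
Qed.

Lemma csumD a b A B : csum a A -> csum b B -> csum (fun k => a k + b k) (A + B).
Proof.
move=> h1 h2; have := cvgCD h1 h2; apply: cvgC_eq => n.
by rewrite big_split.
Qed.

Lemma csumZ c a A : csum a A -> csum (fun k => c * a k) (c * A).
Proof.
move=> h1; have := cvgCM (cvgC_cst c) h1; apply: cvgC_eq => n.
by rewrite mulr_sumr.
Qed.

Lemma csum_shift a A : csum a A <-> csum (fun k => a k.+1) (A - a 0%N).
Proof.
split => h.
  have := cvgCD ((cvgC_shift _ _).2 h) (cvgC_cst (- a 0%N)).
  apply: cvgC_eq => n; rewrite big_ord_recl addrAC subrr add0r.
  by apply: eq_bigr => i _.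
apply/cvgC_shift; have := cvgCD h (cvgC_cst (a 0%N)); rewrite subrK.
apply: cvgC_eq => n; rewrite big_ord_recl addrC; congr (_ + _).
Qed.

Lemma csum_unique a A B : csum a A -> csum a B -> A = B.
Proof. exact: cvgC_unique. Qed.

Lemma csum_head a : (forall k, a k.+1 = 0) -> csum a (a 0%N).
Proof.
move=> h; apply/csum_shift; rewrite subrr; have := cvgC_cst (0 : C).
by apply: cvgC_eq => n; rewrite big1.
Qed.

Lemma geo_sum_le (q : R) n : 0 <= q < 1 -> \sum_(i < n) q ^+ i <= (1 - q)^-1.
Proof.
move=> /andP[q0 q1]; have p : 0 < 1 - q by rewrite subr_gt0.
rewrite -[leRHS]mul1r ler_pdivlMr// mulrC.
have -> : (1 - q) * \sum_(i < n) q ^+ i = 1 - q ^+ n.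
  by rewrite -opprB mulNr -subrX1 opprB.
by rewrite gerBl exprn_ge0.
Qed.

Lemma natmul_geo_le (q : R) n : 0 <= q < 1 -> n%:R * q ^+ n <= (1 - q)^-1.
Proof.
move=> q01; have /andP[q0 q1] := q01.
rewrite (le_trans _ (geo_sum_le n q01))//.
have -> : n%:R * q ^+ n = \sum_(i < n) q ^+ n.
  by rewrite sumr_const card_ord mulr_natl.
by apply: ler_sum => i _; rewrite ler_wiXn2l ?(ltW q1)// ltnW.
Qed.

(** Writing q as the square of its root, one factor sqrt(q)^n absorbs n and the other tends to 0. *)
Lemma natmul_geo_cvg (q : R) : 0 <= q < 1 -> (n%:R * q ^+ n) @[n --> \oo] --> (0 : R).
Proof.
move=> /andP[q0 q1].
have [s0 s1] : 0 <= Num.sqrt q /\ Num.sqrt q < 1.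
  by rewrite sqrtr_ge0 -sqrtr1 ltr_sqrt.
have ss : q = Num.sqrt q * Num.sqrt q by rewrite -expr2 sqr_sqrtr.
apply: (@squeeze_cvgr _ _ _ _ (fun=> 0)
  (fun n => (1 - Num.sqrt q)^-1 * Num.sqrt q ^+ n)).
- near=> n; rewrite mulr_ge0 ?exprn_ge0//= {1}ss exprMn mulrA.
  by rewrite ler_wpM2r ?exprn_ge0// natmul_geo_le ?s0.
- exact: cvg_cst.
- by apply: cvg_geometric; rewrite ger0_norm.
Unshelve. all: by end_near. Qed.

Lemma cvgC_tail_le b B (M q : R) : 0 <= q < 1 ->
  (forall k, nc (b k) <= M * q ^+ k) -> csum b B ->
  forall n, nc (B - \sum_(k < n) b k) <= M / (1 - q) * q ^+ n.
Proof.
move=> q01 hb hB n; have /andP[q0 q1] := q01.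
have M0 : 0 <= M by have := hb 0%N; rewrite expr0 mulr1; apply/le_trans/normc_ge0.
have st j : nc (\sum_(k < n + j) b k - \sum_(k < n) b k) <= M / (1 - q) * q ^+ n.
  rewrite big_split_ord/= addrAC subrr add0r (le_trans (normc_sum _ _))//.
  apply: (@le_trans _ _ (\sum_(i < j) M * q ^+ n * q ^+ i)).
    by apply: ler_sum => i _; rewrite (le_trans (hb _))// exprD mulrA.
  by rewrite -mulr_sumr [leRHS]mulrAC ler_wpM2l ?geo_sum_le// mulr_ge0 ?exprn_ge0.
apply/ler_addgt0Pr => e e0; have [N hN] := hB _ e0.
rewrite -[B](subrK (\sum_(k < n + N) b k)) -addrA (le_trans (normcDl _ _))// [leRHS]addrC.
by rewrite lerD ?st// normcB ltW// hN// leq_addl.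
Qed.

Definition conv a b k : C := \sum_(i < k.+1) a i * b (k - i)%N.

Lemma sum_conv a b n :
  \sum_(k < n) conv a b k = \sum_(i < n) a i * \sum_(j < n - i) b j.
Proof.
elim: n => [|n ih]; first by rewrite !big_ord0.
rewrite big_ord_recr/= ih /conv [X in _ + X]big_ord_recr/= [RHS]big_ord_recr/=.
rewrite subnn subSn// subnn big_ord_recl big_ord0 addr0 addrA; congr (_ + _).
rewrite -big_split/=; apply: eq_bigr => i _.
by rewrite -mulrDr subSn ?(ltnW (ltn_ord i))// big_ord_recr.
Qed.

(** The partial sum of the Cauchy product differs from B times the partial sum of a by the sum over
    i < n of a_i times the tail of b from n - i on. Each term is O(q^n), so the difference is O(n
    q^n). *)
Lemma csum_conv a b A B (M q : R) : 0 <= q < 1 ->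
  (forall k, nc (a k) <= M * q ^+ k) -> (forall k, nc (b k) <= M * q ^+ k) ->
  csum a A -> csum b B -> csum (conv a b) (A * B).
Proof.
move=> q01 ha hb hA hB; have /andP[q0 q1] := q01.
have M0 : 0 <= M by have := hb 0%N; rewrite expr0 mulr1; apply/le_trans/normc_ge0.
have h0 : cvgC (fun n => \sum_(k < n) conv a b k - (\sum_(k < n) a k) * B) 0.
  apply: (@cvgC_squeeze _ _ (fun n => M * (M / (1 - q)) * (n%:R * q ^+ n))).
    move=> n; rewrite subr0 sum_conv mulr_suml -sumrB.
    rewrite (le_trans (normc_sum _ _))//.
    apply: (@le_trans _ _ (\sum_(i < n) M * (M / (1 - q)) * q ^+ n)).
      apply: ler_sum => i _; rewrite -mulrBr Normc.normcM normcB.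
      have -> : q ^+ n = q ^+ i * q ^+ (n - i).
        by rewrite -exprD subnKC// ltnW.
      by rewrite mulrACA ler_pM ?normc_ge0// (cvgC_tail_le q01 hb).
    by rewrite sumr_const card_ord [leRHS]mulrCA mulr_natl.
  rewrite -[X in _ --> X](mulr0 (M * (M / (1 - q)))).
  by apply: cvgM; [exact: cvg_cst|exact: natmul_geo_cvg].
have := cvgCD h0 (cvgCM hA (cvgC_cst B)); rewrite add0r.
by apply: cvgC_eq => n; rewrite subrK.
Qed.

End complex_series.

(** * Power series expansions, their products and inverses *)

Section analytic.
Variable R : realType.
Local Notation C := R[i].
Local Notation nc := (@Normc.normc R).
Implicit Types (a b : nat -> C) (z w l : C) (g h : C -> C).
Local Open Scope complex_scope.

Lemma analytic_atP g z : analytic_at g z <-> exists (r : R) a, 0 < r /\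
  forall w, nc w < r -> csum (fun k => a k * w ^+ k) (g (z + w)).
Proof.
split => -[r [a [r0 ha]]]; exists r, a; split => // w wr.
  have := ha (z + w); rewrite addrAC subrr add0r normE ltcR => /(_ wr)/cvgCP.
  by apply: cvgC_eq => n; rewrite /series/= big_mkord.
apply/cvgCP; have := ha (w - z); rewrite -ltcR => /(_ wr).
by rewrite [z + _]addrC subrK; apply: cvgC_eq => n; rewrite /series/= big_mkord.
Qed.

(* The ratio is fixed to 1/2 so that two series can be compared on the same disc. *)
Lemma analytic_geo g z : analytic_at g z -> exists (a : nat -> C) (r M : R),
  [/\ 0 < r, forall k, nc (a k) * r ^+ k <= M * 2^-1 ^+ k &
      forall w, nc w <= r -> csum (fun k => a k * w ^+ k) (g (z + w))].
Proof.
move=> /analytic_atP[r [a [r0 ha]]].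
have r2 : 0 < r / 2 by rewrite divr_gt0.
have nr2 : nc (r / 2)%:C = r / 2 by rewrite normcR ger0_norm// ltW.
have [|M hM] := @csum_bounded _ _ _ (ha (r / 2)%:C _).
  by rewrite nr2 ltr_pdivrMr// ltr_pMr// ltr1n.
exists a, (r / 2 / 2), M; split; first by rewrite divr_gt0.
  move=> k; have := hM k; rewrite Normc.normcM normcX nr2.
  by rewrite [in X in _ -> X]exprMn mulrA => h; rewrite ler_wpM2r ?exprn_ge0 ?invr_ge0.
move=> w wr; apply: ha; rewrite (le_lt_trans wr)//.
rewrite -mulrA -[ltRHS]mulr1 ltr_pM2l// -invfM invf_lt1 ?mulr_gt0//.
by rewrite -natrM ltr1n.
Qed.

Lemma geo_analytic g z (a : nat -> C) (r : R) : 0 < r ->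
  (forall w, nc w <= r -> csum (fun k => a k * w ^+ k) (g (z + w))) ->
  analytic_at g z.
Proof.
move=> r0 h; apply/analytic_atP; exists r, a; split => // w /ltW; exact: h.
Qed.

Lemma geo_shrink (a : nat -> C) (r r' M : R) : 0 < r' <= r ->
  (forall k, nc (a k) * r ^+ k <= M * 2^-1 ^+ k) ->
  forall k, nc (a k) * r' ^+ k <= M * 2^-1 ^+ k.
Proof.
move=> /andP[r'0 r'r] h k; apply: le_trans (h k).
by rewrite ler_wpM2l ?normc_ge0// lerXn2r// ?nnegrE ltW// (lt_le_trans r'0).
Qed.

Lemma term_geo (a : nat -> C) (r M : R) w : nc w <= r ->
  (forall k, nc (a k) * r ^+ k <= M * 2^-1 ^+ k) ->
  forall k, nc (a k * w ^+ k) <= M * 2^-1 ^+ k.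
Proof.
move=> wr h k; apply: le_trans (h k); rewrite Normc.normcM normcX.
rewrite ler_wpM2l ?normc_ge0// lerXn2r// ?nnegrE ?normc_ge0//.
exact: le_trans (normc_ge0 _) wr.
Qed.

Lemma half01 : 0 <= (2^-1 : R) < 1.
Proof. by rewrite invr_ge0 ler0n invf_lt1 ?ltr1n. Qed.

Lemma analytic_cst c z : analytic_at (fun=> c) z.
Proof.
apply: (@geo_analytic _ _ (fun k => if k is 0%N then c else 0) 1) => // w _.
apply/csum_shift; rewrite expr0 mulr1 subrr.
by have := cvgC_cst (0 : C); apply: cvgC_eq => n; rewrite big1// => i _; rewrite mul0r.
Qed.

Lemma analytic_id z : analytic_at id z.
Proof.
apply: (@geo_analytic _ _ (fun k => if k is 0%N then z else if k is 1%N then 1 else 0) 1) => // w _.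
apply/csum_shift; rewrite expr0 mulr1 addrAC subrr add0r.
apply/csum_shift; rewrite expr1 mul1r subrr.
by have := cvgC_cst (0 : C); apply: cvgC_eq => n; rewrite big1// => i _; rewrite mul0r.
Qed.

Lemma analyticD g h z : analytic_at g z -> analytic_at h z ->
  analytic_at (fun w => g w + h w) z.
Proof.
move=> /analytic_atP[r [a [r0 ha]]] /analytic_atP[s [b [s0 hb]]].
apply/analytic_atP; exists (Order.min r s), (fun k => a k + b k).
split; first by rewrite lt_min r0.
move=> w; rewrite lt_min => /andP[wr ws].
have := csumD (ha _ wr) (hb _ ws); apply: cvgC_eq => n.
by apply: eq_bigr => k _; rewrite mulrDl.
Qed.

Lemma analyticM g h z : analytic_at g z -> analytic_at h z ->
  analytic_at (fun w => g w * h w) z.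
Proof.
move=> /analytic_geo[a [r [M [r0 ha hga]]]] /analytic_geo[b [s [N [s0 hb hgb]]]].
pose t := Order.min r s; have t0 : 0 < t by rewrite lt_min r0.
have tr : 0 < t <= r by rewrite t0 ge_min lexx.
have ts : 0 < t <= s by rewrite t0 ge_min lexx orbT.
apply: (@geo_analytic _ _ (conv a b) t) => // w wt.
have MN : forall k, M * 2^-1 ^+ k <= Order.max M N * 2^-1 ^+ k.
  by move=> k; rewrite ler_wpM2r ?exprn_ge0 ?invr_ge0// le_max lexx.
have NM : forall k, N * 2^-1 ^+ k <= Order.max M N * 2^-1 ^+ k.
  by move=> k; rewrite ler_wpM2r ?exprn_ge0 ?invr_ge0// le_max lexx orbT.
have := @csum_conv _ _ _ _ _ (Order.max M N) _ half01
  (fun k => le_trans (term_geo wt (geo_shrink tr ha) k) (MN k))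
  (fun k => le_trans (term_geo wt (geo_shrink ts hb) k) (NM k))
  (hga w (le_trans wt _)) (hgb w (le_trans wt _)).
case/andP: tr => _ tr; case/andP: ts => _ ts => /(_ tr ts).
apply: cvgC_eq => n; apply: eq_bigr => k _; rewrite /conv mulr_suml.
apply: eq_bigr => i _; rewrite mulrACA -exprD subnKC//.
by rewrite -ltnS.
Qed.

Lemma analytic_comp_add g c z : analytic_at g (z + c) ->
  analytic_at (fun w => g (w + c)) z.
Proof.
move=> /analytic_atP[r [a [r0 ha]]]; apply/analytic_atP; exists r, a; split => // w.
by rewrite addrAC; exact: ha.
Qed.

Lemma analyticZ c g z : analytic_at g z -> analytic_at (fun w => c * g w) z.
Proof. by move=> hg; exact: (analyticM (analytic_cst c z) hg). Qed.

Lemma analyticB g h z : analytic_at g z -> analytic_at h z ->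
  analytic_at (fun w => g w - h w) z.
Proof.
move=> hg /(analyticZ (-1)) hh.
have -> : (fun w => g w - h w) = (fun w => g w + -1 * h w).
  by apply/funext => w; rewrite mulN1r.
exact: (analyticD hg hh).
Qed.

Lemma analytic_prod (I : Type) (s : seq I) (F : I -> C -> C) z :
  (forall i, analytic_at (F i) z) -> analytic_at (fun w => \prod_(i <- s) F i w) z.
Proof.
move=> hF; elim: s => [|i s ih].
  under [X in analytic_at X]eq_fun do rewrite big_nil.
  exact: analytic_cst.
under [X in analytic_at X]eq_fun do rewrite big_cons.
exact: (analyticM (hF i) ih).
Qed.

(** Each coefficient of the inverse series depends on all earlier ones, so the recursion carries the
    list of the first n + 1 of them. *)
Fixpoint inv_coefs (a : nat -> C) (n : nat) : seq C :=
  if n is n'.+1 then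
    let s := inv_coefs a n' in
    rcons s (- (a 0%N)^-1 * \sum_(i < n) a i.+1 * s`_(n' - i))
  else [:: (a 0%N)^-1].

Definition inv_coef a n := (inv_coefs a n)`_n.

Lemma size_inv_coefs a n : size (inv_coefs a n) = n.+1.
Proof. by elim: n => //= n ih; rewrite size_rcons ih. Qed.

Lemma nth_inv_coefs a n k : (k <= n)%N -> (inv_coefs a n)`_k = inv_coef a k.
Proof.
elim: n => [|n ih]; first by rewrite leqn0 => /eqP->.
rewrite leq_eqVlt => /predU1P[->//|kn] /=.
by rewrite nth_rcons size_inv_coefs kn ih.
Qed.

Lemma inv_coefS a n :
  inv_coef a n.+1 = - (a 0%N)^-1 * \sum_(i < n.+1) a i.+1 * inv_coef a (n - i).
Proof.
rewrite /inv_coef /= nth_rcons size_inv_coefs ltnn eqxx; congr (_ * _).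
by apply: eq_bigr => i _; rewrite nth_inv_coefs// leq_subr.
Qed.

Lemma conv_inv_coef a : a 0%N != 0 ->
  forall n, conv a (inv_coef a) n = if n is 0%N then 1 else 0.
Proof.
move=> a0 [|n]; first by rewrite /conv big_ord_recl big_ord0 addr0 mulfV.
rewrite /conv big_ord_recl subn0 inv_coefS mulrA mulrN mulfV// mulN1r.
by apply/eqP; rewrite addrC subr_eq0.
Qed.

(** Induction with the majorant (D / r)^k / |a_0|: since D - 1 = M / |a_0|, the recursion sums (D -
    1) D^(k - i) over i <= k to D^(k + 1) - 1. *)
Lemma inv_coef_bound a (r M : R) : a 0%N != 0 -> 0 < r ->
  (forall k, nc (a k) * r ^+ k <= M * 2^-1 ^+ k) ->
  exists (q N : R), 0 < q /\ forall k, nc (inv_coef a k) * q ^+ k <= N.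
Proof.
move=> a0 r0 ha.
have M0 : 0 < M.
  by have := ha 0%N; rewrite !expr0 !mulr1; apply/lt_le_trans/normc_gt0.
have na0 := normc_gt0 a0.
pose D := 1 + M / nc (a 0%N).
have D0 : 0 < D by rewrite addr_gt0// divr_gt0.
have hR k : nc (inv_coef a k) <= (nc (a 0%N))^-1 * (D / r) ^+ k.
  elim/ltn_ind: k => -[_|k ih]; first by rewrite expr0 mulr1 -Normc.normcV.
  rewrite inv_coefS Normc.normcM normcN Normc.normcV ler_wpM2l ?invr_ge0 ?normc_ge0//.
  rewrite (le_trans (normc_sum _ _))//.
  apply: (@le_trans _ _ (\sum_(i < k.+1) M / r ^+ i.+1 *
      ((nc (a 0%N))^-1 * (D / r) ^+ (k - i)))).
    apply: ler_sum => i _; rewrite Normc.normcM ler_pM ?normc_ge0//.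
    + rewrite ler_pdivlMr ?exprn_gt0// (le_trans (ha _))//.
      by rewrite ler_piMr ?(ltW M0)// exprn_ile1 ?invr_ge0// invf_le1 ?ler1n.
    + by apply: ih; rewrite ltnS leq_subr.
  rewrite (eq_bigr (fun i : 'I_k.+1 => (r ^- k.+1 * (D - 1)) * D ^+ (k - i))); last first.
    move=> i _; rewrite /D addrAC subrr add0r expr_div_n.
    have -> : r ^+ k.+1 = r ^+ i.+1 * r ^+ (k - i).
      by rewrite -exprD addSn subnKC// -ltnS.
    by rewrite invfM; ring.
  rewrite -mulr_sumr -mulrA (reindex_inj rev_ord_inj)/=.
  under eq_bigr => i _ do rewrite subSS subKn -1?ltnS//.
  rewrite -subrX1 mulrC expr_div_n ler_wpM2r ?invr_ge0 ?exprn_ge0 ?(ltW r0)//.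
  by rewrite gerBl.
exists (r / D), (nc (a 0%N))^-1; split; first by rewrite divr_gt0.
move=> k; rewrite (le_trans (ler_wpM2r _ (hR k)))//; first by rewrite exprn_ge0// ltW// divr_gt0.
rewrite -mulrA -exprMn; have -> : D / r * (r / D) = 1; last by rewrite expr1n mulr1.
by rewrite mulf_div (mulrC r) divff// mulf_neq0// gt_eqF.
Qed.

Lemma csum_geo_ex b (M q : R) : 0 <= q < 1 ->
  (forall k, nc (b k) <= M * q ^+ k) -> exists B, csum b B.
Proof.
move=> /andP[q0 q1] hb.
have cs (f : nat -> R) : (forall k, `|f k| <= M * q ^+ k) -> cvgn (series f).
  move=> hf; apply: normed_cvg.
  apply: (@series_le_cvg _ (fun k => `|f k|) (geometric M q)) => //.
  - by move=> n; rewrite (le_trans (normr_ge0 _) (hf n)).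
  - by apply: is_cvg_geometric_series; rewrite ger0_norm.
have cr := cs _ (fun k => le_trans (Re_le_normc (b k)) (hb k)).
have ci := cs _ (fun k => le_trans (Im_le_normc (b k)) (hb k)).
exists (limn (series (fun k => complex.Re (b k))) +i*
        limn (series (fun k => complex.Im (b k)))).
apply: cvgC_ReIm => /=.
  rewrite (_ : (fun n => _) = series (fun k => complex.Re (b k)))//.
  by apply/funext => n; rewrite raddf_sum /series/= big_mkord.
rewrite (_ : (fun n => _) = series (fun k => complex.Im (b k)))//.
by apply/funext => n; rewrite raddf_sum /series/= big_mkord.
Qed.

(** The formal inverse has a positive radius of convergence, and its Cauchy product with the
    expansion of g is the constant series 1. *)
Lemma analyticV g z : analytic_at g z -> g z != 0 ->
  analytic_at (fun w => (g w)^-1) z.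
Proof.
move=> /analytic_geo[a [r [M [r0 ha hga]]]] gz0.
have a0 : a 0%N != 0.
  have := hga 0; rewrite addr0 normc0 => /(_ (ltW r0)) h.
  have := @csum_head _ (fun k => a k * 0 ^+ k).
  have h0 k : a k.+1 * 0 ^+ k.+1 = 0 by rewrite exprS mul0r mulr0.
  move=> /(_ h0).
  by rewrite expr0 mulr1 => /csum_unique/(_ h)->.
have [q [N [q0 hb]]] := inv_coef_bound a0 r0 ha.
(* Halving q produces the factor 2^(- k) that the Cauchy product needs. *)
pose t := Order.min r (q / 2).
have t0 : 0 < t by rewrite lt_min r0 divr_gt0.
have tr : 0 < t <= r by rewrite t0 ge_min lexx.
have tq : t <= q / 2 by rewrite ge_min lexx orbT.
have hb' k : nc (inv_coef a k) * t ^+ k <= N * 2^-1 ^+ k.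
  rewrite (@le_trans _ _ (nc (inv_coef a k) * (q / 2) ^+ k))//.
    by rewrite ler_wpM2l ?normc_ge0// lerXn2r// ?nnegrE ltW// divr_gt0.
  by rewrite exprMn mulrA ler_wpM2r ?exprn_ge0 ?invr_ge0.
apply: (@geo_analytic _ _ (inv_coef a) t) => // w wt.
have hA := hga w (le_trans wt (proj2 (andP tr))).
have [B hB] := csum_geo_ex half01 (term_geo wt hb').
pose K := Order.max M N.
have MN k : M * 2^-1 ^+ k <= K * 2^-1 ^+ k.
  by rewrite ler_wpM2r ?exprn_ge0 ?invr_ge0// le_max lexx.
have NM k : N * 2^-1 ^+ k <= K * 2^-1 ^+ k.
  by rewrite ler_wpM2r ?exprn_ge0 ?invr_ge0// le_max lexx orbT.
have hAB := csum_conv half01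
  (fun k => le_trans (term_geo wt (geo_shrink tr ha) k) (MN k))
  (fun k => le_trans (term_geo wt hb' k) (NM k)) hA hB.
have : g (z + w) * B = 1.
  have h k : conv (fun k => a k * w ^+ k) (fun k => inv_coef a k * w ^+ k) k
      = conv a (inv_coef a) k * w ^+ k.
    rewrite /conv mulr_suml; apply: eq_bigr => j _.
    by rewrite mulrACA -exprD subnKC// -ltnS.
  have := @csum_head _ (conv (fun k => a k * w ^+ k) (fun k => inv_coef a k * w ^+ k)).
  have h0 k : conv (fun k => a k * w ^+ k) (fun k => inv_coef a k * w ^+ k) k.+1 = 0.
    by rewrite h conv_inv_coef// mul0r.
  move=> /(_ h0).
  by rewrite h conv_inv_coef// expr0 mulr1 => /csum_unique/(_ hAB)->.
move=> gB; suff -> : (g (z + w))^-1 = B by [].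
have gn0 : g (z + w) != 0.
  by apply/eqP => h; move: gB; rewrite h mul0r => /eqP; rewrite eq_sym oner_eq0.
by rewrite -[LHS]mulr1 -gB mulKf.
Qed.

End analytic.

(** * Identity theorem on a half-plane *)

Section identity_theorem.
Variable R : realType.
Local Notation C := R[i].
Local Notation nc := (@Normc.normc R).
Implicit Types (g h : C -> C) (z w e : C).
Local Open Scope complex_scope.

Definition locally0 g z := exists r : R, 0 < r /\ forall w, nc w < r -> g (z + w) = 0.

(** The coefficients at z vanish one after the other: once those below index k do, a zero at
    distance r t gives |a_k| r^k t^k <= 2 M t^(k + 1), with t arbitrarily small. Zeros on one side
    of z are enough, so the lemma applies at the end of an interval of zeros. *)
Lemma locally0_along g z e (d : R) : e != 0 -> 0 < d -> analytic_at g z ->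
  (forall s : R, 0 < s < d -> g (z + s%:C * e) = 0) -> locally0 g z.
Proof.
move=> e0 d0 /analytic_geo[a [r [M [r0 ha hga]]]] g0.
have ne := normc_gt0 e0.
suff a0 k : a k = 0.
  exists r; split => // w /ltW/hga h.
  apply: (cvgC_unique h); have := cvgC_cst (0 : C); apply: cvgC_eq => n.
  by rewrite big1// => i _; rewrite a0 mul0r.
elim/ltn_ind: k => k ih.
have M0 : 0 <= M by have := ha 0%N; rewrite !expr0 !mulr1; apply/le_trans/normc_ge0.
have key t : 0 < t < Order.min 1 (d * nc e / r) -> nc (a k) * r ^+ k <= 2 * M * t.
  move=> /andP[t0]; rewrite lt_min => /andP[t1 td].
  pose s := t * r / nc e.
  have s0 : 0 < s by rewrite divr_gt0// mulr_gt0.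
  have sd : s < d by move: td; rewrite ltr_pdivlMr// ltr_pdivrMr.
  pose w := s%:C * e.
  have nw : nc w = r * t.
    by rewrite /w Normc.normcM normcR gtr0_norm// /s divfK ?gt_eqF// mulrC.
  have wr : nc w <= r by rewrite nw ger_pMr// ltW.
  have := hga w wr; rewrite g0 ?s0// => hs.
  have t2 : 0 <= t / 2 < 1.
    by rewrite divr_ge0 ?(ltW t0)// ltr_pdivrMr// mul1r (lt_trans t1)// ltr1n.
  have hb j : nc (a j * w ^+ j) <= M * (t / 2) ^+ j.
    rewrite Normc.normcM normcX nw !exprMn mulrA [leRHS]mulrA [leRHS]mulrAC.
    by rewrite ler_wpM2r ?exprn_ge0 ?(ltW t0).
  have := cvgC_tail_le t2 hb hs k.+1.
  rewrite big_ord_recr/= big1 ?add0r; last first.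
    by move=> i _; rewrite ih// mul0r.
  rewrite normcN Normc.normcM normcX nw !exprMn mulrA => /le_trans h.
  rewrite -(ler_pM2r (exprn_gt0 k t0)); apply: h.
  have p : 2^-1 <= 1 - t / 2.
    by move: (t1) => {}t1; lra.
  apply: (@le_trans _ _ (M * 2 * t ^+ k.+1)).
    rewrite ler_pM ?mulr_ge0 ?exprn_ge0 ?invr_ge0 ?(le_trans _ p) ?(ltW t0)//.
      by rewrite ler_wpM2l// -[leRHS]invrK lef_pV2// posrE ?(lt_le_trans _ p)// invr_gt0.
    by rewrite ler_piMr ?exprn_ge0 ?(ltW t0)// exprn_ile1 ?invr_ge0// invf_le1// ler1n.
  by rewrite exprS mulrA (mulrC M).
apply/eqP/negPn/negP => /normc_gt0 ak.
have B0 : 0 < nc (a k) * r ^+ k by rewrite mulr_gt0// exprn_gt0.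
have m0 : 0 < Order.min 1 (d * nc e / r) by rewrite lt_min ltr01 divr_gt0// mulr_gt0.
(* Small enough that 2 M t < |a_k| r^k. *)
pose t := Order.min (Order.min 1 (d * nc e / r) / 2) ((nc (a k) * r ^+ k) / (2 * M + 1) / 2).
have M1 : 0 < 2 * M + 1 by rewrite ltr_pwDr// mulr_ge0.
have t0 : 0 < t by rewrite lt_min !divr_gt0.
have tm : t < Order.min 1 (d * nc e / r).
  rewrite (@le_lt_trans _ _ (Order.min 1 (d * nc e / r) / 2)) ?ge_min ?lexx//.
  by rewrite ltr_pdivrMr// ltr_pMr// ltr1n.
have := key t; rewrite t0 tm => /(_ isT); apply/negP; rewrite -ltNge.
have tB : t * (2 * M + 1) < nc (a k) * r ^+ k.
  apply: (@le_lt_trans _ _ ((nc (a k) * r ^+ k) / (2 * M + 1) / 2 * (2 * M + 1))).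
    by rewrite ler_pM2r// ge_min lexx orbT.
  by rewrite mulrAC divfK ?gt_eqF// ltr_pdivrMr// ltr_pMr// ltr1n.
by apply: lt_trans tB; rewrite mulrC ltr_pM2l// ltrDl.
Qed.

Lemma locally0_near g z e : locally0 g z ->
  exists d : R, 0 < d /\ forall s : R, `|s| < d -> locally0 g (z + s%:C * e).
Proof.
move=> [r [r0 hr]]; have n1 : 0 < nc e + 1 by rewrite ltr_pwDr// normc_ge0.
exists (r / 2 / (nc e + 1)); split; first by rewrite !divr_gt0.
move=> s; rewrite ltr_pdivlMr// => hs; exists (r / 2); split; first by rewrite divr_gt0.
move=> w hw; rewrite -addrA hr// (le_lt_trans (normcDl _ _))// [ltRHS]splitr ltrD//.
rewrite Normc.normcM normcR (le_lt_trans _ hs)// ler_wpM2l// lerDl.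
by [].
Qed.

(** Connectedness of [0, 1]: at the supremum t of the parameters up to which g vanishes locally, g
    vanishes at the points just before, hence near t by [locally0_along] in direction - e; by
    openness t cannot be less than 1. *)
Lemma locally0_segment g z e : e != 0 ->
  (forall s : R, 0 <= s <= 1 -> analytic_at g (z + s%:C * e)) ->
  locally0 g z -> locally0 g (z + e).
Proof.
move=> e0 ga g0.
pose A := [set s : R | 0 <= s <= 1 /\ forall s' : R, 0 <= s' <= s -> locally0 g (z + s'%:C * e)].
have A0 : A 0.
  split; first by rewrite lexx ler01.
  by move=> s' /le_anti<-; rewrite mul0r addr0.
have hA : has_sup A.
  by split; [exists 0|exists 1 => s [/andP[]]].
pose t := sup A.
have t0 : 0 <= t by exact: (ub_le_sup hA.2).
have t1 : t <= 1 by apply: (ge_sup hA.1) => s [/andP[]].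
have hlt s : 0 <= s < t -> locally0 g (z + s%:C * e).
  move=> /andP[s0 st]; have ts : 0 < t - s by rewrite subr_gt0.
  have [s1 [_ hs1] s1t] := sup_adherent ts hA.
  apply: hs1; rewrite s0/= ltW// (le_lt_trans _ s1t)//.
  by rewrite opprB addrCA subrr addr0.
have ht : locally0 g (z + t%:C * e).
  move: t0; rewrite le_eqVlt => /predU1P[<-|t0]; first by rewrite mul0r addr0.
  apply: (@locally0_along _ _ (- e) t) => //; first by rewrite oppr_eq0.
    by apply: ga; rewrite ltW.
  move=> s /andP[s0 st].
  have [r [r0 /(_ 0)]] : locally0 g (z + (t - s)%:C * e).
    by apply: hlt; rewrite subr_ge0 ltW//= gtrBl.
  rewrite normc0 addr0 => /(_ r0); congr (g _ = _).
  by rewrite -addrA mulrN -mulrBl -rmorphB.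
have At : A t.
  split; first by rewrite t0.
  move=> s /andP[s0]; rewrite le_eqVlt => /predU1P[->//|st].
  by apply: hlt; rewrite s0.
have [d [d0 hd]] := locally0_near e ht.
have te : t = 1.
  apply/eqP; rewrite eq_le t1/= leNgt; apply/negP => tlt.
  pose s := Order.min 1 (t + d / 2).
  have ts : t < s by rewrite lt_min tlt ltrDl divr_gt0.
  suff /(ub_le_sup hA.2) : A s by rewrite leNgt ts.
  split; first by rewrite (le_trans t0 (ltW ts)) ge_min lexx.
  move=> s' /andP[s'0 s's]; have [s't|ts'] := ltP s' t; first by apply: hlt; rewrite s'0.
  have -> : z + s'%:C * e = z + t%:C * e + (s' - t)%:C * e.
    by rewrite -addrA -mulrDl -rmorphD addrCA subrr addr0.
  apply: hd.
  rewrite ger0_norm ?subr_ge0// (@le_lt_trans _ _ (d / 2))//.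
    by rewrite lerBlDl (le_trans s's)// ge_min lexx orbT.
  by rewrite ltr_pdivrMr// ltr_pMr// ltr1n.
by move: ht; rewrite te mul1r.
Qed.

(** The half-plane is convex, so a segment inside it joins z to a real point x1 beyond both c and
    x0, near which g and h agree because they agree on a real interval starting there. *)
Lemma analytic_identity g h (c x0 : R) :
  (forall z, c < complex.Re z -> analytic_at g z) ->
  (forall z, c < complex.Re z -> analytic_at h z) ->
  (forall x : R, x0 < x -> g x%:C = h x%:C) ->
  forall z, c < complex.Re z -> g z = h z.
Proof.
move=> ga ha gh z cz; pose f w := g w - h w.
have fa w : c < complex.Re w -> analytic_at f w.
  by move=> cw; exact: (analyticB (ga w cw) (ha w cw)).
suff fz : f z = 0 by apply/eqP; rewrite -subr_eq0; exact/eqP.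
pose x1 := Order.max c x0 + 1.
have cx1 : c < x1 by rewrite ltr_pwDr// le_max lexx.
have x01 : x0 < x1 by rewrite ltr_pwDr// le_max lexx orbT.
have l0 : locally0 f x1%:C.
  apply: (@locally0_along _ _ 1 1) => //.
    exact: fa.
  move=> s /andP[s0 _]; rewrite mulr1 -rmorphD /f gh ?subrr//.
  by rewrite ltr_wpDr// ltW.
have [xz|xz] := eqVneq z x1%:C.
  by rewrite /f xz gh// subrr.
have e0 : z - x1%:C != 0 by rewrite subr_eq0.
have [||r [r0 /(_ 0)]] := @locally0_segment f x1%:C _ e0.
- move=> s /andP[s0 s1]; apply: fa.
  case: z cz {xz e0} => a b /= cz.
  rewrite mul0r subr0; have -> : x1 + s * (a - x1) = (1 - s) * x1 + s * a by ring.
  have [->|sn0] := eqVneq s 0; first by rewrite subr0 mul1r mul0r addr0.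
  have sp : 0 < s by rewrite lt_def sn0.
  have -> : c = (1 - s) * c + s * c by ring.
  by rewrite ler_ltD// ?ltr_pM2l// ler_wpM2l ?subr_ge0// ltW.
- exact: l0.
by rewrite normc0 addr0 (addrC _ (z - _)) subrK => /(_ r0).
Qed.

End identity_theorem.

(** * The complex exponential as a power series *)

Section complex_exponential.
Variable R : realType.
Local Notation C := R[i].
Local Notation nc := (@Normc.normc R).
Local Open Scope complex_scope.

Definition cexp (w : C) : C :=
  (expR (complex.Re w))%:C * (cos (complex.Im w) +i* sin (complex.Im w)).

Lemma cpowE (t : R) z : cpow t z = cexp (z * (ln t)%:C).
Proof. by case: z => x y; rewrite /cpow /cexp /= !mulr0 subr0 add0r. Qed.

Lemma cexpD w z : cexp (w + z) = cexp w * cexp z.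
Proof.
case: w => a b; case: z => c d; rewrite /cexp /= expRD cosD sinD.
apply/eqP; rewrite eq_complex /=; apply/andP; split; apply/eqP; ring.
Qed.

Lemma normc_cexp w : nc (cexp w) = expR (complex.Re w).
Proof.
case: w => x y; rewrite /cexp Normc.normcM normcR ger0_norm ?expR_ge0//=.
by rewrite cos2Dsin2 sqrtr1 mulr1.
Qed.

Lemma csum_real (f : nat -> R) (l : R) : series f @ \oo --> l ->
  csum (fun k => (f k)%:C) l%:C.
Proof.
move=> h; apply: cvgC_ReIm => /=.
  rewrite (_ : (fun n => _) = series f)//; apply/funext => n.
  by rewrite raddf_sum /series/= big_mkord.
rewrite (_ : (fun n => _) = cst 0); first exact: cvg_cst.
by apply/funext => n; rewrite raddf_sum big1.
Qed.

Lemma csum_expR (p : R) : csum (fun k => p%:C ^+ k / k`!%:R) (expR p)%:C.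
Proof.
have := @csum_real (exp_coeff p) (expR p).
have -> : (fun k => (exp_coeff p k)%:C) = (fun k => p%:C ^+ k / k`!%:R).
  by apply/funext => k; rewrite exp_coeffE rmorphM mulrC fmorphV/= rmorphXn rmorph_nat.
apply; rewrite expRE; have := is_cvg_series_exp_coeff p; rewrite exp_coeffE; exact.
Qed.

(** Real and imaginary parts are put in the shape of [cos_coeff] and [sin_coeff], where the parity
    factor selects the terms. *)
Lemma exp_i (q : R) k : (0 +i* q) ^+ k =
  ((~~ odd k)%:R * (-1) ^+ k./2 * q ^+ k) +i* ((odd k)%:R * (-1) ^+ k.-1./2 * q ^+ k).
Proof.
have ev j : (0 +i* q) ^+ j.*2 = ((-1) ^+ j * q ^+ j.*2)%:C :> C.
  elim: j => [|j ih]; first by rewrite !expr0 mulr1.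
  rewrite doubleS 2!exprS ih; apply/eqP; rewrite eq_complex /= !exprS.
  by apply/andP; split; apply/eqP; ring.
rewrite -[k](odd_double_half k); case: (odd k); rewrite /= ?add0n ?add1n.
  rewrite exprS ev !odd_double /= doubleK.
  by apply/eqP; rewrite eq_complex /= exprS; apply/andP; split; apply/eqP; ring.
rewrite ev odd_double /= doubleK !mul1r !mul0r.
by [].
Qed.

Lemma csum_cexp_imag (q : R) :
  csum (fun k => (0 +i* q) ^+ k / k`!%:R) (cos q +i* sin q).
Proof.
apply: cvgC_ReIm => /=.
  rewrite (_ : (fun n => _) = series (cos_coeff q)); last first.
    apply/funext => n; rewrite raddf_sum /series/= big_mkord.
    apply: eq_bigr => i _; rewrite -(rmorph_nat (@real_complex_def _ (Phant R))) -fmorphV.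
    by rewrite exp_i /= mulr0 subr0 cos_coeffE mulrAC.
  by rewrite cos.unlock; exact: is_cvg_series_cos_coeff.
rewrite (_ : (fun n => _) = series (sin_coeff q)); last first.
  apply/funext => n; rewrite raddf_sum /series/= big_mkord.
  apply: eq_bigr => i _; rewrite -(rmorph_nat (@real_complex_def _ (Phant R))) -fmorphV.
  by rewrite exp_i /= mulr0 add0r sin_coeffE mulrAC.
by rewrite sin.unlock; exact: is_cvg_series_sin_coeff.
Qed.

Lemma normc_exp_term w k : nc (w ^+ k / k`!%:R) = nc w ^+ k / k`!%:R.
Proof.
rewrite Normc.normcM normcX Normc.normcV -(rmorph_nat (@real_complex_def _ (Phant R))).
by rewrite normcR ger0_norm.
Qed.

(** The terms of the convergent series at 2 |w| are bounded, which gives the ratio 1/2 at w. *)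
Lemma exp_term_geo w : exists M, forall k, nc (w ^+ k / k`!%:R) <= M * 2^-1 ^+ k.
Proof.
have [M hM] := csum_bounded (csum_expR (2 * nc w)).
exists M => k; have := hM k; rewrite !normc_exp_term normcR ger0_norm; last first.
  by rewrite mulr_ge0 ?normc_ge0.
rewrite exprMn -mulrA mulrC -ler_pdivlMr ?exprn_gt0//.
by rewrite exprVn.
Qed.

Lemma conv_exp (x y : C) k :
  conv (fun k => x ^+ k / k`!%:R) (fun k => y ^+ k / k`!%:R) k = (x + y) ^+ k / k`!%:R.
Proof.
rewrite [x + y]addrC exprDn mulr_suml; apply: eq_bigr => i _.
have ik : (i <= k)%N by rewrite -ltnS.
have nz j : (j`!%:R : C) != 0 by rewrite pnatr_eq0 -lt0n fact_gt0.
have : ('C(k, i)%:R : C) * (i`!%:R * (k - i)`!%:R) = k`!%:R.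
  by rewrite -!natrM bin_fact.
have := nz i; have := nz (k - i)%N; have := nz k.
move: (k`!%:R) (i`!%:R) ((k - i)`!%:R) => a b c a0 b0 c0 h.
rewrite -[_ *+ _]mulr_natr mulrACA -invfM (mulrC (x ^+ i)) -[RHS]mulrA; congr (_ * _).
apply: (mulIf (mulf_neq0 c0 b0)); rewrite mulVf ?mulf_neq0//.
by rewrite mulrAC h divff.
Qed.

(** Cauchy product of the series of exp(Re w) and of exp(i Im w). *)
Lemma csum_cexp w : csum (fun k => w ^+ k / k`!%:R) (cexp w).
Proof.
have [M hM] := exp_term_geo (complex.Re w)%:C.
have [N hN] := exp_term_geo (0 +i* complex.Im w).
have l1 k : M * 2^-1 ^+ k <= Order.max M N * 2^-1 ^+ k.
  by rewrite ler_wpM2r ?exprn_ge0 ?invr_ge0// le_max lexx.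
have l2 k : N * 2^-1 ^+ k <= Order.max M N * 2^-1 ^+ k.
  by rewrite ler_wpM2r ?exprn_ge0 ?invr_ge0// le_max lexx orbT.
have := csum_conv (half01 R) (fun k => le_trans (hM k) (l1 k))
  (fun k => le_trans (hN k) (l2 k)) (csum_expR _) (csum_cexp_imag _).
apply: cvgC_eq => n; apply: eq_bigr => k _; rewrite conv_exp.
by case: w {hM hN} => a b; congr (_ ^+ _ / _); rewrite /= -[LHS]/((a + 0) +i* (0 + b)) addr0 add0r.
Qed.

Lemma normc_exp_sum_le w n :
  nc (\sum_(k < n) w ^+ k / k`!%:R) <= expR (nc w).
Proof.
rewrite (le_trans (normc_sum _ _))//; under eq_bigr do rewrite normc_exp_term.
have h : series (exp_coeff (nc w)) @ \oo --> expR (nc w).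
  by rewrite expRE; have := is_cvg_series_exp_coeff (nc w); rewrite exp_coeffE; exact.
have -> : \sum_(k < n) nc w ^+ k / k`!%:R = series (exp_coeff (nc w)) n.
  by rewrite /series/= big_mkord.
rewrite -(cvg_lim _ h)//; apply: nondecreasing_cvgn_le; last by apply/cvg_ex; exists (expR (nc w)).
by apply: nondecreasing_series => k _ _; rewrite exp_coeff_ge0// normc_ge0.
Qed.

End complex_exponential.

(** * Integrals of complex-valued functions *)

Section complex_integral.
Context d (T : measurableType d) (R : realType) (mu : {measure set T -> \bar R}).
Variables (D : set T) (mD : measurable D).
Local Notation C := R[i].
Local Notation nc := (@Normc.normc R).
Local Open Scope complex_scope.
Implicit Types (f g : T -> C).

Lemma le_integrableR (f g : T -> R) : measurable_fun D f ->
  (forall x, D x -> `|f x| <= g x) ->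
  mu.-integrable D (EFin \o g) -> mu.-integrable D (EFin \o f).
Proof.
move=> mf fg; apply: le_integrable => //; first exact/measurable_EFinP.
move=> x Dx /=; rewrite lee_fin (le_trans (fg x Dx))//.
exact: ler_norm.
Qed.

Lemma integrableZR (k : R) (f : T -> R) :
  mu.-integrable D (EFin \o f) -> mu.-integrable D (EFin \o (fun x => k * f x)).
Proof. by move=> /(integrableZl mD k). Qed.

Lemma cvg_RintegralD (f_ : nat -> T -> R) (f G : T -> R) :
  (forall n, measurable_fun D (f_ n)) -> measurable_fun D f ->
  (forall x, D x -> f_ n x @[n --> \oo] --> f x) ->
  mu.-integrable D (EFin \o G) ->
  (forall n x, D x -> `|f_ n x| <= G x) ->
  \int[mu]_(x in D) f_ n x @[n --> \oo] --> \int[mu]_(x in D) f x.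
Proof.
move=> mf_ mf f_f iG fG.
have [] := @dominated_convergence _ _ _ mu D mD (fun n => EFin \o f_ n) (EFin \o f) (EFin \o G).
- by move=> n; exact/measurable_EFinP.
- exact/measurable_EFinP.
- apply: aeW => x Dx; apply: cvg_EFin; first by apply: nearW.
  exact: f_f.
- exact: iG.
- by apply: aeW => x n Dx /=; rewrite lee_fin; exact: fG.
move=> fi _ h; have fin : (\int[mu]_(x in D) (EFin \o f) x)%E \is a fin_num.
  exact: integrable_fin_num.
by apply: fine_cvg; rewrite fineK.
Qed.

Definition cintegrable f := mu.-integrable D (EFin \o (@complex.Re R \o f)) /\
  mu.-integrable D (EFin \o (@complex.Im R \o f)).

Lemma cintegrable_dominated f (G : T -> R) :
  measurable_fun D (@complex.Re R \o f) -> measurable_fun D (@complex.Im R \o f) ->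
  (forall x, D x -> nc (f x) <= G x) -> mu.-integrable D (EFin \o G) -> cintegrable f.
Proof.
move=> mr mi fG iG; split; apply: le_integrableR iG => // x Dx /=.
  exact: le_trans (Re_le_normc _) (fG x Dx).
exact: le_trans (Im_le_normc _) (fG x Dx).
Qed.

Lemma cintegralD f g : cintegrable f -> cintegrable g ->
  cintegral mu D (fun x => f x + g x) = cintegral mu D f + cintegral mu D g.
Proof.
move=> [fr fi] [gr gi]; rewrite /cintegral; apply/eqP; rewrite eq_complex /=.
rewrite -!RintegralD//; apply/andP; split; apply/eqP; apply: eq_Rintegral => x _;
  by rewrite raddfD.
Qed.

Lemma cintegralZ c f : cintegrable f ->
  cintegral mu D (fun x => c * f x) = c * cintegral mu D f.
Proof.
case: c => a b [fr fi]; rewrite /cintegral; apply/eqP; rewrite eq_complex /=.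
rewrite -!RintegralZl// -RintegralB//; [|exact: integrableZR..].
rewrite -RintegralD//; [|exact: integrableZR..].
by apply/andP; split; apply/eqP; apply: eq_Rintegral => x _; case: (f x).
Qed.

Lemma cintegrableD f g : cintegrable f -> cintegrable g -> cintegrable (fun x => f x + g x).
Proof.
move=> [fr fi] [gr gi]; split.
  rewrite (_ : _ \o _ = ((EFin \o (@complex.Re R \o f)) \+ (EFin \o (@complex.Re R \o g)))%E).
    exact: integrableD.
  by apply/funext => x /=; rewrite raddfD.
rewrite (_ : _ \o _ = ((EFin \o (@complex.Im R \o f)) \+ (EFin \o (@complex.Im R \o g)))%E).
  exact: integrableD.
by apply/funext => x /=; rewrite raddfD.
Qed.

Lemma cintegral0 : cintegral mu D (fun=> 0) = 0.
Proof. by rewrite /cintegral /=; congr (_ +i* _); rewrite Rintegral_cst// mul0r. Qed.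

Lemma cintegrable0 : cintegrable (fun=> 0).
Proof. by split; rewrite (_ : _ \o _ = cst 0%E)//; exact: integrable0. Qed.

Lemma cintegrable_sum n (F : 'I_n -> T -> C) : (forall i, cintegrable (F i)) ->
  cintegrable (fun x => \sum_(i < n) F i x).
Proof.
elim: n F => [|n ih] F hF.
  by under eq_fun do rewrite big_ord0; exact: cintegrable0.
by under eq_fun do rewrite big_ord_recr/=; apply: cintegrableD => //; exact: ih.
Qed.

Lemma cintegral_sum n (F : 'I_n -> T -> C) : (forall i, cintegrable (F i)) ->
  cintegral mu D (fun x => \sum_(i < n) F i x) = \sum_(i < n) cintegral mu D (F i).
Proof.
elim: n F => [|n ih] F hF.
  by under eq_fun do rewrite big_ord0; rewrite cintegral0 big_ord0.
under eq_fun do rewrite big_ord_recr/=.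
rewrite cintegralD//; last exact: cintegrable_sum.
by rewrite ih// big_ord_recr.
Qed.

Lemma cvg_cintegral (f_ : nat -> T -> C) f (G : T -> R) :
  (forall n, measurable_fun D (@complex.Re R \o f_ n)) ->
  (forall n, measurable_fun D (@complex.Im R \o f_ n)) ->
  measurable_fun D (@complex.Re R \o f) -> measurable_fun D (@complex.Im R \o f) ->
  (forall x, D x -> cvgC (f_ ^~ x) (f x)) ->
  mu.-integrable D (EFin \o G) ->
  (forall n x, D x -> nc (f_ n x) <= G x) ->
  cvgC (fun n => cintegral mu D (f_ n)) (cintegral mu D f).
Proof.
move=> mr_ mi_ mr mi f_f iG fG; apply: cvgC_ReIm => /=.
  apply: (@cvg_RintegralD _ _ G) => // [x Dx|n x Dx].
    exact: cvgC_Re (f_f x Dx).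
  exact: le_trans (Re_le_normc _) (fG n x Dx).
apply: (@cvg_RintegralD _ _ G) => // [x Dx|n x Dx].
  exact: cvgC_Im (f_f x Dx).
exact: le_trans (Im_le_normc _) (fG n x Dx).
Qed.

Lemma eq_cintegral f g : (forall x, D x -> f x = g x) ->
  cintegral mu D f = cintegral mu D g.
Proof.
by move=> fg; congr (_ +i* _); apply: eq_Rintegral => x /set_mem Dx; rewrite fg.
Qed.

Lemma cintegral_real (f : T -> R) :
  cintegral mu D (fun x => (f x)%:C) = (\int[mu]_(x in D) f x)%:C.
Proof. by rewrite /cintegral /=; congr (_ +i* _); rewrite Rintegral_cst// mul0r. Qed.

Lemma normc_cintegral_le f (G : T -> R) :
  measurable_fun D (@complex.Re R \o f) -> measurable_fun D (@complex.Im R \o f) ->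
  (forall x, D x -> nc (f x) <= G x) -> mu.-integrable D (EFin \o G) ->
  nc (cintegral mu D f) <= 2 * \int[mu]_(x in D) G x.
Proof.
move=> mr mi fG iG; have [ir ii] := cintegrable_dominated mr mi fG iG.
rewrite (le_trans (normc_le_ReIm _))//= mulr_natl mulr2n lerD//.
  rewrite (le_trans (le_normr_Rintegral mD ir))//; apply: le_Rintegral => //.
    exact: (integrable_abse ir).
  by move=> x Dx; exact: le_trans (Re_le_normc _) (fG x Dx).
rewrite (le_trans (le_normr_Rintegral mD ii))//; apply: le_Rintegral => //.
  exact: (integrable_abse ii).
by move=> x Dx; exact: le_trans (Im_le_normc _) (fG x Dx).
Qed.

End complex_integral.

(** * Mellin transforms and the Gamma function *)

Section mellin.
Context d (T : measurableType d) (R : realType) (mu : {measure set T -> \bar R}).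
Variables (D : set T) (mD : measurable D).
Local Notation C := R[i].
Local Notation nc := (@Normc.normc R).
Local Open Scope complex_scope.
Implicit Types (f g : T -> C).

Definition cmeas f := measurable_fun D (@complex.Re R \o f) /\
  measurable_fun D (@complex.Im R \o f).

Lemma cmeasD f g : cmeas f -> cmeas g -> cmeas (fun x => f x + g x).
Proof.
move=> [fr fi] [gr gi]; split.
  rewrite (_ : _ \o _ = (@complex.Re R \o f) \+ (@complex.Re R \o g)).
    exact: measurable_funD.
  by apply/funext => x /=; rewrite raddfD.
rewrite (_ : _ \o _ = (@complex.Im R \o f) \+ (@complex.Im R \o g)).
  exact: measurable_funD.
by apply/funext => x /=; rewrite raddfD.
Qed.

Lemma cmeasM f g : cmeas f -> cmeas g -> cmeas (fun x => f x * g x).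
Proof.
move=> [fr fi] [gr gi]; split.
  rewrite (_ : _ \o _ = ((@complex.Re R \o f) \* (@complex.Re R \o g)) \-
                        ((@complex.Im R \o f) \* (@complex.Im R \o g))).
    by apply: measurable_funB; exact: measurable_funM.
  by apply/funext => x /=; case: (f x) => a b; case: (g x).
rewrite (_ : _ \o _ = ((@complex.Re R \o f) \* (@complex.Im R \o g)) \+
                      ((@complex.Im R \o f) \* (@complex.Re R \o g))).
  by apply: measurable_funD; exact: measurable_funM.
by apply/funext => x /=; case: (f x) => a b; case: (g x).
Qed.

Lemma cmeasR (f : T -> R) : measurable_fun D f -> cmeas (fun x => (f x)%:C).
Proof. by move=> mf; split => //; exact: measurable_cst. Qed.

Lemma cmeas_cst c : cmeas (fun=> c).
Proof. by split; exact: measurable_cst. Qed.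

Lemma cmeasX f n : cmeas f -> cmeas (fun x => f x ^+ n).
Proof.
move=> mf; elim: n => [|n ih]; first by under eq_fun do rewrite expr0; exact: cmeas_cst.
by under eq_fun do rewrite exprS; exact: cmeasM.
Qed.

Lemma cmeas_sum n (F : 'I_n -> T -> C) : (forall i, cmeas (F i)) ->
  cmeas (fun x => \sum_(i < n) F i x).
Proof.
elim: n F => [|n ih] F hF.
  by under eq_fun do rewrite big_ord0; exact: cmeas_cst.
by under eq_fun do rewrite big_ord_recr/=; apply: cmeasD => //; exact: ih.
Qed.

Lemma cmeas_cexp f : cmeas f -> cmeas (fun x => cexp (f x)).
Proof.
move=> [fr fi]; apply: cmeasM.
  by apply: cmeasR; apply: measurableT_comp => //; exact: measurable_expR.
split; rewrite /comp /=.
  by apply: measurableT_comp fi; apply: continuous_measurable_fun; exact: continuous_cos.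
by apply: measurableT_comp fi; apply: continuous_measurable_fun; exact: continuous_sin.
Qed.

Lemma exp_sum_le (x : R) n : 0 <= x -> \sum_(k < n) x ^+ k / k`!%:R <= expR x.
Proof.
move=> x0; have := normc_exp_sum_le x%:C n; rewrite normcR ger0_norm//.
apply: le_trans; rewrite (le_trans _ (Re_le_normc _))// raddf_sum/=.
rewrite (le_trans _ (ler_norm _))// ler_sum// => i _.
rewrite -(rmorph_nat (@real_complex_def _ (Phant R))) -fmorphV -rmorphXn -rmorphM.
by [].
Qed.

Lemma exp_term_le (x : R) k : 0 <= x -> x ^+ k / k`!%:R <= expR x.
Proof.
move=> x0; rewrite (le_trans _ (exp_sum_le k.+1 x0))// big_ord_recr/= lerDr.
by apply: sumr_ge0 => i _; rewrite divr_ge0// exprn_ge0.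
Qed.

Variables (K om : T -> R).
Hypotheses (mK : measurable_fun D K) (mom : measurable_fun D om).

Lemma cmeas_mellin z : cmeas (fun t => cpow (K t) z * (om t)%:C).
Proof.
apply: cmeasM; last exact: cmeasR.
under eq_fun do rewrite cpowE; apply: cmeas_cexp; apply: cmeasM; first exact: cmeas_cst.
by apply: cmeasR; apply: measurableT_comp mK; exact: measurable_ln.
Qed.

(** K^(z0 + w) = K^z0 exp(w ln K) is expanded in powers of w and integrated term by term. For |w| <=
    r every partial sum of the exponential is bounded by exp(r |ln K|), whence that factor in the
    hypothesis on G. *)
Lemma mellin_analytic (z0 : C) (r : R) (G : T -> R) : 0 < r ->
  mu.-integrable D (EFin \o G) ->
  (forall t, D t ->
    expR (complex.Re z0 * ln (K t)) * expR (r * `|ln (K t)|) * `|om t| <= G t) ->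
  analytic_at (fun z => cintegral mu D (fun t => cpow (K t) z * (om t)%:C)) z0.
Proof.
move=> r0 iG hG; pose L t := ln (K t).
have mL : measurable_fun D L by apply: measurableT_comp mK; exact: measurable_ln.
pose F k t := cexp (z0 * (L t)%:C) * (om t)%:C * ((L t)%:C ^+ k / k`!%:R).
have mF k : cmeas (F k).
  apply: cmeasM.
    apply: cmeasM; last exact: cmeasR.
    by apply: cmeas_cexp; apply: cmeasM; [exact: cmeas_cst|exact: cmeasR].
  by apply: cmeasM; [apply: cmeasX; exact: cmeasR|exact: cmeas_cst].
have Re0 t : complex.Re (z0 * (L t)%:C) = complex.Re z0 * L t.
  by case: (z0) => a b; rewrite /= mulr0 subr0.
have iF k : cintegrable mu D (F k).
  have [mr mi] := mF k.
  apply: (cintegrable_dominated mD mr mi (G := fun t => r ^- k * G t)).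
    move=> t Dt; rewrite [leLHS]Normc.normcM [X in X * _]Normc.normcM normc_cexp Re0 normc_exp_term !normcR.
    apply: le_trans (ler_wpM2l _ (hG t Dt)); last by rewrite invr_ge0 exprn_ge0// ltW.
    rewrite -/(L t) (_ : r ^- k * _ = expR (complex.Re z0 * L t) * `|om t| *
      (r ^- k * expR (r * `|L t|))); last by ring.
    rewrite ler_wpM2l ?mulr_ge0 ?expR_ge0// ler_pdivlMl ?exprn_gt0// mulrA -exprMn.
    by rewrite exp_term_le// mulr_ge0// ltW.
  exact: integrableZR.
apply: (@geo_analytic _ _ _ (fun k => cintegral mu D (F k)) r) => // w wr.
have iFw k : cintegrable mu D (fun t => w ^+ k * F k t).
  have [mr mi] := cmeasM (cmeas_cst (w ^+ k)) (mF k).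
  have [ir ii] := iF k.
  have [a b] := (integrableZR mD (nc (w ^+ k)) (integrable_abse ir),
                 integrableZR mD (nc (w ^+ k)) (integrable_abse ii)).
  apply: (cintegrable_dominated mD mr mi (G := fun t => nc (w ^+ k) * (`|complex.Re (F k t)| + `|complex.Im (F k t)|))).
    by move=> t _; rewrite Normc.normcM ler_wpM2l ?normc_ge0// normc_le_ReIm.
  apply: integrableZR => //.
  by have := integrableD mD (integrable_abse ir) (integrable_abse ii).
have fE n t : \sum_(k < n) w ^+ k * F k t =
    cexp (z0 * (L t)%:C) * (om t)%:C * \sum_(k < n) (w * (L t)%:C) ^+ k / k`!%:R.
  rewrite mulr_sumr; apply: eq_bigr => k _; rewrite /F exprMn mulrCA; congr (_ * _).
  by rewrite mulrA.
have := @cvg_cintegral _ _ _ mu D mD (fun n t => \sum_(k < n) w ^+ k * F k t)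
  (fun t => cpow (K t) (z0 + w) * (om t)%:C) G.
have -> : (fun n => cintegral mu D (fun t => \sum_(k < n) w ^+ k * F k t)) =
    (fun n => \sum_(k < n) cintegral mu D (F k) * w ^+ k).
  apply/funext => n; rewrite cintegral_sum//; apply: eq_bigr => k _.
  by rewrite cintegralZ// mulrC.
apply => //.
- by move=> n; have [] := cmeas_sum (fun i : 'I_n => cmeasM (cmeas_cst (w ^+ i)) (mF i)).
- by move=> n; have [] := cmeas_sum (fun i : 'I_n => cmeasM (cmeas_cst (w ^+ i)) (mF i)).
- by have [] := cmeas_mellin (z0 + w).
- by have [] := cmeas_mellin (z0 + w).
- move=> t Dt; rewrite cpowE mulrDl cexpD -(mulrAC (cexp (z0 * _))).
  have := csumZ (cexp (z0 * (L t)%:C) * (om t)%:C) (csum_cexp (w * (L t)%:C)).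
  by apply: cvgC_eq => n; rewrite fE mulr_sumr.
- move=> n t Dt; rewrite fE [leLHS]Normc.normcM [X in X * _]Normc.normcM normc_cexp Re0 normcR.
  apply: le_trans (hG t Dt); rewrite mulrAC ler_wpM2r// ler_wpM2l ?expR_ge0//.
  rewrite (le_trans (normc_exp_sum_le _ _))// ler_expR Normc.normcM normcR.
  by rewrite ler_wpM2r.
Qed.

End mellin.

(** * The real Gamma function *)

Section half_line_integral.
Variable R : realType.
Local Notation mu := (@lebesgue_measure R).
Local Notation Rpos := (`]0, +oo[%classic : set R).

Lemma is_derive_cont (f : R -> R) (x d : R) : is_derive x 1 f d -> {for x, continuous f}.
Proof. by move=> [df _]; apply: differentiable_continuous; exact/derivable1_diffP. Qed.

Lemma cont_expR_half (C x : R) : {for x, continuous (fun t : R => C * expR (- (t / 2)))}.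
Proof. exact: is_derive_cont. Qed.

Lemma cont_expRN (x : R) : {for x, continuous (fun t : R => expR (- t))}.
Proof. exact: is_derive_cont. Qed.

Lemma cont_expR_ln (y x : R) : 0 < x -> {for x, continuous (fun t : R => expR (y * ln t))}.
Proof. by move=> x0; have := is_derive1_ln x0 => dl; exact: is_derive_cont. Qed.

Lemma cvg_expR_half0 (C : R) : (C * expR (- (t / 2))) @[t --> 0^'+] --> C.
Proof.
apply: cvg_at_right_filter.
have h : (C * expR (- (t / 2))) @[t --> (0 : R)] --> C * expR (- (0 / 2)).
  exact: (@cont_expR_half C 0).
by move: h; rewrite mul0r oppr0 expR0 mulr1.
Qed.

(** The half-line is exhausted by the intervals [1/(n + 1), oo[; as f is nonnegative, monotone
    convergence applies and integrability comes out as a result. *)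
Lemma ge0_FTC_0y (f F : R -> R) (l l0 : R) :
  (forall x, 0 < x -> 0 <= f x) -> (forall x, 0 < x -> {for x, continuous f}) ->
  (forall x : R, 0 < x -> is_derive x 1 F (f x)) ->
  F x @[x --> +oo] --> l -> F x @[x --> 0^'+] --> l0 ->
  (\int[mu]_(x in Rpos) (f x)%:E)%E = (l - l0)%:E.
Proof.
move=> f0 cf dF Fl Fl0; pose a n : R := n.+1%:R^-1.
have a0 n : 0 < a n by rewrite invr_gt0.
have mf : measurable_fun Rpos f.
  apply: open_continuous_measurable_fun => //.
  by move=> x; rewrite inE/= in_itv/= andbT; exact: cf.
have -> : Rpos = \bigcup_n `[a n, +oo[%classic.
  apply/seteqP; split => [x /=|x [n _]] /=; rewrite !in_itv/= !andbT; last exact: lt_le_trans.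
  move=> x0; exists (Num.truncn x^-1) => //=; rewrite in_itv/= andbT.
  rewrite -[leRHS]invrK lef_pV2 ?posrE ?invr_gt0// ltW//.
  by rewrite truncnS_gt.
have h : (\int[mu]_(x in `[a i, +oo[%classic) (f x)%:E)%E @[i --> \oo] -->
   (\int[mu]_(x in \bigcup_n `[a n, +oo[%classic) (f x)%:E)%E.
  apply: ge0_nondecreasing_set_cvg_integral.
  - apply/nondecreasing_seqP => n; rewrite subsetEset; apply: subset_itvr.
    by rewrite bnd_simp lef_pV2 ?posrE ?ltr0n// ler_nat.
  - by move=> i; exact: measurable_itv.
  - move=> i; apply/measurable_EFinP; apply: measurable_funS mf => //.
    by apply: subset_itvr; rewrite bnd_simp.
  - move=> i x /=; rewrite in_itv/= andbT => ax.
    by rewrite lee_fin f0// (lt_le_trans (a0 i)).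
have E i : (\int[mu]_(x in `[a i, +oo[%classic) (f x)%:E)%E = (l - F (a i))%:E.
  have P x : a i <= x -> 0 < x by exact/lt_le_trans.
  rewrite (@ge0_continuous_FTC2y _ f F (a i) l)//.
  - by move=> x /P; exact: f0.
  - by apply: continuous_in_subspaceT => x; rewrite inE/= in_itv/= andbT => /P; exact: cf.
  - by move=> x /ltW/P /dF[].
  - have [dFa _] := dF _ (a0 i).
    apply: cvg_at_right_filter.
    by apply: differentiable_continuous; exact/derivable1_diffP.
  - move=> x; rewrite in_itv/= andbT => /ltW/P /dF[_].
    by rewrite derive1E.
rewrite (funext E) in h.
apply: (cvg_unique _ h) => //.
apply: cvg_EFin; first exact: nearW.
apply: cvgB; first exact: cvg_cst.
move/cvg_at_rightP : Fl0; apply; split; first by move=> n; exact: a0.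
exact: cvg_harmonic.
Qed.

Definition gint (x t : R) : R := expR ((x - 1) * ln t) * expR (- t).

Definition rgamma (x : R) : R := \int[mu]_(t in Rpos) gint x t.

(** For t <= 1 the left side is at most 1; for t > 1 it is at most t^k with k > x, which up to the
    factor k! 2^k is a term of the series of exp(t / 2). *)
Lemma expR_ln_le (x : R) : 0 <= x -> exists C, 0 <= C /\
  forall t, 0 < t -> expR (x * ln t) <= C * expR (t / 2).
Proof.
move=> x0; pose k := (Num.truncn x).+1.
have xk : x <= k%:R by rewrite ltW// truncnS_gt.
exists (1 + k`!%:R * 2 ^+ k); split; first by rewrite addr_ge0// mulr_ge0// exprn_ge0.
move=> t t0; have [t1|t1] := leP t 1.
  apply: (@le_trans _ _ 1); first by rewrite -expR0 ler_expR mulr_ge0_le0// ln_le0.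
  rewrite -[leLHS]mul1r ler_pM//; first by rewrite lerDl mulr_ge0// exprn_ge0.
  by rewrite -expR0 ler_expR divr_ge0// ltW.
apply: (@le_trans _ _ (t ^+ k)).
  rewrite -[in leRHS](lnK t0) -expRM_natl ler_expR ler_wpM2r//.
  by rewrite ln_ge0// ltW.
have h := exp_term_le k (divr_ge0 (ltW t0) (ler0n R 2)).
rewrite expr_div_n in h.
have k0 : 0 < k`!%:R :> R by rewrite ltr0n fact_gt0.
have : t ^+ k <= k`!%:R * 2 ^+ k * expR (t / 2).
  rewrite -mulrA -ler_pdivrMl// -ler_pdivrMl ?exprn_gt0//.
  by rewrite (_ : _ * (_ * _) = t ^+ k / 2 ^+ k / k`!%:R)//; ring.
by move/le_trans; apply; rewrite ler_wpM2r ?expR_ge0// lerDr.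
Qed.

Lemma cvg_expR_half : expR (- (t / 2)) @[t --> +oo] --> (0 : R).
Proof.
apply: (cvg_comp _ _ _ (@cvgr_expR R)).
by apply: gt0_cvgMly => //; rewrite invr_gt0.
Qed.

Lemma integral_expR_half (C : R) : 0 <= C ->
  (\int[mu]_(t in Rpos) (C * expR (- (t / 2)))%:E)%E = (2 * C)%:E.
Proof.
move=> C0.
have -> : 2 * C = 0 - (- (2 * C)) by rewrite sub0r opprK.
apply: (@ge0_FTC_0y _ (fun t => - (2 * C) * expR (- (t / 2)))).
- by move=> x _; rewrite mulr_ge0 ?expR_ge0.
- by move=> x _; exact: cont_expR_half.
- move=> x _; apply: is_derive_eq.
  by rewrite !scaler0 add0r /GRing.scale /=; field.
- rewrite -[X in _ --> X](mulr0 (- (2 * C))); apply: cvgM; first exact: cvg_cst.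
  exact: cvg_expR_half.
- exact: cvg_expR_half0.
Qed.

Lemma integrable_expR_half (C : R) : mu.-integrable Rpos (EFin \o (fun t => C * expR (- (t / 2)))).
Proof.
apply: integrableZR => //; apply/integrableP; split.
  apply/measurable_EFinP; apply: measurableT_comp; first exact: measurable_expR.
  by apply: measurable_funTS; apply: measurableT_comp => //; exact: measurable_funM.
rewrite (_ : (\int[mu]_(t in _) `|_|)%E = (\int[mu]_(t in Rpos) (1 * expR (- (t / 2)))%:E)%E).
  by rewrite integral_expR_half// ltry.
by apply: eq_integral => t _ /=; rewrite mul1r ger0_norm// expR_ge0.
Qed.

Lemma measurable_gint x : measurable_fun Rpos (gint x).
Proof.
apply: measurable_funTS; apply: measurable_funM; last first.
  by apply: measurableT_comp => //; exact: measurable_expR.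
apply: measurableT_comp; first exact: measurable_expR.
by apply: measurable_funM => //; exact: measurable_ln.
Qed.

Lemma measurable_Rpos : measurable (Rpos : set (measurableTypeR R)).
Proof. exact: measurable_itv. Qed.

Lemma gint_gt0 x t : 0 < gint x t. Proof. by rewrite mulr_gt0 ?expR_gt0. Qed.

(** The derivative of t^x exp(- t) is x [gint x] - [gint (x + 1)], of varying sign. Adding C exp(- t
    / 2), with C such that this dominates [gint (x + 1)], makes it nonnegative, so one use of the
    fundamental theorem yields both the integrability of [gint x] and the functional equation. *)
Lemma integral_gintS x : 0 < x -> mu.-integrable Rpos (EFin \o gint x) /\
  rgamma (x + 1) = x * rgamma x.
Proof.
move=> x0; have [C [C0 hC]] := expR_ln_le (ltW x0).
have g1 t : gint (x + 1) t = expR (x * ln t) * expR (- t) by rewrite /gint addrK.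
have bnd t : 0 < t -> gint (x + 1) t <= C * expR (- (t / 2)).
  move=> t0; rewrite g1 (_ : expR (- (t / 2)) = expR (t / 2) * expR (- t)).
    by rewrite mulrA ler_wpM2r ?expR_ge0// hC.
  by rewrite -expRD; congr expR; field.
have i1 : mu.-integrable Rpos (EFin \o gint (x + 1)).
  apply: (@le_integrableR _ _ R mu Rpos _ (gint (x + 1)) (fun t => C * expR (- (t / 2)))) => //.
  - exact: measurable_gint.
  - move=> t /=; rewrite in_itv/= andbT => t0; rewrite gtr0_norm ?gint_gt0//.
    exact: bnd.
  - exact: integrable_expR_half.
pose f t := x * gint x t - gint (x + 1) t + C * expR (- (t / 2)).
have If : (\int[mu]_(t in Rpos) (f t)%:E)%E = (2 * C)%:E.
  have -> : 2 * C = 0 - (- (2 * C)) by rewrite sub0r opprK.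
  apply: (@ge0_FTC_0y _ (fun t => expR (x * ln t) * expR (- t) - 2 * C * expR (- (t / 2)))).
  - move=> t t0; rewrite /f -addrA addr_ge0 ?mulr_ge0 ?(ltW x0) ?(ltW (gint_gt0 _ _))//.
    by rewrite addrC subr_ge0 bnd.
  - move=> t t0.
    apply: cvgD; last exact: cont_expR_half.
    apply: cvgB; last by apply: cvgM; [exact: cont_expR_ln|exact: cont_expRN].
    by apply: cvgM; [exact: cvg_cst|apply: cvgM; [exact: cont_expR_ln|exact: cont_expRN]].
  - move=> t t0; have := is_derive1_ln t0 => dl.
    apply: is_derive_eq; rewrite /f g1 /gint !scaler0 ?addr0 ?add0r /GRing.scale /=.
    have -> : expR ((x - 1) * ln t) = expR (x * ln t) / t.
      by rewrite mulrBl mul1r expRB lnK.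
    by field; rewrite gt_eqF.
  - rewrite -[X in _ --> X](subr0 0); apply: cvgB.
      apply: (@squeeze_cvgr _ _ _ _ (fun=> 0) (fun t => C * expR (- (t / 2)))).
      + near=> t; rewrite mulr_ge0 ?expR_ge0//= -g1 bnd//.
      + exact: cvg_cst.
      + rewrite -[X in _ --> X](mulr0 C); apply: cvgM; first exact: cvg_cst.
        exact: cvg_expR_half.
    rewrite -[X in _ --> X](mulr0 (2 * C)); apply: cvgM; first exact: cvg_cst.
    exact: cvg_expR_half.
  - rewrite -[X in _ --> X]add0r; apply: cvgD.
      rewrite -[X in _ --> X](mul0r (expR (- 0))); apply: cvgM.
        apply: cvg_trans (powR_cvg0 x0); apply: near_eq_cvg; near=> t.
        by rewrite /powR gt_eqF.
      by apply: cvg_at_right_filter; exact: cont_expRN.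
    by apply: cvgN; exact: cvg_expR_half0.
have f0 t : 0 < t -> 0 <= f t.
  move=> t0; rewrite /f -addrA addr_ge0 ?mulr_ge0 ?(ltW x0) ?(ltW (gint_gt0 _ _))//.
  by rewrite addrC subr_ge0 bnd.
have mf : measurable_fun Rpos f.
  apply: measurable_funD; last by have /measurable_int/measurable_EFinP := integrable_expR_half C.
  apply: measurable_funB; last exact: measurable_gint.
  by apply: measurable_funM => //; exact: measurable_gint.
have fi : mu.-integrable Rpos (EFin \o f).
  apply/integrableP; split; first exact/measurable_EFinP.
  rewrite (_ : (\int[mu]_(t in _) `|_|)%E = (\int[mu]_(t in Rpos) (f t)%:E)%E).
    by rewrite If ltry.
  apply: eq_integral => t; rewrite inE /= in_itv/= andbT => t0.
  by rewrite ger0_norm// f0.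
have ix : mu.-integrable Rpos (EFin \o gint x).
  rewrite (_ : gint x = fun t => x^-1 * (f t + (gint (x + 1) t + (- C) * expR (- (t / 2))))).
    apply: integrableZR => //.
    have := integrableD _ fi (integrableD _ i1 (integrable_expR_half (- C))).
    by apply.
  apply/funext => t; rewrite /f; field.
  by rewrite gt_eqF.
split => //; rewrite /rgamma.
have : \int[mu]_(t in Rpos) f t = 2 * C by rewrite /Rintegral If.
have e2 : \int[mu]_(t in Rpos) (C * expR (- (t / 2))) = 2 * C.
  by rewrite /Rintegral integral_expR_half.
rewrite RintegralD//; last 2 first.
- have := integrableB _ (integrableZR _ x ix) i1; apply => //.
- exact: integrable_expR_half.
rewrite RintegralB//; last exact: integrableZR.
rewrite RintegralZl// e2 => h; apply/esym/eqP; rewrite -subr_eq0.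
by apply/eqP; apply: (addIr (2 * C)); rewrite h add0r.
Unshelve. all: by end_near. Qed.

(** The integrand is bounded below by a positive constant on [1, 2]. *)
Lemma rgamma_gt0 x : 0 < x -> 0 < rgamma x.
Proof.
move=> x0; have [ix _] := integral_gintS x0.
rewrite lt_def; apply/andP; split; last first.
  by apply: Rintegral_ge0 => t _; rewrite ltW// gint_gt0.
apply/eqP => h.
pose m := expR (- `|x - 1|) * expR (- 2) : R.
have m0 : 0 < m by rewrite mulr_gt0 ?expR_gt0.
have hm t : 1 <= t <= 2 -> m <= gint x t.
  move=> /andP[t1 t2]; have t0 : 0 < t by exact: lt_le_trans t1.
  rewrite ler_pM ?expR_ge0 ?ler_expR ?lerN2//.
  have l0 : 0 <= ln t by rewrite ln_ge0.
  have l1 : ln t <= 1.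
    have tN : -1 < t - 1 by lra.
    have := le_ln1Dx tN; rewrite (_ : 1 + (t - 1) = t); [lra|ring].
  rewrite lerNl (le_trans (ler_norm _))// normrN normrM ler_piMr// ger0_norm//.
have sub : `[1, 2]%classic `<=` Rpos.
  by move=> t /=; rewrite !in_itv/= andbT => /andP[t1 _]; exact: lt_le_trans t1.
suff : ((m : R)%:E <= 0%:E)%E by rewrite lee_fin leNgt m0.
have <- : (\int[mu]_(t in Rpos) (gint x t)%:E)%E = 0%:E.
  by rewrite -[LHS]fineK ?integrable_fin_num//; congr EFin.
apply: (@le_trans _ _ (\int[mu]_(t in `[1%R, 2%R]) (gint x t)%:E)%E); last first.
  apply: ge0_subset_integral => //.
    by apply/measurable_EFinP; exact: measurable_gint.
  by move=> t _; rewrite lee_fin ltW// gint_gt0.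
have -> : m%:E = (\int[mu]_(t in `[1%R, 2%R]) m%:E)%E.
  rewrite integral_cst//= lebesgue_measure_itv/= lte_fin ltr1n/= -EFinD -EFinM.
  by congr EFin; rewrite -[LHS]mulr1; congr (_ * _); ring.
apply: ge0_le_integral => //.
- by move=> t _; rewrite lee_fin ltW.
- apply/measurable_EFinP; apply: measurable_funS (measurable_gint x) => //.
Qed.

Lemma rgammaS x : 0 < x -> rgamma (x + 1) = x * rgamma x.
Proof. by move=> /integral_gintS[]. Qed.

Lemma integrable_gint x : 0 < x -> mu.-integrable Rpos (EFin \o gint x).
Proof. by move=> /integral_gintS[]. Qed.

End half_line_integral.

(** * Analyticity and absence of zeros of Gamma for Re z > 1 *)

Section complex_gamma.
Variable R : realType.
Local Notation C := R[i].
Local Notation nc := (@Normc.normc R).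
Local Notation mu := (@lebesgue_measure R).
Local Notation Rpos := (`]0, +oo[%classic : set R).
Local Open Scope complex_scope.

Lemma cpow_real (t x : R) : cpow t x%:C = (expR (x * ln t))%:C.
Proof.
rewrite /cpow /= mul0r cos0 sin0; apply/eqP.
by rewrite eq_complex /= !mul0r !mulr0 subr0 mulr1 addr0 !eqxx.
Qed.

Lemma Gamma_real (x : R) : Gamma x%:C = (rgamma x)%:C.
Proof.
rewrite /Gamma /rgamma -cintegral_real//; apply: eq_cintegral => // t _.
by rewrite -rmorphB cpow_real -rmorphM.
Qed.

(** The radius is taken to be x = Re z - 1: the quantity t^x exp(x |ln t|) to dominate is then 1 for
    t <= 1 and t^(2 x) for t > 1. *)
Lemma Gamma_analytic z : 1 < complex.Re z -> analytic_at (@Gamma R) z.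
Proof.
move=> z1; pose x := complex.Re (z - 1).
have x0 : 0 < x by case: z z1 @x => a b /=; rewrite subr_gt0.
have x2 : 0 <= 2 * x by rewrite mulr_ge0// ltW.
have [A [A0 hA]] := expR_ln_le x2.
rewrite /Gamma; apply: (analytic_comp_add (g := fun z => cintegral mu Rpos
  (fun t => cpow t z * (expR (- t))%:C)) (c := -1)).
apply: (@mellin_analytic _ _ R mu Rpos _ id (fun t => expR (- t)) _ _ (z - 1) x
  (fun t => (1 + A) * expR (- (t / 2)))) => //.
- by apply: measurableT_comp => //; exact: measurable_expR.
- exact: integrable_expR_half.
- move=> t /=; rewrite in_itv/= andbT => t0.
  rewrite (ger0_norm (expR_ge0 _)) -/x.
  have -> : expR (- (t / 2)) = expR (t / 2) * expR (- t).
    by rewrite -expRD; congr expR; field.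
  rewrite mulrA ler_wpM2r ?expR_ge0// -expRD.
  have e1 : 1 <= expR (t / 2) by rewrite -expR0 ler_expR divr_ge0// ltW.
  have [t1|t1] := leP t 1.
    rewrite ler0_norm ?ln_le0// mulrN subrr expR0 (le_trans e1)//.
    by rewrite ler_peMl ?expR_ge0// lerDl.
  rewrite ger0_norm ?ln_ge0 ?(ltW t1)// (_ : _ + _ = 2 * x * ln t); last by ring.
  rewrite (le_trans (hA _ t0))//.
  by rewrite ler_wpM2r ?expR_ge0// lerDr.
Qed.

Lemma GammaS (z : C) : 1 < complex.Re z -> Gamma (z + 1) = z * Gamma z.
Proof.
apply: (@analytic_identity _ (fun z => Gamma (z + 1)) (fun z => z * Gamma z) 1 1).
- move=> {}z z1; apply: analytic_comp_add; apply: Gamma_analytic.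
  by case: z z1 => a b /= a1; rewrite ltr_wpDr.
- by move=> {}z z1; exact: (analyticM (analytic_id z) (Gamma_analytic z1)).
- move=> x x1; have -> : x%:C + 1 = (x + 1)%:C by rewrite rmorphD.
  by rewrite !Gamma_real rgammaS ?(lt_trans ltr01)// rmorphM.
Qed.

Lemma norm_cexp_imagB (a b : R) :
  nc ((cos a +i* sin a) - (cos b +i* sin b)) <= 2 * `|a - b|.
Proof.
have lip (f g : R -> R) : (forall x : R, is_derive x 1 f (g x)) -> (forall x, `|g x| <= 1) ->
    `|f a - f b| <= `|a - b|.
  move=> df g1; wlog ab : a b / a < b.
    move=> W; have [ab|ba|->] := ltgtP a b; last by rewrite !subrr normr0.
      exact: W.
    by rewrite distrC (distrC a); exact: W.
  have [|c _ E] := @MVT R f g a b ab (fun x _ => df x).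
    by apply: derivable_within_continuous => x _; have [] := df x.
  by rewrite distrC (distrC a) E normrM ler_piMl.
rewrite (le_trans (normc_le_ReIm _))//= mulr_natl mulr2n lerD//.
  by apply: (lip _ (fun x => - sin x)) => x; rewrite normrN ler_norml sin_geN1 sin_le1.
by apply: (lip _ cos) => x; rewrite ler_norml cos_geN1 cos_le1.
Qed.

(** With s = exp(l) this reads l^2 <= 2 (exp(l) + exp(- l) - 2); for l >= 0 it follows from 1 + l +
    l^2 / 2 <= exp(l) and 1 - l <= exp(- l). *)
Lemma sqr_ln_le (s : R) : 0 < s -> ln s ^+ 2 <= 2 * (s + s^-1 - 2).
Proof.
move=> s0; have P x : 0 <= x -> x ^+ 2 <= 2 * (expR x + expR (- x) - 2) :> R.
  move=> x0; have := exp_sum_le 3 x0.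
  rewrite !big_ord_recr big_ord0 /= add0r expr0 expr1 !factS fact0 !divr1 => h1.
  have h2 := expR_ge1Dx (- x).
  have -> : x ^+ 2 = 2 * (x ^+ 2 / (3 * (2 * (1 * 1)))%N%:R * 3) by field.
  have : 0 <= x ^+ 2 := sqr_ge0 _; lra.
have e : expR (ln s) = s by rewrite lnK.
have eN : expR (- ln s) = s^-1 by rewrite expRN e.
have [l0|/ltW l0] := leP 0 (ln s); first by have := P _ l0; rewrite e eN.
have := P (- ln s); rewrite oppr_ge0 opprK e eN sqrrN => /(_ l0).
by rewrite (addrC s^-1).
Qed.

(* Compares the integrand of [Gamma (X + i y)] with [X ^ (i y)] times that of [Gamma X]. *)
Lemma gamma_integrand_close (X y t e : R) : 0 < X -> 0 < t -> 0 < e ->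
  nc (cexp (((X - 1) +i* y) * (ln t)%:C) * (expR (- t))%:C -
      (cos (y * ln X) +i* sin (y * ln X)) * (gint X t)%:C)
  <= `|y| * (e + 2 / e * (t / X + X / t - 2)) * gint X t.
Proof.
move=> X0 t0 e0.
have -> : cexp (((X - 1) +i* y) * (ln t)%:C) * (expR (- t))%:C =
    (cos (y * ln t) +i* sin (y * ln t)) * (gint X t)%:C.
  rewrite /cexp /gint /= !mulr0 subr0 add0r rmorphM.
  by rewrite mulrAC -rmorphM mulrC.
rewrite -mulrBl Normc.normcM normcR gtr0_norm ?gint_gt0// ler_wpM2r ?(ltW (gint_gt0 _ _))//.
rewrite (le_trans (norm_cexp_imagB _ _))// -mulrBr normrM mulrCA ler_wpM2l//.
have s0 : 0 < t / X by rewrite divr_gt0.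
have lE : ln t - ln X = ln (t / X) by rewrite ln_div ?posrE.
have := sqr_ln_le s0; rewrite -lE invf_div -(real_normK (num_real (ln t - ln X))).
set w := `|_|; set q := _ - 2 => h.
have : 0 <= (w - e) ^+ 2 := sqr_ge0 _.
rewrite sqrrB => h2.
rewrite (_ : e + _ = (e ^+ 2 + 2 * q) / e); last by field; rewrite gt_eqF.
rewrite ler_pdivlMr//; apply: le_trans (lerD (lexx _) h).
by rewrite -subr_ge0 (_ : _ - _ = w ^+ 2 - w * e *+ 2 + e ^+ 2)//; ring.
Qed.

(** Gamma(X + 1) / X + X Gamma(X - 1) - 2 Gamma(X) = Gamma(X) / (X - 1). This measures how strongly
    the mass of [gint X] concentrates around t = X as X grows. *)
Lemma integral_close (X : R) : 1 < X ->
  mu.-integrable Rpos (EFin \o (fun t => (t / X + X / t - 2) * gint X t)) /\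
  \int[mu]_(t in Rpos) ((t / X + X / t - 2) * gint X t) = rgamma X / (X - 1).
Proof.
move=> X1; have X0 : 0 < X by exact: lt_trans X1.
have X10 : 0 < X - 1 by rewrite subr_gt0.
pose h t := X^-1 * gint (X + 1) t + (X * gint (X - 1) t + (- 2) * gint X t).
have E t : 0 < t -> (t / X + X / t - 2) * gint X t = h t.
  move=> t0; rewrite /h /gint addrK.
  have -> : expR (X * ln t) = t * expR ((X - 1) * ln t).
    by rewrite mulrBl mul1r expRB lnK// [RHS]mulrC divfK ?gt_eqF.
  have -> : expR ((X - 1 - 1) * ln t) = expR ((X - 1) * ln t) / t.
    by rewrite [X in expR X]mulrBl mul1r expRB lnK.
  by field; rewrite !gt_eqF.
have i1 := integrableZR (@measurable_Rpos R) X^-1 (integrable_gint (addr_gt0 X0 ltr01)).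
have i2 := integrableZR (@measurable_Rpos R) X (integrable_gint X10).
have i3 := integrableZR (@measurable_Rpos R) (- 2) (integrable_gint X0).
have i23 : mu.-integrable Rpos (EFin \o (fun t => X * gint (X - 1) t + (- 2) * gint X t)).
  by have := integrableD (@measurable_Rpos R) i2 i3; apply.
have ih : mu.-integrable Rpos (EFin \o h).
  by have := integrableD (@measurable_Rpos R) i1 i23; apply.
split.
  apply: eq_integrable ih => // t; rewrite inE /= in_itv/= andbT => t0.
  by rewrite E.
transitivity (\int[mu]_(t in Rpos) h t).
  by apply: eq_Rintegral => t; rewrite inE /= in_itv/= andbT => t0; rewrite E.
have -> : \int[mu]_(t in Rpos) h t =
    X^-1 * rgamma (X + 1) + (X * rgamma (X - 1) + - 2 * rgamma X).
  apply: (etrans (RintegralD (@measurable_Rpos R) i1 i23)); congr (_ + _).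
    by apply: RintegralZl => //; apply: integrable_gint; rewrite addr_gt0.
  apply: (etrans (RintegralD (@measurable_Rpos R) i2 i3)).
  by congr (_ + _); apply: RintegralZl => //; exact: integrable_gint.
have rX : rgamma X = (X - 1) * rgamma (X - 1) by rewrite -rgammaS// subrK.
by rewrite rgammaS// rX; field; rewrite !gt_eqF.
Qed.

(** Since the mass of [gint X] sits near t = X, Gamma(X + i y) differs from X^(i y) Gamma(X) by less
    than Gamma(X), which is the modulus of the latter. *)
Lemma Gamma_large_neq0 (X y : R) : 1 + 32 * (`|y| + 1) ^+ 2 < X -> Gamma (X +i* y) != 0.
Proof.
move=> hX; set Y := `|y| + 1 in hX.
have Y0 : 0 < Y by rewrite ltr_pwDr.
have X1 : 1 < X by apply: le_lt_trans hX; rewrite lerDl mulr_ge0// sqr_ge0.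
have X0 : 0 < X by exact: lt_trans X1.
(* Balances the two errors: |y| e < 1/4, and 8 |y| Y / (X - 1) <= 1/4 because X - 1 > 32 Y^2. The
   factor 2 of [normc_cintegral_le] then leaves a total below 1. *)
pose e := (4 * Y)^-1; have e0 : 0 < e by rewrite invr_gt0 mulr_gt0.
pose c : C := cos (y * ln X) +i* sin (y * ln X).
have nc1 : nc c = 1 by rewrite /= cos2Dsin2 sqrtr1.
have [iq Iq] := integral_close X1.
have ig := integrable_gint X0.
pose G t := `|y| * (e + 2 / e * (t / X + X / t - 2)) * gint X t.
have GE t : G t = (`|y| * e) * gint X t + (`|y| * (2 / e)) * ((t / X + X / t - 2) * gint X t).
  by rewrite /G; ring.
have j1 := integrableZR (@measurable_Rpos R) (`|y| * e) ig.
have j2 := integrableZR (@measurable_Rpos R) (`|y| * (2 / e)) iq.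
have iG : mu.-integrable Rpos (EFin \o G).
  rewrite (funext GE); have := integrableD (@measurable_Rpos R) j1 j2; exact.
have IG : \int[mu]_(t in Rpos) G t = (`|y| * e + `|y| * (2 / e) / (X - 1)) * rgamma X.
  rewrite (funext GE) RintegralD// !RintegralZl// -/(rgamma X) Iq.
  by ring.
pose f t := cexp (((X - 1) +i* y) * (ln t)%:C) * (expR (- t))%:C.
have mln : measurable_fun Rpos (@ln R) by apply: measurable_funTS; exact: measurable_ln.
have mf : cmeas Rpos f.
  apply: cmeasM.
    by apply: cmeas_cexp; apply: cmeasM; [exact: cmeas_cst|exact: cmeasR].
  apply: cmeasR; apply: measurable_funTS; apply: measurableT_comp => //; exact: measurable_expR.
have mg : cmeas Rpos (fun t => c * (gint X t)%:C).
  by apply: cmeasM; [exact: cmeas_cst|apply: cmeasR; exact: measurable_gint].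
have mNg : cmeas Rpos (fun t => - 1 * (c * (gint X t)%:C)) by apply: cmeasM => //; exact: cmeas_cst.
have [mr mi] := cmeasD mf mNg.
have cg : cintegrable mu Rpos (fun t => c * (gint X t)%:C).
  have [a b] := mg; apply: (cintegrable_dominated (@measurable_Rpos R) a b (G := gint X)) => //.
  by move=> t _; rewrite Normc.normcM nc1 mul1r normcR gtr0_norm ?gint_gt0.
have cNg : cintegrable mu Rpos (fun t => - 1 * (c * (gint X t)%:C)).
  have [a b] := mNg; apply: (cintegrable_dominated (@measurable_Rpos R) a b (G := gint X)) => //.
  by move=> t _; rewrite mulN1r normcN Normc.normcM nc1 mul1r normcR gtr0_norm ?gint_gt0.
have Gf : Gamma (X +i* y) = cintegral mu Rpos f.
  have hz : (X +i* y) - 1 = (X - 1) +i* y.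
    by apply/eqP; rewrite eq_complex /= oppr0 addr0 !eqxx.
  by apply: eq_cintegral => t _; rewrite hz cpowE.
have key (t : R) : 0 < t -> nc (f t + - 1 * (c * (gint X t)%:C)) <= G t.
  by move=> t0; rewrite mulN1r; exact (gamma_integrand_close y X0 t0 e0).
have diff : nc (Gamma (X +i* y) - c * (rgamma X)%:C) <= 2 * \int[mu]_(t in Rpos) G t.
  have -> : Gamma (X +i* y) - c * (rgamma X)%:C =
      cintegral mu Rpos (fun t => f t + - 1 * (c * (gint X t)%:C)).
    have cf : cintegrable mu Rpos f.
      have [a b] := mf; apply: (cintegrable_dominated (@measurable_Rpos R) a b (G := gint X)) => //.
      move=> t _; rewrite Normc.normcM normc_cexp normcR gtr0_norm ?expR_gt0//=.
      by rewrite mulr0 subr0 lexx.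
    rewrite cintegralD// cintegralZ// Gf mulN1r; congr (_ - _).
    rewrite cintegralZ ?cintegral_real//; split => //=.
    by rewrite (_ : _ \o _ = cst 0%E)//; exact: integrable0.
  apply: (normc_cintegral_le (@measurable_Rpos R)) => // t; rewrite /= in_itv/= andbT => t0.
  exact: key.
apply/eqP => G0; move: diff; rewrite G0 sub0r normcN Normc.normcM nc1 mul1r normcR.
have g0 := rgamma_gt0 X0; rewrite gtr0_norm// IG mulrA ler_pMl//.
apply/negP; rewrite -ltNge.
have yY : `|y| <= Y by rewrite lerDl.
have -> : `|y| * e = `|y| / Y / 4 by rewrite /e invfM; ring.
have -> : `|y| * (2 / e) / (X - 1) = 8 * (`|y| * Y) / (X - 1) by rewrite /e invrK; ring.
have a1 : `|y| / Y < 1 by rewrite ltr_pdivrMr// mul1r ltrDl.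
have a2 : 8 * (`|y| * Y) / (X - 1) <= 1 / 4.
  rewrite ler_pdivrMr ?subr_gt0//.
  have : `|y| * Y <= Y ^+ 2 by rewrite expr2 ler_wpM2r// ltW.
  by lra.
by lra.
Qed.

(** The functional equation carries a zero at z to all z + n, whose real part eventually exceeds the
    bound of [Gamma_large_neq0] while the imaginary part stays fixed. *)
Lemma Gamma_neq0 (z : C) : 1 < complex.Re z -> Gamma z != 0.
Proof.
move=> z1; apply/negP => /eqP G0.
have Gn n : 1 < complex.Re (z + n%:R) /\ Gamma (z + n%:R) = 0.
  elim: n => [|n [h1 h2]]; first by rewrite addr0.
  rewrite -natr1 addrA; split; last by rewrite GammaS// h2 mulr0.
  by move: h1; case: (z + n%:R) => a b /= h1; rewrite ltr_wpDr.
case: z z1 G0 Gn => x y /= x1 _ Gn.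
pose n := Num.truncn (1 + 32 * (`|y| + 1) ^+ 2).
have [_] := Gn n.+1; apply/eqP.
have -> : (x +i* y) + n.+1%:R = (x + n.+1%:R) +i* y.
  by rewrite -(rmorph_nat (@real_complex_def _ (Phant R))) /= -[LHS]/((_ + _) +i* (_ + _)) addr0.
by apply: Gamma_large_neq0; rewrite (lt_le_trans (truncnS_gt _))// lerDr (le_trans ler01)// ltW.
Qed.

End complex_gamma.

(** * Integration by parts in R^n x R *)

Section bounded_support.
Context d (T : measurableType d) (R : realType) (mu : {measure set T -> \bar R}).

Lemma integrable_bounded_support (K : set T) (f : T -> R) (B : R) : measurable K ->
  (mu K < +oo)%E -> measurable_fun setT f -> (forall t, ~ K t -> f t = 0) ->
  (forall t, `|f t| <= B) -> mu.-integrable setT (EFin \o f).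
Proof.
move=> mK Kfin mf f0 fB.
have -> : EFin \o f = ((EFin \o f) \_ K).
  apply/funext => t; rewrite patchE; case: ifPn => // /negP tK /=.
  by rewrite f0// => Kt; apply: tK; rewrite inE.
apply/(integrable_mkcond _ mK); apply: measurable_bounded_integrable => //.
- exact: measurable_funTS.
- by exists B; split; [exact: num_real|move=> x Bx t _; exact: le_trans (fB t) (ltW Bx)].
Qed.

End bounded_support.

(** * Fubini and integrals of derivatives on tuples *)

Section tuple_lebesgue.
Variable R : realType.
Local Notation T := (measurableTypeR R).
Local Notation leb := (@lebesgue_measure R).
Local Notation mun n := (tuple_measure leb n).

Lemma lebesgue_abs_le (M : R) : (leb [set s : R | (`|s| <= M)%R] < +oo)%E.
Proof.
rewrite (_ : [set s | _] = `[- M, M]%classic); last first.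
  by apply/seteqP; split => s /=; rewrite in_itv/= ler_norml.
by rewrite lebesgue_measure_itv/=; case: ifPn => // _; rewrite -EFinD ltry.
Qed.

Lemma measurable_abs_le (M : R) : measurable ([set s | `|s| <= M] : set T).
Proof.
rewrite (_ : [set s | _] = `[- M, M]%classic); first exact: measurable_itv.
by apply/seteqP; split => s /=; rewrite in_itv/= ler_norml.
Qed.

Lemma line_integral_derivative (g g' : R -> R) (M : R) :
  (forall s : R, is_derive s 1 g (g' s)) -> continuous g' ->
  (forall s, M < `|s| -> g s = 0) -> (forall s, M < `|s| -> g' s = 0) ->
  (\int[leb]_s (g' s)%:E)%E = 0%E.
Proof.
move=> dg cg' g0 g'0; pose N : R := `|M| + 1.
have N0 : 0 < N by rewrite ltr_pwDr.
have MN : M < N by rewrite (le_lt_trans (ler_norm _))// ltrDl.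
have -> : (\int[leb]_s (g' s)%:E)%E = (\int[leb]_(s in `[(- N)%R, N]) (g' s)%:E)%E.
  rewrite [RHS]integral_mkcond; apply: eq_integral => s _.
  rewrite patchE; case: ifPn => // /negP sN; rewrite g'0// (lt_le_trans MN)// leNgt.
  apply/negP => sN'; apply: sN; rewrite inE /= in_itv/= -ler_norml.
  exact: ltW.
have cg s : {for s, continuous g} by have := dg s; exact: is_derive_cont.
rewrite (@continuous_FTC2 _ g' g)//.
- by rewrite !g0 ?normrN ?gtr0_norm// subee.
- by rewrite -subr_gt0 opprK addr_gt0.
- exact: continuous_subspaceT.
- split; first by move=> s _; have [] := dg s.
  + by apply: cvg_at_right_filter; exact: cg.
  + by apply: cvg_at_left_filter; exact: cg.
- by move=> s _; rewrite derive1E; have [] := dg s.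
Qed.

Lemma tuple_box_measurable n (M : R) :
  measurable [set t : n.-tuple T | forall j, `|tnth t j| <= M].
Proof.
rewrite (_ : [set t | _] = \bigcap_(j : 'I_n) ((fun t : n.-tuple T => tnth t j) @^-1` [set s : T | `|s| <= M])).
  apply: fin_bigcap_measurable => [|j _]; first exact: finite_finset.
  rewrite -[X in measurable X]setTI; apply: measurable_tnth => //.
  exact: measurable_abs_le.
by apply/seteqP; split => t h j /=; [move=> _; exact: h|exact: (h j I)].
Qed.

Lemma tuple_box_finite n (M : R) :
  (mun n [set t : n.-tuple T | forall j, (`|tnth t j| <= M)%R] < +oo)%E.
Proof.
elim: n => [|n ih].
  by rewrite /= diracE; case: (_ \in _) => //=; rewrite ltry.
rewrite /= /cons_measure /pushforward.
rewrite (_ : _ @^-1` _ = [set s : T | `|s| <= M] `*` [set t : n.-tuple T | forall j, `|tnth t j| <= M]).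
  rewrite product_measure1E; [|exact: measurable_abs_le|exact: tuple_box_measurable].
  by apply: lte_mul_pinfty => //; rewrite ge0_fin_numE// lebesgue_abs_le.
apply/seteqP; split => -[s t] /=.
  move=> h; split; first by have := h ord0; rewrite tnth0.
  by move=> j; have := h (lift ord0 j); rewrite tnthS.
by move=> [hs ht] j; case: (unliftP ord0 j) => [i ->|->]; rewrite ?tnthS ?tnth0.
Qed.

Lemma measurable_cons_pair n : measurable_fun [set: T * n.-tuple T]
  (fun z : T * n.-tuple T => [tuple of z.1 :: z.2]).
Proof. exact: measurable_cons. Qed.

Lemma ge0_tuple_integralS n (F : n.+1.-tuple T -> \bar R) :
  measurable_fun setT F -> (forall t, (0 <= F t)%E) ->
  (\int[mun n.+1]_t F t = \int[leb]_s \int[mun n]_t F [tuple of s :: t])%E.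
Proof.
move=> mF F0; rewrite -(@fubini_tonelli1 _ _ _ _ _ leb (mun n) (fun z => F [tuple of z.1 :: z.2]))//.
  rewrite [LHS](@ge0_integral_pushforward _ _ _ _ _ _ (@measurable_cons_pair n) (leb \x mun n)%E setT F)//.
by apply: measurableT_comp => //; exact: measurable_cons_pair.
Qed.

Lemma tuple_integrableS n (F : n.+1.-tuple T -> \bar R) :
  (mun n.+1).-integrable setT F ->
  (leb \x mun n)%E.-integrable setT (fun z => F [tuple of z.1 :: z.2]).
Proof.
move=> /integrableP[mF iF]; apply/integrableP; split.
  by apply: measurableT_comp => //; exact: measurable_cons_pair.
apply: le_lt_trans iF; rewrite [leRHS](@ge0_integral_pushforward _ _ _ _ _ _ (@measurable_cons_pair n) (leb \x mun n)%E setT)//.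
exact: measurableT_comp.
Qed.

Lemma tuple_integralS n (F : n.+1.-tuple T -> \bar R) :
  (mun n.+1).-integrable setT F ->
  (\int[mun n.+1]_t F t = \int[leb]_s \int[mun n]_t F [tuple of s :: t])%E.
Proof.
move=> iF; have iF' := tuple_integrableS iF.
rewrite [RHS](integral12_prod_meas1 iF').
rewrite [LHS](@integral_pushforward _ _ _ _ _ _ (@measurable_cons_pair n) (leb \x mun n)%E setT F)//.
exact: measurable_int iF.
Qed.

Lemma tuple_integralS_swap n (F : n.+1.-tuple T -> \bar R) :
  (mun n.+1).-integrable setT F ->
  (\int[mun n.+1]_t F t = \int[mun n]_t \int[leb]_s F [tuple of s :: t])%E.
Proof.
move=> iF; rewrite tuple_integralS//; exact: (Fubini (tuple_integrableS iF)).
Qed.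

Definition tupd n (t : n.-tuple T) (i : 'I_n) (s : R) : n.-tuple T :=
  [tuple if j == i then s : T else tnth t j | j < n].

Lemma tupd0 n (s s' : R) (t : n.-tuple T) :
  tupd [tuple of (s : T) :: t] ord0 s' = [tuple of (s' : T) :: t].
Proof.
apply: eq_from_tnth => j; rewrite tnth_mktuple.
by case: (unliftP ord0 j) => [i ->|->]; rewrite ?tnthS ?tnth0.
Qed.

Lemma tupdS n (s s' : R) (t : n.-tuple T) (i : 'I_n) :
  tupd [tuple of (s : T) :: t] (lift ord0 i) s' = [tuple of (s : T) :: tupd t i s'].
Proof.
apply: eq_from_tnth => j; rewrite tnth_mktuple.
case: (unliftP ord0 j) => [k ->|->]; last by rewrite !tnth0.
by rewrite !tnthS tnth_mktuple (inj_eq lift_inj).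
Qed.

(** Induction on n: if the differentiated coordinate is the head, it is integrated first; otherwise
    the head is frozen and the statement for the tail applies. *)
Lemma tuple_integral_derivative n (i : 'I_n) (Q Q' : n.-tuple T -> R) (M B : R) :
  measurable_fun setT Q' -> (forall t, `|Q' t| <= B) ->
  (forall (t : n.-tuple T) j, M < `|tnth t j| -> Q t = 0) ->
  (forall (t : n.-tuple T) j, M < `|tnth t j| -> Q' t = 0) ->
  (forall t (s : R), is_derive s 1 (fun s => Q (tupd t i s)) (Q' (tupd t i s))) ->
  (forall t, continuous (fun s : R => Q' (tupd t i s))) ->
  (\int[mun n]_t (Q' t)%:E = 0)%E.
Proof.
elim: n i Q Q' => [[]//|n ih] i Q Q' mQ' Q'B Q0 Q'0 dQ cQ'.
have iQ' : (mun n.+1).-integrable setT (EFin \o Q').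
  apply: (@integrable_bounded_support _ _ R (mun n.+1)
    [set t : n.+1.-tuple T | forall j, `|tnth t j| <= M] Q' B) => //.
  - exact: tuple_box_measurable.
  - exact: tuple_box_finite.
  - by move=> t /existsNP[j]; move/negP; rewrite -ltNge; exact: Q'0.
case: (unliftP ord0 i) => [j|] ij; rewrite {}ij in dQ cQ'.
  rewrite tuple_integralS//= integral0_eq// => s _.
  apply: (ih j (fun t => Q [tuple of (s : T) :: t])).
  - apply: measurableT_comp mQ' _.
    by apply: measurable_cons; [exact: measurable_cst|exact: measurable_id].
  - by move=> t; exact: Q'B.
  - by move=> t k tk; apply: (Q0 _ (lift ord0 k)); rewrite tnthS.
  - by move=> t k tk; apply: (Q'0 _ (lift ord0 k)); rewrite tnthS.
  - move=> t s'; have := dQ [tuple of (s : T) :: t] s'.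
    by under eq_fun do rewrite tupdS; rewrite tupdS.
  - move=> t; have := cQ' [tuple of (s : T) :: t].
    by under eq_fun do rewrite tupdS.
rewrite tuple_integralS_swap//= integral0_eq// => t _.
pose q s := Q [tuple of (s : T) :: t].
apply: (@line_integral_derivative q _ M).
- move=> s; have := dQ [tuple of (0 : T) :: t] s.
  by under eq_fun do rewrite tupd0; rewrite tupd0.
- have := cQ' [tuple of (0 : T) :: t].
  by under eq_fun do rewrite tupd0.
- by move=> s Ms; apply: (Q0 _ ord0); rewrite tnth0.
- by move=> s Ms; apply: (Q'0 _ ord0); rewrite tnth0.
Qed.

End tuple_lebesgue.

(** * Directional derivatives as derivatives along lines *)

Section directional_derivative.
Variables (R : realType) (V : normedModType R).

Lemma is_derive_along (f : V -> R) (q v : V) (s d : R) :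
  is_derive (q + s *: v) v f d -> is_derive s 1 (fun s => f (q + s *: v)) d.
Proof.
move=> [df dE].
have E : (fun h : R => h^-1 *: (f (q + (h *: 1 + s) *: v) - f (q + s *: v))) =
         (fun h : R => h^-1 *: (f (h *: v + (q + s *: v)) - f (q + s *: v))).
  by apply/funext => h; rewrite [h *: 1]mulr1 scalerDl addrCA addrA.
by split; [rewrite /derivable|rewrite -dE /derive]; rewrite /= E.
Qed.

Lemma is_derive_alongP (f : V -> R) (p v : V) (d : R) :
  is_derive (0 : R) 1 (fun s => f (p + s *: v)) d -> is_derive p v f d.
Proof.
move=> [df dE].
have E : (fun h : R => h^-1 *: (f (p + (h *: 1 + 0 : R) *: v) - f (p + (0 : R) *: v))) =
         (fun h : R => h^-1 *: (f (h *: v + p) - f p)).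
  by apply/funext => h; rewrite [h *: 1]mulr1 addr0 scale0r addr0 (addrC p).
by split; [move: df; rewrite /derivable|rewrite -dE /derive]; rewrite /= E.
Qed.

Lemma is_derive_compR (h : R -> R) (f : V -> R) (p v : V) (d e : R) :
  is_derive p v f d -> is_derive (f p) 1 h e -> is_derive p v (h \o f) (e * d).
Proof.
move=> df dh; apply: is_derive_alongP.
have df0 : is_derive (0 : R) 1 (fun s => f (p + s *: v)) d.
  by apply: is_derive_along; rewrite scale0r addr0.
have dh0 : is_derive (f (p + (0 : R) *: v)) 1 h e by rewrite scale0r addr0.
have := @is_derive1_comp R h (fun s => f (p + s *: v)) 0 e d dh0 df0.
by apply.
Qed.

End directional_derivative.

(** * Integration over the half-space y < b *)

Section space_integral.
Variables (R : realType) (n : nat).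
Local Notation T := (measurableTypeR R).
Local Notation leb := (@lebesgue_measure R).
Local Notation mun := (tuple_measure leb n).
Local Notation Vmu := (mun \x leb)%E.
Local Notation V := ('rV[R]_n * R)%type.

Definition vpt (z : n.-tuple T * T) : V := (\row_i tnth z.1 i, z.2).

Let rat_box (c : n.-tuple rat * rat * nat) : set (n.-tuple T * T) :=
  [set z | (forall i, `|tnth z.1 i - ratr (tnth c.1.1 i)| < c.2.+1%:R^-1) /\
           `|z.2 - ratr c.1.2| < c.2.+1%:R^-1].

Let measurable_rat_box c : measurable (rat_box c).
Proof.
have mT (q : rat) (e : R) : measurable ([set s | `|s - ratr q| < e] : set T).
  rewrite (_ : [set s | _] = `]ratr q - e, ratr q + e[%classic); first exact: measurable_itv.
  by apply/seteqP; split => s /=; rewrite in_itv/= ltr_distl.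
rewrite (_ : rat_box c =
  (\bigcap_(j : 'I_n) ((fun z : n.-tuple T * T => tnth z.1 j) @^-1`
     [set s | `|s - ratr (tnth c.1.1 j)| < c.2.+1%:R^-1])) `&`
  ((fun z : n.-tuple T * T => z.2) @^-1` [set s | `|s - ratr c.1.2| < c.2.+1%:R^-1])).
  apply: measurableI.
    apply: fin_bigcap_measurable => [|j _]; first exact: finite_finset.
    rewrite -[X in measurable X]setTI.
    have h : measurable_fun setT (fun z : n.-tuple T * T => tnth z.1 j).
      by apply: (measurableT_comp (measurable_tnth j)); exact: measurable_fst.
    by apply: h => //; exact: mT.
  rewrite -[X in measurable X]setTI.
  have h : measurable_fun setT (fun z : n.-tuple T * T => z.2) by exact: measurable_snd.
  by apply: h => //; exact: mT.
apply/seteqP; split => z /=.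
  by move=> [h1 h2]; split => // j _; exact: h1.
by move=> [h1 h2]; split => // j; exact: h1.
Qed.

(** Measurability refers to the product of tuples with R, openness to row vectors times R. The two
    are reconciled by covering an open set with the countably many rational boxes of size 1/(k + 1)
    that it contains. *)
Lemma open_vpt_measurable (O : set V) : open O -> measurable (vpt @^-1` O).
Proof.
move=> oO.
pose B k := if unpickle k is Some c then
  if `[< rat_box c `<=` vpt @^-1` O >] then rat_box c else set0 else set0.
rewrite (_ : vpt @^-1` O = \bigcup_k B k).
  apply: bigcup_measurable => k _; rewrite /B; case: unpickle => [c|]; last exact: measurable0.
  by case: ifP => _; [exact: measurable_rat_box|exact: measurable0].
apply/seteqP; split => z; last first.
  move=> [k _]; rewrite /B; case: unpickle => // c; case: ifPn => //.
  by move=> /asboolP; apply.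
move=> Oz; have : nbhs (vpt z) O by apply: open_nbhs_nbhs.
move=> /nbhs_ballP[e /= e0 eO].
pose N := Num.truncn (2 / e).
have N0 : (0 : R) < N.+1%:R^-1 by rewrite invr_gt0.
have Ne : N.+1%:R^-1 < e / 2.
  rewrite -[ltRHS]invrK ltf_pV2 ?posrE ?invr_gt0 ?divr_gt0//.
  by rewrite invf_div truncnS_gt.
have rq (x : R) : exists q : rat, `|x - ratr q| < N.+1%:R^-1.
  have /rat_in_itvoo[q] : x - N.+1%:R^-1 < x + N.+1%:R^-1.
    by rewrite ltrD2l gtrN.
  by rewrite in_itv/= => h; exists q; rewrite distrC ltr_distl.
have /choice[q hq] : forall i, exists q : rat, `|tnth z.1 i - ratr q| < N.+1%:R^-1.
  by move=> i; exact: rq.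
have [q' hq'] := rq z.2.
pose c := ([tuple q i | i < n], q', N).
have cz : rat_box c z by split => //= i; rewrite tnth_mktuple.
exists (pickle c); first exact: I.
rewrite /B pickleK; case: ifPn => [_|/negP h]; first exact: cz.
exfalso; apply: h.
apply/asboolP => w [w1 w2]; apply: eO; split.
  split => // i j; rewrite !mxE /ball/= [ltRHS]splitr.
  rewrite -[X in `|X|](subrKA (ratr (q j))) (le_lt_trans (ler_normD _ _))// ltrD//.
    exact: lt_trans (hq j) Ne.
  by rewrite distrC; have := w1 j; rewrite /= tnth_mktuple => /lt_trans; exact.
rewrite /ball/= [ltRHS]splitr -[X in `|X|](subrKA (ratr q')).
rewrite (le_lt_trans (ler_normD _ _))// ltrD//; first exact: lt_trans hq' Ne.
by rewrite distrC; exact: lt_trans w2 Ne.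
Qed.

Lemma continuous_vpt_measurable (f : V -> R) : continuous f ->
  measurable_fun setT (f \o vpt).
Proof.
move=> cf; apply: (measurability _ (RGenOpens.measurableE R)).
move=> /= _ [_ [a [c ->]] <-]; rewrite setTI comp_preimage; apply: open_vpt_measurable.
by apply: open_comp => [p _|]; [exact: cf|exact: interval_open].
Qed.

(** Continuity on the open half-space y < 0 only, where real powers of - y are regular. *)
Definition contH (F : V -> R) := forall p : V, p.2 < 0 -> {for p, continuous F}.

Variables (b : R) (hb : b < 0).

(** Composition with this retraction turns continuity on y < 0 into global continuity without
    changing values on y <= b. *)
Definition vclamp (p : V) : V := (p.1, Order.min p.2 b).

Lemma contH_clamp F : contH F -> continuous (F \o vclamp).
Proof.
move=> cF p; apply: continuous_comp; last first.
  by apply: cF; rewrite /vclamp /= gt_min hb orbT.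
have h1 : (q.1 : 'rV[R]_n) @[q --> p] --> p.1 by exact: cvg_fst.
have h2 : Order.min (q.2 : R) b @[q --> p] --> Order.min p.2 b.
  apply: (@continuous_min R V (fun q : V => q.2) (fun=> b) p); last exact: cvg_cst.
  exact: cvg_snd.
exact: (cvg_pair h1 h2).
Qed.

Definition Hb : set (n.-tuple T * T) := [set z | z.2 < b].

Lemma measurable_Hb : measurable Hb.
Proof.
rewrite (_ : Hb = snd @^-1` (`]-oo, b[%classic : set T)); last first.
  by apply/seteqP; split => z /=; rewrite in_itv.
rewrite -[X in measurable X]setTI.
by apply: (@measurable_snd _ _ (n.-tuple T) T) => //; exact: measurable_itv.
Qed.

Lemma vclampE z : Hb z -> vclamp (vpt z) = vpt z.
Proof. by move=> /ltW zb; rewrite /vclamp /vpt /=; congr pair; apply/min_idPl. Qed.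

Lemma contH_measurable F : contH F -> measurable_fun Hb (F \o vpt).
Proof.
move=> cF; apply: (@eq_measurable_fun _ _ _ _ _ ((F \o vclamp) \o vpt)).
  by move=> z /set_mem Hz; rewrite /= vclampE.
by apply: measurable_funTS; apply: continuous_vpt_measurable; exact: contH_clamp.
Qed.

Definition yb_supp (M : R) (F : V -> R) := forall p : V, p.2 <= b ->
  (exists i, M < `|p.1 0 i|) \/ p.2 < - M -> F p = 0.

Lemma contH_bounded F (M : R) : contH F -> exists B : R, 0 <= B /\ forall p : V, p.2 <= b ->
  (forall i, `|p.1 0 i| <= M) -> - M <= p.2 -> `|F p| <= B.
Proof.
move=> cF.
pose K : set V := [set x : 'rV[R]_n | forall i, `[- M, M]%classic (x 0 i)] `*` `[- M, b]%classic.
have cK : compact K.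
  apply: compact_setX; last exact: segment_compact.
  apply: (@rV_compact R n (fun=> `[- M, M]%classic)) => i; exact: segment_compact.
have : compact ((F \o vclamp) @` K).
  by apply: continuous_compact cK; apply: continuous_subspaceT; exact: contH_clamp.
move=> /compact_bounded[B [_ hB]]; exists (`|B| + 1); split; first by rewrite addr_ge0.
move=> p pb p1 p2; apply: (hB (`|B| + 1)); first by rewrite (le_lt_trans (ler_norm _))// ltrDl.
exists p; last by rewrite /= /vclamp (min_idPl pb) -surjective_pairing.
split => /= [i|]; rewrite in_itv/=; first by rewrite -ler_norml.
by rewrite p2.
Qed.

Lemma contH_supp_bounded F (M : R) : contH F -> yb_supp M F ->
  exists B : R, forall p : V, p.2 <= b -> `|F p| <= B.
Proof.
move=> cF sF; have [B [B0 hB]] := contH_bounded M cF; exists B => p pb.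
have [h|h] := pselect ((exists i, M < `|p.1 0 i|) \/ p.2 < - M).
  by rewrite sF// normr0.
apply: hB => // [i|]; rewrite leNgt; apply/negP => h'; apply: h; [left; exists i|right]; exact: h'.
Qed.

Lemma vbox_finite (M : R) : (Vmu [set z : n.-tuple T * T |
  (forall j, (`|tnth z.1 j| <= M)%R) /\ (`|z.2| <= M)%R] < +oo)%E.
Proof.
rewrite (_ : [set z | _] = [set t : n.-tuple T | forall j, (`|tnth t j| <= M)%R] `*`
   [set s : T | (`|s| <= M)%R]) //.
rewrite product_measure1E; [|exact: tuple_box_measurable|exact: measurable_abs_le].
by apply: lte_mul_pinfty => //; [rewrite ge0_fin_numE// tuple_box_finite|exact: lebesgue_abs_le].
Qed.

Lemma vbox_measurable (M : R) : measurable [set z : n.-tuple T * T |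
  (forall j, (`|tnth z.1 j| <= M)%R) /\ (`|z.2| <= M)%R].
Proof.
rewrite (_ : [set z | _] = [set t : n.-tuple T | forall j, (`|tnth t j| <= M)%R] `*`
   [set s : T | (`|s| <= M)%R]) //.
by apply: measurableX; [exact: tuple_box_measurable|exact: measurable_abs_le].
Qed.

Lemma Hb_restrict_measurable F : contH F -> measurable_fun setT ((F \o vpt) \_ Hb).
Proof. by move=> cF; apply/(measurable_restrictT _ measurable_Hb); exact: contH_measurable. Qed.

Lemma contH_integrableT F (M : R) : contH F -> yb_supp M F ->
  Vmu.-integrable setT (EFin \o ((F \o vpt) \_ Hb)).
Proof.
move=> cF sF; have [B hB] := contH_supp_bounded cF sF.
pose N := Order.max M (- M).
apply: (@integrable_bounded_support _ _ R Vmu _ _ (Order.max B 0) (vbox_measurable N) (vbox_finite N)).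
- exact: Hb_restrict_measurable.
- move=> z hz; rewrite patchE; case: ifPn => // /set_mem zb; apply: sF; first exact: ltW.
  apply: contrapT => h; apply: hz; split => [j|].
    rewrite leNgt; apply/negP => h'; apply: h; left; exists j; rewrite mxE.
    by apply: le_lt_trans h'; rewrite le_max lexx.
  rewrite ler0_norm ?(ltW (lt_trans zb hb))// leNgt; apply/negP => h'; apply: h; right.
  by rewrite /= -ltrNr; apply: le_lt_trans h'; rewrite le_max lexx.
- move=> z; rewrite patchE; case: ifPn => [/set_mem zb|_]; last by rewrite normr0 le_max lexx orbT.
  by rewrite le_max hB// ltW.
Qed.

Lemma contH_integrable F (M : R) : contH F -> yb_supp M F -> Vmu.-integrable Hb (EFin \o (F \o vpt)).
Proof.
move=> cF /(contH_integrableT cF) h; apply/(integrable_mkcond _ measurable_Hb).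
by rewrite restrict_EFin.
Qed.

Definition bint (F : V -> R) : R := \int[Vmu]_(z in Hb) F (vpt z).

Lemma bintE F : bint F = fine (\int[Vmu]_z (EFin \o ((F \o vpt) \_ Hb)) z)%E.
Proof. by rewrite /bint Rintegral_mkcond. Qed.

Lemma vpt_tupd (t : n.-tuple T) (y : T) i (s : R) :
  vpt (tupd t i s, y) = vpt (tupd t i 0, y) + s *: direction R (Some i).
Proof.
congr pair => /=; last by rewrite scaler0 addr0.
apply/rowP => j; rewrite !mxE !tnth_mktuple eqxx /=.
by case: ifP => _; rewrite ?mulr1 ?add0r ?mulr0 ?addr0.
Qed.

Lemma bint_dx (i : 'I_n) (F F' : V -> R) (M : R) : contH F' -> yb_supp M F -> yb_supp M F' ->
  (forall p : V, p.2 < 0 -> is_derive p (direction R (Some i)) F (F' p)) -> bint F' = 0.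
Proof.
move=> cF' sF sF' dF; have [B hB] := contH_supp_bounded cF' sF'.
have iF := contH_integrableT cF' sF'.
rewrite bintE.
rewrite -(integral21_prod_meas1 iF) integral0_eq// => y _; rewrite /fubini_G /=.
have [yb|yb] := ltP y b; last first.
  by rewrite integral0_eq// => t _; rewrite /= patchE memNset// /Hb /= ltNge yb.
have E t : ((F' \o vpt) \_ Hb) (t, y) = F' (vpt (t, y)) by rewrite patchE mem_set.
under eq_integral do rewrite E.
have y0 : y < 0 by exact: lt_trans hb.
apply: (@tuple_integral_derivative _ _ i (fun t => F (vpt (t, y))) (fun t => F' (vpt (t, y))) M B).
- rewrite (_ : (fun t => _) = (fun t => ((F' \o vpt) \_ Hb) (t, y))); last first.
    by apply/funext => t; rewrite E.
  exact: (measurableT_comp (Hb_restrict_measurable cF') (measurable_fun_pair (@measurable_id _ _ _) (@measurable_cst _ _ _ _ _ y))).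
- by move=> t; apply: hB; exact: ltW.
- by move=> t j tj; apply: sF; [exact: ltW|left; exists j; rewrite mxE].
- by move=> t j tj; apply: sF'; [exact: ltW|left; exists j; rewrite mxE].
- move=> t s; under eq_fun do rewrite vpt_tupd.
  have h : (vpt (tupd t i 0, y) + s *: direction R (Some i)).2 < 0 by rewrite /= scaler0 addr0.
  by rewrite (vpt_tupd _ _ _ s); exact: (is_derive_along (dF _ h)).
- move=> t s; under eq_fun do rewrite vpt_tupd.
  apply: (@continuous_comp _ _ _ (fun s : R => vpt (tupd t i 0, y) + s *: direction R (Some i)) F').
    by apply: cvgD; [exact: cvg_cst|apply: cvgZl; exact: cvg_id].
  by apply: cF'; rewrite /= scaler0 addr0.
Qed.

Lemma vpt_y (t : n.-tuple T) (y : R) : vpt (t, y) = vpt (t, 0 : T) + y *: direction R None.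
Proof. by congr pair => /=; [rewrite scaler0 addr0|rewrite add0r [y *: 1]mulr1]. Qed.

(** The fundamental theorem in y leaves the value of F at y = b, which vanishes by the last
    hypothesis; the other end lies below the support. *)
Lemma bint_dy (F F' : V -> R) (M : R) : contH F' -> yb_supp M F -> yb_supp M F' ->
  (forall p : V, p.2 < 0 -> is_derive p (direction R None) F (F' p)) ->
  (forall x, F (x, b) = 0) -> bint F' = 0.
Proof.
move=> cF' sF sF' dF Fb0.
have iF := contH_integrableT cF' sF'.
rewrite bintE.
rewrite -(integral12_prod_meas1 iF) integral0_eq// => t _; rewrite /fubini_F /=.
pose g (y : R) := F (vpt (t, y : T)); pose g' (y : R) := F' (vpt (t, y : T)).
have dg (y : R) : y < 0 -> is_derive y 1 g (g' y).
  move=> y0; rewrite /g /g'; under eq_fun do rewrite vpt_y; rewrite (vpt_y _ y).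
  have h : (vpt (t, 0 : T) + y *: direction R None).2 < 0 by rewrite /= add0r [y *: 1]mulr1.
  exact: (is_derive_along (dF _ h)).
have cg' (y : R) : y < 0 -> {for y, continuous g'}.
  move=> y0; rewrite (_ : g' = fun y : R => F' (vpt (t, 0 : T) + y *: direction R None)); last first.
    by apply/funext => y'; rewrite /g' vpt_y.
  apply: (@continuous_comp _ _ _ (fun y : R => vpt (t, 0 : T) + y *: direction R None) F').
    by apply: cvgD; [exact: cvg_cst|apply: cvgZl; exact: cvg_id].
  by apply: cF'; rewrite /= add0r [y *: 1]mulr1.
(* Puts - N below both b and - M. *)
pose N : R := `|M| + 1 - b.
have Nb : - N < b by rewrite /N opprB ltrBlDr ltrDl ltr_pwDr.
have MN : M < N by rewrite /N -addrA (le_lt_trans (ler_norm _))// ltrDl subr_gt0 (lt_trans hb).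
have -> : (\int[leb]_y (((F' \o vpt) \_ Hb) (t, y))%:E)%E =
    (\int[leb]_(y in `[(- N)%R, b]) (g' y)%:E)%E.
  transitivity (\int[leb]_(y in `[(- N)%R, b[) (g' y)%:E)%E; last first.
    rewrite integral_itv_bndo_bndc//; apply/measurable_EFinP.
    apply: (@eq_measurable_fun _ _ _ _ _ (fun y : T => ((F' \o vpt) \_ Hb) (t, y))).
      move=> y /set_mem /=; rewrite in_itv/= => /andP[_ yb].
      by rewrite patchE mem_set.
    by apply: measurable_funTS; exact: (measurableT_comp (Hb_restrict_measurable cF') (measurable_fun_pair (@measurable_cst _ _ _ _ _ t) (@measurable_id _ _ _))).
  rewrite [RHS]integral_mkcond; apply: eq_integral => y _; rewrite !patchE /=.
  case: ifPn => [/set_mem yb|/negP yb]; case: ifPn => [/set_mem|/negP] h //.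
    congr EFin; apply: sF'; first exact: ltW.
    right; rewrite /= (lt_trans _ (_ : - N < - M)) ?ltrN2//.
    by rewrite ltNge; apply/negP => h'; apply: h; rewrite inE /= in_itv/= h'.
  by exfalso; apply: yb; rewrite inE; move: h => /=; rewrite in_itv/= => /andP[].
have neg y : y <= b -> y < 0 by move=> /le_lt_trans; apply.
rewrite (@continuous_FTC2 _ g' g)//.
- rewrite /g Fb0 sF ?subee//=; first exact: ltW.
  by right; rewrite ltrN2.
- apply: continuous_in_subspaceT => y; rewrite inE /= in_itv/= => /andP[_ /neg]; exact: cg'.
- have cgy y : y < 0 -> {for y, continuous g} by move=> /dg; exact: is_derive_cont.
  split.
  + by move=> y; rewrite in_itv/= => /andP[_ /ltW/neg/dg[]].
  + by apply: cvg_at_right_filter; apply: cgy; apply: neg; exact: ltW.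
  + by apply: cvg_at_left_filter; apply: cgy; exact: neg.
- by move=> y; rewrite in_itv/= => /andP[_ /ltW/neg/dg[_]]; rewrite derive1E.
Qed.

End space_integral.

(** * Green's formula for the Tricomi operator *)

Section weighted_derivatives.
Variables (R : realType) (n : nat).
Local Notation V := ('rV[R]_n * R)%type.
Implicit Types (f g : V -> R) (p v : V).
Local Notation dir o := (@direction R n o).

Lemma is_derive_lin2 p v : is_derive p v (fun q : V => - q.2) (- v.2).
Proof.
apply: is_derive_alongP => /=.
rewrite (_ : (fun s : R => _) = (fun s : R => - (p.2 + s * v.2))); last by apply/funext.
by apply: is_derive_eq; rewrite /GRing.scale /=; ring.
Qed.

Lemma is_derive_snd p v : is_derive p v (fun q : V => q.2) v.2.
Proof.
apply: is_derive_alongP => /=.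
rewrite (_ : (fun s : R => _) = (fun s : R => p.2 + s * v.2)); last by apply/funext.
by apply: is_derive_eq; rewrite /GRing.scale /=; ring.
Qed.

Lemma is_derive_ypow r p v : p.2 < 0 ->
  is_derive p v (fun q : V => (- q.2) `^ r) (- (r * (- p.2) `^ (r - 1)) * v.2).
Proof.
move=> p0; have s0 : 0 < - p.2 by rewrite oppr_gt0.
have := is_derive_compR (is_derive_lin2 p v) (@is_derive1_powR R r _ s0).
by rewrite mulrN -mulNr.
Qed.

Lemma is_derive_sqnorm p v :
  is_derive p v (fun q : V => sqnorm q.1) (2 * \sum_(i < n) p.1 0 i * v.1 0 i).
Proof.
apply: is_derive_alongP => /=.
rewrite (_ : (fun s : R => _) = (fun s : R => sqnorm p.1 +
    (s * (2 * \sum_(i < n) p.1 0 i * v.1 0 i) + s ^+ 2 * sqnorm v.1))).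
  set c := 2 * _; set d := sqnorm v.1.
  by apply: is_derive_eq; rewrite /GRing.scale /=; ring.
apply/funext => s; rewrite /sqnorm !mulr_sumr -!big_split/=.
by apply: eq_bigr => i _; rewrite !mxE; ring.
Qed.

Lemma continuous_coord i : continuous (fun p : V => p.1 0 i).
Proof.
move=> p; apply: (@continuous_comp _ _ _ fst (fun x : 'rV[R]_n => x 0 i)).
  exact: cvg_fst.
exact: coord_continuous.
Qed.

Lemma contH_y : contH (fun p : V => p.2).
Proof. by move=> p _; exact: cvg_snd. Qed.

Lemma contH_cst (c : R) : contH (fun _ : V => c).
Proof. by move=> p _; exact: cvg_cst. Qed.

Lemma contHD f g : contH f -> contH g -> contH (fun p => f p + g p).
Proof. by move=> cf cg p p0; apply: cvgD; [exact: cf|exact: cg]. Qed.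

Lemma contHM f g : contH f -> contH g -> contH (fun p => f p * g p).
Proof. by move=> cf cg p p0; apply: cvgM; [exact: cf|exact: cg]. Qed.

Lemma contHN f : contH f -> contH (fun p => - f p).
Proof. by move=> cf p p0; apply: cvgN; exact: cf. Qed.

Lemma contHB f g : contH f -> contH g -> contH (fun p => f p - g p).
Proof. by move=> cf cg p p0; apply: cvgB; [exact: cf|exact: cg]. Qed.

Lemma contH_comp (h : R -> R) f : continuous h -> contH f -> contH (fun p => h (f p)).
Proof. by move=> ch cf p p0; apply: (continuous_comp (cf p p0)); exact: ch. Qed.

Lemma contH_sum (I : Type) (s : seq I) (F : I -> V -> R) : (forall i, contH (F i)) ->
  contH (fun p => \sum_(i <- s) F i p).
Proof.
move=> cF; elim: s => [|i s ih].
  by under eq_fun do rewrite big_nil; exact: contH_cst.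
by under eq_fun do rewrite big_cons; exact: contHD.
Qed.

Lemma contH_coord i : contH (fun p : V => p.1 0 i).
Proof. by move=> p _; exact: continuous_coord. Qed.

Lemma contH_sqnorm : contH (fun p : V => sqnorm p.1).
Proof.
apply: contH_sum => i; rewrite (_ : (fun p : V => _) = fun p : V => p.1 0 i * p.1 0 i).
  by apply: contHM; exact: contH_coord.
by apply/funext => p; rewrite expr2.
Qed.

Lemma contH_ypow r : contH (fun p : V => (- p.2) `^ r).
Proof.
move=> p p0; have s0 : 0 < - p.2 by rewrite oppr_gt0.
apply: (@continuous_comp _ _ _ (fun p : V => - p.2) (fun s => s `^ r)).
  by apply: cvgN; exact: cvg_snd.
by have := @is_derive1_powR R r _ s0; exact: is_derive_cont.
Qed.

(* A list of triples (c, r, s) encodes the operator f |-> sum of c (- y)^r (pderiv s f). *)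
Definition term := (R * R * seq (option 'I_n))%type.
Implicit Types l : seq term.

Definition ev l f p : R := \sum_(a <- l) a.1.1 * (- p.2) `^ a.1.2 * pderiv a.2 f p.

Definition mulp r l : seq term := [seq (a.1.1, a.1.2 + r, a.2) | a <- l].
Definition scalt c l : seq term := [seq (c * a.1.1, a.1.2, a.2) | a <- l].
Definition dxt i l : seq term := [seq (a.1.1, a.1.2, Some i :: a.2) | a <- l].
(** Product rule, the y-derivative of (- y)^r being - r (- y)^(r - 1). *)
Definition dyt l : seq term := [seq (a.1.1, a.1.2, None :: a.2) | a <- l] ++
  [seq (- (a.1.1 * a.1.2), a.1.2 - 1, a.2) | a <- l].
Definition lapt l : seq term := flatten [seq dxt i (dxt i l) | i <- enum 'I_n].
(** For y < 0, [ev (Tt l) f] is T applied to [ev l f]; the factor y is written as - (- y)^1 to stay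
    within the encoding. *)
Definition Tt l : seq term := scalt (-1) (mulp 1 (lapt l)) ++ dyt (dyt l).

Lemma evE l f p : ev l f p = \sum_(a <- l) a.1.1 * (- p.2) `^ a.1.2 * pderiv a.2 f p.
Proof. by []. Qed.

Lemma ev_nil f p : ev [::] f p = 0.
Proof. by rewrite /ev big_nil. Qed.

Lemma ev_cat l1 l2 f p : ev (l1 ++ l2) f p = ev l1 f p + ev l2 f p.
Proof. by rewrite /ev big_cat. Qed.

Lemma ev_scal c l f p : ev (scalt c l) f p = c * ev l f p.
Proof. by rewrite /ev big_map mulr_sumr; apply: eq_bigr => a _; rewrite !mulrA. Qed.

Lemma powRDp (s x y : R) : 0 < s -> s `^ (x + y) = s `^ x * s `^ y.
Proof. by move=> s0; rewrite powRD// (gt_eqF s0) implybT. Qed.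

Lemma ev_mulp r l f p : p.2 < 0 -> ev (mulp r l) f p = (- p.2) `^ r * ev l f p.
Proof.
move=> p0; rewrite /ev big_map mulr_sumr; apply: eq_bigr => a _ /=.
rewrite powRDp ?oppr_gt0//; ring.
Qed.

Lemma ev_lap l f p : ev (lapt l) f p = \sum_(i < n) ev (dxt i (dxt i l)) f p.
Proof.
rewrite /ev /lapt big_flatten big_map/= big_enum/=.
by apply: eq_bigr => i _; rewrite !big_map.
Qed.

Lemma ev_T l f p : p.2 < 0 -> ev (Tt l) f p =
  p.2 * (\sum_(i < n) ev (dxt i (dxt i l)) f p) + ev (dyt (dyt l)) f p.
Proof.
move=> p0; rewrite ev_cat ev_scal ev_mulp// powRr1 ?oppr_ge0 ?ltW// ev_lap; ring.
Qed.

Lemma contH_ev l f : smooth f -> contH (ev l f).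
Proof.
move=> sf; apply: contH_sum => a; apply: contHM; last by move=> p _; exact: (sf a.2).1.
by apply: contHM; [exact: contH_cst|exact: contH_ypow].
Qed.

Lemma smooth_is_derive f s o p : smooth f -> is_derive p (dir o) (pderiv s f) (pderiv (o :: s) f p).
Proof. by move=> sf; apply: derivableP; exact: (sf s).2. Qed.

Lemma is_derive_ev_aux l f p o : smooth f -> p.2 < 0 -> is_derive p (dir o) (ev l f)
  (\sum_(a <- l) a.1.1 * ((- p.2) `^ a.1.2 * pderiv (o :: a.2) f p +
    pderiv a.2 f p * (- (a.1.2 * (- p.2) `^ (a.1.2 - 1)) * (dir o).2))).
Proof.
move=> sf p0; rewrite /ev; elim: l => [|a l ih].
  under eq_fun do rewrite big_nil; rewrite big_nil; exact: is_derive_cst.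
under eq_fun do rewrite big_cons; rewrite big_cons.
have d1 := is_derive_ypow a.1.2 (dir o) p0.
have d2 := smooth_is_derive a.2 o p sf.
have d3 : is_derive p (dir o) (fun q : V => a.1.1 * (- q.2) `^ a.1.2 * pderiv a.2 f q)
   (a.1.1 * ((- p.2) `^ a.1.2 * pderiv (o :: a.2) f p +
    pderiv a.2 f p * (- (a.1.2 * (- p.2) `^ (a.1.2 - 1)) * (dir o).2))).
  apply: is_derive_eq.
  by rewrite /GRing.scale /=; ring.
exact: (is_deriveD d3 ih).
Qed.

Lemma is_derive_ev_x l f p i : smooth f -> p.2 < 0 ->
  is_derive p (dir (Some i)) (ev l f) (ev (dxt i l) f p).
Proof.
move=> sf p0; have h := is_derive_ev_aux l (Some i) sf p0.
rewrite (_ : ev (dxt i l) f p = \sum_(a <- l) a.1.1 * ((- p.2) `^ a.1.2 *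
   pderiv (Some i :: a.2) f p + pderiv a.2 f p * (- (a.1.2 * (- p.2) `^ (a.1.2 - 1)) *
   (dir (Some i)).2)))//.
by rewrite /ev big_map; apply: eq_bigr => a _ /=; rewrite !mulr0 addr0 mulrA.
Qed.

Lemma is_derive_ev_y l f p : smooth f -> p.2 < 0 ->
  is_derive p (dir None) (ev l f) (ev (dyt l) f p).
Proof.
move=> sf p0; have h := is_derive_ev_aux l None sf p0.
rewrite (_ : ev (dyt l) f p = \sum_(a <- l) a.1.1 * ((- p.2) `^ a.1.2 *
   pderiv (None :: a.2) f p + pderiv a.2 f p * (- (a.1.2 * (- p.2) `^ (a.1.2 - 1)) *
   (dir None).2)))//.
rewrite ev_cat /ev !big_map -big_split/=; apply: eq_bigr => a _ /=; ring.
Qed.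

Definition ybounded (M : R) f := forall p : V, p.2 < - M -> f p = 0.

Lemma ybounded_pderiv M f s : ybounded M f -> ybounded M (pderiv s f).
Proof.
move=> h; elim: s => [//|o s ih] p pM /=.
have c0 : is_derive p (dir o) (fun _ : V => (0 : R)) 0 by exact: is_derive_cst.
have : is_derive p (dir o) (pderiv s f) 0.
  apply: near_eq_is_derive c0.
  have oU : open [set q : V | q.2 < - M].
    apply: (@open_comp _ _ (fun q : V => q.2) [set y | y < - M]); last exact: open_lt.
    by move=> q _; exact: cvg_snd.
  have : nbhs p [set q : V | q.2 < - M] by apply: open_nbhs_nbhs.
  by apply: filterS => q /ih.
by case.
Qed.

Lemma ybounded_ev M l f : ybounded M f -> ybounded M (ev l f).
Proof.
by move=> h p pM; rewrite /ev big1// => a _; rewrite (ybounded_pderiv _ h)// mulr0.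
Qed.

Lemma ev_le l f p (B : R) : p.2 < 0 -> (forall a, a \in l -> `|pderiv a.2 f p| <= B) ->
  `|ev l f p| <= (\sum_(a <- l) `|a.1.1| * (- p.2) `^ a.1.2) * B.
Proof.
move=> p0 hB; rewrite mulr_suml (le_trans (ler_norm_sum _ _ _))//.
rewrite big_seq [leRHS]big_seq; apply: ler_sum => a al.
by rewrite !normrM (ger0_norm (powR_ge0 _ _)) ler_wpM2l ?hB// mulr_ge0// powR_ge0.
Qed.

Lemma pderiv_linear c f g s : smooth f -> smooth g ->
  pderiv s (fun p => c * f p + g p) = (fun p => c * pderiv s f p + pderiv s g p).
Proof.
move=> sf sg; elim: s => [//|o s ih] /=; apply/funext => p; rewrite ih.
have d1 := smooth_is_derive s o p sf; have d2 := smooth_is_derive s o p sg.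
have : is_derive p (dir o) (fun q : V => c * pderiv s f q + pderiv s g q)
    (c * pderiv (o :: s) f p + pderiv (o :: s) g p).
  by apply: is_derive_eq.
by case.
Qed.

Lemma smooth_linear c f g : smooth f -> smooth g -> smooth (fun p => c * f p + g p).
Proof.
move=> sf sg s; rewrite pderiv_linear//; split.
  move=> p; apply: cvgD; last exact: (sg s).1.
  by apply: cvgM; [exact: cvg_cst|exact: (sf s).1].
move=> o p.
have d1 := smooth_is_derive s o p sf; have d2 := smooth_is_derive s o p sg.
have : is_derive p (dir o) (fun q : V => c * pderiv s f q + pderiv s g q)
    (c * pderiv (o :: s) f p + pderiv (o :: s) g p).
  by apply: is_derive_eq.
by case.
Qed.

Lemma ev_linear l c f g p : smooth f -> smooth g ->
  ev l (fun p => c * f p + g p) p = c * ev l f p + ev l g p.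
Proof.
move=> sf sg; rewrite /ev mulr_sumr -big_split/=; apply: eq_bigr => a _.
by rewrite pderiv_linear//; ring.
Qed.

Lemma test_function_ybounded f : test_function f -> exists M, ybounded M f.
Proof.
move=> [_ /compact_bounded[M [_ hM]]]; exists (`|M| + 1) => p pM; apply/eqP/negPn/negP => fp.
have : `|p| <= `|M| + 1.
  apply: (hM (`|M| + 1)); first by rewrite (le_lt_trans (ler_norm _))// ltrDl.
  by apply: subset_closure.
rewrite prod_normE/= ge_max => /andP[_]; apply/negP; rewrite -ltNge.
by rewrite -normrN (lt_le_trans _ (ler_norm _))// ltrNr.
Qed.

End weighted_derivatives.

Opaque ev.

(** * Cone coordinates and Green's identity *)

Section green.
Variables (R : realType) (n : nat) (b : R) (hb : b < 0).
Local Notation V := ('rV[R]_n * R)%type.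
Local Notation a := (apar b).
Local Notation dir o := (@direction R n o).
Implicit Types (f : V -> R) (p v : V).

Lemma apar_gt0 : 0 < a.
Proof. by rewrite /apar mulr_gt0 ?divr_gt0// powR_gt0// oppr_gt0. Qed.

Definition kap : R := 8 / 3 * a.

Lemma kap_gt0 : 0 < kap.
Proof. by rewrite /kap mulr_gt0 ?apar_gt0// divr_gt0. Qed.

Definition s32 p : R := (- p.2) `^ (3 / 2).

Lemma s32_gt0 p : p.2 < 0 -> 0 < s32 p.
Proof. by move=> p0; rewrite powR_gt0// oppr_gt0. Qed.

Lemma s32_sqr p : p.2 < 0 -> s32 p ^+ 2 = (- p.2) ^+ 3.
Proof.
move=> p0; have s0 : 0 < - p.2 by rewrite oppr_gt0.
rewrite expr2 -powRDp// (_ : 3 / 2 + 3 / 2 = 3%:R); last by field.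
by rewrite powR_mulrn// ltW.
Qed.

Lemma nonzero p : p.2 < 0 -> [/\ p.2 != 0, s32 p != 0 & kap != 0].
Proof. by move=> p0; rewrite lt_eqF// !gt_eqF ?kap_gt0// s32_gt0. Qed.

(* zeta = u / (v - u), so that u / v = zeta / (1 + zeta). *)
Definition zeta p : R := 4 / 9 * s32 p / kap - 1 / 2 + (a ^+ 2 - sqnorm p.1) / (kap * s32 p).

(** This is s d zeta / ds for s = - y, expressed through zeta and [s32]. *)
Definition gam p : R := 4 / 3 * s32 p / kap - 3 / 2 * zeta p - 3 / 4.

Lemma ufunE p : p.2 < 0 -> - ufun b p / 9 = kap * s32 p * zeta p.
Proof.
move=> p0; have s0 := s32_gt0 p0; have k0 := kap_gt0; have nz := nonzero p0.
rewrite /ufun -/(s32 p) (_ : p.2 ^+ 3 = - s32 p ^+ 2); last by rewrite s32_sqr//; ring.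
rewrite /zeta (_ : kap * s32 p * _ = 4 / 9 * s32 p ^+ 2 - kap / 2 * s32 p + (a ^+ 2 - sqnorm p.1)).
  by rewrite /kap; field.
by field; rewrite !gt_eqF.
Qed.

Lemma DminusE p : p.2 < b -> Dminus b p <-> 0 < zeta p.
Proof.
move=> pb; have p0 := lt_trans pb hb.
have E : (0 < zeta p) = (ufun b p < 0).
  by rewrite -(pmulr_rgt0 (zeta p) (mulr_gt0 kap_gt0 (s32_gt0 p0))) -ufunE// pmulr_lgt0// oppr_gt0.
by rewrite E; split => [[]|].
Qed.

Lemma is_derive_s32 p v : p.2 < 0 ->
  is_derive p v s32 (- (3 / 2 * s32 p / - p.2) * v.2).
Proof.
move=> p0; have s0 : 0 < - p.2 by rewrite oppr_gt0.
have := is_derive_ypow (3 / 2) v p0.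
by rewrite powRDp// powR_inv1 ?ltW// mulrA.
Qed.

Lemma is_derive_inv_s32 p v : p.2 < 0 ->
  is_derive p v (fun q => (s32 q)^-1) (3 / 2 / s32 p / - p.2 * v.2).
Proof.
move=> p0; have s0 : 0 < - p.2 by rewrite oppr_gt0.
have := is_derive_ypow (- (3 / 2)) v p0.
rewrite (_ : - (- (3 / 2) * _) = 3 / 2 / s32 p / - p.2).
  by under eq_fun do rewrite powRN.
rewrite powRDp// powR_inv1 ?ltW// powRN /s32; ring.
Qed.

Lemma is_derive_zeta p v : p.2 < 0 -> is_derive p v zeta
  (- 2 * (\sum_(i < n) p.1 0 i * v.1 0 i) / (kap * s32 p) - gam p / - p.2 * v.2).
Proof.
move=> p0; have s0 := s32_gt0 p0; have k0 := kap_gt0; have nz := nonzero p0.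
have d1 := is_derive_s32 v p0; have d2 := is_derive_inv_s32 v p0.
have d3 := is_derive_sqnorm p v.
rewrite (_ : zeta = fun q => (4 / 9 / kap) * s32 q - 1 / 2 + (a ^+ 2 - sqnorm q.1) * (kap^-1 * (s32 q)^-1)).
  apply: is_derive_eq; rewrite /GRing.scale /= /gam /zeta; case: nz => [y0 sn kn]; field.
  by do ?[apply/andP; split].
by apply/funext => q; rewrite /zeta [(kap * s32 q)^-1]invfM (mulrAC (4 / 9)).
Qed.

Lemma contH_s32 : contH s32.
Proof. exact: contH_ypow. Qed.

Lemma contH_inv_s32 : contH (fun p => (s32 p)^-1).
Proof.
rewrite (_ : (fun p => _) = (fun p : V => (- p.2) `^ (- (3 / 2)))); first exact: contH_ypow.
by apply/funext => p; rewrite powRN.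
Qed.

Lemma contH_zeta : contH zeta.
Proof.
rewrite (_ : zeta = fun q => (4 / 9 / kap) * s32 q - 1 / 2 + (a ^+ 2 - sqnorm q.1) * (kap^-1 * (s32 q)^-1)).
  apply: contHD; first by apply: contHB; [apply: contHM; [exact: contH_cst|exact: contH_s32]|exact: contH_cst].
  apply: contHM; first by apply: contHB; [exact: contH_cst|exact: contH_sqnorm].
  by apply: contHM; [exact: contH_cst|exact: contH_inv_s32].
by apply/funext => q; rewrite /zeta [(kap * s32 q)^-1]invfM (mulrAC (4 / 9)).
Qed.

(** At y = b one has - u / 9 = - |x|^2. Hence functions that vanish for zeta <= 0 leave no boundary
    term on y = b. *)
Lemma zeta_le0 x : zeta (x, b) <= 0.
Proof.
have s0 : 0 < s32 (x, b) by exact: s32_gt0.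
rewrite -(pmulr_rle0 (zeta (x, b)) (mulr_gt0 kap_gt0 s0)) -ufunE//.
rewrite /ufun /= pmulr_lle0// oppr_le0.
rewrite (_ : b ^+ 3 = - (3 / 2 * a) ^+ 2).
  rewrite (_ : (- b) `^ (3 / 2) = 3 / 2 * a); last by rewrite /apar; field.
  by rewrite (_ : _ + _ = 9 * sqnorm x); [rewrite mulr_ge0// sumr_ge0// => i _; exact: sqr_ge0|field].
rewrite (_ : 3 / 2 * a = s32 (x, b)); last by rewrite /apar /s32 /=; field.
by rewrite s32_sqr//=; ring.
Qed.

(** In the cone |x| < (2/3) (- y)^(3/2) - a, so a lower bound on y bounds x as well. *)
Lemma zeta_supp M p : p.2 <= b -> - M <= p.2 -> 0 < zeta p -> forall i, `|p.1 0 i| <= 2 / 3 * M `^ (3 / 2).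
Proof.
move=> pb pM z0 i; have p0 := le_lt_trans pb hb.
have s0 := s32_gt0 p0; have a0 := apar_gt0.
have := mulr_gt0 (mulr_gt0 kap_gt0 s0) z0.
rewrite -ufunE// /ufun -/(s32 p) (_ : p.2 ^+ 3 = - s32 p ^+ 2); last by rewrite s32_sqr//; ring.
set s := s32 p in s0 *; move=> h.
have sM : s <= M `^ (3 / 2).
  have s1 : 0 <= - p.2 by rewrite oppr_ge0 ltW.
  have s2 : - p.2 <= M by rewrite lerNl.
  by apply: ge0_ler_powR => //; rewrite ?nnegrE ?divr_ge0// (le_trans s1).
have as_ : a <= 2 / 3 * s.
  rewrite /apar ler_wpM2l ?divr_ge0//; apply: ge0_ler_powR; last by rewrite lerN2.
  - by rewrite divr_ge0.
  - by rewrite nnegrE oppr_ge0 ltW.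
  - by rewrite nnegrE oppr_ge0 ltW.
have xi : p.1 0 i ^+ 2 <= sqnorm p.1.
  by rewrite /sqnorm (bigD1 i)//= lerDl sumr_ge0// => j _; exact: sqr_ge0.
have r0 : 0 <= 2 / 3 * M `^ (3 / 2) by rewrite mulr_ge0 ?divr_ge0 ?powR_ge0.
rewrite -ler_sqr ?nnegrE// real_normK ?num_real//.
apply: (@le_trans _ _ ((2 / 3 * s) ^+ 2)); last first.
  by rewrite ler_sqr ?nnegrE ?mulr_ge0 ?divr_ge0 ?powR_ge0 ?ler_wpM2l ?divr_ge0 ?(ltW s0).
nra.
Qed.

Definition cone_bound (M : R) := Order.max M (2 / 3 * M `^ (3 / 2)).

Lemma cone_supp M F : (forall p, p.2 <= b -> zeta p <= 0 -> F p = 0) -> ybounded M F ->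
  yb_supp b (cone_bound M) F.
Proof.
move=> zF yF p pb h; have [pM|pM] := ltP p.2 (- M); first exact: yF.
apply: zF => //; rewrite leNgt; apply/negP => z0.
case: h => [[i iM]|yM]; last first.
  by move: yM; rewrite ltNge (le_trans _ pM)// lerN2 le_max lexx.
by move: iM; rewrite ltNge (le_trans (zeta_supp pb pM z0 i))// le_max lexx orbT.
Qed.

Lemma contHV F : contH F -> (forall p, p.2 < 0 -> F p != 0) -> contH (fun p => (F p)^-1).
Proof. by move=> cF F0 p p0; apply: cvgV; [exact: F0|exact: cF]. Qed.

Lemma contHX F k : contH F -> contH (fun p => F p ^+ k).
Proof. by move=> cF; elim: k => [|k ih]; [exact: contH_cst|under eq_fun do rewrite exprS; exact: contHM]. Qed.

Lemma contH_gam : contH gam.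
Proof.
apply: contHB; last exact: contH_cst.
apply: contHB; last by apply: contHM; [exact: contH_cst|exact: contH_zeta].
apply: contHM; last exact: contH_cst.
by apply: contHM; [exact: contH_cst|exact: contH_s32].
Qed.

Lemma bintD F G M : contH F -> contH G -> yb_supp b M F -> yb_supp b M G ->
  bint b (fun p => F p + G p) = bint b F + bint b G.
Proof.
move=> cF cG sF sG; rewrite /bint; have mH := @measurable_Hb R n b.
by rewrite (RintegralD mH (contH_integrable hb cF sF) (contH_integrable hb cG sG)).
Qed.

Lemma eq_bint F G : (forall p, p.2 < b -> F p = G p) -> bint b F = bint b G.
Proof. by move=> h; apply: eq_Rintegral => z /set_mem zb; exact: h. Qed.

Lemma bintZ c F M : contH F -> yb_supp b M F -> bint b (fun p => c * F p) = c * bint b F.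
Proof.
move=> cF sF; rewrite /bint; have mH := @measurable_Hb R n b.
by rewrite -RintegralZl//; exact: (contH_integrable hb cF sF).
Qed.

Lemma yb_suppD M F G : yb_supp b M F -> yb_supp b M G -> yb_supp b M (fun p => F p + G p).
Proof. by move=> sF sG p pb h; rewrite sF// sG// addr0. Qed.

Lemma yb_suppM' M F G : yb_supp b M G -> yb_supp b M (fun p => F p * G p).
Proof. by move=> sG p pb h; rewrite sG// mulr0. Qed.

Lemma bint_sum0 (I : Type) (r : seq I) (F : I -> V -> R) M : (forall i, contH (F i)) ->
  (forall i, yb_supp b M (F i)) -> (forall i, bint b (F i) = 0) ->
  bint b (fun p => \sum_(i <- r) F i p) = 0 /\ yb_supp b M (fun p => \sum_(i <- r) F i p).
Proof.
move=> cF sF F0; elim: r => [|i r [ih1 ih2]].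
  split => [|p _ _]; last by rewrite big_nil.
  under [X in bint b X]eq_fun do rewrite big_nil.
  by rewrite /bint /Rintegral integral0.
under eq_fun do rewrite big_cons.
split; last exact: yb_suppD.
by rewrite (@bintD _ _ M)// ?F0 ?ih1 ?addr0//; exact: contH_sum.
Qed.

Section solution.
Variables (q : R) (Th Th1 Th2 : R -> R).
Hypotheses (dTh : forall z : R, is_derive z 1 Th (Th1 z))
  (dTh1 : forall z : R, is_derive z 1 Th1 (Th2 z)) (cTh2 : continuous Th2)
  (Th0 : forall z, z <= 0 -> Th z = 0) (Th10 : forall z, z <= 0 -> Th1 z = 0)
  (Th20 : forall z, z <= 0 -> Th2 z = 0).

Definition Uq p : R := (- p.2) `^ q * Th (zeta p).

(** The image of [Uq] under T, as [TU_sum] shows. Inserting [gam], the terms in [s32] cancel exactly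
    when q = 1/2 - 3 n / 4, which for n = 2 m + 1 is the exponent - 1/4 - 3 m / 2; what remains is
    then a hypergeometric operator in zeta. *)
Definition TUq p : R := (- p.2) `^ (q - 2) *
  (9 / 4 * zeta p * (1 + zeta p) * Th2 (zeta p) +
   ((2 * q - 5 / 2) * gam p + (2 * n%:R + 2) * (s32 p / kap)) * Th1 (zeta p) +
   q * (q - 1) * Th (zeta p)).

Let Ux i p := - 2 * p.1 0 i * ((- p.2) `^ q / kap * (s32 p)^-1 * Th1 (zeta p)).
Let Uxx i p := - 2 * ((- p.2) `^ q / kap * (s32 p)^-1 * Th1 (zeta p)) +
  4 * p.1 0 i ^+ 2 * ((- p.2) `^ q * (kap * s32 p) ^- 2 * Th2 (zeta p)).
Let Uy p := - (- p.2) `^ (q - 1) * (q * Th (zeta p) + gam p * Th1 (zeta p)).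
Let Uyy p := (- p.2) `^ (q - 2) * ((q - 1) * (q * Th (zeta p) + gam p * Th1 (zeta p))
   + q * gam p * Th1 (zeta p) + (2 * s32 p / kap - 3 / 2 * gam p) * Th1 (zeta p)
   + gam p ^+ 2 * Th2 (zeta p)).

Let dThz p v : p.2 < 0 -> is_derive p v (fun q => Th (zeta q)) (Th1 (zeta p) *
  (- 2 * (\sum_(i < n) p.1 0 i * v.1 0 i) / (kap * s32 p) - gam p / - p.2 * v.2)).
Proof. by move=> p0; exact: (is_derive_compR (is_derive_zeta v p0) (dTh _)). Qed.

Let dTh1z p v : p.2 < 0 -> is_derive p v (fun q => Th1 (zeta q)) (Th2 (zeta p) *
  (- 2 * (\sum_(i < n) p.1 0 i * v.1 0 i) / (kap * s32 p) - gam p / - p.2 * v.2)).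
Proof. by move=> p0; exact: (is_derive_compR (is_derive_zeta v p0) (dTh1 _)). Qed.

Let sum_dir (x : 'rV[R]_n) i : \sum_(j < n) x 0 j * (dir (Some i)).1 0 j = x 0 i.
Proof.
rewrite (bigD1 i)//= big1 => [|j ji]; rewrite !mxE eqxx ?eqxx ?mulr1 ?addr0//=.
by rewrite (negPf ji) mulr0.
Qed.

Let sum_dirN (x : 'rV[R]_n) : \sum_(j < n) x 0 j * (dir None).1 0 j = 0.
Proof. by rewrite big1// => j _; rewrite /= !mxE mulr0. Qed.

Let dUx i p : p.2 < 0 -> is_derive p (dir (Some i)) Uq (Ux i p).
Proof.
move=> p0; have s0 := s32_gt0 p0; have k0 := kap_gt0; have nz := nonzero p0.
have d1 := is_derive_ypow q (dir (Some i)) p0; have d2 := dThz (dir (Some i)) p0.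
rewrite sum_dir in d2; rewrite /Uq; apply: is_derive_eq; rewrite /Ux /GRing.scale /=.
case: nz => [y0 sn kn]; field; by do ?[apply/andP; split].
Qed.

Let dcoord i p v : is_derive p v (fun q : V => q.1 0 i) (v.1 0 i).
Proof.
apply: is_derive_alongP => /=.
rewrite (_ : (fun s : R => _) = (fun s : R => p.1 0 i + s * v.1 0 i)); last first.
  by apply/funext => s; rewrite !mxE.
by apply: is_derive_eq; rewrite /GRing.scale /=; ring.
Qed.

Let dUxx i p : p.2 < 0 -> is_derive p (dir (Some i)) (Ux i) (Uxx i p).
Proof.
move=> p0; have s0 := s32_gt0 p0; have k0 := kap_gt0; have nz := nonzero p0.
have d1 := is_derive_ypow q (dir (Some i)) p0; have d2 := dTh1z (dir (Some i)) p0.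
have d3 := is_derive_inv_s32 (dir (Some i)) p0; have d4 := dcoord i p (dir (Some i)).
rewrite sum_dir in d2; rewrite /Ux; apply: is_derive_eq; rewrite /Uxx /GRing.scale /=.
rewrite !mxE !eqxx /=.
case: nz => [y0 sn kn]; field; by do ?[apply/andP; split].
Qed.

Let powRB1 (s r : R) : 0 < s -> s `^ (r - 1) = s `^ r / s.
Proof. by move=> s0; rewrite powRDp// powR_inv1// ltW. Qed.

Let powRB2 (s r : R) : 0 < s -> s `^ (r - 2) = s `^ r / s ^+ 2.
Proof.
move=> s0; rewrite (_ : r - 2 = r - 1 - 1); last by ring.
by rewrite !powRB1//; field; rewrite gt_eqF.
Qed.

Let dUy p : p.2 < 0 -> is_derive p (dir None) Uq (Uy p).
Proof.
move=> p0; have s0 := s32_gt0 p0; have k0 := kap_gt0; have nz := nonzero p0.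
have s1 : 0 < - p.2 by rewrite oppr_gt0.
have d1 := is_derive_ypow q (dir None) p0; have d2 := dThz (dir None) p0.
rewrite sum_dirN in d2; rewrite /Uq; apply: is_derive_eq; rewrite /Uy /GRing.scale /=.
rewrite !powRB1//.
case: nz => [y0 sn kn]; field; by do ?[apply/andP; split].
Qed.

Let dUyy p : p.2 < 0 -> is_derive p (dir None) Uy (Uyy p).
Proof.
move=> p0; have s0 := s32_gt0 p0; have k0 := kap_gt0; have nz := nonzero p0.
have s1 : 0 < - p.2 by rewrite oppr_gt0.
have d1 := is_derive_ypow (q - 1) (dir None) p0; have d2 := dThz (dir None) p0.
have d3 := dTh1z (dir None) p0; have d4 := is_derive_zeta (dir None) p0.
have d5 := is_derive_s32 (dir None) p0.
rewrite sum_dirN in d2 d3 d4; rewrite /Uy /gam; apply: is_derive_eq; rewrite /Uyy /GRing.scale /=.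
rewrite /gam !powRB1// powRB2//.
case: nz => [y0 sn kn]; field; by do ?[apply/andP; split].
Qed.

Let TU_sum p : p.2 < 0 -> p.2 * (\sum_(i < n) Uxx i p) + Uyy p = TUq p.
Proof.
move=> p0; case: (nonzero p0) => [y0 sn kn].
have s1 : 0 < - p.2 by rewrite oppr_gt0.
rewrite big_split/= sumr_const card_ord -mulr_suml -mulr_sumr -/(sqnorm p.1).
rewrite /Uyy /TUq powRB2//.
have E : sqnorm p.1 = a ^+ 2 - (zeta p - 4 / 9 * s32 p / kap + 1 / 2) * (kap * s32 p).
  by rewrite /zeta; field; do ?[apply/andP; split].
have a0 : a != 0 by rewrite gt_eqF// apar_gt0.
have h3 : s32 p ^+ 2 = - p.2 ^+ 3 by rewrite s32_sqr//; ring.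
rewrite E /gam -[_ *+ n]mulr_natr.
set z := zeta p; set s := s32 p in sn h3 *; set y := p.2 in y0 h3 *.
set A := Th1 z; set B := Th2 z; set D := Th z; set P := _ `^ q.
move: h3 sn; move: a0; rewrite /kap; set c := apar b => c0 h3 sn.
have -> : y * (- 2 * (P / (8 / 3 * c) / s * A) * n%:R +
   4 * (c ^+ 2 - (z - 4 / 9 * s / (8 / 3 * c) + 1 / 2) * (8 / 3 * c * s)) *
   (P * (8 / 3 * c * s) ^- 2 * B)) =
   P / (- y) ^+ 2 * (2 * n%:R * (s / (8 / 3 * c)) * A -
   4 * (c ^+ 2 - (z - 4 / 9 * s / (8 / 3 * c) + 1 / 2) * (8 / 3 * c * s)) / (8 / 3 * c) ^+ 2 * B).
  apply/eqP; rewrite -subr_eq0; apply/eqP.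
  transitivity ((s ^+ 2 + y ^+ 3) * P * (- (2 * n%:R * A) / (8 / 3 * c) / (s * y ^+ 2) +
     4 * (c ^+ 2 - (z - 4 / 9 * s / (8 / 3 * c) + 1 / 2) * (8 / 3 * c * s)) / (8 / 3 * c) ^+ 2 * B / (s ^+ 2 * y ^+ 2))).
    by field; do ?[apply/andP; split].
  by rewrite h3 addNr !mul0r.
by field; do ?[apply/andP; split].
Qed.

Lemma contH_TUq : contH TUq.
Proof.
have czT : contH (fun p => Th (zeta p)).
  by apply: contH_comp; [move=> z; exact: is_derive_cont (dTh z)|exact: contH_zeta].
have czT1 : contH (fun p => Th1 (zeta p)).
  by apply: contH_comp; [move=> z; exact: is_derive_cont (dTh1 z)|exact: contH_zeta].
have czT2 := contH_comp cTh2 contH_zeta.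
have cP r : contH (fun p => (- p.2) `^ r) by exact: contH_ypow.
have cs := contH_s32; have cz := contH_zeta; have cg := contH_gam.
apply: contHM => //; apply: contHD; last by apply: contHM => //; exact: contH_cst.
apply: contHD.
  apply: contHM => //; apply: contHM; first by apply: contHM => //; exact: contH_cst.
  by apply: contHD => //; exact: contH_cst.
apply: contHM => //; apply: contHD; first by apply: contHM => //; exact: contH_cst.
by do ?[apply: contHM => //]; exact: contH_cst.
Qed.

(** T is formally self-adjoint: with g = [ev l f], the difference U T g - (T U) g is a divergence.
    Its integral vanishes because U and its first derivatives vanish for zeta <= 0, in particular on
    y = b, and g vanishes for y < - M. *)
Lemma green l f M : smooth f -> ybounded M f ->
  bint b (fun p => Uq p * ev (Tt l) f p) = bint b (fun p => TUq p * ev l f p).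
Proof.
move=> sf yf.
have cTh : continuous Th by move=> z; exact: is_derive_cont (dTh z).
have cTh1 : continuous Th1 by move=> z; exact: is_derive_cont (dTh1 z).
have czT := contH_comp cTh contH_zeta; have czT1 := contH_comp cTh1 contH_zeta.
have czT2 := contH_comp cTh2 contH_zeta.
have cU : contH Uq by apply: contHM => //; exact: contH_ypow.
have cP r : contH (fun p => (- p.2) `^ r) by exact: contH_ypow.
have cs := contH_s32; have cz := contH_zeta; have cg := contH_gam.
have cUxx i : contH (Uxx i).
  have cks : contH (fun p => (kap * s32 p) ^- 2).
    apply: contHV; first by apply: contHX; apply: contHM => //; exact: contH_cst.
    by move=> p p0; case: (nonzero p0) => *; rewrite expf_neq0// mulf_neq0.
  apply: contHD.
    apply: contHM; first exact: contH_cst.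
    do 2 (apply: contHM => //); last exact: contH_inv_s32.
    by apply: contHM => //; exact: contH_cst.
  apply: contHM; first by apply: contHM; [exact: contH_cst|apply: contHX; exact: contH_coord].
  by do 2 (apply: contHM => //).
have cUyy : contH Uyy.
  apply: contHM => //; apply: contHD; last by apply: contHM => //; exact: contHX.
  apply: contHD.
    apply: contHD; last by do ?[apply: contHM => //]; exact: contH_cst.
    apply: contHM; first exact: contH_cst.
    by apply: contHD; apply: contHM => //; exact: contH_cst.
  apply: contHM => //; apply: contHB; last by apply: contHM => //; exact: contH_cst.
  by do ?[apply: contHM => //]; exact: contH_cst.
have cTU := contH_TUq.
pose Fx i p := p.2 * (Uq p * ev (dxt i (dxt i l)) f p + - (Uxx i p * ev l f p)).
pose Fy p := Uq p * ev (dyt (dyt l)) f p + - (Uyy p * ev l f p).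
have ce l' : contH (ev l' f) by exact: contH_ev.
have cFx i : contH (Fx i).
  apply: contHM; first exact: contH_y.
  by apply: contHD; [exact: contHM|apply: contHN; exact: contHM].
have cFy : contH Fy.
  by apply: contHD; [exact: contHM|apply: contHN; exact: contHM].
have sU F l' : (forall p, zeta p <= 0 -> F p = 0) -> yb_supp b (cone_bound M) (fun p => F p * ev l' f p).
  move=> F0; apply: cone_supp => [p _ z|p pM]; first by rewrite F0// mul0r.
  by rewrite (ybounded_ev _ yf)// mulr0.
have sN F : yb_supp b (cone_bound M) F -> yb_supp b (cone_bound M) (fun p => - F p).
  by move=> sF p pb h; rewrite sF// oppr0.
have zU p : zeta p <= 0 -> Uq p = 0 by move=> z; rewrite /Uq Th0// mulr0.
have zUx i p : zeta p <= 0 -> Ux i p = 0 by move=> z; rewrite /Ux Th10// !mulr0.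
have zUxx i p : zeta p <= 0 -> Uxx i p = 0 by move=> z; rewrite /Uxx Th10// Th20// !mulr0 addr0.
have zUy p : zeta p <= 0 -> Uy p = 0 by move=> z; rewrite /Uy Th0// Th10// !mulr0 addr0 mulr0.
have zUyy p : zeta p <= 0 -> Uyy p = 0.
  by move=> z; rewrite /Uyy Th0// Th10// Th20// !(mulr0, addr0).
have zTU p : zeta p <= 0 -> TUq p = 0.
  by move=> z; rewrite /TUq Th0// Th10// Th20// !(mulr0, addr0).
have sFx i : yb_supp b (cone_bound M) (Fx i).
  by move=> p pb h; rewrite /Fx (sU _ _ zU)// (sU _ _ (zUxx i))// subr0 mulr0.
have sFy : yb_supp b (cone_bound M) Fy.
  by apply: yb_suppD; [exact: sU|apply: sN; exact: sU].
have Fx0 i : bint b (Fx i) = 0.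
  apply: (@bint_dx R n b hb i (fun p => p.2 * (Uq p * ev (dxt i l) f p + - (Ux i p * ev l f p))) _ (cone_bound M)) => //.
    by move=> p pb h; rewrite (sU _ _ zU)// (sU _ _ (zUx i))// subr0 mulr0.
  move=> p p0; have d1 := dUx i p0; have d2 := dUxx i p0.
  have d3 := is_derive_ev_x l i sf p0; have d4 := is_derive_ev_x (dxt i l) i sf p0.
  have d5 := is_derive_snd p (dir (Some i)).
  by apply: is_derive_eq; rewrite /Fx /GRing.scale /=; ring.
have Fy0 : bint b Fy = 0.
  apply: (@bint_dy R n b hb (fun p => Uq p * ev (dyt l) f p + - (Uy p * ev l f p)) _ (cone_bound M)) => //.
  - by apply: yb_suppD; [exact: sU|apply: sN; exact: sU].
  - move=> p p0; have d1 := dUy p0; have d2 := dUyy p0.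
    have d3 := is_derive_ev_y l sf p0; have d4 := is_derive_ev_y (dyt l) sf p0.
    by apply: is_derive_eq; rewrite /Fy /GRing.scale /=; ring.
  - by move=> x; rewrite zU ?zUy ?zeta_le0// !mul0r subr0.
have [Sx0 sSx] := bint_sum0 (index_enum 'I_n) cFx sFx Fx0.
have : bint b (fun p => \sum_(i < n) Fx i p + Fy p) = 0.
  by rewrite (bintD _ _ sSx sFy)// ?Sx0 ?Fy0 ?addr0//; exact: contH_sum.
rewrite (@eq_bint _ (fun p => Uq p * ev (Tt l) f p + (-1) * (TUq p * ev l f p))).
  rewrite (@bintD _ _ (cone_bound M)); first last.
  - by apply: yb_suppM'; exact: sU.
  - exact: sU.
  - by apply: contHM; [exact: contH_cst|exact: contHM].
  - exact: contHM.
  by rewrite (@bintZ _ _ (cone_bound M)) ?mulN1r; [move=> /eqP; rewrite subr_eq0 => /eqP|exact: contHM|exact: sU].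
move=> p pb; have p0 := lt_trans pb hb.
rewrite ev_T// -TU_sum// /Fx /Fy -mulr_sumr big_split/= sumrN -mulr_suml -mulr_sumr; ring.
Qed.

End solution.
End green.

(** * Analytic continuation of the powers of k *)

Section cone_powers.
Variables (R : realType) (n : nat) (b : R) (hb : b < 0).
Local Notation T := (measurableTypeR R).
Local Notation V := ('rV[R]_n * R)%type.
Local Notation C := R[i].
Local Notation nc := (@Normc.normc R).
Local Notation Vmu := (tuple_measure (@lebesgue_measure R) n \x @lebesgue_measure R)%E.
Local Notation kap := (kap b).
Local Notation zeta := (@zeta R n b).
Local Open Scope complex_scope.
Implicit Types (F G : V -> R) (p : V) (z : C) (M x : R).

Definition Dv : set (n.-tuple T * T) := @vpt R n @^-1` Dminus b.

Definition kfun p := - ufun b p / 9.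

Lemma kfun_gt0 p : Dminus b p -> 0 < kfun p.
Proof. by move=> [_ u0]; rewrite divr_gt0// oppr_gt0. Qed.

Lemma Dv_Hb : Dv `<=` @Hb R n b.
Proof. by move=> z []. Qed.

Lemma DvE (z : n.-tuple T * T) : @Hb R n b z -> Dv z <-> 0 < zeta (vpt z).
Proof. exact: (@DminusE R n b hb (vpt z)). Qed.

Lemma Dv_zeta (z : n.-tuple T * T) : Dv z -> 0 < zeta (vpt z).
Proof. by move=> Dz; apply/DvE => //; exact: Dv_Hb. Qed.

Lemma measurable_Dv : measurable Dv.
Proof.
rewrite (_ : Dv = @Hb R n b `&` ((zeta \o @vpt R n) @^-1` `]0, +oo[)).
  by apply: (contH_measurable hb (@contH_zeta R n b)); [exact: measurable_Hb|exact: measurable_itv].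
apply/seteqP; split => z.
  by move=> Dz; split; [exact: Dv_Hb|by rewrite /= in_itv/= andbT; exact: Dv_zeta].
by move=> [Hz]; rewrite /= in_itv/= andbT => z0; apply/DvE.
Qed.

Lemma contH_measurable_Dv F : contH F -> measurable_fun Dv (F \o @vpt R n).
Proof.
by move=> cF; apply: measurable_funS (@measurable_Hb R n b) Dv_Hb _; exact: contH_measurable.
Qed.

Lemma measurable_kfun : measurable_fun Dv (kfun \o @vpt R n).
Proof.
apply: (@eq_measurable_fun _ _ _ _ _ ((fun p => kap * s32 p * zeta p) \o @vpt R n)).
  move=> z /set_mem /Dv_Hb zb; rewrite /= /kfun ufunE//; exact: lt_trans zb hb.
apply: contH_measurable_Dv; apply: contHM; last exact: contH_zeta.
by apply: contHM; [exact: contH_cst|exact: contH_s32].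
Qed.

Lemma kfun_bound M p : Dminus b p -> - M <= p.2 -> kfun p <= (M `^ (3 / 2)) ^+ 2.
Proof.
move=> Dp pM; have pb := Dp.1; have p0 := lt_trans pb hb; have s0 := s32_gt0 p0.
have as_ : apar b <= 2 / 3 * s32 p.
  rewrite /apar ler_wpM2l ?divr_ge0//; apply: ge0_ler_powR; last by rewrite lerN2 ltW.
  - by rewrite divr_ge0.
  - by rewrite nnegrE oppr_ge0 ltW.
  - by rewrite nnegrE oppr_ge0 ltW.
have a0 := apar_gt0 hb.
have sM : s32 p <= M `^ (3 / 2).
  have s1 : 0 <= - p.2 by rewrite oppr_ge0 ltW.
  have s2 : - p.2 <= M by rewrite lerNl.
  by apply: ge0_ler_powR => //; rewrite ?nnegrE ?divr_ge0// (le_trans s1).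
apply: (@le_trans _ _ (s32 p ^+ 2)); last by rewrite ler_sqr ?nnegrE ?powR_ge0 ?(ltW s0).
have q0 : 0 <= sqnorm p.1 by apply: sumr_ge0 => i _; exact: sqr_ge0.
rewrite /kfun /ufun -/(s32 p) (_ : p.2 ^+ 3 = - s32 p ^+ 2); last by rewrite s32_sqr//; ring.
nra.
Qed.

Lemma Dv_integrable F M : contH F -> ybounded M F -> Vmu.-integrable Dv (EFin \o (F \o @vpt R n)).
Proof.
move=> cF yF; have mD := measurable_Dv; have mFD := contH_measurable_Dv cF.
pose N := Order.max (cone_bound M) M.
have [B [B0 hB]] := contH_bounded hb N cF.
have small (z : n.-tuple T * T) : Dv z -> (forall i, `|(vpt z).1 0 i| <= N) \/ F (vpt z) = 0.
  move=> Dz; have [pM|pM] := ltP (vpt z).2 (- M); first by right; exact: yF.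
  left => i; apply: (le_trans (@zeta_supp R n b hb M (vpt z) (ltW (Dv_Hb Dz)) pM (Dv_zeta Dz) i)).
  by rewrite /N /cone_bound !le_max lexx orbT.
apply/(integrable_mkcond _ mD); rewrite restrict_EFin.
apply: (@integrable_bounded_support _ _ R Vmu _ ((F \o @vpt R n) \_ Dv) B (@vbox_measurable R n N) (@vbox_finite R n N)).
- by apply/(measurable_restrictT _ mD).
- move=> z hz; rewrite patchE; case: ifPn => // /set_mem Dz.
  have [h|//] := small z Dz; have [pM|pM] := ltP (vpt z).2 (- M); first exact: yF.
  exfalso; apply: hz; split => [j|]; first by have := h j; rewrite mxE.
  have z0 : z.2 < 0 := lt_trans (Dv_Hb Dz) hb.
  by rewrite ler0_norm ?(ltW z0)// lerNl (le_trans _ pM)// lerN2 le_max lexx orbT.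
- move=> z; rewrite patchE; case: ifPn => [/set_mem Dz|_]; last by rewrite normr0.
  rewrite /=; have [h|->] := small z Dz; last by rewrite normr0.
  have [pM|pM] := ltP (vpt z).2 (- M); first by rewrite /= yF ?normr0.
  apply: hB => //; first exact/ltW/(Dv_Hb Dz).
  by rewrite (le_trans _ pM)// lerN2 le_max lexx orbT.
Qed.

Definition Ic z F : C := cintegral Vmu Dv (fun w => cpow (kfun (vpt w)) z * (F (vpt w))%:C).

Lemma Ic_vintegral z F : vintegral (Dminus b) (fun p => cpow (- ufun b p / 9) z * (F p)%:C) = Ic z F.
Proof. by []. Qed.

(** Where ln k < 0 the two exponentials cancel; elsewhere k is bounded above as long as y >= - M. *)
Lemma kpow_dominated x M : 0 < x -> exists B : R, 0 <= B /\ forall p, Dminus b p -> - M <= p.2 ->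
  expR (x * ln (kfun p)) * expR (x * `|ln (kfun p)|) <= B.
Proof.
move=> x0; pose K0 := (M `^ (3 / 2)) ^+ 2 + 1.
exists (expR (x * ln K0) ^+ 2 + 1); split; first by rewrite addr_ge0// sqr_ge0.
move=> p Dp pM; have k0 := kfun_gt0 Dp.
have kK : kfun p <= K0 by rewrite (le_trans (kfun_bound Dp pM))// lerDl.
rewrite -expRD -mulrDr; have [l0|l0] := leP 0 (ln (kfun p)).
  rewrite ger0_norm// ler_wpDr// expr2 -expRD -mulrDr ler_expR ler_wpM2l ?(ltW x0)//.
  by rewrite lerD// ler_ln// posrE (lt_le_trans k0).
by rewrite ltr0_norm// subrr mulr0 expR0 lerDr sqr_ge0.
Qed.

Lemma Ic_analytic F M z : contH F -> ybounded M F -> 0 < complex.Re z ->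
  analytic_at (fun z => Ic z F) z.
Proof.
move=> cF yF z0; have mD := measurable_Dv; have mK := measurable_kfun.
have mF := contH_measurable_Dv cF.
have [B [B0 hB]] := kpow_dominated M z0.
have iF := Dv_integrable cF yF.
have iG : Vmu.-integrable Dv (EFin \o (fun w => B * `|F (vpt w)|)).
  by apply: (integrableZR mD B); exact: (integrable_norm iF).
(* The radius of the disc is Re z: any smaller real part that remains nonnegative still gives powers
   of k bounded near the cone. *)
apply: (@mellin_analytic _ _ R Vmu Dv mD (kfun \o @vpt R n) (F \o @vpt R n) mK mF z
  (complex.Re z) (fun w => B * `|F (vpt w)|) z0 iG).
move=> w Dw /=; have [pM|pM] := ltP (vpt w).2 (- M); first by rewrite yF// normr0 !mulr0.
by rewrite ler_wpM2r//; exact: hB.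
Qed.

Lemma Ic_integrable F M z : contH F -> ybounded M F -> 0 < complex.Re z ->
  cintegrable Vmu Dv (fun w => cpow (kfun (vpt w)) z * (F (vpt w))%:C).
Proof.
move=> cF yF z0; have mD := measurable_Dv; have mK := measurable_kfun.
have mF := contH_measurable_Dv cF.
have [B [B0 hB]] := kpow_dominated M z0.
have iF := Dv_integrable cF yF.
have iG : Vmu.-integrable Dv (EFin \o (fun w => B * `|F (vpt w)|)).
  by apply: (integrableZR mD B); exact: (integrable_norm iF).
have [mr mi] := @cmeas_mellin _ _ R Dv (kfun \o @vpt R n) (F \o @vpt R n) mK mF z.
apply: (cintegrable_dominated mD mr mi _ iG) => w Dw.
rewrite Normc.normcM normcR cpowE normc_cexp /=.
have [pM|pM] := ltP (vpt w).2 (- M); first by rewrite yF// normr0 !mulr0.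
rewrite ler_wpM2r//; apply: le_trans (hB _ Dw pM).
rewrite (_ : complex.Re (z * _) = complex.Re z * ln (kfun (vpt w))); last first.
  by case: (z) => c d; rewrite /= !mulr0 subr0.
by rewrite ler_peMr ?expR_ge0// -expR0 ler_expR mulr_ge0// ltW.
Qed.

Lemma Ic_linear c F G M z : contH F -> ybounded M F -> contH G -> ybounded M G ->
  0 < complex.Re z -> Ic z (fun p => c * F p + G p) = c%:C * Ic z F + Ic z G.
Proof.
move=> cF yF cG yG z0; have mD := measurable_Dv.
have iF := Ic_integrable cF yF z0; have iG := Ic_integrable cG yG z0.
have iZ : cintegrable Vmu Dv (fun w => c%:C * (cpow (kfun (vpt w)) z * (F (vpt w))%:C)).
  have cF' : contH (fun p => c * F p) by apply: contHM => //; exact: contH_cst.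
  have yF' : ybounded M (fun p => c * F p) by move=> p pM; rewrite yF// mulr0.
  have := Ic_integrable cF' yF' z0.
  by under [X in cintegrable _ _ X]eq_fun do rewrite rmorphM mulrCA.
rewrite /Ic -(cintegralZ mD _ iF) -(cintegralD mD iZ iG); apply: eq_cintegral => w _.
by rewrite rmorphD rmorphM mulrDr mulrCA.
Qed.

Lemma eq_Ic z F G : (forall p, Dminus b p -> F p = G p) -> Ic z F = Ic z G.
Proof. by move=> h; apply: eq_cintegral => w Dw; rewrite h. Qed.

Lemma Ic_nil z (f : V -> R) : Ic z (ev [::] f) = 0.
Proof.
rewrite /Ic (_ : (fun w => _) = fun=> 0); last by apply/funext => w; rewrite ev_nil mulr0.
by apply: cintegral0; exact: measurable_Dv.
Qed.

(** Extension of k^x by 0 outside the cone: integrals over the cone become integrals over the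
    half-space, where integration by parts is available. *)
Definition kpow x p := if 0 < zeta p then expR (x * ln (kfun p)) else 0.

Lemma Ic_real x F : Ic x%:C F = (bint b (fun p => kpow x p * F p))%:C.
Proof.
rewrite /Ic; under eq_cintegral do rewrite cpow_real -rmorphM.
rewrite cintegral_real /bint; last exact: measurable_Dv.
congr (_ %:C); rewrite Rintegral_mkcond [RHS]Rintegral_mkcond.
apply: eq_Rintegral => w _; rewrite !patchE /kpow.
case: ifPn => [/set_mem Dw|nD].
  by rewrite mem_set; [rewrite Dv_zeta|exact: Dv_Hb].
case: ifPn => // /set_mem Hw; case: ifPn => [z0|_]; last by rewrite mul0r.
by move: nD; rewrite mem_set//; apply/DvE.
Qed.

End cone_powers.

Opaque Ic.

(** * Green's identity for powers of k *)

Section cone_green.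
Variables (R : realType).

Definition ppow (x z : R) : R := if 0 < z then expR (x * ln z) else 0.

Lemma ppow0 (x z : R) : z <= 0 -> ppow x z = 0.
Proof. by move=> z0; rewrite /ppow ltNge z0. Qed.

Lemma ppowS (x z : R) : 0 < z -> ppow x z = z * ppow (x - 1) z.
Proof. move=> z0; rewrite /ppow z0; transitivity (expR (ln z) * expR ((x - 1) * ln z)).
  by rewrite -expRD; congr expR; ring.
by rewrite lnK. Qed.

(** At 0 the difference quotient is h^(x - 1) for h > 0 and 0 for h < 0, so it tends to 0. *)
Lemma is_derive_ppow (x z : R) : 1 < x -> is_derive z 1 (ppow x) (x * ppow (x - 1) z).
Proof.
move=> x1; have [z0|z0|z0] := ltgtP z 0.
- apply: (@near_eq_is_derive _ _ _ (fun=> 0)).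
  + by near=> y; rewrite ppow0// ltW//; near: y; exact: lt_nbhsl.
  + by rewrite ppow0 ?(ltW z0)// mulr0; exact: is_derive_cst.
- have dl := is_derive1_ln z0; apply: (@near_eq_is_derive _ _ _ (fun y => expR (x * ln y))).
    by near=> y; rewrite /ppow ifT//; near: y; exact: lt_nbhsr.
  apply: is_derive_eq; rewrite -/(ppow x z) /GRing.scale /=.
  have := ppowS x z0; rewrite {1}/ppow z0 => ->.
  by field; rewrite gt_eqF.
- rewrite z0 {2}/ppow ltxx mulr0.
  have h : h^-1 *: (ppow x (h *: 1 + 0) - ppow x 0) @[h --> (0 : R)^'] --> (0 : R).
    (* d solves d^(x - 1) = e. *)
    apply/cvgrPdist_lt => e e0; pose d := expR (ln e / (x - 1)).
    near=> h; have h0 : h != 0 by near: h; exact: nbhs_dnbhs_neq.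
    rewrite sub0r normrN addr0 [h *: 1]mulr1 {2}/ppow ltxx subr0 /GRing.scale /=.
    have [hp|hn] := ltP 0 h; last by rewrite ppow0// mulr0 normr0.
    rewrite ppowS// mulKf// /ppow hp ger0_norm ?expR_ge0//.
    rewrite -[ltRHS](lnK e0) ltr_expR mulrC -ltr_pdivlMr ?subr_gt0//.
    rewrite -[ltRHS]expRK ltr_ln ?posrE ?expR_gt0//.
    have : `|h| < d.
      near: h; apply: dnbhs0_lt; exact: expR_gt0.
    by rewrite gtr0_norm.
  by split; [apply/cvg_ex; exists 0; exact: h|exact: cvg_lim h].
Unshelve. all: by end_near. Qed.

Variables (n : nat) (b : R) (hb : b < 0).
Local Notation V := ('rV[R]_n * R)%type.
Local Notation kap := (kap b).
Local Notation zeta := (@zeta R n b).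
Local Notation kpow := (@kpow R n b).
Implicit Types (f : V -> R) (p : V) (M x r : R).
Local Open Scope complex_scope.

Lemma kpowE x p : p.2 < 0 -> kpow x p = kap `^ x * (- p.2) `^ (3 / 2 * x) * ppow x (zeta p).
Proof.
move=> p0; have s0 := s32_gt0 p0; have k0 := kap_gt0 hb; rewrite /kpow /ppow.
case: ifPn => [z0|_]; last by rewrite mulr0.
rewrite powRrM -/(s32 p) /kfun ufunE//.
move: k0 s0 z0; move: (kap) (s32 p) (zeta p) => K S Z k0 s0 z0.
by rewrite !lnM ?posrE ?mulr_gt0// !mulrDr !expRD /powR !gt_eqF.
Qed.

Lemma contH_kpow x : 1 < x -> contH (kpow x).
Proof.
move=> x1 p p0.
have h : contH (fun p : V => kap `^ x * (- p.2) `^ (3 / 2 * x) * ppow x (zeta p)).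
  apply: contHM; first by apply: contHM; [exact: contH_cst|exact: contH_ypow].
  by apply: contH_comp; [move=> z; exact: is_derive_cont (is_derive_ppow z x1)|exact: contH_zeta].
have oU : open [set q : V | q.2 < 0].
  by apply: (@open_comp _ _ (fun q : V => q.2) [set y | y < 0]); [move=> q _; exact: cvg_snd|exact: open_lt].
have E : \forall q \near p, kap `^ x * (- q.2) `^ (3 / 2 * x) * ppow x (zeta q) = kpow x q.
  have : nbhs p [set q : V | q.2 < 0] by apply: open_nbhs_nbhs.
  by apply: filterS => q q0; rewrite kpowE.
rewrite /prop_for /continuous_at kpowE//.
by apply: cvg_trans (h _ p0); apply: near_eq_cvg.
Qed.

Lemma kpow_supp x M F : ybounded M F -> yb_supp b (cone_bound M) (fun p => kpow x p * F p).
Proof.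
move=> yF; apply: cone_supp => // p; last by move=> pM; rewrite yF// mulr0.
by move=> _ z0; rewrite /kpow ltNge z0 mul0r.
Qed.

(** Green's identity with q = r + 3 x / 2 and Th the x-th power of the positive part, since s^r k^x
    is a constant times s^q zeta^x in the cone; x > 3 keeps the exponents of Th and of its two
    derivatives above 1. Rewritten in powers of k, the lower-order part carries only the two weights
    r - 1/2 and r + 1. *)
Lemma green_Ic r x l f M : 3 < x -> smooth f -> ybounded M f ->
  Ic b x%:C (ev (mulp r (Tt l)) f) =
  Ic b x%:C (ev (scalt (r * (r - 1)) (mulp (r - 2) l)) f) +
  Ic b (x - 1)%:C (ev (scalt (- x * (3 / 2 * r + 3 / 8) * kap) (mulp (r - 1 / 2) l) ++
    scalt (x * (8 / 3 * r + 4 * x + 2 * n%:R - 4 / 3)) (mulp (r + 1) l)) f).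
Proof.
move=> x3 sf yf; have k0 := kap_gt0 hb.
have x1 : 1 < x by lra.
have x11 : 1 < x - 1 by lra.
have x21 : 1 < x - 1 - 1 by lra.
have ce l' : contH (ev l' f) by exact: contH_ev.
have ye l' : ybounded M (ev l' f) by exact: ybounded_ev.
rewrite !Ic_real// -rmorphD; congr (_ %:C).
rewrite -(@bintD R n b hb _ _ (cone_bound M)); first last.
- exact: kpow_supp.
- exact: kpow_supp.
- by apply: contHM; [exact: contH_kpow|].
- by apply: contHM; [exact: contH_kpow|].
pose Th := ppow x; pose Th1 z := x * ppow (x - 1) z.
pose Th2 z := x * ((x - 1) * ppow (x - 1 - 1) z).
have dTh (z : R) : is_derive z 1 Th (Th1 z) by exact: is_derive_ppow.
have dTh1 (z : R) : is_derive z 1 Th1 (Th2 z).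
  by have d := is_derive_ppow z x11; apply: is_derive_eq.
have cTh2 : continuous Th2.
  move=> z; apply: cvgM; first exact: cvg_cst.
  apply: cvgM; first exact: cvg_cst.
  exact: is_derive_cont (is_derive_ppow z x21).
have Th0 z : z <= 0 -> Th z = 0 by exact: ppow0.
have Th10 z : z <= 0 -> Th1 z = 0 by move=> z0; rewrite /Th1 ppow0// mulr0.
have Th20 z : z <= 0 -> Th2 z = 0 by move=> z0; rewrite /Th2 ppow0// !mulr0.
have G := @green R n b hb (r + 3 / 2 * x) Th Th1 Th2 dTh dTh1 cTh2 Th0 Th10 Th20 l f M sf yf.
transitivity (kap `^ x * bint b (fun p => Uq b (r + 3 / 2 * x) Th p * ev (Tt l) f p)).
  rewrite -(@bintZ R n b hb (kap `^ x) _ (cone_bound M)); first last.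
  - apply: cone_supp => // [p _ z0|p pM]; first by rewrite /Uq Th0// mulr0 mul0r.
    by rewrite (ybounded_ev _ yf)// mulr0.
  - apply: contHM; last exact: ce.
    apply: contHM; first exact: contH_ypow.
    by apply: contH_comp; [move=> z; exact: is_derive_cont (dTh z)|exact: contH_zeta].
  apply: eq_bint => p pb; have p_lt0 := lt_trans pb hb.
  rewrite ev_mulp// kpowE// /Uq powRDp ?oppr_gt0// /Th; ring.
have dTU p : p.2 < b -> kap `^ x * TUq b (r + 3 / 2 * x) Th Th1 Th2 p =
    r * (r - 1) * (- p.2) `^ (r - 2) * kpow x p +
    (- x * (3 / 2 * r + 3 / 8) * kap * (- p.2) `^ (r - 1 / 2) +
     x * (8 / 3 * r + 4 * x + 2 * n%:R - 4 / 3) * (- p.2) `^ (r + 1)) * kpow (x - 1) p.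
  move=> pb; have y0 := lt_trans pb hb.
  have s0 : 0 < - p.2 by rewrite oppr_gt0.
  have [z0|z0] := ltP 0 (zeta p); last first.
    by rewrite /TUq Th0// Th10// Th20// /kpow ltNge z0 /= !(mulr0, addr0).
  case: (nonzero hb y0) => [yn sn kn].
  rewrite /TUq !kpowE// /Th /Th1 /Th2 (ppowS x z0) (ppowS (x - 1) z0).
  rewrite (_ : 3 / 2 * (x - 1) = 3 / 2 * x - 3 / 2); last by ring.
  rewrite (_ : r + 3 / 2 * x - 2 = r - 2 + 3 / 2 * x); last by ring.
  rewrite (_ : r - 1 / 2 = r - 2 + 3 / 2); last by field.
  rewrite (_ : r + 1 = r - 2 + 3); last by ring.
  have -> : kap `^ (x - 1) = kap `^ x / kap by rewrite powRDp// powR_inv1// ltW.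
  have -> : (- p.2) `^ (3 / 2 * x - 3 / 2) = (- p.2) `^ (3 / 2 * x) / s32 p by rewrite powRDp// powRN.
  have -> : (- p.2) `^ (r - 2 + 3 / 2 * x) = (- p.2) `^ (r - 2) * (- p.2) `^ (3 / 2 * x) by rewrite powRDp.
  have -> : (- p.2) `^ (r - 2 + 3 / 2) = (- p.2) `^ (r - 2) * s32 p by rewrite powRDp.
  have -> : (- p.2) `^ (r - 2 + 3) = (- p.2) `^ (r - 2) * s32 p ^+ 2.
    by rewrite powRDp// s32_sqr// -[(- p.2) ^+ 3]powR_mulrn ?(ltW s0).
  by rewrite /gam; field; do ?[apply/andP; split].
rewrite G -(@bintZ R n b hb (kap `^ x) _ (cone_bound M)); first last.
- apply: cone_supp => // [p _ z0|p pM]; last by rewrite (ybounded_ev _ yf)// mulr0.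
  by rewrite /TUq Th0// Th10// Th20// !(mulr0, addr0) mul0r.
- apply: contHM; last exact: ce.
  exact: (@contH_TUq R n b (r + 3 / 2 * x) Th Th1 Th2 dTh dTh1 cTh2).
apply: eq_bint => p pb; have y0 := lt_trans pb hb.
by rewrite mulrA dTU// ev_cat !ev_scal !ev_mulp//; ring.
Qed.

End cone_green.

(** * Continuation of k^z / Gamma(z + 1) to Re z > - m - 1 *)

Section continued_powers.
Variables (R : realType) (m n : nat) (hn : n = (2 * m + 1)%N) (b : R) (hb : b < 0).
Local Notation V := ('rV[R]_n * R)%type.
Local Notation C := R[i].
Local Notation kap := (kap b).
Local Open Scope complex_scope.
Implicit Types (f : V -> R) (p : V) (M x r : R) (z : C) (l : seq (term R n)).

(** Above any level y = - M the cone is bounded, so a bound in y controls all integrals over it. In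
    contrast to test functions, this class is stable under restriction to the y-axis. *)
Definition tame f := smooth f /\ exists M, ybounded M f.

Lemma ybounded_le M M' f : M <= M' -> ybounded M f -> ybounded M' f.
Proof. by move=> MM' yf p pM; apply: yf; rewrite (lt_le_trans pM)// lerN2. Qed.

Lemma Ic_ev_linear c l l1 l2 f f1 f2 z : tame f1 -> tame f2 ->
  (forall p, Dminus b p -> ev l f p = c * ev l1 f1 p + ev l2 f2 p) -> 0 < complex.Re z ->
  Ic b z (ev l f) = c%:C * Ic b z (ev l1 f1) + Ic b z (ev l2 f2).
Proof.
move=> [sf1 [M1 yf1]] [sf2 [M2 yf2]] E z0; rewrite (eq_Ic _ E).
have y1 := ybounded_ev l1 yf1; have y2 := ybounded_ev l2 yf2.
pose M := Order.max M1 M2.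
have h1 : M1 <= M by rewrite le_max lexx.
have h2 : M2 <= M by rewrite le_max lexx orbT.
exact: (@Ic_linear R n b hb c (ev l1 f1) (ev l2 f2) M z (@contH_ev R n l1 f1 sf1) (ybounded_le h1 y1)
  (@contH_ev R n l2 f2 sf2) (ybounded_le h2 y2) z0).
Qed.

Lemma nE : n%:R = 2 * m%:R + 1 :> R.
Proof. by rewrite hn natrD natrM. Qed.

(* Chosen so that integrating k^x against Sl l amounts to multiplying the integral of k^(x-1) against l by 4 x (x + m). *)
Definition Sl l := mulp (- (1 / 4)) (Tt (mulp (- (3 / 4)) l)) ++ scalt (- (5 / 16)) (mulp (- 3) l).

(** - 1/4 is the root of 3 r / 2 + 3/8, so the weight r - 1/2 drops out of [green_Ic]. The inner
    factor (- y)^(- 3/4) cancels the weight r + 1 = 3/4, the term with - 5/16 removes r (r - 1), and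
    8 r / 3 + 4 x + 2 n - 4/3 = 4 (x + m) for n = 2 m + 1. *)
Lemma Ic_Sl x l f : 3 < x -> tame f ->
  Ic b x%:C (ev (Sl l) f) = (4 * x * (x + m%:R))%:C * Ic b (x - 1)%:C (ev l f).
Proof.
move=> x3 tf; have [sf [M yf]] := tf.
have x0 : 0 < complex.Re x%:C by rewrite /= (lt_trans _ x3).
have x10 : 0 < complex.Re (x - 1)%:C by rewrite /=; lra.
rewrite (@Ic_ev_linear (- (5 / 16)) _ (mulp (- 3) l) (mulp (- (1 / 4)) (Tt (mulp (- (3 / 4)) l))) f f f)//; last first.
  by move=> p [pb _]; rewrite /Sl ev_cat ev_scal addrC.
rewrite (@green_Ic R n b hb (- (1 / 4)) x (mulp (- (3 / 4)) l) f M x3 sf yf).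
rewrite (@Ic_ev_linear (5 / 16) (scalt (- (1 / 4) * (- (1 / 4) - 1)) (mulp (- (1 / 4) - 2) (mulp (- (3 / 4)) l))) (mulp (- 3) l) [::] f f f _ tf tf _ x0); last first.
  move=> p [pb _]; have p0 := lt_trans pb hb; rewrite ev_scal !ev_mulp// ev_nil addr0.
  rewrite (_ : - 3 = - (1 / 4) - 2 + - (3 / 4) :> R); last by field.
  by rewrite [_ `^ (- (1 / 4) - 2 + - (3 / 4))]powRDp ?oppr_gt0//; field.
rewrite (@Ic_ev_linear (4 * x * (x + m%:R)) _ l [::] f f f _ tf tf _ x10); last first.
  move=> p [pb _]; have p0 := lt_trans pb hb; rewrite ev_cat !ev_scal !ev_mulp// ev_nil addr0.
  have h : (- p.2) `^ (- (1 / 4) + 1) * (- p.2) `^ (- (3 / 4)) = 1.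
    rewrite -powRDp ?oppr_gt0//.
    by rewrite (_ : - (1 / 4) + 1 + - (3 / 4) = 0 :> R) ?powRr0//; field.
  rewrite (_ : 3 / 2 * - (1 / 4) + 3 / 8 = 0); last by field.
  by rewrite mulr0 !mul0r add0r (mulrA (_ `^ _)) h nE; field.
rewrite (Ic_nil hb x%:C f) (Ic_nil hb (x - 1)%:C f).
set A := Ic _ _ (ev (mulp _ l) f); set B := Ic _ _ (ev l f).
by clearbody A B; rewrite rmorphN mulNr !addr0 addrA addNr add0r.
Qed.

(** For Re z > - m - 1 the exponent shifted by [Nm] has real part above 1, and the exponent - m is
    sent to 2. *)
Definition Nm := m.+2.

(** Gamma(z + 1) times the factors 4 x (x + m) of [Ic_Sl] for x = z + 1, ..., z + [Nm]: the factors
    x are absorbed into Gamma(z + [Nm] + 1), and what is left has no zero for Re z > - m - 1. *)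
Definition Xnorm z : C := Gamma (z + Nm.+1%:R) * \prod_(i < Nm) (4 * (z + (m.+1 + i)%:R)).

(* The continuation of f |-> k^z / Gamma(z+1) to Re z > - m - 1: the operator Sl is applied
   often enough for the exponent z + Nm to have positive real part. *)
Definition Xf z l f : C := (Xnorm z)^-1 * Ic b (z + Nm%:R) (ev (iter Nm Sl l) f).

Lemma ReD z (k : nat) : complex.Re (z + k%:R) = complex.Re z + k%:R.
Proof. by rewrite raddfD /= -(rmorph_nat (@real_complex_def _ (Phant R))). Qed.

Lemma Xnorm_neq0 z : - m.+1%:R < complex.Re z -> Xnorm z != 0.
Proof.
move=> z0; rewrite mulf_neq0//.
  apply: Gamma_neq0; rewrite ReD /Nm -[m.+3%:R]natr1 -[m.+2%:R]natr1; lra.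
apply/prodf_neq0 => i _; rewrite mulf_neq0// ?pnatr_eq0//.
apply/eqP => /(congr1 (@complex.Re R)); rewrite ReD /= natrD => h.
have : (0 : R) <= i%:R by []. lra.
Qed.

Lemma Xnorm_analytic z : - m.+1%:R < complex.Re z -> analytic_at Xnorm z.
Proof.
move=> z0; apply: analyticM.
  apply: analytic_comp_add; apply: Gamma_analytic.
  rewrite ReD /Nm -[m.+3%:R]natr1 -[m.+2%:R]natr1; lra.
apply: analytic_prod => i; apply: analyticZ.
exact: (analyticD (analytic_id z) (analytic_cst _ z)).
Qed.

Lemma Xf_analytic l f z : tame f -> - m.+1%:R < complex.Re z -> analytic_at (fun z => Xf z l f) z.
Proof.
move=> [sf [M yf]] z0.
apply: (analyticM (analyticV (Xnorm_analytic z0) (Xnorm_neq0 z0))).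
apply: (@analytic_comp_add R (fun w => Ic b w (ev (iter Nm Sl l) f))).
apply: (Ic_analytic hb (@contH_ev R n _ f sf) (ybounded_ev _ yf)).
by rewrite ReD /Nm -[m.+2%:R]natr1; lra.
Qed.

Lemma Ic_iter k l f x : 2 < x -> tame f ->
  Ic b (x + k%:R)%:C (ev (iter k Sl l) f) =
  (\prod_(i < k) (4 * (x + (1 + i)%:R) * (x + (1 + i)%:R + m%:R)))%:C * Ic b x%:C (ev l f).
Proof.
move=> x2 tf; elim: k => [|k ih]; first by rewrite big_ord0 mul1r addr0.
have xk : 3 < x + k.+1%:R by rewrite -natr1; have : (0 : R) <= k%:R by []; lra.
rewrite big_ord_recr/= (Ic_Sl (iter k Sl l) xk tf).
rewrite (_ : x + k.+1%:R - 1 = x + k%:R); last by rewrite -natr1; ring.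
rewrite ih mulrA -rmorphM; congr ((_)%:C * _).
by rewrite add1n; ring.
Qed.

Lemma rgamma_shift k x : 0 < x -> rgamma (x + k%:R) = \prod_(i < k) (x + i%:R) * rgamma x.
Proof.
move=> x0; elim: k => [|k ih]; first by rewrite big_ord0 mul1r addr0.
rewrite big_ord_recr/= -natr1 addrA rgammaS ?ih; first ring.
by rewrite ltr_wpDr.
Qed.

Lemma Xf_real l f x : 2 < x -> tame f ->
  Xf x%:C l f = ((rgamma (x + 1))^-1)%:C * Ic b x%:C (ev l f).
Proof.
move=> x2 tf; have g0 : 0 < rgamma (x + 1) by apply: rgamma_gt0; lra.
have rn (k : nat) : x%:C + k%:R = (x + k%:R)%:C.
  by rewrite rmorphD /= -(rmorph_nat (@real_complex_def _ (Phant R))).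
rewrite /Xf /Xnorm !rn Gamma_real Ic_iter// mulrA; congr (_ * _).
rewrite (_ : \prod_(i < Nm) _ = (\prod_(i < Nm) (4 * (x + (m.+1 + i)%:R)))%:C); last first.
  rewrite rmorph_prod; apply: eq_bigr => i _.
  by rewrite rmorphM rn; congr (_ * _); rewrite -(rmorph_nat (@real_complex_def _ (Phant R))).
rewrite -rmorphM -fmorphV -rmorphM; congr (_ %:C).
rewrite (_ : x + Nm.+1%:R = x + 1 + Nm%:R); last by rewrite -natr1; ring.
rewrite rgamma_shift; last by lra.
set A := \prod_(i < Nm) (x + 1 + i%:R); set B := \prod_(i < Nm) (4 * _).
have -> : \prod_(i < Nm) (4 * (x + (1 + i)%:R) * (x + (1 + i)%:R + m%:R)) = A * B.
  rewrite -big_split/=; apply: eq_bigr => i _; rewrite !natrD -[m.+1%:R]natr1; ring.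
have A0 : A != 0.
  apply/prodf_neq0 => i _; rewrite gt_eqF//.
  have : (0 : R) <= i%:R by []. lra.
have B0 : B != 0.
  apply/prodf_neq0 => i _; rewrite gt_eqF// mulr_gt0//.
  have : (0 : R) <= (m.+1 + i)%:R by []. lra.
by field; rewrite A0 B0 gt_eqF.
Qed.

(** For real x > 2 this is [Xf_real]; the identity theorem extends it to the half-plane. *)
Lemma Xf_eq l f z : 0 < complex.Re z -> tame f ->
  Xf z l f = (Gamma (z + 1))^-1 * Ic b z (ev l f).
Proof.
move=> z0 tf; have [sf [M yf]] := tf; move: z z0.
apply: (@analytic_identity R (fun z => Xf z l f) (fun z => (Gamma (z + 1))^-1 * Ic b z (ev l f)) 0 2).
- move=> z z0; apply: Xf_analytic => //; apply: lt_trans z0; by rewrite oppr_lt0.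
- move=> z z0; have z1 : 1 < complex.Re (z + 1) by have := ReD z 1; rewrite mulr1n => ->; lra.
  apply: (analyticM (analyticV (analytic_comp_add (Gamma_analytic z1)) (Gamma_neq0 z1))).
  exact: (Ic_analytic hb (@contH_ev R n _ f sf) (ybounded_ev _ yf)).
- move=> x x2; rewrite Xf_real//; congr (_ * _).
  by rewrite -(rmorph1 (@real_complex_def _ (Phant R))) -rmorphD Gamma_real fmorphV.
Qed.

(** Agreement on the open cone suffices: for large real exponents [Xf] is a normalized integral over
    the cone, and the identity theorem does the rest. *)
Lemma Xf_linear c l l1 l2 f f1 f2 z : tame f -> tame f1 -> tame f2 ->
  (forall p, Dminus b p -> ev l f p = c * ev l1 f1 p + ev l2 f2 p) -> - m.+1%:R < complex.Re z ->
  Xf z l f = c%:C * Xf z l1 f1 + Xf z l2 f2.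
Proof.
move=> tf t1 t2 E; move: z.
apply: (@analytic_identity R (fun z => Xf z l f) (fun z => c%:C * Xf z l1 f1 + Xf z l2 f2) _ 2).
- by move=> z z0; exact: Xf_analytic.
- move=> z z0; exact: (analyticD (analyticZ c%:C (Xf_analytic l1 t1 z0)) (Xf_analytic l2 t2 z0)).
- move=> x x2; have x0 : 0 < complex.Re x%:C by rewrite /=; lra.
  by rewrite !Xf_real// (Ic_ev_linear t1 t2 E x0); ring.
Qed.

(** Since Gamma(z + 1) = z Gamma(z), the normalization absorbs the factor x in front of the
    lower-order part of [green_Ic]; the identity thus keeps its meaning at z = 0, - 1, ..., - m +
    1. *)
Lemma Xf_green r l f z : tame f -> - m%:R < complex.Re z ->
  Xf z (mulp r (Tt l)) f = Xf z (scalt (r * (r - 1)) (mulp (r - 2) l)) f +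
    ((- ((3 / 2 * r + 3 / 8) * kap))%:C * Xf (z - 1) (mulp (r - 1 / 2) l) f +
     (4 * z + (8 / 3 * r + 4 * m%:R + 2 / 3)%:C) * Xf (z - 1) (mulp (r + 1) l) f).
Proof.
move=> tf; move: z; have [sf [M yf]] := tf.
have lt1 z : - m%:R < complex.Re z -> - m.+1%:R < complex.Re z by rewrite -[m.+1%:R]natr1; lra.
have lt2 z : - m%:R < complex.Re z -> - m.+1%:R < complex.Re (z - 1).
  by rewrite raddfB /= -[m.+1%:R]natr1; lra.
have an l' z : - m%:R < complex.Re z -> analytic_at (fun z => Xf (z - 1) l' f) z.
  move=> z0; apply: (@analytic_comp_add R (fun w => Xf w l' f) (- 1)).
  by apply: Xf_analytic => //; exact: lt2.
apply: (@analytic_identity R (fun z => Xf z (mulp r (Tt l)) f) (fun z => Xf z (scalt (r * (r - 1)) (mulp (r - 2) l)) f +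
    ((- ((3 / 2 * r + 3 / 8) * kap))%:C * Xf (z - 1) (mulp (r - 1 / 2) l) f +
     (4 * z + (8 / 3 * r + 4 * m%:R + 2 / 3)%:C) * Xf (z - 1) (mulp (r + 1) l) f)) _ 3).
- by move=> z z0; apply: Xf_analytic => //; exact: lt1.
- move=> z z0; have a1 := Xf_analytic (scalt (r * (r - 1)) (mulp (r - 2) l)) tf (lt1 _ z0).
  have a2 := analyticZ (- ((3 / 2 * r + 3 / 8) * kap))%:C (an (mulp (r - 1 / 2) l) z z0).
  have a3 := analyticD (analyticZ 4 (analytic_id z)) (analytic_cst (8 / 3 * r + 4 * m%:R + 2 / 3)%:C z).
  exact: (analyticD a1 (analyticD a2 (analyticM a3 (an (mulp (r + 1) l) z z0)))).
- move=> x x3; have x0 : 0 < complex.Re (x - 1)%:C by rewrite /=; lra.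
  rewrite -[x%:C - 1](rmorphB (@real_complex_def _ (Phant R)) x 1) !Xf_real//; [|lra..].
  rewrite (green_Ic hb _ _ x3 sf yf).
  rewrite (@Ic_ev_linear (x * (8 / 3 * r + 4 * x + 2 * n%:R - 4 / 3)) _ (mulp (r + 1) l)
    (scalt (- x * (3 / 2 * r + 3 / 8) * kap) (mulp (r - 1 / 2) l)) f f f _ tf tf _ x0); last first.
    by move=> p _; rewrite ev_cat !ev_scal addrC.
  have [s0 [M0 y0]] := tf.
  have E2 : Ic b (x - 1)%:C (ev (scalt (- x * (3 / 2 * r + 3 / 8) * kap) (mulp (r - 1 / 2) l)) f) =
      (- x * (3 / 2 * r + 3 / 8) * kap)%:C * Ic b (x - 1)%:C (ev (mulp (r - 1 / 2) l) f).
    rewrite (@Ic_ev_linear (- x * (3 / 2 * r + 3 / 8) * kap) _ (mulp (r - 1 / 2) l) [::] f f f _ tf tf _ x0); last first.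
      by move=> p _; rewrite ev_scal ev_nil addr0.
    by rewrite (Ic_nil hb) addr0.
  rewrite E2 subrK.
  have x00 : 0 < x by lra.
  have g0 := rgamma_gt0 x00; rewrite rgammaS// mulrDr; congr (_ + _).
  rewrite mulrDr addrC; congr (_ + _).
    by rewrite !mulrA -!rmorphM; congr (_ %:C * _); field; rewrite !gt_eqF.
  have -> : 4 * x%:C + (8 / 3 * r + 4 * m%:R + 2 / 3)%:C = (4 * x + (8 / 3 * r + 4 * m%:R + 2 / 3))%:C.
    rewrite -(rmorph_nat (@real_complex_def _ (Phant R))) -(rmorphM (@real_complex_def _ (Phant R))).
    by rewrite -(rmorphD (@real_complex_def _ (Phant R))).
  rewrite !mulrA -!(rmorphM (@real_complex_def _ (Phant R))).
  congr (_ %:C * _); rewrite nE; field; by rewrite !gt_eqF.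
Qed.

End continued_powers.

(** * Identification of [delta_u] *)

Section delta.
Variables (R : realType) (m n : nat) (hn : n = (2 * m + 1)%N) (b : R) (hb : b < 0).
Local Notation V := ('rV[R]_n * R)%type.
Local Notation C := R[i].
Local Notation Xf := (Xf m b).
Local Open Scope complex_scope.

Lemma ReNn (k : nat) : complex.Re (- k%:R : C) = - k%:R.
Proof. by rewrite raddfN /= -(rmorph_nat (@real_complex_def _ (Phant R))). Qed.

(** [Xf] is an admissible continuation, so the choice made in [delta_u] is a genuine one; the
    identity theorem on the smaller of the two half-planes shows that the chosen continuation has
    the same value. The condition q < m keeps - q - 1 right of - m - 1. *)
Lemma delta_uE (q : nat) (l : seq (term R n)) (f h : V -> R) : (q < m)%N -> tame f ->
  (forall p, Dminus b p -> h p = ev l f p) ->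
  delta_u b q h = Xf (- q.+1%:R) l f.
Proof.
move=> qm tf E; have qm1 : - m.+1%:R < - q.+1%:R :> R by rewrite ltrN2 ltr_nat ltnS.
have W : is_delta_u b q h (Xf (- q.+1%:R) l f).
  exists (- m.+1%:R), (fun z => Xf z l f); split => //.
    by move=> z z0; exact: Xf_analytic.
  by move=> z z0; rewrite (Xf_eq hn hb l z0 tf) Ic_vintegral; congr (_ * _); rewrite (eq_Ic z E).
have [c [g [c1 ga gE gw]]] : is_delta_u b q h (delta_u b q h).
  by apply: xgetPex; exists (Xf (- q.+1%:R) l f).
rewrite gw; pose c0 := Order.max c (- m.+1%:R).
have h1 z : c0 < complex.Re z -> c < complex.Re z by rewrite gt_max => /andP[].
have h2 z : c0 < complex.Re z -> - m.+1%:R < complex.Re z by rewrite gt_max => /andP[].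
apply: (@analytic_identity R g (fun z => Xf z l f) c0 0).
- by move=> z /h1; exact: ga.
- by move=> z /h2; exact: Xf_analytic.
- move=> x x0; have x0' : 0 < complex.Re x%:C by [].
  rewrite (gE _ x0') (Xf_eq hn hb l x0' tf) Ic_vintegral; congr (_ * _).
  by rewrite (eq_Ic _ E).
- by rewrite ReNn gt_max c1 qm1.
Qed.

End delta.

(** * Contribution of the tip of the cone *)

Section coordinate_scaling.
Variables (R : realType) (n : nat).
Local Notation V := ('rV[R]_n * R)%type.
Local Notation dir o := (@direction R n o).
Implicit Types (f g : V -> R) (p : V) (e : R) (i : 'I_n).

Definition sc i e p : V := (\row_j (if j == i then e * p.1 0 j else p.1 0 j), p.2).

Definition sc_weight i e (o : option 'I_n) : R := if o == Some i then e else 1.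

Lemma sc_dir i e p s o : sc i e (p + s *: dir o) = sc i e p + (s * sc_weight i e o) *: dir o.
Proof.
congr pair; last by case: o => [j|] /=; rewrite ?scaler0// /sc_weight /= mulr1.
apply/rowP => j; rewrite !mxE; case: o => [k|] /=; rewrite /sc_weight /=; last first.
  by rewrite !mxE !mulr0 !addr0.
rewrite !mxE eqxx /=; have [->|jk] := eqVneq j k; last by rewrite !mulr0 !addr0.
by rewrite !mulr1 (inj_eq Some_inj); case: ifP => _; rewrite ?mulr1// mulrDr mulrC (mulrC e s).
Qed.

Lemma sc_line i e p : sc i e p = sc i 0 p + (e * p.1 0 i) *: dir (Some i).
Proof.
congr pair; last by rewrite /= scaler0 addr0.
apply/rowP => j; rewrite !mxE eqxx /=; have [->|] := eqVneq j i.
  by rewrite mul0r add0r mulr1.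
by rewrite mulr0 addr0.
Qed.

Let is_derive_mulr (c x : R) : is_derive x 1 (fun s : R => s * c) c.
Proof. by apply: is_derive_eq; rewrite /GRing.scale /=; ring. Qed.

Lemma is_derive_sc i e f p o d : is_derive (sc i e p) (dir o) f d ->
  is_derive p (dir o) (f \o sc i e) (sc_weight i e o * d).
Proof.
move=> df; apply: is_derive_alongP.
rewrite (_ : (fun s => _) = (fun s => f (sc i e p + s *: dir o)) \o (fun s => s * sc_weight i e o)).
  rewrite mulrC; apply: is_derive1_comp; last exact: is_derive_mulr.
  by apply: is_derive_along; rewrite mul0r scale0r addr0.
by apply/funext => s /=; rewrite sc_dir.
Qed.

Lemma is_derive_sc_param i e f p d : is_derive (sc i e p) (dir (Some i)) f d ->
  is_derive e 1 (fun e => f (sc i e p)) (p.1 0 i * d).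
Proof.
move=> df.
rewrite (_ : (fun e => _) = (fun s => f (sc i 0 p + s *: dir (Some i))) \o (fun e => e * p.1 0 i)).
  rewrite mulrC; apply: is_derive1_comp; last exact: is_derive_mulr.
  by apply: is_derive_along; rewrite -sc_line.
by apply/funext => s /=; rewrite sc_line.
Qed.

Lemma continuous_sc i e : continuous (sc i e).
Proof.
move=> p; have h2 : (q.2 : R) @[q --> p] --> p.2 by exact: cvg_snd.
pose X (q : V) : 'rV[R]_n := q.1 + (q.1 0 i * (e - 1)) *: delta_mx 0 i.
rewrite (_ : sc i e = fun q => (X q, q.2)); last first.
  apply/funext => q; congr pair; apply/rowP => j; rewrite !mxE eqxx /=.
  by have [->|_] := eqVneq j i; [rewrite mulr1; ring|rewrite mulr0 addr0].
have h1 : X q @[q --> p] --> X p.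
  apply: cvgD; first exact: cvg_fst.
  by apply: cvgZl; apply: cvgM; [exact: continuous_coord|exact: cvg_cst].
exact: (cvg_pair h1 h2).
Qed.

Definition sc_pow i e (s : seq (option 'I_n)) : R := e ^+ count_mem (Some i) s.

Lemma pderiv_sc i e f s : smooth f -> pderiv s (f \o sc i e) = (fun p => sc_pow i e s * pderiv s f (sc i e p)).
Proof.
move=> sf; elim: s => [|o s ih] /=; first by apply/funext => p; rewrite /sc_pow expr0 mul1r.
apply/funext => p; rewrite ih.
have d1 := is_derive_sc (smooth_is_derive s o (sc i e p) sf).
have : is_derive p (dir o) (fun q => sc_pow i e s * pderiv s f (sc i e q))
    (sc_pow i e s * (sc_weight i e o * pderiv (o :: s) f (sc i e p))).
  exact: (is_deriveZ (sc_pow i e s) d1).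
move=> [_ ->]; rewrite mulrA /sc_pow /= exprD /sc_weight eq_sym; congr (_ * _).
by rewrite mulrC; case: ifP => _; rewrite ?expr1// expr0.
Qed.

Lemma smooth_sc i e f : smooth f -> smooth (f \o sc i e).
Proof.
move=> sf s; rewrite pderiv_sc//; split.
  move=> p; apply: cvgM; first exact: cvg_cst.
  by apply: (@continuous_comp _ _ _ (sc i e) (pderiv s f)); [exact: continuous_sc|exact: (sf s).1].
move=> o p; have d1 := is_derive_sc (smooth_is_derive s o (sc i e p) sf).
by have [] := is_deriveZ (sc_pow i e s) d1.
Qed.

Lemma tame_sc i e f : tame f -> tame (f \o sc i e).
Proof. by move=> [sf [M yf]]; split; [exact: smooth_sc|exists M => p pM; exact: yf]. Qed.

Lemma smooth_pderiv s f : smooth f -> smooth (pderiv s f).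
Proof.
move=> sf t; have -> : pderiv t (pderiv s f) = pderiv (t ++ s) f by rewrite /pderiv; elim: t => //= o t ->.
exact: sf.
Qed.

Lemma tame_pderiv s f : tame f -> tame (pderiv s f).
Proof. by move=> [sf [M yf]]; split; [exact: smooth_pderiv|exists M; exact: ybounded_pderiv]. Qed.

Definition dsc i (l : seq (term R n)) f e p : R := \sum_(a <- l) a.1.1 * (- p.2) `^ a.1.2 *
  ((count_mem (Some i) a.2)%:R * e ^+ (count_mem (Some i) a.2).-1 * pderiv a.2 f (sc i e p) +
   e ^+ count_mem (Some i) a.2 * (p.1 0 i * pderiv (Some i :: a.2) f (sc i e p))).

Lemma ev_sc i l f e p : smooth f -> ev l (f \o sc i e) p =
  \sum_(a <- l) a.1.1 * (- p.2) `^ a.1.2 * (e ^+ count_mem (Some i) a.2 * pderiv a.2 f (sc i e p)).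
Proof. by move=> sf; rewrite evE; apply: eq_bigr => a _; rewrite pderiv_sc. Qed.

Lemma is_derive_ev_sc i l f e p : smooth f ->
  is_derive e 1 (fun e => ev l (f \o sc i e) p) (dsc i l f e p).
Proof.
move=> sf; under eq_fun do rewrite ev_sc//; rewrite /dsc.
elim: l => [|a l ih].
  under eq_fun do rewrite big_nil; rewrite big_nil; exact: is_derive_cst.
under eq_fun do rewrite big_cons; rewrite big_cons.
have d1 := is_derive_sc_param (smooth_is_derive a.2 (Some i) (sc i e p) sf).
have d2 : is_derive e 1 (fun e => a.1.1 * (- p.2) `^ a.1.2 *
    (e ^+ count_mem (Some i) a.2 * pderiv a.2 f (sc i e p)))
    (a.1.1 * (- p.2) `^ a.1.2 * ((count_mem (Some i) a.2)%:R * e ^+ (count_mem (Some i) a.2).-1 * pderiv a.2 f (sc i e p) +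
   e ^+ count_mem (Some i) a.2 * (p.1 0 i * pderiv (Some i :: a.2) f (sc i e p)))).
  set k := count_mem _ _.
  have dk : is_derive e 1 (fun x : R => x ^+ k) (k%:R * e ^+ k.-1).
    elim: k => [|k ihk].
      by rewrite mul0r; under eq_fun do rewrite expr0; exact: is_derive_cst.
    under eq_fun do rewrite exprS; apply: (is_derive_eq (is_deriveM (is_derive_id e 1) ihk)).
    rewrite /GRing.scale /= -[k.+1%:R]natr1; case: k {ihk} => [|k] /=; first by ring.
    by rewrite exprS; ring.
  have d3 := is_deriveZ (a.1.1 * (- p.2) `^ a.1.2) (is_deriveM dk d1).
  by apply: (is_derive_eq d3); rewrite /GRing.scale /=; ring.
exact: (is_deriveD d2 ih).
Qed.

Lemma contH_dsc i l f e : smooth f -> contH (dsc i l f e).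
Proof.
move=> sf.
have cp s : contH (fun p => pderiv s f (sc i e p)).
  move=> p _; apply: (@continuous_comp _ _ _ (sc i e) (pderiv s f)); [exact: continuous_sc|exact: (sf s).1].
apply: contH_sum => a; apply: contHM; first by apply: contHM; [exact: contH_cst|exact: contH_ypow].
apply: contHD; first by apply: contHM; [exact: contH_cst|exact: cp].
by apply: contHM; [exact: contH_cst|apply: contHM; [exact: contH_coord|exact: cp]].
Qed.

Lemma ybounded_dsc i l f e M : ybounded M f -> ybounded M (dsc i l f e).
Proof.
move=> yf p pM; rewrite /dsc big1// => a _.
by rewrite !(ybounded_pderiv _ yf)// !mulr0 addr0 mulr0.
Qed.

Variables (b : R) (hb : b < 0).

(** The bound is uniform for e at distance less than 1 from e0, as differentiation under the
    integral sign requires. *)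
Lemma dsc_bounded i l f e0 (N : R) : smooth f -> 0 <= N -> exists B : R, forall e p, `|e - e0| < 1 -> p.2 <= b ->
  (forall j, `|p.1 0 j| <= N) -> - N <= p.2 -> `|dsc i l f e p| <= B.
Proof.
move=> sf N0; pose E := `|e0| + 1; have E1 : 1 <= E by rewrite lerDr.
have pd s : exists B : R, 0 <= B /\ forall e p, `|e - e0| < 1 -> p.2 <= b ->
    (forall j, `|p.1 0 j| <= N) -> - N <= p.2 -> `|pderiv s f (sc i e p)| <= B.
  have cs : contH (pderiv s f) by move=> p _; exact: (sf s).1.
  have [B [B0 hB]] := contH_bounded hb (E * N) cs.
  exists B; split => // e p eE pb pN p2; apply: hB => //=; last first.
    by rewrite (le_trans _ p2)// lerN2 ler_peMl.
  move=> j; rewrite mxE; case: ifP => _; last by rewrite (le_trans (pN j))// ler_peMl.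
  rewrite normrM ler_pM// /E -lerBlDl; apply: (le_trans (lerB_dist _ _)); exact: ltW.
have td (a : term R n) : exists B : R, forall e p, `|e - e0| < 1 -> p.2 <= b ->
    (forall j, `|p.1 0 j| <= N) -> - N <= p.2 ->
    `|a.1.1 * (- p.2) `^ a.1.2 *
      ((count_mem (Some i) a.2)%:R * e ^+ (count_mem (Some i) a.2).-1 * pderiv a.2 f (sc i e p) +
      e ^+ count_mem (Some i) a.2 * (p.1 0 i * pderiv (Some i :: a.2) f (sc i e p)))| <= B.
  have [B1 [B10 hB1]] := pd a.2; have [B2 [B20 hB2]] := pd (Some i :: a.2).
  have [B3 [B30 hB3]] := contH_bounded hb N (@contH_ypow R n a.1.2).
  set k := count_mem _ _.
  exists (`|a.1.1| * B3 * (k%:R * E ^+ k.-1 * B1 + E ^+ k * (N * B2))) => e p eE pb pN p2.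
  have eE' : `|e| <= E.
    by rewrite /E -lerBlDl; apply: (le_trans (lerB_dist _ _)); exact: ltW.
  have ek j : `|e ^+ j| <= E ^+ j by rewrite normrX lerXn2r ?nnegrE// (le_trans _ E1).
  rewrite normrM normrM ler_pM ?mulr_ge0//.
    by rewrite ler_wpM2l//; exact: hB3.
  rewrite (le_trans (ler_normD _ _))// lerD// !normrM.
    apply: ler_pM; [by rewrite mulr_ge0|by []| |exact: hB1].
    by rewrite normr_nat ler_wpM2l.
  apply: ler_pM; [by []|by rewrite mulr_ge0|exact: ek|].
  by apply: ler_pM => //; exact: hB2.
rewrite /dsc; elim: l => [|a l [B hB]].
  by exists 0 => e p _ _ _ _; rewrite big_nil normr0.
have [B' hB'] := td a; exists (B' + B) => e p eE pb pN p2.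
by rewrite big_cons (le_trans (ler_normD _ _))// lerD//; [exact: hB'|exact: hB].
Qed.

End coordinate_scaling.

(** * Invariance of the tip contribution under scaling of a coordinate *)

Section tip.
Variables (R : realType) (m n : nat) (hn : n = (2 * m + 1)%N) (b : R) (hb : b < 0).
Local Notation T := (measurableTypeR R).
Local Notation V := ('rV[R]_n * R)%type.
Local Notation C := R[i].
Local Notation Vmu := (tuple_measure (@lebesgue_measure R) n \x @lebesgue_measure R)%E.
Local Notation dir o := (@direction R n o).
Local Notation Xf := (Xf m b).
Local Notation Sl := (@Sl R n).
Local Notation kpow := (@kpow R n b).
Local Open Scope complex_scope.
Implicit Types (f : V -> R) (p : V) (x r : R) (z : C) (l : seq (term R n)) (i : 'I_n).

(** Differentiation under the integral sign. Scaling x_i moves the support of f, but the factor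
    [kpow] confines the integrand to the cone above y = - M, hence to a fixed box on which a
    constant dominates. *)
Lemma is_derive_bint_sc i l f (e : R) x : 1 < x -> tame f ->
  is_derive e 1 (fun e => bint b (fun p => kpow x p * ev l (f \o sc i e) p))
    (bint b (fun p => kpow x p * dsc i l f e p)).
Proof.
move=> x1 [sf [M yf]].
pose N := Order.max (Order.max (cone_bound M) M) 0.
have N0 : 0 <= N by rewrite le_max lexx orbT.
have [B hB] := dsc_bounded hb i l e sf N0.
have [K [K0 hK]] := contH_bounded hb N (@contH_kpow R n b hb x x1).
have MN : M <= N by rewrite /N !le_max lexx orbT.
have CN : cone_bound M <= N by rewrite /N 2!le_max lexx.
pose box : set (n.-tuple T * T) := [set z | (forall j, `|tnth z.1 j| <= N) /\ `|z.2| <= N].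
have mH := @measurable_Hb R n b.
have ye (e' : R) : ybounded M (ev l (f \o sc i e')).
  by apply: ybounded_ev => p pM; exact: yf.
have dE (e' : R) p : is_derive e' 1 (fun e : R => kpow x p * ev l (f \o sc i e) p) (kpow x p * dsc i l f e' p).
  exact: (is_deriveZ (kpow x p) (is_derive_ev_sc i l e' p sf)).
pose G (z : n.-tuple T * T) : R := K * `|B| * \1_box z.
have G0 (z : n.-tuple T * T) : 0 <= G z by rewrite !mulr_ge0.
have iG : Vmu.-integrable (@Hb R n b) (EFin \o G).
  apply: (@integrableS _ _ _ Vmu setT) => //.
  apply: (@integrable_bounded_support _ _ R Vmu _ G (K * `|B|) (@vbox_measurable R n N) (@vbox_finite R n N)).
  - by apply: measurable_funM; [exact: measurable_cst|apply: measurable_indic; exact: (@vbox_measurable R n N)].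
  - by move=> z hz; rewrite /G indicE memNset// mulr0.
  - by move=> z; rewrite ger0_norm// /G indicE; case: (_ \in _); rewrite ?mulr1// mulr0 mulr_ge0.
have intf (e' : R) : Vmu.-integrable (@Hb R n b) (EFin \o (fun z : n.-tuple T * T => kpow x (vpt z) * ev l (f \o sc i e') (vpt z))).
  apply: (@contH_integrable R n b hb (fun p => kpow x p * ev l (f \o sc i e') p) (cone_bound M)); last exact: kpow_supp.
  by apply: contHM; [exact: contH_kpow|apply: contH_ev; exact: smooth_sc].
have Ie : `]e - 1, e + 1[%classic e by rewrite /= in_itv/= ltrBlDr ltrDl ltr01.
have derf (e' : R) (z : n.-tuple T * T) : `]e - 1, e + 1[%classic e' -> Hb b z ->
    derivable (fun e : R => kpow x (vpt z) * ev l (f \o sc i e) (vpt z)) e' 1.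
  by move=> _ _; have [] := dE e' (vpt z).
have d1E (e' : R) (z : n.-tuple T * T) : partial1of2 (fun (e : R) (z : n.-tuple T * T) => kpow x (vpt z) * ev l (f \o sc i e) (vpt z)) e' z =
    kpow x (vpt z) * dsc i l f e' (vpt z).
  by rewrite partial1of2E; have [_ ->] := dE e' (vpt z).
have Gub (e' : R) (z : n.-tuple T * T) : `]e - 1, e + 1[%classic e' -> Hb b z ->
    `|partial1of2 (fun (e : R) (z : n.-tuple T * T) => kpow x (vpt z) * ev l (f \o sc i e) (vpt z)) e' z| <= G z.
  move=> /=; rewrite in_itv/= => /andP[e1 e2] Hz; rewrite d1E /G indicE.
  have z0 : z.2 < 0 := lt_trans Hz hb.
  have [zb|zb] := pselect (box z); last first.
    rewrite memNset// mulr0.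
    rewrite (kpow_supp hb x (ybounded_dsc i l e' yf)) ?normr0//; first exact: ltW.
    apply: contrapT => h; apply: zb; split => [j|].
      rewrite leNgt; apply/negP => h'; apply: h; left; exists j; rewrite mxE.
      exact: le_lt_trans h'.
    rewrite ltr0_norm// leNgt; apply/negP => h'; apply: h; right.
    by rewrite /= ltrNr; exact: le_lt_trans h'.
  rewrite mem_set// mulr1 normrM.
  have zN : - N <= z.2 by have := zb.2; rewrite ltr0_norm// lerNl.
  have zj j : `|(vpt z).1 0 j| <= N by rewrite mxE; exact: zb.1.
  apply: ler_pM => //; first by apply: hK => //; exact: ltW.
  apply: le_trans (ler_norm _); apply: hB => //; last exact: ltW.
  by rewrite ltr_distl e1.
split.
  exact: (@derivable_under_integral R _ _ Vmu _ _ mH e (e - 1) (e + 1) Ie (fun x _ => intf x) derf G G0 iG Gub).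
rewrite -derive1E /bint (@differentiation_under_integral R _ _ Vmu _ _ mH e (e - 1) (e + 1) Ie (fun x _ => intf x) derf G G0 iG Gub).
by apply: eq_Rintegral => z _; rewrite d1E.
Qed.

(** As the x_i-derivative of k is - 2 x_i, one has x_i k^x = - (1 / (2 (x + 1))) times the
    x_i-derivative of k^(x + 1). The factor x_i that differentiation in e brings out is thus traded
    for a second x_i-derivative of f and the exponent x + 1. *)
Lemma Ic_dsc i r f (e : R) x : 2 < x -> tame f ->
  Ic b x%:C (dsc i [:: (1, r, [::])] f e) =
  (e / (2 * (x + 1)))%:C * Ic b (x + 1)%:C (ev [:: (1, r, [::])] (pderiv [:: Some i; Some i] f \o sc i e)).
Proof.
move=> x2 tf; have [sf [M yf]] := tf.
pose g p := (- p.2) `^ r * pderiv [:: Some i] f (sc i e p).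
pose g' p := (- p.2) `^ r * (e * pderiv [:: Some i; Some i] f (sc i e p)).
have cp s : contH (fun p => pderiv s f (sc i e p)).
  move=> p _; apply: (@continuous_comp _ _ _ (sc i e) (pderiv s f)); [exact: continuous_sc|exact: (sf s).1].
have cg : contH g by apply: contHM; [exact: contH_ypow|exact: cp].
have cg' : contH g' by apply: contHM; [exact: contH_ypow|apply: contHM; [exact: contH_cst|exact: cp]].
have yg : ybounded M g by move=> p pM; rewrite /g (ybounded_pderiv _ yf)// mulr0.
have yg' : ybounded M g' by move=> p pM; rewrite /g' (ybounded_pderiv _ yf)// !mulr0.
have dg p : p.2 < 0 -> is_derive p (dir (Some i)) g (g' p).
  move=> p0; have d1 := is_derive_ypow r (dir (Some i)) p0.
  have d2 := is_derive_sc (smooth_is_derive [:: Some i] (Some i) (sc i e p) sf).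
  apply: (is_derive_eq (is_deriveM d1 d2)); rewrite /GRing.scale /= /g' /sc_weight eqxx mulr0 mulr0 addr0//.
have x11 : 1 < x + 1 by lra.
have x1 : 1 < x by lra.
have k0 := kap_gt0 hb.
have dk p : p.2 < 0 -> is_derive p (dir (Some i)) (kpow (x + 1)) (- 2 * (x + 1) * p.1 0 i * kpow x p).
  move=> p0; have [y0 sn kn] := nonzero hb p0; have s0 : 0 < - p.2 by rewrite oppr_gt0.
  have oU : open [set q : V | q.2 < 0].
    by apply: (@open_comp _ _ (fun q : V => q.2) [set y | y < 0]); [move=> q _; exact: cvg_snd|exact: open_lt].
  apply: (@near_eq_is_derive _ _ _ (fun p : V => (kap b) `^ (x + 1) * ((- p.2) `^ (3 / 2 * (x + 1)) * ppow (x + 1) (zeta b p)))).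
    have : nbhs p [set q : V | q.2 < 0] by apply: open_nbhs_nbhs.
    by apply: filterS => q q0; rewrite kpowE// mulrA.
  have d1 := is_derive_ypow (3 / 2 * (x + 1)) (dir (Some i)) p0.
  have d2 := is_derive_compR (is_derive_zeta hb (dir (Some i)) p0) (is_derive_ppow (zeta b p) x11).
  have d3 := is_deriveZ ((kap b) `^ (x + 1)) (is_deriveM d1 d2).
  apply: (is_derive_eq d3); rewrite /GRing.scale /= kpowE// addrK.
  have -> : \sum_(j < n) p.1 0 j * (delta_mx 0 i : 'rV[R]_n) 0 j = p.1 0 i.
    rewrite (bigD1 i)//= big1 => [|j ji]; rewrite !mxE ?eqxx ?mulr1 ?addr0//=.
    by rewrite (negPf ji) mulr0.
  have -> : kap b `^ (x + 1) = kap b `^ x * kap b by rewrite powRDp// powRr1// ltW.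
  have -> : (- p.2) `^ (3 / 2 * (x + 1)) = (- p.2) `^ (3 / 2 * x) * s32 p.
    by rewrite mulrDr mulr1 powRDp.
  by field; do ?[apply/andP; split].
have F0 : bint b (fun p => (- 2 * (x + 1) * p.1 0 i * kpow x p) * g p + kpow (x + 1) p * g' p) = 0.
  apply: (@bint_dx R n b hb i (fun p => kpow (x + 1) p * g p) _ (cone_bound M)).
  - apply: contHD; last by apply: contHM => //; exact: contH_kpow.
    apply: contHM => //; apply: contHM; last exact: contH_kpow.
    by apply: contHM; [exact: contH_cst|exact: contH_coord].
  - exact: kpow_supp.
  - move=> p pb h; rewrite (kpow_supp hb (x + 1) yg')// addr0.
    have := kpow_supp hb x yg pb h; rewrite -mulrA => ->; by rewrite mulr0.
  - move=> p p0; apply: (is_derive_eq (is_deriveM (dk p p0) (dg p p0))).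
    by rewrite /GRing.scale /=; ring.
have yx : ybounded M (fun p => p.1 0 i * g p) by move=> p pM; rewrite yg// mulr0.
have cx : contH (fun p => p.1 0 i * g p) by apply: contHM => //; exact: contH_coord.
have cA : contH (fun p => kpow x p * (p.1 0 i * g p)) by apply: contHM => //; exact: contH_kpow.
have cB : contH (fun p => kpow (x + 1) p * g' p) by apply: contHM => //; exact: contH_kpow.
have F1 : - 2 * (x + 1) * bint b (fun p => kpow x p * (p.1 0 i * g p)) + bint b (fun p => kpow (x + 1) p * g' p) = 0.
  rewrite -[RHS]F0 -(@bintZ R n b hb (- 2 * (x + 1)) _ (cone_bound M) cA (kpow_supp hb x yx)).
  rewrite -(@bintD R n b hb _ _ (cone_bound M)) //; first last.
  - exact: kpow_supp.
  - by move=> p pb h; rewrite (kpow_supp hb x yx)// mulr0.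
  - by apply: contHM => //; exact: contH_cst.
  by apply: eq_bint => p _; ring.
have E1 p : Dminus b p -> dsc i [:: (1, r, [::])] f e p = p.1 0 i * g p.
  by move=> _; rewrite /dsc big_seq1 /= !mul0r add0r expr0 !mul1r /g /= mulrCA.
have E2 : e * bint b (fun p => kpow (x + 1) p * ev [:: (1, r, [::])] (pderiv [:: Some i; Some i] f \o sc i e) p) =
    bint b (fun p => kpow (x + 1) p * g' p).
  have tf2 : smooth (pderiv [:: Some i; Some i] f \o sc i e) by apply: smooth_sc; exact: smooth_pderiv.
  have yf2 : ybounded M (pderiv [:: Some i; Some i] f \o sc i e) by move=> p pM; exact: (ybounded_pderiv [:: Some i; Some i] yf).
  rewrite -(@bintZ R n b hb e _ (cone_bound M)); first last.
  - by apply: kpow_supp => //; exact: ybounded_ev.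
  - by apply: contHM; [exact: contH_kpow|exact: contH_ev].
  by apply: eq_bint => p _; rewrite evE big_seq1 mul1r (mulrCA e) (mulrCA e).
rewrite (eq_Ic _ E1) !Ic_real// -rmorphM; congr (_ %:C).
have -> : bint b (fun p => kpow x p * (p.1 0 i * g p)) = bint b (fun p => kpow (x + 1) p * g' p) / (2 * (x + 1)).
  move/eqP: F1; rewrite addrC addr_eq0 => /eqP ->; field; rewrite gt_eqF//; lra.
by rewrite -E2 mulrAC.
Qed.

Lemma real_scalar_natr (k : nat) : (k%:R : R)%:C = k%:R.
Proof. exact: (rmorph_nat (@real_complex_def _ (Phant R))). Qed.

(* The derivative in the scaling parameter continues analytically, and for large z it carries
   the factor 4 (z + m + 1), which vanishes at the tip exponent z = - m - 1. *)
Lemma Ic_dsc_eq0 i r f (e : R) : tame f ->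
  Ic b 2%:C (dsc i (iter (Nm m) Sl (Sl [:: (1, r, [::])])) f e) = 0.
Proof.
move=> tf; have [sf [M yf]] := tf; set l := [:: (1, r, [::])]; set L := iter _ _ _.
set f2 := pderiv [:: Some i; Some i] f \o sc i e.
have tf2 : tame f2 by apply: tame_sc; exact: tame_pderiv.
(* Here z is the exponent before the [Nm] + 1 applications of [Sl]; at z = - m - 1 the integral in
   [A] has exponent 2. *)
pose A z : C := (Xnorm m (z + 1))^-1 * Ic b (z + 1 + (Nm m)%:R) (dsc i L f e).
pose B z : C := 2 * e%:C * (z + m.+1%:R) * Xf (z + 1) l f2.
have Re1 z : complex.Re (z + 1) = complex.Re z + 1 by have := ReD z 1; rewrite mulr1n.
have AB z : - m.+2%:R < complex.Re z -> A z = B z.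
  move: z; have lt z : - m.+2%:R < complex.Re z -> - m.+1%:R < complex.Re (z + 1).
    by rewrite Re1 -[m.+2%:R]natr1; lra.
  apply: (@analytic_identity R A B _ 2).
  - move=> z z0; apply: analyticM.
      apply: (@analytic_comp_add R (fun w => (Xnorm m w)^-1)).
      exact: (analyticV (Xnorm_analytic (lt _ z0)) (Xnorm_neq0 (lt _ z0))).
    rewrite (_ : (fun w => _) = fun w => Ic b (w + (1 + (Nm m)%:R)) (dsc i L f e)); last first.
      by apply/funext => w; rewrite -(addrA w).
    apply: (@analytic_comp_add R (fun w => Ic b w (dsc i L f e))).
    apply: (Ic_analytic hb (@contH_dsc R n i L f e sf) (ybounded_dsc i L e yf)).
    rewrite (addrA z) ReD Re1 /Nm -[m.+2%:R]natr1; move: z0; rewrite -[m.+2%:R]natr1; lra.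
  - move=> z z0; apply: analyticM; last first.
      apply: (@analytic_comp_add R (fun w => Xf w l f2)).
      exact: (Xf_analytic hb l tf2 (lt _ z0)).
    exact: (analyticZ (2 * e%:C) (analyticD (analytic_id z) (analytic_cst _ z))).
  - move=> x x2; have x1 : 1 < x by lra.
    have xN : 1 < x + 1 + (Nm m)%:R by have : (0 : R) <= (Nm m)%:R by []; lra.
    have x12 : 2 < x + 1 by lra.
    have e1 : x%:C + 1 = (x + 1)%:C by rewrite rmorphD.
    have e2 : x%:C + 1 + (Nm m)%:R = (x + 1 + (Nm m)%:R)%:C by rewrite e1 -real_scalar_natr -rmorphD.
    have x13 : 3 < x + 1 by lra.
    pose P : R := \prod_(k < Nm m) (4 * (x + 1 + (1 + k)%:R) * (x + 1 + (1 + k)%:R + m%:R)).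
    pose Q : R := 4 * (x + 1) * (x + 1 + m%:R).
    (* The proportionality holds for every e, hence also between the e-derivatives. *)
    have E : (fun e : R => bint b (fun p => kpow (x + 1 + (Nm m)%:R) p * ev L (f \o sc i e) p)) =
       (fun e : R => (P * Q) *: bint b (fun p => kpow x p * ev l (f \o sc i e) p)).
      apply/funext => e'; have tfe := tame_sc i e' tf.
      have := Ic_iter hn hb (Nm m) (Sl l) x12 tfe.
      rewrite (Ic_Sl hn hb l x13 tfe) addrK !Ic_real// -!rmorphM.
      by move/(congr1 (@complex.Re R)) => /= ->; rewrite mulrA.
    have d12 : bint b (fun p => kpow (x + 1 + (Nm m)%:R) p * dsc i L f e p) =
        (P * Q) *: bint b (fun p => kpow x p * dsc i l f e p).
      have := is_derive_bint_sc i L e xN tf; rewrite E => d1.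
      have [_ <-] := d1; by have [_ <-] := is_deriveZ (P * Q) (is_derive_bint_sc i l e x1 tf).
    have d13 : Ic b (x + 1 + (Nm m)%:R)%:C (dsc i L f e) = (P * Q)%:C * Ic b x%:C (dsc i l f e).
      by rewrite !Ic_real// d12 -rmorphM.
    rewrite /A /B e2 d13 (Ic_dsc i r e x2 tf) /Xf e2.
    rewrite (Ic_iter hn hb (Nm m) l x12 tf2) -/P e1 -/l -/f2.
    set W := Ic _ _ (ev l f2); set X := (Xnorm _ _)^-1; clearbody W X.
    have -> : (P * Q)%:C = P%:C * Q%:C by rewrite rmorphM.
    have -> : 2 * e%:C * (x%:C + m.+1%:R) = Q%:C * (e / (2 * (x + 1)))%:C.
      rewrite -!real_scalar_natr -rmorphD -!rmorphM; congr (_ %:C).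
      by rewrite /Q -natr1; field; rewrite gt_eqF//; lra.
    ring.
have z0 : - m.+2%:R < complex.Re (- m.+1%:R : C) by rewrite ReNn ltrN2 ltr_nat.
have := AB _ z0; rewrite /A /B addNr mulr0 mul0r.
have e3 : - m.+1%:R + 1 = - m%:R :> C by rewrite -[m.+1%:R]natr1 opprD addrNK.
have e4 : - m%:R + (Nm m)%:R = 2 %:C :> C.
  by rewrite real_scalar_natr /Nm -[m.+2]addn2 natrD addKr.
rewrite e3 e4 => /eqP; rewrite mulf_eq0 => /orP[|/eqP//].
by rewrite invr_eq0 (negPf (Xnorm_neq0 _))// ReNn ltrN2 ltr_nat.
Qed.

Lemma NmE : - m%:R + (Nm m)%:R = 2%:C :> C.
Proof. by rewrite real_scalar_natr /Nm -[m.+2]addn2 natrD addKr. Qed.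

(** The derivative in e vanishes by [Ic_dsc_eq0], so e = 0 and e = 1 give the same value. *)
Lemma ell_sc i r f : tame f -> Xf (- m%:R) (Sl [:: (1, r, [::])]) (f \o sc i 0) =
  Xf (- m%:R) (Sl [:: (1, r, [::])]) f.
Proof.
move=> tf; rewrite /Xf NmE; congr (_ * _); set L := iter _ _ _.
pose phi (e : R) : R := bint b (fun p => kpow 2 p * ev L (f \o sc i e) p).
have lt12 : 1 < 2 :> R by rewrite ltr1n.
have dphi (e : R) : is_derive e 1 phi 0.
  have := is_derive_bint_sc i L e lt12 tf.
  have := Ic_dsc_eq0 i r e tf; rewrite Ic_real// -/L => /(congr1 (@complex.Re R)) /= ->.
  exact.
have f1 : f \o sc i 1 = f.
  apply/funext => p /=; congr f; rewrite [RHS]surjective_pairing; congr pair.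
  by apply/rowP => j; rewrite mxE mul1r if_same.
rewrite !Ic_real//; congr (_ %:C); rewrite -[in RHS]f1.
exact: (is_derive_0_is_cst 0 1 dphi).
Qed.

Definition axis f p : R := f (0, p.2).

Lemma axisE f : axis f = foldr (fun i g => g \o sc i 0) f (enum 'I_n).
Proof.
apply/funext => p.
suff H (s : seq 'I_n) (q : V) : foldr (fun i g => g \o sc i 0) f s q =
    f (\row_j (if j \in s then 0 else q.1 0 j), q.2).
  rewrite H /axis; congr (f (_, _)); apply/rowP => j.
  by rewrite !mxE mem_enum.
elim: s q => [|i s ih] q /=.
  congr f; rewrite [LHS]surjective_pairing; congr pair.
  by apply/rowP => j; rewrite mxE.
rewrite ih /=; congr (f (_, _)); apply/rowP => j; rewrite !mxE inE.
by case: (j \in s); rewrite ?orbT ?orbF// mul0r.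
Qed.

Lemma tame_fold f (s : seq 'I_n) : tame f -> tame (foldr (fun i g => g \o sc i 0) f s).
Proof. by move=> tf; elim: s => //= i s ih; exact: tame_sc. Qed.

Lemma tame_axis f : tame f -> tame (axis f).
Proof. by rewrite axisE; exact: tame_fold. Qed.

Lemma ell_axis r f : tame f -> Xf (- m%:R) (Sl [:: (1, r, [::])]) (axis f) =
  Xf (- m%:R) (Sl [:: (1, r, [::])]) f.
Proof.
move=> tf; rewrite axisE; elim: (enum _) => //= i s ih.
by rewrite ell_sc//; exact: tame_fold.
Qed.

End tip.

(** * Integrals of powers of c - |t|^2 over balls *)

Section ball_moments.
Variable R : realType.
Local Notation T := (measurableTypeR R).
Local Notation leb := (@lebesgue_measure R).
Local Notation mun := (fun k => tuple_measure leb k).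
Implicit Types (c q s u : R).

Lemma affine_integral (la c : R) (G : R -> R) : 0 < la -> continuous G -> (forall x, 0 <= G x) ->
  (\int[leb]_x (G x)%:E = \int[leb]_x (G (la * x + c) * la)%:E)%E.
Proof.
move=> la0 cG G0; pose F (x : R) := la * x + c.
have dF (x : R) : is_derive x 1 F la.
  by apply: is_derive_eq; rewrite /GRing.scale /=; ring.
have F' : derive1 F = cst la by apply/funext => x; rewrite derive1E; have [_ ->] := dF x.
rewrite (@increasing_ge0_integration_by_substitutionT R F G)//.
- by apply: eq_integral => x _; rewrite F'.
- by move=> x y xy; rewrite /F ltrD2r ltr_pM2l.
- by rewrite F'; move=> x; exact: cvg_cst.
- by rewrite F'; exact: is_cvg_cst.
- by rewrite F'; exact: is_cvg_cst.
- apply/cvgrNyPle => A; apply: filterS (@nbhs_ninfty_le R ((A - c) / la) (num_real _)) => x /= h.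
  by rewrite /F -lerBrDr mulrC -ler_pdivlMr.
- apply/cvgryPge => A; apply: filterS (@nbhs_pinfty_ge R ((A - c) / la) (num_real _)) => x /= h.
  by rewrite /F -lerBlDr mulrC -ler_pdivrMr.
Qed.

Lemma ge0_integralZ_line (k : R) (f : R -> R) : 0 <= k -> measurable_fun setT f ->
  (forall x, 0 <= f x) -> (\int[leb]_x (k * f x)%:E = k%:E * \int[leb]_x (f x)%:E)%E.
Proof.
move=> k0 mf f0; rewrite -ge0_integralZl_EFin//; last exact/measurable_EFinP.
by move=> x _; rewrite lee_fin.
Qed.

Lemma measurable_ppow q : 1 < q -> measurable_fun setT (ppow q).
Proof.
move=> q1; apply: continuous_measurable_fun => x.
exact: is_derive_cont (is_derive_ppow x q1).
Qed.

Lemma measurable_expRN : measurable_fun setT (fun u : R => expR (- u)).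
Proof. by apply: measurableT_comp => //; exact: measurable_expR. Qed.

Lemma continuous_ppow q : 1 < q -> continuous (ppow q).
Proof. by move=> q1 x; exact: is_derive_cont (is_derive_ppow x q1). Qed.

Lemma ppow_ge0 q s : 0 <= ppow q s.
Proof. by rewrite /ppow; case: ifP => // _; exact: expR_ge0. Qed.

Lemma ppowM q s u : 0 < s -> ppow q (s * u) = expR (q * ln s) * ppow q u.
Proof.
move=> s0; rewrite /ppow pmulr_rgt0//; case: ifPn => [u0|_]; last by rewrite mulr0.
by rewrite lnM ?posrE// mulrDr expRD.
Qed.

Lemma continuous_sqr_sub q c : 1 < q -> continuous (fun s : R => ppow q (c - s ^+ 2)).
Proof.
move=> q1 s; apply: (@continuous_comp _ _ _ (fun s : R => c - s ^+ 2) (ppow q)); last exact: continuous_ppow.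
by apply: cvgB; [exact: cvg_cst|exact: exprn_continuous].
Qed.

Lemma integral_ppow_expRN q : 0 < q ->
  (\int[leb]_u (ppow q u * expR (- u))%:E = (rgamma (q + 1))%:E)%E.
Proof.
move=> q0; have q10 : 0 < q + 1 by rewrite addr_gt0.
have ig := integrable_gint q10.
rewrite /rgamma fineK; last exact: integrable_fin_num ig.
rewrite [RHS]integral_mkcond; apply: eq_integral => u _.
rewrite patchE /ppow /gint addrK; case: ifPn => [u0|u0].
  by rewrite mem_set//= in_itv/= u0.
by rewrite memNset ?mul0r//= in_itv/= andbT; exact/negP.
Qed.

Lemma integral_ppow_sqr q : 1 < q -> exists B : R,
  B * rgamma (q + 3 / 2) = Num.sqrt pi * rgamma (q + 1) /\
  forall c, (\int[leb]_s (ppow q (c - s ^+ 2))%:E = (B * ppow (q + 1 / 2) c)%:E)%E.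
Proof.
move=> q1; have q0 : 0 < q by lra.
(* Kept in the extended reals: its finiteness is read off from Tonelli's theorem at the end. *)
pose BE := (\int[leb]_s (ppow q (1 - s ^+ 2))%:E)%E.
have mp c : measurable_fun setT (fun s : R => ppow q (c - s ^+ 2)).
  by apply: continuous_measurable_fun; exact: continuous_sqr_sub.
have sc0 c : (\int[leb]_s (ppow q (c - s ^+ 2))%:E = (ppow (q + 1 / 2) c)%:E * BE)%E.
  have [c0|c0] := leP c 0.
    rewrite ppow0// mul0e integral0_eq// => s _; rewrite ppow0//.
    by rewrite subr_le0 (le_trans c0)// sqr_ge0.
  have r0 : 0 < Num.sqrt c by rewrite sqrtr_gt0.
  rewrite (@affine_integral _ 0 (fun s => ppow q (c - s ^+ 2)) r0 (@continuous_sqr_sub q c q1)); last by move=> x; exact: ppow_ge0.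
  rewrite -(ge0_integralZ_line (ppow_ge0 _ _) (mp 1) (fun s => ppow_ge0 q _)).
  apply: eq_integral => s _; congr EFin.
  rewrite addr0 exprMn sqr_sqrtr ?(ltW c0)// -{1}[c]mulr1 -mulrBr ppowM// mulrAC; congr (_ * _).
  rewrite /ppow c0 mulrDl expRD; congr (_ * _).
  rewrite (_ : ln c = ln (Num.sqrt c) * 2); first by rewrite (_ : 1 / 2 * _ = ln (Num.sqrt c)); [rewrite lnK|field].
  by rewrite -{1}(sqr_sqrtr (ltW c0)) lnXn// mulr_natr.
have gauss : (\int[leb]_s (expR (- s ^+ 2))%:E = (Num.sqrt pi)%:E)%E.
  by rewrite -integralT_gauss.
have g1 : 0 < rgamma (q + 1) by apply: rgamma_gt0; lra.
have g2 : 0 < rgamma (q + 3 / 2) by apply: rgamma_gt0; lra.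
pose K (z : T * T) : \bar R := (ppow q (z.2 - z.1 ^+ 2) * expR (- z.2))%:E.
have mK : measurable_fun setT K.
  apply/measurable_EFinP; apply: measurable_funM.
    apply: (measurableT_comp (f := ppow q)).
      by apply: continuous_measurable_fun; exact: continuous_ppow.
    apply: measurable_funB; first exact: measurable_snd.
    by apply: measurable_funX; exact: measurable_fst.
  apply: (measurableT_comp (f := fun u : R => expR (- u))); last exact: measurable_snd.
  by apply: measurableT_comp => //; exact: measurable_expR.
have K0 z : (0 <= K z)%E by rewrite lee_fin mulr_ge0 ?ppow_ge0 ?expR_ge0.
have := @fubini_tonelli _ _ _ _ _ leb leb K mK K0.
have -> : (\int[leb]_x \int[leb]_y K (x, y) = (Num.sqrt pi * rgamma (q + 1))%:E)%E.
  have mg : measurable_fun setT (fun s : R => expR (- s ^+ 2)) by exact: measurable_gauss_fun.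
  rewrite mulrC EFinM -gauss -(ge0_integralZ_line (ltW g1) mg (fun s => expR_ge0 _)).
  apply: eq_integral => s _.
  have cK : continuous (fun u => ppow q (u - s ^+ 2) * expR (- u)).
    move=> u; apply: cvgM; last exact: cont_expRN.
    apply: (@continuous_comp _ _ _ (fun u : R => u - s ^+ 2) (ppow q)); last exact: continuous_ppow.
    by apply: cvgB; [exact: cvg_id|exact: cvg_cst].
  have h0 u : 0 <= ppow q u * expR (- u) by rewrite mulr_ge0 ?ppow_ge0 ?expR_ge0.
  have mh : measurable_fun setT (fun u => ppow q u * expR (- u)).
    by apply: measurable_funM; [exact: measurable_ppow|exact: measurable_expRN].
  rewrite /K /= (@affine_integral 1 (s ^+ 2) _ ltr01 cK); last first.
    by move=> u; rewrite mulr_ge0 ?ppow_ge0 ?expR_ge0.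
  rewrite mulrC EFinM -(integral_ppow_expRN q0) -(ge0_integralZ_line (expR_ge0 _) mh h0).
  apply: eq_integral => u _; congr EFin.
  by rewrite mul1r mulr1 addrK opprD expRD; ring.
have -> : (\int[leb]_y \int[leb]_x K (x, y) = (rgamma (q + 3 / 2))%:E * BE)%E.
  have q12 : 0 < q + 1 / 2 by lra.
  transitivity (\int[leb]_y ((ppow (q + 1 / 2) y * expR (- y))%:E * BE))%E.
    apply: eq_integral => u _; rewrite /K /=.
    rewrite mulrC EFinM -muleA -sc0 -(ge0_integralZ_line (expR_ge0 _) (mp u) (fun s => ppow_ge0 q _)).
    by apply: eq_integral => s _; rewrite mulrC.
  have q34 : q + 1 / 2 + 1 = q + 3 / 2 by field.
  rewrite ge0_integralZr//; first by rewrite (integral_ppow_expRN q12) q34.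
  - apply/measurable_EFinP; apply: measurable_funM; last exact: measurable_expRN.
    by apply: measurable_ppow; lra.
  - by move=> u _; rewrite lee_fin mulr_ge0 ?ppow_ge0 ?expR_ge0.
  - by apply: integral_ge0 => s _; rewrite lee_fin ppow_ge0.
move=> E; have BE0 : (0 <= BE)%E by apply: integral_ge0 => s _; rewrite lee_fin ppow_ge0.
move: E sc0; case: BE BE0 => [B _ [E] sc0|_|]; first last.
- by rewrite leeNy_eq.
- by rewrite gt0_muley.
exists B; split; first by rewrite mulrC E.
by move=> c; rewrite sc0 -EFinM mulrC.
Qed.

Definition tsq k (t : k.-tuple T) : R := \sum_(i < k) tnth t i ^+ 2.

Lemma measurable_ball j q c : 1 < q -> measurable_fun setT (fun t : j.-tuple T => ppow q (c - tsq t)).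
Proof.
move=> q1; apply: (measurableT_comp (f := ppow q)); first exact: measurable_ppow.
apply: measurable_funB; first exact: measurable_cst.
by apply: measurable_sum => i; apply: measurable_funX; exact: measurable_tnth.
Qed.

(** One coordinate at a time: each integration raises the exponent by 1/2 and contributes a quotient
    of Gamma values half a unit apart, and these quotients telescope. *)
Lemma integral_ball k q c : 1 < q -> (\int[mun k]_t (ppow q (c - tsq t))%:E =
  (Num.sqrt pi ^+ k * rgamma (q + 1) / rgamma (q + 1 + k%:R / 2) * ppow (q + k%:R / 2) c)%:E)%E.
Proof.
elim: k c => [|k ih] c q1.
  rewrite /= integral_dirac//; last by apply/measurable_EFinP; exact: measurable_ball.
  rewrite /tsq big_ord0 subr0 expr0 mul0r !addr0 mul1r divff ?mul1r ?diracE ?mem_set ?mul1e//.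
  by rewrite gt_eqF// rgamma_gt0//; lra.
rewrite ge0_tuple_integralS; [|by apply/measurable_EFinP; exact: measurable_ball|by move=> t; rewrite lee_fin ppow_ge0].
have k0 : 0 <= k%:R / 2 :> R by rewrite divr_ge0.
set A := _ / rgamma (q + 1 + k%:R / 2) in ih.
have g1 : 0 < rgamma (q + 1) by apply: rgamma_gt0; lra.
have g2 : 0 < rgamma (q + 1 + k%:R / 2) by apply: rgamma_gt0; lra.
have A0 : 0 <= A by rewrite divr_ge0 ?mulr_ge0 ?exprn_ge0 ?sqrtr_ge0 ?ltW.
have qk : 1 < q + k%:R / 2 by lra.
have [B [hB iB]] := integral_ppow_sqr qk.
transitivity (\int[leb]_s (A * ppow (q + k%:R / 2) (c - s ^+ 2))%:E)%E.
  apply: eq_integral => s _; rewrite -ih//; apply: eq_integral => t _.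
  congr (ppow _ _)%:E; rewrite /tsq big_ord_recl tnth0 opprD addrA; congr (_ - _).
  by apply: eq_bigr => i _; rewrite tnthS.
have mq : measurable_fun setT (fun s : R => ppow (q + k%:R / 2) (c - s ^+ 2)).
  by apply: continuous_measurable_fun; exact: continuous_sqr_sub.
rewrite (ge0_integralZ_line A0 mq (fun s => ppow_ge0 _ _)).
rewrite iB -EFinM; congr EFin; rewrite mulrA (_ : q + k%:R / 2 + 1 / 2 = q + k.+1%:R / 2); last first.
    by rewrite -natr1; field.
  congr (_ * _); move: hB; rewrite (_ : q + k%:R / 2 + 3 / 2 = q + 1 + k.+1%:R / 2); last by rewrite -natr1; field.
  rewrite (_ : q + k%:R / 2 + 1 = q + 1 + k%:R / 2); last by ring.
  have g3 : 0 < rgamma (q + 1 + k.+1%:R / 2) by apply: rgamma_gt0; rewrite -natr1; lra.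
  move=> /eqP; rewrite -[_ == _](inj_eq (mulIf (invr_neq0 (lt0r_neq0 g3)))) mulfK ?lt0r_neq0// => /eqP ->.
  by rewrite /A exprS; field; rewrite !gt_eqF.
Qed.

End ball_moments.

(** * Values of Gamma at 1, 3 and 7/2 *)

Section gamma_values.
Variable R : realType.
Local Notation leb := (@lebesgue_measure R).

Lemma is_derive_exprn k (x : R) : is_derive x 1 (fun y : R => y ^+ k) (k%:R * x ^+ k.-1).
Proof.
elim: k => [|k ih].
  by rewrite mul0r; under eq_fun do rewrite expr0; exact: is_derive_cst.
under eq_fun do rewrite exprS; apply: (is_derive_eq (is_deriveM (is_derive_id x 1) ih)).
rewrite /GRing.scale /= -[k.+1%:R]natr1; case: k {ih} => [|k] /=; first by ring.
by rewrite exprS; ring.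
Qed.

Lemma rgamma1 : rgamma (1 : R) = 1.
Proof.
rewrite /rgamma /Rintegral.
have -> : (fun x : R => (gint 1 x)%:E) = (fun x => (expR (- x))%:E).
  by apply/funext => x; rewrite /gint subrr mul0r expR0 mul1r.
suff -> : (\int[leb]_(x in `]0%R, +oo[) (expR (- x))%:E = (0 - (- 1))%:E)%E by rewrite /= sub0r opprK.
apply: (@ge0_FTC_0y R (fun x => expR (- x)) (fun x => - expR (- x))).
- by move=> x _; exact: expR_ge0.
- by move=> x _; exact: cont_expRN.
- by move=> x _; apply: is_derive_eq; rewrite /GRing.scale /=; ring.
- rewrite -oppr0; apply: cvgN; exact: cvgr_expR.
- apply: cvgN; apply: cvg_at_right_filter.
  by have := @cont_expRN R 0; rewrite /prop_for /continuous_at oppr0 expR0.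
Qed.

Lemma rgamma3 : rgamma (3 : R) = 2.
Proof.
rewrite (_ : 3 = 1 + 1 + 1 :> R); last by ring.
by rewrite rgammaS// rgammaS// rgamma1; ring.
Qed.

Lemma integral_sqr_1B : (\int[leb]_s (ppow 2 (1 - s ^+ 2 : R))%:E = (16 / 15)%:E)%E.
Proof.
pose f (s : R) := (1 - s ^+ 2) ^+ 2; pose F (s : R) := s - 2 / 3 * s ^+ 3 + s ^+ 5 / 5.
have p2 (z : R) : 0 <= z -> ppow 2 z = z ^+ 2.
  rewrite le_eqVlt /ppow => /orP[/eqP <-|z0]; first by rewrite ltxx expr0n.
  by rewrite z0 mulr_natl -lnXn// lnK// posrE exprn_gt0.
have -> : (\int[leb]_s (ppow 2 (1 - s ^+ 2 : R))%:E = \int[leb]_(s in `[(- 1)%R, 1%R]) (f s)%:E)%E.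
  rewrite [RHS]integral_mkcond; apply: eq_integral => s _; rewrite patchE.
  case: ifPn => [/set_mem|/negP h].
    rewrite /= in_itv/= -ler_norml => s1; congr EFin; apply: p2.
    by rewrite subr_ge0 -[s ^+ 2]real_normK ?num_real// exprn_ile1.
  rewrite ppow0// subr_le0 -[s ^+ 2]real_normK ?num_real// exprn_ege1//.
  by rewrite leNgt; apply/negP => /ltW s1; apply: h; rewrite inE/= in_itv/= -ler_norml.
have dF (s : R) : is_derive s 1 F (f s).
  have d3 := is_derive_exprn 3 s; have d5 := is_derive_exprn 5 s.
  by apply: is_derive_eq; rewrite /GRing.scale /= /f; field.
have cf (s : R) : {for s, continuous f}.
  have d2 := is_derive_exprn 2 s.
  have df : is_derive s 1 f (2 * (1 - s ^+ 2) * (- (2 * s))).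
    rewrite /f; under eq_fun do rewrite expr2.
    by apply: is_derive_eq; rewrite /GRing.scale /=; ring.
  exact: is_derive_cont df.
have cF (s : R) : {for s, continuous F} by exact: is_derive_cont (dF s).
rewrite (@continuous_FTC2 _ f F)//.
- by congr EFin; rewrite /F; field.
- by apply: continuous_subspaceT => s; exact: cf.
- split.
  + by move=> s _; have [] := dF s.
  + by apply: cvg_at_right_filter; exact: cF.
  + by apply: cvg_at_left_filter; exact: cF.
- by move=> s _; have [_] := dF s; rewrite derive1E.
Qed.

(** The constant of [integral_ppow_sqr] for q = 2 is 16/15, by an explicit primitive, and Gamma(3) =
    2. Together with the functional equation this gives the Gamma(7/2 + m) that occurs in
    [integral_ball] for q = 2 in dimension 2 m + 1. *)
Lemma rgamma72 : rgamma (7 / 2 : R) = 15 / 8 * Num.sqrt pi.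
Proof.
have [B [hB iB]] := @integral_ppow_sqr R 2 ltac:(by rewrite ltr1n).
have := iB 1; rewrite integral_sqr_1B /ppow ltr01 ln1 mulr0 expR0 mulr1 => -[EB].
move: hB; rewrite -EB (_ : 2 + 3 / 2 = 7 / 2 :> R); last by field.
rewrite (_ : 2 + 1 = 3 :> R); last by ring.
by rewrite rgamma3 => h; rewrite -[LHS](mulKf (_ : 16 / 15 != 0 :> R))// h; field.
Qed.

End gamma_values.

(** * Functions of y alone *)

Section axis_integral.
Variables (R : realType) (n : nat) (b : R) (hb : b < 0).
Local Notation T := (measurableTypeR R).
Local Notation leb := (@lebesgue_measure R).
Local Notation mun := (tuple_measure leb n).
Local Notation Vmu := (mun \x leb)%E.
Local Notation V := ('rV[R]_n * R)%type.
Local Notation dir o := (@direction R n o).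
Local Notation Sl := (@Sl R n).
Implicit Types (g F : V -> R) (l : seq (term R n)) (y : R).

(** This is t - t_0, so that k = tau^2 - |x|^2. *)
Definition tau y : R := 2 / 3 * (- y) `^ (3 / 2) - apar b.

Lemma tau_b : tau b = 0. Proof. by rewrite /tau /apar subrr. Qed.

Lemma tau_gt0 y : y < b -> 0 < tau y.
Proof.
move=> yb; rewrite /tau /apar subr_gt0 ltr_pM2l ?divr_gt0//.
by apply: gt0_ltr_powR; rewrite ?divr_gt0// ?nnegrE ?oppr_ge0 ?ltW ?ltrN2// (lt_trans yb).
Qed.

Lemma kpow_axis x (t : n.-tuple T) y : y < b -> kpow b x (vpt (t, y : T)) = ppow x (tau y ^+ 2 - tsq t).
Proof.
move=> yb; have y0 : (vpt (t, y : T)).2 < 0 := lt_trans yb hb.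
have E : kfun b (vpt (t, y : T)) = tau y ^+ 2 - tsq t.
  have h := s32_sqr y0; rewrite /kfun /ufun /= in h *.
  rewrite (_ : y ^+ 3 = - ((- y) `^ (3 / 2)) ^+ 2); last by rewrite h; ring.
  rewrite (_ : sqnorm _ = tsq t); last by apply: eq_bigr => i _; rewrite mxE.
  by rewrite /tau; field.
rewrite /kpow /ppow -E; have := ufunE hb y0; rewrite -/(kfun b _) => ->.
by rewrite pmulr_rgt0// mulr_gt0 ?kap_gt0// s32_gt0.
Qed.

Lemma left_FTC (F F' : R -> R) (M : R) :
  (forall y, y < 0 -> is_derive y 1 F (F' y)) -> (forall y, y < 0 -> {for y, continuous F'}) ->
  (forall y, y < - M -> F y = 0) -> (forall y, y < - M -> F' y = 0) ->
  (\int[leb]_(y in `]-oo, b[) (F' y)%:E = (F b)%:E)%E.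
Proof.
move=> dF cF' F0 F'0.
pose N : R := `|M| + 1 - b.
have Nb : - N < b by rewrite /N opprB ltrBlDr ltrDl ltr_pwDr.
have MN : M < N by rewrite /N -addrA (le_lt_trans (ler_norm _))// ltrDl subr_gt0 (lt_trans hb).
have neg y : y <= b -> y < 0 by move=> /le_lt_trans; apply.
have cw : {within `[- N, b], continuous F'}.
  by apply: continuous_in_subspaceT => y; rewrite inE /= in_itv/= => /andP[_ /neg]; exact: cF'.
have -> : (\int[leb]_(y in `]-oo, b[) (F' y)%:E)%E = (\int[leb]_(y in `[(- N)%R, b]) (F' y)%:E)%E.
  transitivity (\int[leb]_(y in `[(- N)%R, b[) (F' y)%:E)%E; last first.
    rewrite integral_itv_bndo_bndc//; apply/measurable_EFinP.
    apply: (@measurable_funS _ _ _ _ `[- N, b]%classic) => //.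
      by move=> y /=; rewrite !in_itv/= => /andP[-> /ltW].
    exact: subspace_continuous_measurable_fun.
  rewrite [LHS]integral_mkcond [RHS]integral_mkcond; apply: eq_integral => y _; rewrite !patchE /=.
  case: ifPn => [/set_mem|/negP] yb; case: ifPn => [/set_mem|/negP] h //.
    congr EFin; apply: F'0; move: yb => /=; rewrite in_itv/= => yb.
    rewrite (lt_trans _ (_ : - N < - M)) ?ltrN2//.
    by rewrite ltNge; apply/negP => h'; apply: h; rewrite inE /= in_itv/= h'.
  by exfalso; apply: yb; rewrite inE; move: h => /=; rewrite !in_itv/= => /andP[].
have cF y : y < 0 -> {for y, continuous F} by move=> /dF; exact: is_derive_cont.
rewrite (@continuous_FTC2 _ F' F)//.
- by rewrite (F0 (- N)) ?sube0//= ltrN2.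
- split.
  + by move=> y; rewrite in_itv/= => /andP[_ /ltW/neg/dF[]].
  + by apply: cvg_at_right_filter; apply: cF; apply: neg; exact: ltW.
  + by apply: cvg_at_left_filter; apply: cF; exact: neg.
- by move=> y; rewrite in_itv/= => /andP[_ /ltW/neg/dF[_]]; rewrite derive1E.
Qed.

(** For F independent of x, the integral in x is that of k^2 over the ball of radius [tau y]. *)
Lemma bint_axis F (M : R) : contH F -> ybounded M F -> (forall p, F p = F (0, p.2)) ->
  (bint b (fun p => kpow b 2 p * F p))%:E =
  (\int[leb]_(y in `]-oo, b[) ((Num.sqrt pi ^+ n * rgamma 3 / rgamma (3 + n%:R / 2)) *
     ppow (2 + n%:R / 2) (tau y ^+ 2) * F (0%R, y))%:E)%E.
Proof.
move=> cF yF F0; have lt12 : 1 < 2 :> R by rewrite ltr1n.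
have ck : contH (fun p => kpow b 2 p * F p) by apply: contHM => //; exact: contH_kpow.
have iF := contH_integrableT hb ck (kpow_supp hb 2 yF).
rewrite bintE fineK; last exact: integrable_fin_num iF.
rewrite -(integral21_prod_meas1 iF) [RHS]integral_mkcond.
apply: eq_integral => y _; rewrite /fubini_G patchE /=.
case: ifPn => [/set_mem|/negP yb]; last first.
  rewrite integral0_eq// => t _ /=; rewrite patchE memNset//= => Hy.
  by apply: yb; rewrite inE/= in_itv.
rewrite /= in_itv/= => yb.
rewrite (_ : 3 = 2 + 1 :> R); last by ring.
rewrite EFinM -integral_ball//.
transitivity (\int[mun]_t ((ppow 2 (tau y ^+ 2 - tsq t))%:E * (F (0%R, y))%:E))%E.
  apply: eq_integral => t _; rewrite patchE mem_set//= kpow_axis//.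
  by rewrite EFinM [in LHS]F0.
have mb : measurable_fun setT (fun t : n.-tuple T => (ppow 2 (tau y ^+ 2 - tsq t))%:E).
  by apply/measurable_EFinP; exact: measurable_ball.
rewrite integralZr//; apply/integrableP; split => //.
under eq_integral do rewrite gee0_abs ?lee_fin ?ppow_ge0//.
by rewrite integral_ball// ltry.
Qed.

Lemma is_derive_axis F y d : is_derive ((0, y) : V) (dir None) F d ->
  is_derive y 1 (fun y => F (0, y)) d.
Proof.
move=> dF; have E y' : (0, y') = (0, 0) + y' *: dir None :> V.
  by congr pair; rewrite /= ?scaler0 ?addr0// add0r [_ *: _]mulr1.
under eq_fun do rewrite E; by apply: is_derive_along; rewrite -E.
Qed.

Definition axial g := forall p : V, g p = g (0, p.2).

Lemma axial_pderiv g s : axial g -> axial (pderiv s g).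
Proof.
move=> ag; elim: s => [|o s ih]; first exact: ag.
move=> p; rewrite /= /derive.
suff -> : (fun h : R => h^-1 *: ((pderiv s g \o shift p) (h *: dir o) - pderiv s g p)) =
    (fun h : R => h^-1 *: ((pderiv s g \o shift ((0, p.2) : V)) (h *: dir o) - pderiv s g (0, p.2))) by [].
apply/funext => h; congr (_ *: (_ - _)); last exact: ih.
by rewrite /= [LHS]ih [RHS]ih.
Qed.

Lemma axial_ev g l : axial g -> axial (ev l g).
Proof.
by move=> ag p; rewrite !evE; apply: eq_bigr => a _; rewrite (axial_pderiv a.2 ag p).
Qed.

Lemma axial_ev_dx g l i p : smooth g -> axial g -> p.2 < 0 -> ev (dxt i l) g p = 0.
Proof.
move=> sg ag p0; have [_ <-] := is_derive_ev_x l i sg p0.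
suff : is_derive p (dir (Some i)) (ev l g) 0 by case.
apply: is_derive_alongP.
rewrite (_ : (fun s : R => _) = fun=> ev l g p); first exact: is_derive_cst.
apply/funext => s; rewrite (axial_ev l ag (_ + _)) [RHS](axial_ev l ag) /=.
by rewrite scaler0 addr0.
Qed.

Lemma ev_Sl_axis g l y : smooth g -> axial g -> y < 0 -> ev (Sl l) g (0, y) =
  (- y) `^ (- (1 / 4)) * ev (dyt (dyt (mulp (- (3 / 4)) l))) g (0, y) -
  5 / 16 * (- y) `^ (- 3) * ev l g (0, y).
Proof.
move=> sg ag y0; rewrite /Sl ev_cat ev_scal !ev_mulp// ev_T//= big1 ?mulr0 ?add0r; last first.
  by move=> i _; rewrite axial_ev_dx.
by ring.
Qed.

(** On the axis [Sl] is a second derivative in tau brought to Liouville form: its formal adjoint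
    sends tau^k to k (k - 1) tau^(k - 2), the constant 5/16 cancelling the second derivative of (-
    y)^(- 1/4). The function differentiated here is the bracket left by integrating by parts
    twice. *)
Lemma axis_step g l k y : smooth g -> axial g -> y < 0 ->
  is_derive y 1 (fun y => tau y ^+ k * (- y) `^ (- (1 / 4)) * ev (dyt (mulp (- (3 / 4)) l)) g (0, y) -
    (- k%:R * tau y ^+ k.-1 * (- y) `^ (1 / 4) + 1 / 4 * tau y ^+ k * (- y) `^ (- (5 / 4))) *
     ev (mulp (- (3 / 4)) l) g (0, y))
   (tau y ^+ k * ev (Sl l) g (0, y) - k%:R * (k.-1)%:R * tau y ^+ k.-2 * ev l g (0, y)).
Proof.
move=> sg ag y0; have s0 : 0 < - y by rewrite oppr_gt0.
have py r : is_derive y 1 (fun y => (- y) `^ r) (- (r * (- y) `^ (r - 1))).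
  have := is_derive_axis (@is_derive_ypow R n r (0, y) (dir None) y0).
  by rewrite /= mulr1.
have dt : is_derive y 1 tau (- (- y) `^ (1 / 2)).
  have d := py (3 / 2); apply: is_derive_eq; rewrite /GRing.scale /= (_ : 3 / 2 - 1 = 1 / 2); last by field.
  by field.
have dtk j : is_derive y 1 (fun y => tau y ^+ j) (j%:R * tau y ^+ j.-1 * - (- y) `^ (1 / 2)).
  exact: (is_derive1_comp (is_derive_exprn j (tau y)) dt).
have d1 := is_derive_axis (@is_derive_ev_y R n (mulp (- (3 / 4)) l) g (0, y) sg y0).
have d2 := is_derive_axis (@is_derive_ev_y R n (dyt (mulp (- (3 / 4)) l)) g (0, y) sg y0).
have dk := dtk k; have dk1 := dtk k.-1.
have p1 := py (- (1 / 4)); have p2 := py (1 / 4); have p3 := py (- (5 / 4)).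
apply: is_derive_eq; rewrite /GRing.scale /= ev_Sl_axis// ev_mulp//=.
(* All exponents are multiples of 1/4, so the identity becomes rational in Q. *)
pose Q := (- y) `^ (1 / 4).
have Q0 : Q != 0 by rewrite gt_eqF// powR_gt0.
have pQ (j : nat) : (- y) `^ (1 / 4 * j%:R) = Q ^+ j by rewrite powRrM powR_mulrn// powR_ge0.
have e1 : (- y) `^ (- (1 / 4)) = Q^-1 by rewrite powRN.
have e2 : (- y) `^ (1 / 2) = Q ^+ 2 by rewrite -pQ; congr (_ `^ _); field.
have e3 : (- y) `^ (- (3 / 4)) = Q ^- 3 by rewrite powRN -pQ; congr (_ `^ _)^-1; field.
have e4 : (- y) `^ (- (5 / 4)) = Q ^- 5 by rewrite powRN -pQ; congr (_ `^ _)^-1; field.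
have e5 : (- y) `^ (- (1 / 4) - 1) = Q ^- 5.
  by rewrite (_ : - (1 / 4) - 1 = - (5 / 4)) ?e4//; field.
have e6 : (- y) `^ (1 / 4 - 1) = Q ^- 3.
  by rewrite (_ : 1 / 4 - 1 = - (3 / 4)) ?e3//; field.
have e7 : (- y) `^ (- (5 / 4) - 1) = Q ^- 9.
  by rewrite (_ : - (5 / 4) - 1 = - (1 / 4 * 9%:R)) ?powRN ?pQ//; field.
have e8 : (- y) `^ (- 3) = Q ^- 12.
  by rewrite (_ : - 3 = - (1 / 4 * 12%:R) :> R) ?powRN ?pQ//; field.
rewrite e1 e2 e3 e4 e5 e6 e7 e8 -/Q.
by field.
Qed.

Lemma contH_axis F : contH F -> forall y, y < 0 -> {for y, continuous (fun y : R => F (0, y))}.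
Proof.
move=> cF y y0; have E y' : (0, y') = (0, 0) + y' *: dir None :> V.
  by congr pair; rewrite /= ?scaler0 ?addr0// add0r [_ *: _]mulr1.
rewrite (_ : (fun y => _) = fun y : R => F ((0, 0) + y *: dir None)); last by apply/funext => y'; rewrite -E.
apply: (@continuous_comp _ _ _ (fun y : R => ((0, 0) : V) + y *: dir None) F).
  by apply: cvgD; [exact: cvg_cst|apply: cvgZl; exact: cvg_id].
by apply: cF; rewrite -E.
Qed.

(** Each use of [axis_step] lowers the power of tau by 2 and contributes the product of that power
    and its predecessor, which builds up the factorial. As tau vanishes at b, the brackets do too,
    except the last one, of power 1, which leaves (- b)^(1/4 - 3/4). *)
Lemma axis_primitive g l k M : smooth g -> axial g -> ybounded M g -> exists F : R -> R,
  [/\ forall y, y < 0 -> is_derive y 1 F (tau y ^+ (k.*2.+1) * ev (iter k.+1 Sl l) g (0, y)),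
      forall y, y < - M -> F y = 0 &
      F b = (k.*2.+1)`!%:R * (- b) `^ (- (1 / 2)) * ev l g (0, b)].
Proof.
move=> sg ag yg; elim: k => [|k [F [dF F0 Fb]]].
  eexists; split.
  - move=> y y0; apply: (is_derive_eq (axis_step l 1 sg ag y0)) => /=.
    by rewrite mulr0 !mul0r subr0.
  - by move=> y yM /=; rewrite !(ybounded_ev _ yg)// !mulr0 subr0.
  - rewrite /= tau_b expr0 !expr1 !mul0r mulr0 mul0r addr0 sub0r ev_mulp//= factS fact0.
    rewrite !mulNr opprK !mul1r mulrA -powRDp ?oppr_gt0//.
    by congr (_ `^ _ * _); field.
exists (fun y => (tau y ^+ k.*2.+3 * (- y) `^ (- (1 / 4)) * ev (dyt (mulp (- (3 / 4)) (iter k.+1 Sl l))) g (0, y) -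
    (- (k.*2.+3)%:R * tau y ^+ k.*2.+2 * (- y) `^ (1 / 4) + 1 / 4 * tau y ^+ k.*2.+3 * (- y) `^ (- (5 / 4))) *
     ev (mulp (- (3 / 4)) (iter k.+1 Sl l)) g (0, y)) + (k.*2.+3)%:R * (k.*2.+2)%:R * F y); split.
- move=> y y0.
  apply: (is_derive_eq (is_deriveD (axis_step (iter k.+1 Sl l) k.*2.+3 sg ag y0)
     (is_deriveZ ((k.*2.+3)%:R * (k.*2.+2)%:R) (dF y y0)))).
  by rewrite /GRing.scale /= doubleS; ring.
- by move=> y yM /=; rewrite F0// !(ybounded_ev _ yg)// !mulr0 subr0 addr0.
- by rewrite /= tau_b !exprS !mul0r !mulr0 !mul0r addr0 mul0r subr0 add0r Fb doubleS !factS !natrM; ring.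
Qed.

End axis_integral.

(** * Value of the tip contribution *)

Section tip_value.
Variables (R : realType) (m n : nat) (hn : n = (2 * m + 1)%N) (b : R) (hb : b < 0).
Local Notation V := ('rV[R]_n * R)%type.
Local Notation C := R[i].
Local Notation Xf := (Xf m b).
Local Notation Sl := (@Sl R n).
Local Open Scope complex_scope.

(** Duplication formula: (2 N + 1)! = 2 4^N N! Gamma(N + 3/2) / sqrt(pi) for N = k + 2, where
    Gamma(7/2) = (15/8) sqrt(pi). *)
Lemma half_factorial k : (k.+2.*2.+1)`!%:R =
  2 * 4 ^+ k.+2 * k.+2`!%:R * (15 / 8 * \prod_(i < k) (7 / 2 + i%:R)) :> R.
Proof.
elim: k => [|k ih]; first by rewrite big_ord0 (_ : 2.*2.+1`! = 120)%N// (_ : 2`! = 2)%N//; field.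
have E : (k.+3.*2.+1`! = k.+2.*2.+3 * (k.+2.*2.+2 * k.+2.*2.+1`!))%N by rewrite doubleS 2!factS.
rewrite big_ord_recr/= E (factS k.+2) 3!natrM ih.
have -> : (k.+2.*2.+3 = 7 + 2 * k)%N by rewrite -mul2n !mulnS.
have -> : (k.+2.*2.+2 = 6 + 2 * k)%N by rewrite -mul2n !mulnS.
by rewrite [4 ^+ k.+3]exprS !natrD !natrM -[k.+3]add3n natrD; field.
Qed.

Lemma Xnorm_tip : Xnorm m (- m%:R) = (2 * 4 ^+ m.+2 * m.+2`!%:R : R)%:C.
Proof.
rewrite /Xnorm /Nm (_ : - m%:R + m.+3%:R = (3 : R)%:C :> C); last first.
  by rewrite real_scalar_natr -[m.+3]addn3 natrD addKr.
rewrite Gamma_real rgamma3 -mulrA [RHS]rmorphM; congr (_ * _).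
rewrite (_ : \prod_(i < m.+2) _ = \prod_(i < m.+2) (4 * i.+1%:R : R)%:C); last first.
  apply: eq_bigr => i _; rewrite (rmorphM (@real_complex_def _ (Phant R)) 4) /= !real_scalar_natr; congr (_ * _).
  by rewrite addSnnS natrD addKr.
rewrite -(rmorph_prod (@real_complex_def _ (Phant R))); congr (_ %:C); rewrite big_split/= prodr_const card_ord; congr (_ * _).
by elim: m.+2 => [|k ih]; rewrite ?big_ord0 ?fact0// big_ord_recr/= ih factS natrM mulrC.
Qed.

(** Formally [Sl] produces the factor 4 x (x + m), zero at x = - m, against a pole of the normalized
    power of k at - m - 1: the product is a multiple of the delta at the tip. Its size is read off
    on the axis, where the factorial (2 m + 5)! cancels [Xnorm] at - m and the Gamma(7/2 + m) of the
    ball constant, leaving 2 pi^m. *)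
Lemma ell_value r (f : V -> R) : tame f -> Xf (- m%:R) (Sl [:: (1, r, [::])]) f =
  (2 * pi ^+ m * (- b) `^ (r - 1 / 2) * f (0, b))%:C.
Proof.
move=> tf; rewrite -(ell_axis hn hb r tf); have tg := tame_axis tf; have [sg [M yg]] := tg.
have ag : axial (axis f) by move=> p.
set g := axis f in tg sg yg ag *; set l := [:: (1, r, [::])].
have lt12 : 1 < 2 :> R by rewrite ltr1n.
rewrite /Xf NmE Xnorm_tip -iterSr Ic_real// -fmorphV -rmorphM; congr (_ %:C).
have [F [dF F0 Fb]] := axis_primitive hb l m.+2 sg ag yg.
set L := iter m.+3 Sl l in dF; rewrite -/L.
pose C0 : R := Num.sqrt pi ^+ n * rgamma 3 / rgamma (3 + n%:R / 2).
have sp : 0 < Num.sqrt pi :> R by rewrite sqrtr_gt0 pi_gt0.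
have C0E : C0 = 2 * pi ^+ m / (15 / 8 * \prod_(i < m) (7 / 2 + i%:R)).
  rewrite /C0 (nE _ hn) (_ : 3 + (2 * m%:R + 1) / 2 = 7 / 2 + m%:R :> R); last by field.
  rewrite rgamma_shift ?divr_gt0// rgamma72 rgamma3 hn addn1 exprSr exprM sqr_sqrtr ?pi_ge0//.
  have P0 : \prod_(i < m) (7 / 2 + i%:R) != 0 :> R.
    by apply/prodf_neq0 => i _; rewrite gt_eqF// ltr_pwDl// divr_gt0.
  by field; rewrite P0 gt_eqF.
have bE : bint b (fun p => kpow b 2 p * ev L g p) = C0 * F b.
  apply: EFin_inj; have cL : contH (ev L g) by exact: contH_ev.
  rewrite (bint_axis hb cL (ybounded_ev L yg) (axial_ev L ag)) -/C0.
  pose F1 y := C0 * F y; pose F2 y := C0 * (tau b y ^+ m.+2.*2.+1 * ev L g (0, y)).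
  have d1 (y : R) : y < 0 -> is_derive y 1 F1 (F2 y) by move=> y0; exact: (is_deriveZ C0 (dF y y0)).
  have c1 (y : R) : y < 0 -> {for y, continuous F2}.
    move=> y0; apply: cvgM; first exact: cvg_cst.
    apply: cvgM; last exact: (contH_axis cL y0).
    have ct : {for y, continuous (tau b)}.
      have ct32 := @contH_axis R n (@s32 R n) (@contH_s32 R n) y y0.
      by apply: cvgB; [apply: cvgM; [exact: cvg_cst|exact: ct32]|exact: cvg_cst].
    exact: (@continuous_comp _ _ _ (tau b) (fun x => x ^+ m.+2.*2.+1) y ct (@exprn_continuous _ _ _)).
  have z1 (y : R) : y < - M -> F1 y = 0 by move=> yM; rewrite /F1 F0// mulr0.
  have z2 (y : R) : y < - M -> F2 y = 0 by move=> yM; rewrite /F2 (ybounded_ev _ yg)// !mulr0.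
  rewrite -[RHS](left_FTC hb d1 c1 z1 z2).
  apply: eq_integral => y /set_mem /=; rewrite in_itv/= => yb; congr EFin.
  rewrite -mulrA; congr (_ * (_ * _)); have t0 := tau_gt0 hb yb.
  rewrite /ppow exprn_gt0// lnXn// (nE _ hn).
  rewrite (_ : (2 + (2 * m%:R + 1) / 2) * _ = (m.+2.*2.+1)%:R * ln (tau b y)).
    by rewrite mulr_natl -lnXn// lnK// posrE exprn_gt0.
  have -> : (m.+2.*2.+1 = 5 + 2 * m)%N by rewrite -mul2n !mulnS.
  by rewrite -mulr_natr natrD natrM; field.
rewrite bE Fb half_factorial C0E evE big_seq1 /= -/g.
have P0 : \prod_(i < m) (7 / 2 + i%:R) != 0 :> R.
  by apply/prodf_neq0 => i _; rewrite gt_eqF// ltr_pwDl// divr_gt0.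
have f0 : m.+2`!%:R != 0 :> R by rewrite pnatr_eq0 -lt0n fact_gt0.
rewrite (_ : (- b) `^ (r - 1 / 2) = (- b) `^ r * (- b) `^ (- (1 / 2))); last by rewrite powRDp// oppr_gt0.
rewrite (_ : g (0, b) = f (0, b))//.
have e4 : 4 ^+ m.+2 != 0 :> R by rewrite expf_neq0.
move: P0 f0 e4; move: (\prod_(i < m) _) (m.+2`!%:R) (4 ^+ m.+2) => P W E P0 f0 e4.
by field; rewrite P0 f0 e4.
Qed.

End tip_value.

(** * The exponent 0 and the natural exponents *)

Section boundary_value.
Variables (R : realType) (m n : nat) (hn : n = (2 * m + 1)%N) (b : R) (hb : b < 0).
Local Notation V := ('rV[R]_n * R)%type.
Local Notation T := (measurableTypeR R).
Local Notation C := R[i].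
Local Notation nc := (@Normc.normc R).
Local Notation Xf := (Xf m b).
Local Notation Vmu := (tuple_measure (@lebesgue_measure R) n \x @lebesgue_measure R)%E.
Local Open Scope complex_scope.
Implicit Types (f F : V -> R) (l : seq (term R n)).

Lemma analytic_cvg_seq (g : C -> C) (z : C) : analytic_at g z ->
  cvgC (fun j => g (z + (j.+1%:R^-1)%:C)) (g z).
Proof.
move=> /analytic_geo[a [r [M [r0 ha hga]]]] e e0.
have gz : g z = a 0%N.
  have h0 : nc (0 : C) <= r by rewrite normc0 ltW.
  have := hga 0 h0; rewrite addr0 => h; apply: (csum_unique h).
  have := @csum_head R (fun k => a k * 0 ^+ k); rewrite expr0 mulr1; apply.
  by move=> k; rewrite expr0n mulr0.
have M0 : 0 <= M by have := ha 0%N; rewrite !expr0 !mulr1; apply/le_trans/normc_ge0.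
(* For j + 1 > A the point 1/(j + 1) lies in the disc and M / (r (j + 1)) < e. *)
pose A := Order.max r^-1 ((M + 1) / (r * e)).
exists (Num.truncn A) => j jA.
have Aj : A < j.+1%:R.
  by apply: lt_le_trans (truncnS_gt _) _; rewrite ler_nat ltnS.
pose t : R := r^-1 / j.+1%:R.
have j0 : 0 < j.+1%:R :> R by [].
have t0 : 0 < t by rewrite divr_gt0 ?invr_gt0.
have t1 : t < 1.
  by rewrite ltr_pdivrMr// mul1r; apply: le_lt_trans Aj; rewrite le_max lexx.
have Mt : M * t < e.
  have : (M + 1) / (r * e) < j.+1%:R by apply: le_lt_trans Aj; rewrite le_max lexx orbT.
  rewrite ltr_pdivrMr ?mulr_gt0// => h.
  rewrite /t mulrA ltr_pdivrMr// ltr_pdivrMr// mulrAC; apply: lt_le_trans (_ : M + 1 <= _); first by rewrite ltrDl.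
  by rewrite mulrC (mulrC e); exact: ltW.
pose w : C := (j.+1%:R^-1)%:C.
have nw : nc w = r * t.
  by rewrite normcR ger0_norm ?invr_ge0// /t mulrA divff ?gt_eqF// mul1r.
clearbody t.
have wr : nc w <= r by rewrite nw ger_pMr// ltW.
have t2 : 0 <= t / 2 < 1.
  by rewrite divr_ge0 ?(ltW t0)// ltr_pdivrMr// mul1r (lt_trans t1)// ltr1n.
have hbk k : nc (a k * w ^+ k) <= M * (t / 2) ^+ k.
  rewrite Normc.normcM normcX nw !exprMn mulrA [leRHS]mulrA [leRHS]mulrAC.
  by rewrite ler_wpM2r ?exprn_ge0 ?(ltW t0).
have := cvgC_tail_le t2 hbk (hga w wr) 1; rewrite big_ord1 expr0 mulr1 expr1 -gz => h.
apply: le_lt_trans Mt; apply: (le_trans h).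
have p : 2^-1 <= 1 - t / 2 by move: (t1) => {}t1; lra.
have p0 : 0 < 1 - t / 2 by apply: lt_le_trans p; rewrite invr_gt0.
rewrite -mulrA ler_wpM2l// mulrCA ler_piMr ?(ltW t0)//.
by rewrite -invfM invf_le1 ?mulr_gt0//; move: p; lra.
Qed.

Definition JD F : R := \int[Vmu]_(w in @Dv R n b) F (vpt w).

Lemma Ic_Rint (x : R) F : Ic b x%:C F =
  (\int[Vmu]_(w in @Dv R n b) (expR (x * ln (kfun b (vpt w))) * F (vpt w)))%:C.
Proof.
rewrite -Ic_vintegral /vintegral; rewrite -cintegral_real; last exact: measurable_Dv.
by apply: eq_cintegral => w _ /=; rewrite cpow_real -rmorphM.
Qed.

Lemma Ic_nat (i : nat) F : Ic b (i%:R)%:C F = (JD (fun p => kfun b p ^+ i * F p))%:C.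
Proof.
rewrite Ic_Rint; congr (_ %:C); apply: eq_Rintegral => w /set_mem Dw; congr (_ * _).
have k0 := kfun_gt0 Dw.
by rewrite mulr_natl -lnXn// lnK// posrE exprn_gt0.
Qed.

Lemma cvg_natS_inv : (j.+1%:R^-1 : R) @[j --> \oo] --> (0 : R).
Proof. exact: cvg_harmonic. Qed.

Lemma JD_limit F M : contH F -> ybounded M F ->
  \int[Vmu]_(w in @Dv R n b) (expR (j.+1%:R^-1 * ln (kfun b (vpt w))) * F (vpt w)) @[j --> \oo] --> JD F.
Proof.
move=> cF yF; have mD := @measurable_Dv R n b hb.
have mF : measurable_fun (@Dv R n b) (F \o @vpt R n) := contH_measurable_Dv hb cF.
have mk := @measurable_kfun R n b hb.
have iG : Vmu.-integrable (@Dv R n b) (EFin \o (fun w => (1 + (M `^ (3 / 2)) ^+ 2) * `|F (vpt w)|)).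
  by apply: (integrableZR mD); exact: (integrable_norm (Dv_integrable hb cF yF)).
apply: (cvg_RintegralD mD _ mF _ iG).
- move=> j; apply: measurable_funM => //; apply: measurableT_comp; first exact: measurable_expR.
  by apply: measurable_funM; [exact: measurable_cst|apply: measurableT_comp mk; exact: measurable_ln].
- move=> w Dw; rewrite -[X in _ --> X]mul1r; apply: cvgM; last exact: cvg_cst.
  set L := ln _; have h : expR (j.+1%:R^-1 * L) @[j --> \oo] --> expR (0 * L).
    apply: (continuous_cvg _ (@continuous_expR R _)).
    by apply: cvgM; [exact: cvg_natS_inv|exact: cvg_cst].
  by move: h; rewrite mul0r expR0.
- move=> j w Dw; rewrite normrM ger0_norm ?expR_ge0//.
  have [yM|yM] := ltP (vpt w).2 (- M); first by rewrite yF// normr0 !mulr0.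
  rewrite ler_wpM2r//; have k0 := kfun_gt0 Dw.
  apply: (@le_trans _ _ (1 + kfun b (vpt w))); last by rewrite lerD2l; exact: kfun_bound.
  have [l0|l0] := leP 0 (ln (kfun b (vpt w))).
    rewrite ler_wpDl// -[leRHS]lnK// ler_expR ler_piMl// invf_le1// ler1n//.
  rewrite ler_wpDr ?(ltW k0)// -expR0 ler_expR mulr_ge0_le0 ?invr_ge0// ltW//.
Qed.

Lemma rgamma_nat i : rgamma (i.+1%:R : R) = i`!%:R.
Proof.
elim: i => [|i ih]; first by rewrite rgamma1.
by rewrite -[i.+2%:R]natr1 rgammaS// ih factS natrM.
Qed.

(** As [Xf_eq] covers Re z > 0, the value at 0 is obtained as the limit along 1/(j + 1): [Xf] is
    analytic at 0, and the integrals converge by domination. *)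
Lemma Xf0 l f : tame f -> Xf 0 l f = (JD (ev l f))%:C.
Proof.
move=> tf; have [sf [M yf]] := tf.
(* Gamma(z + 3) in place of Gamma(z + 1) keeps the argument inside the half-plane Re > 1 near z =
   0. *)
pose Y z : C := Xf z l f * Gamma (z + 3).
have h0 : - m.+1%:R < complex.Re (0 : C) by rewrite oppr_lt0.
have h3 : 1 < complex.Re (0 + 3 : C) by rewrite add0r -real_scalar_natr /= ltr1n.
have aY : analytic_at Y 0.
  apply: analyticM; first exact: (Xf_analytic hb l tf h0).
  exact: (@analytic_comp_add R (@Gamma R) 3 0 (Gamma_analytic h3)).
have := analytic_cvg_seq aY.
have -> : Y 0 = Xf 0 l f * 2 by rewrite /Y add0r -!real_scalar_natr Gamma_real rgamma3.
have YE j : Y (0 + (j.+1%:R^-1)%:C) = ((j.+1%:R^-1 + 1) * (j.+1%:R^-1 + 2) *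
    \int[Vmu]_(w in @Dv R n b) (expR (j.+1%:R^-1 * ln (kfun b (vpt w))) * ev l f (vpt w)))%:C.
  have x0 : 0 < j.+1%:R^-1 :> R by rewrite invr_gt0.
  move: (j.+1%:R^-1) x0 => x x0; rewrite add0r /Y (Xf_eq hn hb l (z := x%:C) x0 tf) Ic_Rint.
  rewrite -[x%:C + 1]/(x%:C + 1%:C) -(rmorphD (@real_complex_def _ (Phant R))) -real_scalar_natr.
  rewrite -(rmorphD (@real_complex_def _ (Phant R))) !Gamma_real -fmorphV -!rmorphM; congr (_ %:C).
  have x1 : 0 < x + 1 by lra.
  have x2 : 0 < x + 1 + 1 by lra.
  rewrite (_ : x + 3 = x + 1 + 1 + 1); last by ring.
  rewrite (rgammaS x2) (rgammaS x1).
  have g0 := rgamma_gt0 x1; move: (Rintegral _ _ _) => W.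
  by field; rewrite gt_eqF.
move=> /(cvgC_eq YE) hY.
have h2 : cvgC (fun j => ((j.+1%:R^-1 + 1) * (j.+1%:R^-1 + 2) *
    \int[Vmu]_(w in @Dv R n b) (expR (j.+1%:R^-1 * ln (kfun b (vpt w))) * ev l f (vpt w)))%:C) (2 * JD (ev l f))%:C.
  apply: cvgC_ReIm => /=; last exact: cvg_cst.
  rewrite (_ : 2 * JD (ev l f) = (0 + 1) * (0 + 2) * JD (ev l f)); last by ring.
  apply: cvgM; last exact: (JD_limit (@contH_ev R n l f sf) (ybounded_ev l yf)).
  by apply: cvgM; (apply: cvgD; [exact: cvg_natS_inv|exact: cvg_cst]).
have := cvgC_unique hY h2.
rewrite mulrC -real_scalar_natr [RHS]rmorphM => /(mulfI _); apply.
by rewrite real_scalar_natr pnatr_eq0.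
Qed.

Lemma JD_Xf i l f : tame f ->
  (JD (fun p => kfun b p ^+ i * ev l f p))%:C = i`!%:R%:C * Xf i%:R l f.
Proof.
move=> tf; case: i => [|i].
  rewrite Xf0// fact0 mul1r; congr (_ %:C); apply: eq_Rintegral => w _.
  by rewrite expr0 mul1r.
rewrite -Ic_nat -(real_scalar_natr R i.+1).
have i0 : 0 < complex.Re ((i.+1%:R : R)%:C) by rewrite /= ltr0n.
rewrite (Xf_eq hn hb l i0 tf) -[_ + 1]/(_ + 1%:C) -(rmorphD (@real_complex_def _ (Phant R))).
rewrite Gamma_real natr1 rgamma_nat mulrA divff ?mul1r//.
by rewrite real_scalar_natr pnatr_eq0 -lt0n fact_gt0.
Qed.

End boundary_value.

(** * The regular part *)

Section hypergeometric_series.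
Variable R : realType.
Implicit Types (f : R ^nat) (K q z : R).

Lemma linear_geo_le q n : 0 <= q < 1 -> \sum_(0 <= k < n) k.+1%:R * q ^+ k <= (1 - q) ^- 2.
Proof.
move=> /andP[q0 q1]; have d0 : 0 < 1 - q by rewrite subr_gt0.
have dn : 1 - q != 0 by rewrite gt_eqF.
suff -> : \sum_(0 <= k < n) k.+1%:R * q ^+ k =
    (1 - q) ^- 2 - (n.+1%:R / (1 - q) + q / (1 - q) ^+ 2) * q ^+ n.
  rewrite gerBl mulr_ge0 ?exprn_ge0// addr_ge0 ?divr_ge0 ?exprn_ge0 ?(ltW d0)//.
elim: n => [|n ih]; first by rewrite big_nil expr0; field.
by rewrite big_nat_recr//= ih [q ^+ n.+1]exprS -[n.+2%:R]natr1; field.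
Qed.

Definition unit_radius f := forall K, 0 <= K < 1 -> cvgn (pseries f K).

Lemma unit_radius_bound f (M : R) : (forall k, `|f k| <= M * k.+1%:R) -> unit_radius f.
Proof.
move=> fM K K01; apply: normed_cvg.
apply: nondecreasing_is_cvgn.
  apply/nondecreasing_seqP => n; rewrite /series /= [leRHS]big_nat_recr//= lerDl//.
have M0 : 0 <= M by have := fM 0%N; rewrite mulr1; exact: le_trans.
exists (M * (1 - K) ^- 2) => _ [n _ <-]; rewrite /series/=.
apply: le_trans (ler_wpM2l M0 (linear_geo_le n K01)); rewrite mulr_sumr; apply: ler_sum => k _.
rewrite normrM normrX (ger0_norm (_ : 0 <= K)); last by case/andP: K01.
by rewrite mulrA ler_wpM2r// exprn_ge0//; case/andP: K01.
Qed.

(** Comparison with some K' between K and 1: the terms at K' are bounded, so those of the derived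
    series at K are O((k + 1) (K / K')^k). *)
Lemma unit_radius_diffs f : unit_radius f -> unit_radius (pseries_diffs f).
Proof.
move=> uf K /andP[K0 K1]; pose K' := (1 + K) / 2.
have K'0 : 0 < K' by rewrite divr_gt0// ltr_pwDl.
have K'1 : K' < 1 by rewrite ltr_pdivrMr// mul1r; lra.
have KK' : K < K' by rewrite ltr_pdivlMr//; lra.
have cK' : cvgn (pseries f K') by apply: uf; rewrite (ltW K'0).
have [M [_ hM]] := cvg_seq_bounded (cvgP _ (cvg_series_cvg_0 cK')).
have fM k : `|f k * K' ^+ k| <= `|M| + 1 by apply: hM => //; rewrite (le_lt_trans (ler_norm _))// ltrDl.
pose q := K / K'.
have q01 : 0 <= q < 1 by rewrite divr_ge0 ?(ltW K'0)//= ltr_pdivrMr// mul1r.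
have K'n : K' != 0 by rewrite gt_eqF.
apply: normed_cvg; apply: nondecreasing_is_cvgn.
  apply/nondecreasing_seqP => n; rewrite /series /= [leRHS]big_nat_recr//= lerDl//.
have M0 : 0 <= (`|M| + 1) / K' by rewrite divr_ge0 ?addr_ge0 ?(ltW K'0).
exists ((`|M| + 1) / K' * (1 - q) ^- 2) => _ [n _ <-]; rewrite /series/=.
apply: le_trans (ler_wpM2l M0 (linear_geo_le n q01)); rewrite mulr_sumr; apply: ler_sum => k _.
have h := fM k.+1; rewrite normrM normrX (ger0_norm (ltW K'0)) in h.
rewrite /pseries_diffs normrM normrX (ger0_norm K0) normrM (ger0_norm (ler0n R _)).
have Kk : K' ^+ k != 0 by rewrite expf_neq0.
rewrite (_ : _ * (_ * q ^+ k) = k.+1%:R * ((`|M| + 1) / K' ^+ k.+1) * K ^+ k); last first.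
  by rewrite /q expr_div_n [K' ^+ k.+1]exprS; field; rewrite K'n Kk.
rewrite ler_wpM2r ?exprn_ge0// ler_wpM2l ?ler0n// ler_pdivlMr//.
by rewrite exprn_gt0.
Qed.

Definition psum f z : R := limn (pseries f z).

Lemma unit_radius_cvg f z : unit_radius f -> `|z| < 1 -> cvgn (pseries f z).
Proof.
move=> uf z1; pose K : R := (1 + `|z|) / 2.
have zK : `|z| < K by rewrite ltr_pdivlMr//; lra.
have K1 : K < 1 by rewrite ltr_pdivrMr//; lra.
have K0 : 0 <= K by rewrite (le_trans _ (ltW zK)).
have K01 : 0 <= K < 1 by rewrite K0.
by apply: (is_cvg_pseries_inside (uf K K01)); rewrite (ger0_norm K0).
Qed.

Lemma is_derive_psum f z : unit_radius f -> `|z| < 1 ->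
  is_derive z 1 (psum f) (psum (pseries_diffs f) z).
Proof.
move=> uf z1; pose K : R := (1 + `|z|) / 2.
have zK : `|z| < K by rewrite ltr_pdivlMr//; lra.
have K1 : K < 1 by rewrite ltr_pdivrMr//; lra.
have K0 : 0 <= K by rewrite (le_trans _ (ltW zK)).
have uf1 := unit_radius_diffs uf; have uf2 := unit_radius_diffs uf1.
have K01 : 0 <= K < 1 by rewrite K0.
by apply: (@pseries_snd_diffs R f K z (uf K K01) (uf1 K K01) (uf2 K K01)); rewrite (ger0_norm K0).
Qed.

Lemma psum0 f : psum f 0 = f 0%N.
Proof.
apply: cvg_lim => //; rewrite -(cvg_shiftn 1) /=.
apply: (@cvg_near_cst) => //; near=> n; rewrite /pseries /series /= addn1 big_nat_recl//= expr0 mulr1.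
by rewrite big1 ?addr0// => i _; rewrite expr0n mulr0.
Unshelve. all: by end_near. Qed.

Variables (al be ga : R) (al0 : 0 < al) (al1 : al <= 1) (be0 : 0 < be) (bega : be <= ga).

Definition hcoef k : R := pochhammer al k * pochhammer be k / (pochhammer ga k * k`!%:R).

Let ga0 : 0 < ga := lt_le_trans be0 bega.

Lemma pochhammer_gt0 (s : R) k : 0 < s -> 0 < pochhammer s k.
Proof. by move=> s0; apply: prodr_gt0 => i _; rewrite ltr_pwDl. Qed.

Lemma hcoef0 : hcoef 0 = 1.
Proof. by rewrite /hcoef /pochhammer !big_ord0 fact0 !mulr1 divr1. Qed.

Lemma hcoef_rec k : k.+1%:R * (ga + k%:R) * hcoef k.+1 = (al + k%:R) * (be + k%:R) * hcoef k.
Proof.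
rewrite /hcoef /pochhammer !big_ord_recr/= -!/(pochhammer _ _) factS natrM.
have g0 := lt0r_neq0 (pochhammer_gt0 k ga0).
have gk : ga + k%:R != 0 by rewrite gt_eqF// ltr_pwDl.
have f0 : k`!%:R != 0 :> R by rewrite pnatr_eq0 -lt0n fact_gt0.
have k0 : k.+1%:R != 0 :> R by rewrite pnatr_eq0.
move: f0 k0; move: (k`!%:R) (k.+1%:R) => W K f0 k0.
by field; do ?[apply/andP; split].
Qed.

(** al <= 1 and be <= ga make every quotient of consecutive coefficients at most 1. *)
Lemma hcoef_bound k : 0 <= hcoef k <= 1.
Proof.
elim: k => [|k /andP[h0 h1]]; first by rewrite hcoef0 ler01 lexx.
have E : 0 < k.+1%:R * (ga + k%:R) by rewrite mulr_gt0// ltr_pwDl.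
have -> : hcoef k.+1 = (al + k%:R) * (be + k%:R) * hcoef k / (k.+1%:R * (ga + k%:R)).
  by rewrite -hcoef_rec mulrAC divff ?mul1r// gt_eqF.
have a0 : 0 <= al + k%:R by rewrite addr_ge0// ltW.
have b0 : 0 <= be + k%:R by rewrite addr_ge0// ltW.
apply/andP; split; first by apply: divr_ge0 (ltW E); rewrite mulr_ge0// mulr_ge0.
rewrite (ler_pdivrMr _ _ E) mul1r.
rewrite (le_trans (ler_wpM2l _ h1)) ?mulr_ge0// mulr1 ler_pM//; last by rewrite lerD2r.
by rewrite -natr1 addrC lerD2l.
Qed.

Lemma hcoef_radius : unit_radius hcoef.
Proof.
apply: (@unit_radius_bound _ 1) => k; have /andP[h0 h1] := hcoef_bound k.
by rewrite ger0_norm// mul1r (le_trans h1)// ler1n.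
Qed.

Lemma hypergeometricE z : hypergeometric al be ga z = psum hcoef z.
Proof. by []. Qed.

Let d1 := pseries_diffs hcoef.
Let d2 := pseries_diffs d1.

(** By the two-term recursion of the coefficients all powers of z below n cancel, and only a defect
    at the end of the partial sums remains. *)
Lemma hcoef_ode_partial z n :
  z * (1 - z) * (\sum_(0 <= k < n) d2 k * z ^+ k) +
  (ga - (al + be + 1) * z) * (\sum_(0 <= k < n) d1 k * z ^+ k) -
  al * be * (\sum_(0 <= k < n) hcoef k * z ^+ k) =
  (n%:R * n.+1%:R * hcoef n.+1 - (n%:R * (n%:R - 1) + (al + be + 1) * n%:R) * hcoef n) * z ^+ n -
  n%:R * n.+1%:R * hcoef n.+1 * z ^+ n.+1.
Proof.
elim: n => [|n ih]; first by rewrite !big_nil !mul0r !mulr0 !addr0 !mul0r subrr; ring.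
rewrite !big_nat_recr//=.
set S2 := \sum_(0 <= k < n) d2 k * _ in ih *; set S1 := \sum_(0 <= k < n) d1 k * _ in ih *.
set S0 := \sum_(0 <= k < n) hcoef k * _ in ih *.
transitivity (z * (1 - z) * S2 + (ga - (al + be + 1) * z) * S1 - al * be * S0 +
  (z * (1 - z) * (d2 n * z ^+ n) + (ga - (al + be + 1) * z) * (d1 n * z ^+ n) - al * be * (hcoef n * z ^+ n))).
  by move: (d2 n * z ^+ n) (d1 n * z ^+ n) (hcoef n * z ^+ n) => *; ring.
rewrite ih /d2 /d1 /pseries_diffs.
have r0 := hcoef_rec n; have r1 := hcoef_rec n.+1.
rewrite !exprS; move: (z ^+ n) r0 r1 => Z; move: (hcoef n.+2) (hcoef n.+1) (hcoef n) => h2 h1 h0.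
rewrite -![n.+2%:R]natr1 -![n.+1%:R]natr1; move: (n%:R) => N r0 r1.
apply/eqP; rewrite -subr_eq0; apply/eqP.
transitivity (((N + 1) * (ga + N) * h1 - (al + N) * (be + N) * h0) * Z); first by ring.
by rewrite r0 subrr mul0r.
Qed.

(** The defect of the partial sums is made of general terms of the first two derived series, which
    converge inside the unit disc, so it tends to 0. *)
Lemma hypergeometric_ode z : `|z| < 1 ->
  z * (1 - z) * psum d2 z + (ga - (al + be + 1) * z) * psum d1 z - al * be * psum hcoef z = 0.
Proof.
move=> z1; have u0 := hcoef_radius; have u1 := unit_radius_diffs u0; have u2 := unit_radius_diffs u1.
have c0 := unit_radius_cvg u0 z1; have c1 := unit_radius_cvg u1 z1; have c2 := unit_radius_cvg u2 z1.
pose L n := z * (1 - z) * pseries d2 z n + (ga - (al + be + 1) * z) * pseries d1 z n - al * be * pseries hcoef z n.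
have hL : L n @[n --> \oo] --> z * (1 - z) * psum d2 z + (ga - (al + be + 1) * z) * psum d1 z - al * be * psum hcoef z.
  apply: cvgB; last by apply: cvgM; [exact: cvg_cst|exact: c0].
  by apply: cvgD; (apply: cvgM; [exact: cvg_cst|assumption]).
have t1 := cvg_series_cvg_0 c1; have t2 := cvg_series_cvg_0 c2.
have t1' : d1 n.+1 * z ^+ n.+1 @[n --> \oo] --> (0 : R).
  by have := t1; rewrite -(cvg_shiftS (fun n => d1 n * z ^+ n)).
have t2' : d2 n.+1 * z ^+ n.+1 @[n --> \oo] --> (0 : R).
  by have := t2; rewrite -(cvg_shiftS (fun n => d2 n * z ^+ n)).
(* At index n + 2 the factors n in the defect are exactly those of [d1] and [d2], so no further
   growth estimate is needed. *)
have h0 : L n.+2 @[n --> \oo] --> (0 : R).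
  pose e n := z * (d2 n.+1 * z ^+ n.+1) - z ^+ 2 * (d2 n * z ^+ n) -
     (al + be + 1) * z * (d1 n.+1 * z ^+ n.+1) - z ^+ 2 * (d2 n.+1 * z ^+ n.+1).
  have -> : (fun n => L n.+2) = e.
    apply/funext => n; rewrite /L /pseries /series /= hcoef_ode_partial /e /d2 /d1 /pseries_diffs.
    rewrite !exprS; move: (z ^+ n) (hcoef n.+3) (hcoef n.+2) => Z h3 h2.
    by rewrite -![n.+3%:R]natr1 -![n.+2%:R]natr1 -![n.+1%:R]natr1; ring.
  have zz (u : R ^nat) (c : R) : u n @[n --> \oo] --> (0 : R) -> c * u n @[n --> \oo] --> (0 : R).
    by move=> hu; rewrite -[X in _ --> X](mulr0 c); apply: cvgM => //; exact: cvg_cst.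
  rewrite -[X in _ --> X](subr0 (0 : R)); apply: cvgB; last exact: zz.
  rewrite -[X in _ --> X](subr0 (0 : R)); apply: cvgB; last exact: zz.
  by rewrite -[X in _ --> X](subr0 (0 : R)); apply: cvgB; exact: zz.
have h1 : L n.+2 @[n --> \oo] --> z * (1 - z) * psum d2 z + (ga - (al + be + 1) * z) * psum d1 z - al * be * psum hcoef z.
  by rewrite (cvg_shiftS (fun n => L n.+1)) (cvg_shiftS L).
exact: (cvg_unique _ h1 h0).
Qed.

End hypergeometric_series.

(** * The regular part as a function of zeta *)

Section regular_part.
Variables (R : realType) (m : nat).
Local Notation A := (1 / 6 : R).
Local Notation B := (m%:R + 1 / 6 : R).
Local Notation Cc := (m%:R + 1 : R).
Local Notation hc := (hcoef A B Cc).

Let A0 : 0 < A. Proof. by rewrite divr_gt0. Qed.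
Let A1 : A <= 1. Proof. by rewrite ler_pdivrMr// mul1r ler1n. Qed.
Let B0 : 0 < B. Proof. by rewrite ltr_wpDl// divr_gt0. Qed.
Let BC : B <= Cc. Proof. by rewrite lerD2l. Qed.

Let f0 := psum hc.
Let f1 := psum (pseries_diffs hc).
Let f2 := psum (pseries_diffs (pseries_diffs hc)).

Let u0 : unit_radius hc := hcoef_radius A0 A1 B0 BC.
Let u1 := unit_radius_diffs u0.
Let u2 := unit_radius_diffs u1.

(* The substitution z = ze / (1 + ze) makes F (A, B; Cc; z) regular up to the cone boundary. *)
Definition Hz (ze : R) : R := ze / (1 + ze).
Definition Hw (r ze : R) : R := (1 + ze) `^ r.

(** By Pfaff's transformation this is F(m + 5/6, m + 1/6; m + 1; - ze) for ze near 0; [H1] and [H2]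
    are its first two derivatives. *)
Definition H0 ze := Hw (- B) ze * f0 (Hz ze).
Definition H1 ze := - B * Hw (- B - 1) ze * f0 (Hz ze) + Hw (- B - 2) ze * f1 (Hz ze).
Definition H2 ze := B * (B + 1) * Hw (- B - 2) ze * f0 (Hz ze) -
  (2 * B + 2) * Hw (- B - 3) ze * f1 (Hz ze) + Hw (- B - 4) ze * f2 (Hz ze).

(** The range extends below 0, so that derivatives at the cone ze = 0 are two-sided. *)
Lemma Hz_lt1 (ze : R) : - (1 / 2) < ze -> `|Hz ze| < 1.
Proof.
move=> h; have w0 : 0 < 1 + ze by lra.
by rewrite /Hz ltr_norml ltr_pdivlMr// ltr_pdivrMr// mulN1r mul1r; apply/andP; split; lra.
Qed.

Let is_derive_1D (ze : R) : is_derive ze 1 (fun x : R => 1 + x) 1.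
Proof.
by apply: (is_derive_eq (is_deriveD (is_derive_cst (1 : R) ze (1 : R)) (is_derive_id ze (1 : R)))); rewrite add0r.
Qed.

Let dz (ze : R) : - (1 / 2) < ze -> is_derive ze 1 Hz ((1 + ze) ^- 2).
Proof.
move=> h; have w0 : 1 + ze != 0 by rewrite gt_eqF//; lra.
have d1 := is_derive_1D ze.
have d2 := is_deriveV w0 d1.
by apply: is_derive_eq; rewrite /GRing.scale /=; field.
Qed.

Let dw r (ze : R) : - (1 / 2) < ze -> is_derive ze 1 (Hw r) (r * Hw (r - 1) ze).
Proof.
move=> h; have w0 : 0 < 1 + ze by lra.
have d1 := is_derive_1D ze.
have := @is_derive1_comp R (fun s : R => s `^ r) (fun x : R => 1 + x) ze _ _ (is_derive1_powR r w0) d1.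
by rewrite mulr1.
Qed.

Let df (c : nat -> R) (ze : R) : unit_radius c -> - (1 / 2) < ze ->
  is_derive ze 1 (fun x => psum c (Hz x)) (psum (pseries_diffs c) (Hz ze) * (1 + ze) ^- 2).
Proof. by move=> uc h; exact: (is_derive1_comp (is_derive_psum uc (Hz_lt1 h)) (dz h)). Qed.

Let HwB (ze : R) (k : nat) : - (1 / 2) < ze -> Hw (- B - k%:R) ze = Hw (- B) ze / (1 + ze) ^+ k.
Proof.
move=> h; have w0 : 0 < 1 + ze by lra.
by rewrite /Hw powRDp// [_ `^ (- k%:R)]powRN powR_mulrn// ltW.
Qed.

Lemma is_derive_H0 (ze : R) : - (1 / 2) < ze -> is_derive ze 1 H0 (H1 ze).
Proof.
move=> h; have w0 : 1 + ze != 0 by rewrite gt_eqF//; lra.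
apply: (is_derive_eq (is_deriveM (dw (- B) h) (df u0 h))); rewrite /GRing.scale /= /H1.
have := HwB 1 h; have := HwB 2 h; rewrite -/f0 -/f1 => -> ->.
move: (Hw (- B) ze) (f0 _) (f1 _) => W F0 F1; by field.
Qed.

Lemma is_derive_H1 (ze : R) : - (1 / 2) < ze -> is_derive ze 1 H1 (H2 ze).
Proof.
move=> h; have w0 : 1 + ze != 0 by rewrite gt_eqF//; lra.
have d1 := is_deriveZ (- B) (is_deriveM (dw (- B - 1) h) (df u0 h)).
have d2 := is_deriveM (dw (- B - 2) h) (df u1 h).
have E : H1 = (fun x => - B *: (Hw (- B - 1) x * psum hc (Hz x)) +
    Hw (- B - 2) x * psum (pseries_diffs hc) (Hz x)).
  by apply/funext => x; rewrite /H1 -mulrA.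
rewrite E; apply: (is_derive_eq (is_deriveD d1 d2)); rewrite /GRing.scale /= /H2.
rewrite (_ : - B - 1 - 1 = - B - 2); last by ring.
rewrite (_ : - B - 2 - 1 = - B - 3); last by ring.
rewrite -/f0 -/f1 -/f2.
have := HwB 1 h; have := HwB 2 h; have := HwB 3 h; have := HwB 4 h => -> -> -> ->.
move: (Hw (- B) ze) (f0 _) (f1 _) (f2 _) => W F0 F1 F2; by field.
Qed.

Lemma continuous_H2 (ze : R) : - (1 / 2) < ze -> {for ze, continuous H2}.
Proof.
move=> h.
have cW r : {for ze, continuous (Hw r)} by exact: is_derive_cont (dw r h).
have c0 := is_derive_cont (df u0 h); have c1 := is_derive_cont (df u1 h); have c2 := is_derive_cont (df u2 h).
apply: cvgD; last by apply: cvgM; [exact: cW|exact: c2].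
apply: cvgB.
  by apply: cvgM; [apply: cvgM; [exact: cvg_cst|exact: cW]|exact: c0].
by apply: cvgM; [apply: cvgM; [exact: cvg_cst|exact: cW]|exact: c1].
Qed.

(** Gauss's equation pulled back by z = ze / (1 + ze) and conjugated with the prefactor: the result
    is hypergeometric in - ze with parameters m + 1/6, m + 5/6 and m + 1. *)
Lemma H_ode (ze : R) : - (1 / 2) < ze ->
  ze * (1 + ze) * H2 ze + (m%:R + 1) * (1 + 2 * ze) * H1 ze + B * (m%:R + 5 / 6) * H0 ze = 0.
Proof.
move=> h; have w0 : 1 + ze != 0 by rewrite gt_eqF//; lra.
have := hypergeometric_ode A0 A1 B0 BC (Hz_lt1 h); rewrite -/f0 -/f1 -/f2.
rewrite /H2 /H1 /H0; have := HwB 1 h; have := HwB 2 h; have := HwB 3 h; have := HwB 4 h => -> -> -> ->.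
rewrite {1 2 3}/Hz; move: (Hw (- B) ze) (f0 _) (f1 _) (f2 _) => W F0 F1 F2 E.
transitivity (W / (1 + ze) * (ze / (1 + ze) * (1 - ze / (1 + ze)) * F2 +
   (Cc - (A + B + 1) * (ze / (1 + ze))) * F1 - A * B * F0)); last by rewrite E mulr0.
by field.
Qed.

(** [ha1] and [ha2] are the Taylor coefficients of [H0] at 0 of degrees 1 and 2, in accordance with
    its form F(m + 5/6, m + 1/6; m + 1; - ze). *)
Definition ha1 : R := - (B * (m%:R + 5 / 6) / Cc).
Definition ha2 : R := B * (B + 1) * (m%:R + 5 / 6) * (m%:R + 11 / 6) / (2 * Cc * (Cc + 1)).

Lemma H_at0 : [/\ H0 0 = 1, H1 0 = ha1 & H2 0 = 2 * ha2].
Proof.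
have m0 : (0 : R) <= m%:R by [].
have Cn : Cc != 0 by rewrite gt_eqF// ltr_wpDl.
have Cn1 : Cc + 1 != 0 by rewrite gt_eqF// addr_gt0// ltr_wpDl.
have z0 : Hz 0 = 0 by rewrite /Hz mul0r.
have W r : Hw r 0 = 1 by rewrite /Hw addr0 powR1.
have e0 : f0 0 = 1 by rewrite /f0 psum0 hcoef0.
have r0 := hcoef_rec A B0 BC 0; have r1 := hcoef_rec A B0 BC 1.
have h1 : hc 1 = A * B / Cc.
  move: r0; rewrite hcoef0 !addr0 mulr1; move: (hc 1) => X E.
  apply: (mulfI Cn); transitivity (1%:R * Cc * X); first by ring.
  by rewrite E; field; do ?[apply/andP; split]; rewrite gt_eqF//; lra.
have e1 : f1 0 = A * B / Cc by rewrite /f1 psum0 /pseries_diffs h1; ring.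
have e2 : f2 0 = A * (A + 1) * B * (B + 1) / (Cc * (Cc + 1)).
  rewrite /f2 psum0 /pseries_diffs.
  move: r1; rewrite h1; move: (hc 2) => X E.
  apply: (mulfI Cn1); transitivity (2%:R * (Cc + 1%:R) * X); first by ring.
  by rewrite E; field; do ?[apply/andP; split]; rewrite gt_eqF//; lra.
rewrite /H0 /H1 /H2 z0 !W e0 e1 e2 /ha1 /ha2; split.
- by rewrite mulr1.
- by field; do ?[apply/andP; split]; rewrite gt_eqF//; lra.
- by field; do ?[apply/andP; split]; rewrite gt_eqF//; lra.
Qed.

Definition T2 (ze : R) : R := 1 + ha1 * ze + ha2 * ze ^+ 2.

(* Th0 is the regular part minus its Taylor polynomial at the cone, extended by 0 outside. *)
Definition Th0 ze : R := if 0 < ze then H0 ze - T2 ze else 0.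
Definition Th1 ze : R := if 0 < ze then H1 ze - (ha1 + 2 * ha2 * ze) else 0.
Definition Th2 ze : R := if 0 < ze then H2 ze - 2 * ha2 else 0.

(** At 0 the difference quotient is either 0 or that of f, which tends to g(0) = 0. *)
Lemma is_derive_half (f g : R -> R) (z : R) :
  (forall z : R, - (1 / 2) < z -> is_derive z 1 f (g z)) -> f 0 = 0 -> g 0 = 0 ->
  is_derive z 1 (fun z : R => if 0 < z then f z else 0) (if 0 < z then g z else 0).
Proof.
move=> dF F0 dF0; have [z0|z0|z0] := ltgtP 0 z.
- apply: (@near_eq_is_derive _ _ _ f); last by apply: dF; rewrite (lt_trans _ z0)// oppr_lt0 divr_gt0.
  by near=> y; rewrite ifT//; near: y; exact: lt_nbhsr.
- apply: (@near_eq_is_derive _ _ _ (fun _ : R => (0 : R))).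
  by near=> y; rewrite ltNge ltW//; near: y; exact: lt_nbhsl.
- rewrite -z0; have [df0 df0E] := dF 0 ltac:(by rewrite oppr_lt0 divr_gt0).
  have h0 : h^-1 *: (f (h *: 1 + 0) - f 0) @[h --> (0 : R)^'] --> (0 : R).
    by rewrite -[X in _ --> X]dF0 -df0E; exact: df0.
  pose F (x : R) : R := if 0 < x then f x else 0.
  have h1 : h^-1 *: (F (h *: 1 + 0) - F 0) @[h --> (0 : R)^'] --> (0 : R).
    move/cvgrPdist_lt: h0 => h0; apply/cvgrPdist_lt => e e0; have := h0 e e0.
    apply: filterS => h; rewrite /F F0 ltxx !sub0r !normrN !subr0.
    by case: ifP => // _; rewrite scaler0 normr0.
  by split; [apply/cvg_ex; exists 0; exact: h1|exact: cvg_lim h1].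
Unshelve. all: by end_near. Qed.

Lemma is_derive_Th0 (z : R) : is_derive z 1 Th0 (Th1 z).
Proof.
have [a0 a1 a2] := H_at0.
apply: (@is_derive_half (fun z => H0 z - T2 z) (fun z => H1 z - (ha1 + 2 * ha2 * z))).
- move=> x hx; have d := is_derive_H0 hx; have d2 := is_derive_exprn 2 x; rewrite /T2.
  by apply: is_derive_eq; rewrite /GRing.scale /=; ring.
- by rewrite a0 /T2; ring.
- by rewrite a1; ring.
Qed.

Lemma is_derive_Th1 (z : R) : is_derive z 1 Th1 (Th2 z).
Proof.
have [a0 a1 a2] := H_at0.
apply: (@is_derive_half (fun z => H1 z - (ha1 + 2 * ha2 * z)) (fun z => H2 z - 2 * ha2)).
- move=> x hx; have d := is_derive_H1 hx.
  by apply: is_derive_eq; rewrite /GRing.scale /=; ring.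
- by rewrite a1; ring.
- by rewrite a2; ring.
Qed.

(** The function vanishes at 0, so it is a continuous function of the positive part (z + |z|) /
    2. *)
Lemma continuous_Th2 : continuous Th2.
Proof.
have [_ _ a2] := H_at0.
have c x : - (1 / 2) < x -> {for x, continuous (fun z : R => H2 z - 2 * ha2)}.
  by move=> hx; apply: cvgB; [exact: continuous_H2|exact: cvg_cst].
have E : Th2 = (fun z => H2 z - 2 * ha2) \o (fun z : R => (z + `|z|) / 2).
  apply/funext => z /=; rewrite /Th2; have [z0|z0] := ltP 0 z.
    by rewrite gtr0_norm// (_ : (z + z) / 2 = z)//; field.
  by rewrite ler0_norm// subrr mul0r a2 subrr.
rewrite E => z; apply: continuous_comp.
  apply: cvgM; last exact: cvg_cst.
  by apply: cvgD; [exact: cvg_id|exact: norm_continuous].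
by apply: c; have := ler_norm (- z); rewrite normrN => h; lra.
Qed.

(** [T2] satisfies the equation of [H_ode] in degrees 0 and 1, by the recursion of the Taylor
    coefficients; subtracting it leaves its term of degree 2. *)
Lemma Th_ode (ze : R) : 0 < ze ->
  ze * (1 + ze) * Th2 ze + (m%:R + 1) * (1 + 2 * ze) * Th1 ze + B * (m%:R + 5 / 6) * Th0 ze =
  - ((B + 2) * (m%:R + 17 / 6) * ha2 * ze ^+ 2).
Proof.
move=> z0; have := @H_ode ze ltac:(by rewrite (lt_trans _ z0)// oppr_lt0 divr_gt0).
rewrite /Th0 /Th1 /Th2 z0 => E.
have m0 : (0 : R) <= m%:R by [].
have Cn : Cc != 0 by rewrite gt_eqF// ltr_wpDl.
have Cn1 : Cc + 1 != 0 by rewrite gt_eqF// addr_gt0// ltr_wpDl.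
rewrite -[RHS]addr0 -E /T2 /ha1 /ha2; move: (H0 ze) (H1 ze) (H2 ze) => X Y Z.
by field; do ?[apply/andP; split]; rewrite gt_eqF//; lra.
Qed.

End regular_part.

(** * Telescoping *)

Section assembly.
Variables (R : realType) (m n : nat) (hn : n = (2 * m + 1)%N) (b : R) (hb : b < 0).
Local Notation V := ('rV[R]_n * R)%type.
Local Notation C := R[i].
Local Notation T := (measurableTypeR R).
Local Notation Xf := (Xf m b).
Local Notation JD := (@JD R n b).
Local Notation kap := (kap b).
Local Notation zeta := (@zeta R n b).
Local Notation Vmu := (tuple_measure (@lebesgue_measure R) n \x @lebesgue_measure R)%E.
Local Notation B := (m%:R + 1 / 6 : R).
Local Open Scope complex_scope.

(** This is 3/2 times the exponent - j - 1/6 of (u - v) / 9, which is proportional to s^(3/2);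
    moreover p (p - 1) = (9/4) (j + 1/6) (j + 5/6) for p = [pw j]. *)
Definition pw (j : nat) : R := - (1 / 4) - 3 / 2 * j%:R.

(** Solution of (9/4) (j + 1) kap d_(j+1) = - p_j (p_j - 1) d_j with d_0 = 1, the condition under
    which [telescope] cancels; [dcoef_cr] identifies it with (- 1)^j c_j / kap^j. *)
Definition dcoef (j : nat) : R :=
  \prod_(i < j) - ((i%:R + 1 / 6) * (i%:R + 5 / 6) / ((i%:R + 1) * kap)).

Definition one_t : seq (term R n) := [:: (1, 0, [::])].

Let kap0 : 0 < kap := kap_gt0 hb.

Let kapN0 : kap != 0. Proof. by rewrite gt_eqF. Qed.

Let Dneg (p : V) : Dminus b p -> p.2 < 0.
Proof. by case=> h _; exact: lt_trans hb. Qed.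

Let Dzeta (p : V) : Dminus b p -> 0 < zeta p.
Proof. by move=> Dp; apply/(DminusE hb) => //; case: Dp. Qed.

Lemma dcoefS j : dcoef j.+1 =
  dcoef j * - ((j%:R + 1 / 6) * (j%:R + 5 / 6) / ((j%:R + 1) * kap)).
Proof. by rewrite /dcoef big_ord_recr. Qed.

Let nat1_neq0 (j : nat) : (j%:R + 1 : R) != 0.
Proof. by rewrite natr1 pnatr_eq0. Qed.

Lemma Xf_nil z (f : V -> R) : tame f -> - m.+1%:R < complex.Re z -> Xf z [::] f = 0.
Proof.
move=> tf hz; have := @Xf_linear R m n hn b hb 1 [::] [::] [::] f f f z tf tf tf _ hz.
rewrite rmorph1 mul1r => E.
apply: (addrI (Xf z [::] f)); rewrite addr0; symmetry; apply: E => p _.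
by rewrite ev_nil mulr0 addr0.
Qed.

Lemma Xf_scal c z l (f : V -> R) : tame f -> - m.+1%:R < complex.Re z ->
  Xf z (scalt c l) f = c%:C * Xf z l f.
Proof.
move=> tf hz; rewrite (@Xf_linear R m n hn b hb c _ l [::] f f f z tf tf tf _ hz) ?Xf_nil ?addr0//.
by move=> p _; rewrite ev_scal ev_nil addr0.
Qed.

Let Rez (j : nat) : - m.+1%:R < complex.Re (- m%:R + j%:R : C).
Proof.
rewrite ReD ReNn; apply: (@lt_le_trans _ _ (- m%:R)); first by rewrite ltrN2 ltr_nat.
by rewrite lerDl.
Qed.

Definition ellv (f : V -> R) : R := 2 * pi ^+ m * (- b) `^ (1 / 4) * f (0, b).

(** The weight [pw 0] = - 1/4 is the outer one of [Sl]: up to the term with 5/16, (- y)^(- 1/4) T f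
    is [Sl] applied with the weight 3/4, which contributes the tip value. *)
Lemma step0 f : tame f -> Xf (- m%:R) (mulp (pw 0) (Tt one_t)) f =
  (5 / 16)%:C * Xf (- m%:R) (mulp (pw 0 - 2) one_t) f + (ellv f)%:C.
Proof.
move=> tf; rewrite /ellv (_ : 1 / 4 = 3 / 4 - 1 / 2 :> R); last by field.
rewrite -(ell_value hn hb (3 / 4) tf); apply: (Xf_linear hn hb tf tf tf) => [p Dp|]; last first.
  by have := Rez 0; rewrite mulr0n addr0.
have e1 : mulp (- (3 / 4)) [:: (1, 3 / 4, [::])] = one_t by rewrite /mulp /= subrr.
have e2 : mulp (- 3) [:: (1, 3 / 4, [::])] = mulp (pw 0 - 2) one_t.
  rewrite /mulp /=; congr [:: (_, _, _)]; rewrite /pw mulr0n; by field.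
have e3 : pw 0 = - (1 / 4) by rewrite /pw mulr0n mulr0 subr0.
by rewrite /Sl e1 e2 ev_cat ev_scal e3; ring.
Qed.

(** At z = j + 1 - m and r = [pw j.+1] the coefficient 4 z + 8 r / 3 + 4 m + 2/3 of [Xf_green]
    vanishes, so a single term of order z - 1 is left. *)
Lemma stepS j f : tame f -> Xf (- m%:R + j.+1%:R) (mulp (pw j.+1) (Tt one_t)) f =
  (pw j.+1 * (pw j.+1 - 1))%:C * Xf (- m%:R + j.+1%:R) (mulp (pw j.+1 - 2) one_t) f +
  (9 / 4 * (j%:R + 1) * kap)%:C * Xf (- m%:R + j%:R) (mulp (pw j - 2) one_t) f.
Proof.
move=> tf; rewrite (Xf_green hn hb _ _ tf); last by rewrite ReD ReNn ltrDl ltr0n.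
rewrite (Xf_scal _ _ tf (Rez j.+1)); congr (_ + _).
have -> : - m%:R + j.+1%:R - 1 = - m%:R + j%:R :> C by rewrite -natr1; ring.
have ej : j.+1%:R = j%:R + 1 :> R by rewrite natr1.
have -> : pw j.+1 - 1 / 2 = pw j - 2 by rewrite /pw ej; field.
have -> : 8 / 3 * pw j.+1 + 4 * m%:R + 2 / 3 = 4 * (m%:R - j.+1%:R) :> R by rewrite /pw; field.
have -> : 4 * (- m%:R + j.+1%:R) + (4 * (m%:R - j.+1%:R) : R)%:C = 0 :> C.
  by rewrite rmorphM rmorphB !rmorph_nat; ring.
rewrite mul0r addr0; congr (_%:C * _); rewrite /pw ej; by field.
Qed.

Lemma telescope N f : tame f ->
  \sum_(j < N.+1) (dcoef j)%:C * Xf (- m%:R + (j : nat)%:R) (mulp (pw j) (Tt one_t)) f =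
  (ellv f)%:C + (dcoef N * (pw N * (pw N - 1)))%:C * Xf (- m%:R + N%:R) (mulp (pw N - 2) one_t) f.
Proof.
move=> tf; elim: N => [|N ih].
  rewrite big_ord1 /= mulr0n addr0 step0// {1 2}/dcoef big_ord0 rmorph1 !mul1r addrC.
  by congr (_ + _%:C * _); rewrite /pw mulr0n; field.
rewrite big_ord_recr /= ih stepS// dcoefS; set q := _ / _; set Y := Xf _ _ _; set Y' := Xf _ _ _.
move: (pw N.+1 * (pw N.+1 - 1)) => P'; set r := 9 / 4 * _ * kap.
have e : dcoef N * - q * r = - (dcoef N * (pw N * (pw N - 1))).
  by rewrite /r /q /pw; field; rewrite kapN0 nat1_neq0.
have -> : (dcoef N * (pw N * (pw N - 1)))%:C = - ((dcoef N * - q)%:C * r%:C).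
  by rewrite -rmorphM /= e rmorphN opprK.
have -> : (dcoef N * - q * P')%:C = (dcoef N * - q)%:C * P'%:C by rewrite rmorphM.
move: (dcoef N * - q)%:C r%:C P'%:C (ellv f)%:C => d r' p' e'.
by move: Y Y' => y y'; ring.
Qed.

Lemma eq_JD F G : (forall p, Dminus b p -> F p = G p) -> JD F = JD G.
Proof. by move=> h; apply: eq_Rintegral => w /set_mem Dw; exact: h. Qed.

Let mD := @measurable_Dv R n b hb.

Lemma JD_linear c F G M N : contH F -> ybounded M F -> contH G -> ybounded N G ->
  JD (fun p => c * F p + G p) = c * JD F + JD G.
Proof.
move=> cF yF cG yG; rewrite /JD (RintegralD mD) ?(RintegralZl _ mD)//.
- exact: (Dv_integrable hb cF yF).
- apply: (@Dv_integrable R n b hb (fun p => c * F p) M).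
    by apply: contHM => //; exact: contH_cst.
  by move=> p pM; rewrite yF// mulr0.
- exact: (Dv_integrable hb cG yG).
Qed.

Lemma JD0 : JD (fun _ => 0) = 0.
Proof.
have c0 : contH ((fun _ => 0) : V -> R) by exact: contH_cst.
have := @JD_linear 1 (fun _ => 0) (fun _ => 0) 0 0 c0 (fun _ _ => erefl) c0 (fun _ _ => erefl).
under [X in JD X = _]eq_fun do rewrite mulr0 addr0.
by rewrite mul1r => E; apply: (addrI (JD (fun=> 0))); rewrite addr0 -E.
Qed.

Lemma JD_scale c F M : contH F -> ybounded M F -> JD (fun p => c * F p) = c * JD F.
Proof.
move=> cF yF; rewrite -[RHS]addr0 -JD0 -(@JD_linear c F (fun=> 0) M 0)//; last exact: contH_cst.
by apply: eq_JD => p _; rewrite addr0.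
Qed.

Lemma JD_bint F : JD F = bint b (fun p => kpow b 0%:R p * F p).
Proof.
have := Ic_nat hb 0 F; rewrite (Ic_real hb 0%:R F) => -[->].
by apply: eq_JD => p _; rewrite expr0 mul1r.
Qed.

Let Th00 z : z <= 0 -> Th0 m z = 0 :> R. Proof. by move=> h; rewrite /Th0 ltNge h. Qed.
Let Th10 z : z <= 0 -> Th1 m z = 0 :> R. Proof. by move=> h; rewrite /Th1 ltNge h. Qed.
Let Th20 z : z <= 0 -> Th2 m z = 0 :> R. Proof. by move=> h; rewrite /Th2 ltNge h. Qed.

Let kpow_pos p : 0 < zeta p -> kpow b 0%:R p = 1.
Proof. by move=> z0; rewrite /kpow z0 mulr0n mul0r expR0. Qed.

Let kpow_neg p : zeta p <= 0 -> kpow b 0%:R p = 0.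
Proof. by move=> z0; rewrite /kpow ltNge z0. Qed.

Definition creg : R := - (9 / 4 * (B + 2) * (m%:R + 17 / 6) * ha2 R m).

(** For q = [pw m] the operator in [TUq] is 9/4 times that of [Th_ode], so only the quadratic term
    survives, with coefficient [creg]. *)
Lemma green_remainder f : tame f ->
  JD (fun p => Uq b (pw m) (Th0 m) p * ev (Tt one_t) f p) =
  JD (fun p => creg * ((- p.2) `^ (pw m - 2) * zeta p ^+ 2 * ev one_t f p)).
Proof.
move=> [sf [M yf]]; rewrite !JD_bint.
transitivity (bint b (fun p => Uq b (pw m) (Th0 m) p * ev (Tt one_t) f p)).
  apply: eq_bint => p _; have [z0|z0] := ltP 0 (zeta p); first by rewrite kpow_pos// mul1r.
  by rewrite kpow_neg// mul0r /Uq Th00// mulr0 mul0r.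
rewrite (green hb (pw m) (is_derive_Th0 m) (is_derive_Th1 m) (@continuous_Th2 R m) Th00 Th10 Th20 one_t sf yf).
apply: eq_bint => p pb; have [z0|z0] := ltP 0 (zeta p); last first.
  by rewrite kpow_neg// mul0r /TUq Th00// Th10// Th20// !mulr0 !addr0 mulr0 mul0r.
rewrite kpow_pos// mul1r; have ode := Th_ode m z0.
have nn : n%:R = 2 * m%:R + 1 :> R by rewrite hn natrD natrM.
rewrite /TUq nn; set X := (X in _ * X * _ = _).
have -> : X = 9 / 4 * (zeta p * (1 + zeta p) * Th2 m (zeta p) +
    (m%:R + 1) * (1 + 2 * zeta p) * Th1 m (zeta p) + B * (m%:R + 5 / 6) * Th0 m (zeta p)).
  by rewrite /X /gam /pw; field.
rewrite ode /creg; ring.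
Qed.

(** Equal to [H0] inside the cone and continued outside by the polynomial [T2], which makes it
    continuous on all of R. *)
Definition Hc (ze : R) : R := Th0 m ze + T2 m ze.

Lemma HcE ze : 0 < ze -> Hc ze = H0 m ze.
Proof. by move=> z0; rewrite /Hc /Th0 z0 subrK. Qed.

Lemma continuous_Hc : continuous Hc.
Proof.
move=> z; apply: cvgD; first exact: is_derive_cont (is_derive_Th0 m z).
apply: cvgD; last by apply: cvgM; [exact: cvg_cst|exact: exprn_continuous].
by apply: cvgD; [exact: cvg_cst|apply: cvgM; [exact: cvg_cst|exact: cvg_id]].
Qed.

Let contH_pz q (h : R -> R) l f : continuous h -> smooth f ->
  contH (fun p => (- p.2) `^ q * h (zeta p) * ev l f p).
Proof.
move=> ch sf; apply: contHM; last exact: contH_ev.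
by apply: contHM; [exact: contH_ypow|apply: contH_comp => //; exact: contH_zeta].
Qed.

Let ybounded_pz M (G : V -> R) l f : ybounded M f -> ybounded M (fun p => G p * ev l f p).
Proof. by move=> yf p pM; rewrite (ybounded_ev l yf) ?mulr0. Qed.

(** In the cone zeta = k / (kap s^(3/2)): this turns the weight [pw m] into [pw (m + i)] and yields
    kap^(- i), while i! undoes the normalization by Gamma(i + 1). *)
Lemma JD_term i l f : tame f ->
  (JD (fun p => (- p.2) `^ (pw m) * zeta p ^+ i * ev l f p))%:C =
  (i`!%:R / kap ^+ i)%:C * Xf (- m%:R + (m + i)%:R) (mulp (pw (m + i)) l) f.
Proof.
move=> tf; have [sf [M yf]] := tf.
have zE : - m%:R + (m + i)%:R = i%:R :> C by rewrite natrD addrA addNr add0r.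
have := JD_Xf hn hb i (mulp (pw (m + i)) l) tf; rewrite zE.
set F := fun p : V => (- p.2) `^ (pw m) * zeta p ^+ i * ev l f p.
have -> : JD (fun p => kfun b p ^+ i * ev (mulp (pw (m + i)) l) f p) = kap ^+ i * JD F.
  rewrite -(@JD_scale _ F M); last exact: ybounded_pz.
    apply: eq_JD => p Dp; have p0 := Dneg Dp.
    rewrite /kfun (ufunE hb p0) ev_mulp// /F !exprMn.
    have -> : (- p.2) `^ (pw m) = s32 p ^+ i * (- p.2) `^ (pw (m + i)).
      rewrite /s32 -powR_mulrn ?powR_ge0// -powRrM -powRDp ?oppr_gt0//.
      by congr (_ `^ _); rewrite /pw natrD; ring.
    ring.
  by apply: (@contH_pz (pw m) (fun z => z ^+ i)) => //; exact: exprn_continuous.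
move=> E; rewrite rmorphM fmorphV /= mulrAC -E rmorphM /= mulrC mulrA mulVf ?mul1r//.
by rewrite fmorph_eq0 expf_neq0.
Qed.

Definition reg l f : R := JD (fun p => (- p.2) `^ (pw m) * Hc (zeta p) * ev l f p).

Lemma reg_Tricomi f : tame f -> (reg (Tt one_t) f)%:C =
  (creg * (2 / kap ^+ 2))%:C * Xf (- m%:R + m.+2%:R) (mulp (pw m.+2 - 2) one_t) f +
  (Xf (- m%:R + m%:R) (mulp (pw m) (Tt one_t)) f +
  ((ha1 R m / kap)%:C * Xf (- m%:R + m.+1%:R) (mulp (pw m.+1) (Tt one_t)) f +
   (ha2 R m * (2 / kap ^+ 2))%:C * Xf (- m%:R + m.+2%:R) (mulp (pw m.+2) (Tt one_t)) f)).
Proof.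
move=> tf; have [sf [M yf]] := tf.
set W := fun i (p : V) => (- p.2) `^ (pw m) * zeta p ^+ i * ev (Tt one_t) f p.
set U := fun p : V => (- p.2) `^ (pw m) * Th0 m (zeta p) * ev (Tt one_t) f p.
have cW i : contH (W i).
  by apply: (@contH_pz (pw m) (fun z => z ^+ i)) => //; exact: exprn_continuous.
have yW i : ybounded M (W i) by exact: ybounded_pz.
have cU : contH U.
  by apply: contH_pz => // z; exact: is_derive_cont (is_derive_Th0 m z).
have yU : ybounded M U by exact: ybounded_pz.
have c2 : contH (fun p => ha2 R m * W 2 p + 0).
  by apply: contHD; [apply: contHM => //; exact: contH_cst|exact: contH_cst].
have y2 : ybounded M (fun p => ha2 R m * W 2 p + 0) by move=> p pM; rewrite yW// mulr0 addr0.
have c1 : contH (fun p => ha1 R m * W 1%N p + (ha2 R m * W 2 p + 0)).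
  by apply: contHD => //; apply: contHM => //; exact: contH_cst.
have y1 : ybounded M (fun p => ha1 R m * W 1%N p + (ha2 R m * W 2 p + 0)).
  by move=> p pM; rewrite !yW// !mulr0 !addr0.
have c3 : contH (fun p => 1 * W 0%N p + (ha1 R m * W 1%N p + (ha2 R m * W 2 p + 0))).
  by apply: contHD => //; apply: contHM => //; exact: contH_cst.
have y3 : ybounded M (fun p => 1 * W 0%N p + (ha1 R m * W 1%N p + (ha2 R m * W 2 p + 0))).
  by move=> p pM; rewrite !yW// !mulr0 !addr0.
have -> : reg (Tt one_t) f = JD U + (JD (W 0%N) + (ha1 R m * JD (W 1%N) + ha2 R m * JD (W 2))).
  transitivity (JD (fun p => 1 * U p + (1 * W 0%N p + (ha1 R m * W 1%N p + (ha2 R m * W 2 p + 0))))).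
    apply: eq_JD => p Dp; rewrite /U /W /Hc /T2; ring.
  rewrite (@JD_linear 1 U _ M M)// (@JD_linear 1 (W 0%N) _ M M)// (@JD_linear _ (W 1%N) _ M M)//.
  rewrite (@JD_linear _ (W 2) (fun=> 0) M M)//; last exact: contH_cst.
  by rewrite JD0 addr0 !mul1r.
have -> : JD U = JD (fun p => creg * ((- p.2) `^ (pw m) * zeta p ^+ 2 * ev (mulp (- 2) one_t) f p)).
  rewrite [LHS](green_remainder tf); apply: eq_JD => p Dp; have p0 := Dneg Dp.
  rewrite ev_mulp// [X in creg * (X * _ * _)]powRDp ?oppr_gt0//; ring.
rewrite (@JD_scale _ _ M); last 2 first.
- by apply: (@contH_pz (pw m) (fun z => z ^+ 2)) => //; exact: exprn_continuous.
- exact: ybounded_pz.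
have E0 : (JD (W 0%N))%:C = Xf (- m%:R + m%:R) (mulp (pw m) (Tt one_t)) f.
  by rewrite [LHS](JD_term 0 (Tt one_t) tf) addn0 expr0 divr1 fact0 mulr1n rmorph1 mul1r.
have E1 : (JD (W 1%N))%:C = (kap^-1)%:C * Xf (- m%:R + m.+1%:R) (mulp (pw m.+1) (Tt one_t)) f.
  by rewrite [LHS](JD_term 1 (Tt one_t) tf) addn1 expr1 (_ : 1`! = 1%N)// mulr1n div1r.
have E2 : (JD (W 2))%:C = (2 / kap ^+ 2)%:C * Xf (- m%:R + m.+2%:R) (mulp (pw m.+2) (Tt one_t)) f.
  by rewrite [LHS](JD_term 2 (Tt one_t) tf) addn2 (_ : 2`! = 2%N).
have E3 : (JD (fun p => (- p.2) `^ (pw m) * zeta p ^+ 2 * ev (mulp (- 2) one_t) f p))%:C =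
    (2 / kap ^+ 2)%:C * Xf (- m%:R + m.+2%:R) (mulp (pw m.+2 - 2) one_t) f.
  have -> : mulp (pw m.+2 - 2) one_t = mulp (pw m.+2) (mulp (- 2) one_t).
    by rewrite /mulp /=; congr [:: (_, _, _)]; rewrite !add0r addrC.
  by rewrite (JD_term 2 (mulp (- 2) one_t) tf) addn2 (_ : 2`! = 2%N).
have rd (x y : R) : (x + y)%:C = x%:C + y%:C by rewrite rmorphD.
have rc (x y : R) : (x * y)%:C = x%:C * y%:C by rewrite rmorphM.
rewrite 3!rd !(rc creg) !(rc (ha1 R m)) !(rc (ha2 R m)) E3 E0 E1 E2.
by congr (_ + (_ + (_ + _))); exact: mulrA.
Qed.

(** The Taylor coefficients of the regular part continue the sequence d_j beyond m: both have
    consecutive quotients - (j + 1/6) (j + 5/6) / (j + 1), up to powers of [kap] and the factorials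
    of [JD_term]. *)
Lemma dcoef1 : dcoef m.+1 = dcoef m * (ha1 R m / kap).
Proof. by rewrite dcoefS /ha1; field; rewrite kapN0 nat1_neq0. Qed.

Let nat2_neq0 : (m%:R + 1 + 1 : R) != 0.
Proof. by rewrite natr1 natr1 pnatr_eq0. Qed.

Lemma dcoef2 : dcoef m.+2 = dcoef m * (ha2 R m * (2 / kap ^+ 2)).
Proof.
rewrite dcoefS dcoef1 /ha1 /ha2 -natr1; field.
by do ?[apply/andP; split] => //; move: nat2_neq0 (nat1_neq0 m) => *; rewrite gt_eqF//; have : (0 : R) <= m%:R by []; lra.
Qed.

(** [telescope] with N = m + 2 leaves one term of order 2; as p (p - 1) = (9/4) (m + 13/6) (m +
    17/6) for p = [pw m.+2], its coefficient is opposite to the one coming from [creg]. *)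
Lemma regular_cancel f : tame f ->
  \sum_(j < m) (dcoef j)%:C * Xf (- m%:R + (j : nat)%:R) (mulp (pw j) (Tt one_t)) f +
  (dcoef m * reg (Tt one_t) f)%:C = (ellv f)%:C.
Proof.
move=> tf; rewrite [X in _ + X]rmorphM /= reg_Tricomi//.
have := telescope m.+2 tf; rewrite 3!big_ord_recr /= dcoef2 dcoef1.
have e : dcoef m * (ha2 R m * (2 / kap ^+ 2)) * (pw m.+2 * (pw m.+2 - 1)) =
    - (dcoef m * (creg * (2 / kap ^+ 2))).
  by rewrite /creg /pw -(addn2 m) natrD; move: (ha2 R m) => h; field.
rewrite {}e; move: (ha1 R m / kap) (ha2 R m * _) (creg * _) => a1 a2 a3.
move: (ellv f)%:C => el; set Y := Xf _ [:: _] f; set L0 := Xf _ (mulp (pw m) _) f.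
set L1 := Xf _ (mulp (pw m.+1) _) f; set L2 := Xf _ (mulp (pw m.+2) _) f; set S := \sum_(_ < _) _.
rewrite rmorphN !rmorphM /= => E.
have -> : el = el + - ((dcoef m)%:C * a3%:C) * Y + (dcoef m)%:C * a3%:C * Y by rewrite mulNr addrNK.
rewrite -E; ring.
Qed.

End assembly.

(** * Pairing of [Eminus] with test functions *)

Section representation.
Variables (R : realType) (m n : nat) (hn : n = (2 * m + 1)%N) (b : R) (hb : b < 0).
Local Notation V := ('rV[R]_n * R)%type.
Local Notation C := R[i].
Local Notation Xf := (Xf m b).
Local Notation JD := (@JD R n b).
Local Notation kap := (kap b).
Local Notation zeta := (@zeta R n b).
Local Notation B := (m%:R + 1 / 6 : R).
Local Notation Vmu := (tuple_measure (@lebesgue_measure R) n \x @lebesgue_measure R)%E.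
Local Notation one_t := (@one_t R n).
Local Notation dcoef := (dcoef b).
Local Notation reg := (@reg R m n b).
Local Notation pw := (@pw R).
Local Open Scope complex_scope.

Let kap0 : 0 < kap := kap_gt0 hb.

Let Dneg (p : V) : Dminus b p -> p.2 < 0.
Proof. by case=> h _; exact: lt_trans hb. Qed.

Let Dzeta (p : V) : Dminus b p -> 0 < zeta p.
Proof. by move=> Dp; apply/(DminusE hb) => //; case: Dp. Qed.

Lemma u_sub_v (p : V) : (ufun b p - vfun b p) / 9 = kap * s32 p.
Proof. by rewrite /ufun /vfun /kap /s32; field. Qed.

Lemma vfunE (p : V) : p.2 < 0 -> - vfun b p / 9 = kap * s32 p * (1 + zeta p).
Proof.
move=> p0; transitivity (- ufun b p / 9 + (ufun b p - vfun b p) / 9); first by field.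
by rewrite (ufunE hb p0) u_sub_v; ring.
Qed.

Lemma delta_weight j (p : V) : p.2 < 0 ->
  ((ufun b p - vfun b p) / 9) `^ (- j%:R - 1 / 6) = kap `^ (- j%:R - 1 / 6) * (- p.2) `^ (pw j).
Proof.
move=> p0; rewrite u_sub_v powRM ?(ltW kap0) ?(ltW (s32_gt0 p0))//; congr (_ * _).
by rewrite /s32 -powRrM; congr (_ `^ _); rewrite /pw; field.
Qed.

Lemma regular_weight (p : V) : Dminus b p ->
  (- vfun b p / 9) `^ (- m%:R - 1 / 6) *
    hypergeometric (1 / 6) (m%:R + 1 / 6) (m%:R + 1) (ufun b p / vfun b p) =
  kap `^ (- m%:R - 1 / 6) * ((- p.2) `^ (pw m) * Hc m (zeta p)).
Proof.
move=> Dp; have p0 := Dneg Dp; have z0 := Dzeta Dp; have s0 := s32_gt0 p0.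
have w0 : 0 < 1 + zeta p by rewrite addr_gt0.
have -> : ufun b p / vfun b p = Hz (zeta p).
  have -> : ufun b p = - (9 * (kap * s32 p * zeta p)) by rewrite -(ufunE hb p0); field.
  have -> : vfun b p = - (9 * (kap * s32 p * (1 + zeta p))) by rewrite -(vfunE p0); field.
  rewrite /Hz; move: (gt_eqF kap0) (gt_eqF s0) (gt_eqF w0) => h1 h2 h3.
  by field; rewrite h1 h2 h3.
have hks : 0 <= kap * s32 p by rewrite mulr_ge0// ltW.
rewrite HcE// /H0 /Hw hypergeometricE vfunE// (powRM _ hks (ltW w0)) (powRM _ (ltW kap0) (ltW s0)).
have -> : s32 p `^ (- m%:R - 1 / 6) = (- p.2) `^ (pw m).
  by rewrite /s32 -powRrM; congr (_ `^ _); rewrite /pw; field.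
by rewrite -opprD !mulrA.
Qed.

Definition cr (j : nat) : R := rgamma (j%:R + 5 / 6) * rgamma (j%:R + 1 / 6) /
  (rgamma (5 / 6) * rgamma (1 / 6) * rgamma (j%:R + 1)).

Lemma ccoef_real j : ccoef R j = (cr j)%:C.
Proof.
rewrite /ccoef /cr fmorph_div !rmorphM /= -!Gamma_real.
by rewrite !(rmorphD, rmorphM, fmorphV, rmorph_nat, rmorph1).
Qed.

(** Both sides satisfy the same recursion in j, by the functional equation of Gamma. *)
Lemma dcoef_cr j : dcoef j = (-1) ^+ j * cr j / kap ^+ j.
Proof.
have g5 : 0 < rgamma (5 / 6 : R) by apply: rgamma_gt0; rewrite divr_gt0.
have g1 : 0 < rgamma (1 / 6 : R) by apply: rgamma_gt0; rewrite divr_gt0.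
elim: j => [|j ih].
  rewrite /dcoef big_ord0 /cr mulr0n !add0r rgamma1 !expr0 mulr1 divr1 mul1r divff//.
  by rewrite mulf_neq0// gt_eqF.
have j0 : (0 : R) <= j%:R by [].
have gj : 0 < rgamma (j%:R + 1 : R) by apply: rgamma_gt0; rewrite ltr_wpDl.
have S (x : R) : 0 < x -> rgamma (j.+1%:R + x) = (j%:R + x) * rgamma (j%:R + x).
  by move=> x0; rewrite -natr1 addrAC rgammaS// ltr_wpDl.
rewrite dcoefS ih /cr !S ?divr_gt0// !exprS.
move: (rgamma (j%:R + 1)) (rgamma (j%:R + 5 / 6)) (rgamma (j%:R + 1 / 6)) gj (rgamma (5 / 6)) g5 (rgamma (1 / 6)) g1.
move=> x1 x2 x3 x10 x4 x40 x5 x50.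
have kj : kap ^+ j != 0 by rewrite expf_neq0// gt_eqF.
move: (kap ^+ j) kj ((-1) ^+ j) => kj kj0 sj.
by field; do ?[apply/andP; split] => //; rewrite ?gt_eqF// ltr_wpDl.
Qed.

Lemma kap_split j : kap `^ (- j%:R - 1 / 6) = kap `^ (- (1 / 6)) / kap ^+ j.
Proof.
by rewrite addrC powRDp// [kap `^ (- j%:R)]powRN powR_mulrn// ltW.
Qed.

Lemma reg_scale c l (f : V -> R) : tame f ->
  JD (fun p => c * ((- p.2) `^ (pw m) * Hc m (zeta p) * ev l f p)) = c * reg l f.
Proof.
move=> [sf [M yf]]; apply: (@JD_scale R n b hb _ _ M).
  apply: contHM; last exact: contH_ev.
  by apply: contHM; [exact: contH_ypow|apply: contH_comp; [exact: continuous_Hc|exact: contH_zeta]].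
by move=> p pM; rewrite (ybounded_ev l yf) ?mulr0.
Qed.

Lemma regular_distributionE l (f : V -> R) (g : V -> R) : tame f -> (forall p, Dminus b p -> g p = ev l f p) ->
  regular_distribution (fun p : V =>
      (- vfun b p / 9) `^ (- m%:R - 1 / 6) *
      hypergeometric (1 / 6) (m%:R + 1 / 6) (m%:R + 1) (ufun b p / vfun b p) *
      \1_(Dminus b) p) g = (kap `^ (- m%:R - 1 / 6) * reg l f)%:C.
Proof.
move=> tf E; rewrite -reg_scale//; set h := fun p : V => _ * \1_(Dminus b) p.
have -> : regular_distribution h g = cintegral Vmu setT (fun w => (h (vpt w) * g (vpt w))%:C).
  by rewrite /regular_distribution /vintegral preimage_setT.
rewrite cintegral_real//; congr (_ %:C); rewrite [RHS]Rintegral_mkcond.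
apply: eq_Rintegral => w _; rewrite patchE /h; case: ifPn => [/set_mem Dw|nD].
  rewrite indicE mem_set// mulr1 E// regular_weight//; ring.
by rewrite indicE memNset ?mulr0 ?mul0r// => Dw; move: nD; rewrite mem_set.
Qed.

Definition AK : R := 1 / (2 `^ (1 / 3) * 3 `^ (1 / 3) * pi ^+ m) * kap `^ (- (1 / 6)).

(** Formulated for any g that coincides with [ev l f] on the cone, it serves for a test function
    itself, for [Tricomi f], and with empty l for functions vanishing on the cone. *)
Lemma EminusE l (f : V -> R) (g : V -> R) : tame f -> (forall p, Dminus b p -> g p = ev l f p) ->
  Eminus b m g = AK%:C * (\sum_(j < m) (dcoef j)%:C * Xf (- m%:R + (j : nat)%:R) (mulp (pw j) l) f +
    (dcoef m * reg l f)%:C).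
Proof.
move=> tf E; rewrite /Eminus (regular_distributionE tf E) /mul_distribution.
have D j : (j < m)%N -> delta_u b (m - j - 1) (fun p => ((ufun b p - vfun b p) / 9) `^ (- j%:R - 1 / 6) * g p) =
    (kap `^ (- (1 / 6)) / kap ^+ j)%:C * Xf (- m%:R + j%:R) (mulp (pw j) l) f.
  move=> jm; rewrite (@delta_uE R m n hn b hb _ (scalt (kap `^ (- j%:R - 1 / 6)) (mulp (pw j) l)) f)//; last 2 first.
  - by rewrite -subnDA addn1 ltn_subrL /= (leq_ltn_trans (leq0n j) jm).
  - by move=> p Dp; have p0 := Dneg Dp; rewrite delta_weight// ev_scal ev_mulp// E// mulrA.
  (* For q = m - j - 1 the exponent - q - 1 is j - m. *)
  have -> : - (m - j - 1).+1%:R = - m%:R + j%:R :> C.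
    by rewrite subn1 prednK ?subn_gt0// natrB ?(ltnW jm)// opprB addrC.
  rewrite (Xf_scal hn hb)// ?kap_split// ReD ReNn.
  by apply: (@lt_le_trans _ _ (- m%:R)); [rewrite ltrN2 ltr_nat|rewrite lerDl].
rewrite [Acoef R m * _](_ : _ = AK%:C * \sum_(j < m) (dcoef j)%:C * Xf (- m%:R + (j : nat)%:R) (mulp (pw j) l) f); last first.
  rewrite /Acoef !mulr_sumr; apply: eq_bigr => j _; rewrite D// ccoef_real dcoef_cr /AK.
  rewrite !rmorphM !rmorphXn rmorphN rmorph1 /=; ring.
rewrite [RHS]mulrDr; congr (_ + _); rewrite ccoef_real dcoef_cr kap_split /Acoef /AK.
rewrite !rmorphM !rmorphXn rmorphN rmorph1 /=; ring.
Qed.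

(** kap = (4/3)^2 (- b)^(3/2), so kap^(1/6) = (4/3)^(1/3) (- b)^(1/4), and 2^(1/3) 3^(1/3)
    (4/3)^(1/3) = 8^(1/3) = 2. This is the origin of the constant A_m. *)
Lemma AK_value : AK * (2 * pi ^+ m * (- b) `^ (1 / 4)) = 1.
Proof.
have b0 : 0 < - b by rewrite oppr_gt0.
have q0 : 0 < (- b) `^ (1 / 4) by exact: powR_gt0.
have K : kap `^ (1 / 6) = (4 / 3) `^ (1 / 3) * (- b) `^ (1 / 4).
  have -> : kap = (4 / 3) `^ 2%:R * (- b) `^ (3 / 2).
    by rewrite powR_mulrn ?divr_ge0// /kap /apar; field.
  rewrite powRM ?powR_ge0// -!powRrM; congr (_ `^ _ * _ `^ _); by field.
have e : 2 `^ (1 / 3) * 3 `^ (1 / 3) * (4 / 3) `^ (1 / 3) = 2 :> R.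
  rewrite -!powRM ?mulr_ge0 ?divr_ge0// (_ : 2 * 3 * (4 / 3) = 2 `^ 3%:R :> R).
    by rewrite -powRrM (_ : 3%:R * (1 / 3) = 1 :> R) ?powRr1//; field.
  by rewrite powR_mulrn//; field.
have p0 : 0 < (pi : R) ^+ m by rewrite exprn_gt0// pi_gt0.
rewrite /AK powRN K; move: e.
have : 0 < 2 `^ (1 / 3) :> R by exact: powR_gt0.
have : 0 < 3 `^ (1 / 3) :> R by exact: powR_gt0.
have : 0 < (4 / 3) `^ (1 / 3) :> R by apply: powR_gt0; rewrite divr_gt0.
move: (2 `^ _) (3 `^ _) ((4 / 3) `^ _) (pi ^+ m) ((- b) `^ _) p0 q0 => x y z p q p0 q0 z0 y0 x0 e.
rewrite -e; by field; do ?[apply/andP; split]; rewrite gt_eqF.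
Qed.

Lemma Tricomi_ev (f : V -> R) (p : V) : p.2 < 0 -> Tricomi f p = ev (Tt one_t) f p.
Proof.
move=> p0; rewrite ev_T// /Tricomi; congr (_ * _ + _).
  by apply: eq_bigr => i _; rewrite evE big_seq1 /= powRr0 !mul1r.
by rewrite evE /= !big_cons big_nil /= !mulr0 !powRr0 !(mul0r, mulr0, oppr0, addr0, mul1r).
Qed.

Lemma test_tame (f : V -> R) : test_function f -> tame f.
Proof. by move=> tf; split; [case: tf|exact: test_function_ybounded]. Qed.

Lemma ev_one (f : V -> R) (p : V) : p.2 < 0 -> ev one_t f p = f p.
Proof. by move=> p0; rewrite evE big_seq1 /= powRr0 !mul1r. Qed.

Let E_test (f : V -> R) : test_function f -> Eminus b m f =
  AK%:C * (\sum_(j < m) (dcoef j)%:C * Xf (- m%:R + (j : nat)%:R) (mulp (pw j) one_t) f +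
    (dcoef m * reg one_t f)%:C).
Proof.
by move=> tf; apply: EminusE; [exact: test_tame|move=> p Dp; rewrite ev_one//; exact: Dneg].
Qed.

Lemma Eminus_Tricomi (f : V -> R) : test_function f -> Eminus b m (Tricomi f) = (f (0, b))%:C.
Proof.
move=> /test_tame tf; rewrite (@EminusE (Tt one_t) f)//; last first.
  by move=> p Dp; rewrite Tricomi_ev//; exact: Dneg.
by rewrite (regular_cancel hn hb tf) -rmorphM /= /ellv mulrA AK_value mul1r.
Qed.

Let Rez (j : nat) : - m.+1%:R < complex.Re (- m%:R + j%:R : C).
Proof.
rewrite ReD ReNn; apply: (@lt_le_trans _ _ (- m%:R)); first by rewrite ltrN2 ltr_nat.
by rewrite lerDl.
Qed.

Let contH_reg f : smooth f ->
  contH (fun p => (- p.2) `^ (pw m) * Hc m (zeta p) * ev one_t f p).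
Proof.
move=> sf; apply: contHM; last exact: contH_ev.
by apply: contHM; [exact: contH_ypow|apply: contH_comp; [exact: continuous_Hc|exact: contH_zeta]].
Qed.

Lemma Eminus_linear (c : R) (f g : V -> R) : test_function f -> test_function g ->
  Eminus b m (fun p => c * f p + g p) = c%:C * Eminus b m f + Eminus b m g.
Proof.
move=> tf tg; rewrite (E_test tf) (E_test tg).
move/test_tame: tf => tf; move/test_tame: tg => tg.
have [sf [M yf]] := tf; have [sg [N yg]] := tg.
have th : tame (fun p => c * f p + g p).
  split; first exact: smooth_linear.
  exists (Order.max M N) => p pM; rewrite yf ?yg ?mulr0 ?addr0//.
    by rewrite (lt_le_trans pM)// lerN2 le_max lexx orbT.
  by rewrite (lt_le_trans pM)// lerN2 le_max lexx.
rewrite (@EminusE one_t (fun p => c * f p + g p))//; last by move=> p Dp; rewrite ev_one//; exact: Dneg.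
have -> : reg one_t (fun p => c * f p + g p) = c * reg one_t f + reg one_t g.
  rewrite /reg -(@JD_linear R n b hb _ _ _ M N); last 4 first.
  - exact: contH_reg.
  - by move=> p pM; rewrite (ybounded_ev _ yf) ?mulr0.
  - exact: contH_reg.
  - by move=> p pM; rewrite (ybounded_ev _ yg) ?mulr0.
  by apply: eq_JD => p _; rewrite ev_linear//; ring.
rewrite (eq_bigr (fun j : 'I_m => c%:C * ((dcoef j)%:C * Xf (- m%:R + (j : nat)%:R) (mulp (pw j) one_t) f) +
  (dcoef j)%:C * Xf (- m%:R + (j : nat)%:R) (mulp (pw j) one_t) g)); last first.
  move=> j _; rewrite (@Xf_linear R m n hn b hb c _ (mulp (pw j) one_t) (mulp (pw j) one_t) _ f g _ th tf tg _ (Rez j)).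
    by rewrite mulrDr mulrCA.
  by move=> p _; rewrite ev_linear.
rewrite big_split /= -mulr_sumr !rmorphM rmorphD rmorphM /=; ring.
Qed.

Lemma Eminus_vanish (f : V -> R) : test_function f -> (forall p, Dminus b p -> f p = 0) -> Eminus b m f = 0.
Proof.
move=> tf f0; rewrite (@EminusE [::] f f (test_tame tf)); last by move=> p /f0 ->; rewrite ev_nil.
rewrite big1 => [|j _]; last first.
  by rewrite (_ : mulp (pw j) [::] = [::])// (Xf_nil hn hb (test_tame tf) (Rez j)) mulr0.
rewrite (_ : reg [::] f = 0) ?mulr0 ?addr0 ?mulr0//.
by rewrite -(@JD0 R n b hb); apply: eq_JD => p _; rewrite ev_nil mulr0.
Qed.

(** A test function supported off the closure of the cone vanishes on the cone, hence is
    annihilated. *)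
Lemma support_Eminus : distribution_support (Eminus b m) `<=` closure (@Dminus R n b).
Proof.
move=> p hp; apply: contrapT => np.
have oU : open (~` closure (@Dminus R n b)) by exact/closed_openC/closed_closure.
have [f [tf sf]] := hp _ oU np; apply/negP; rewrite negbK; apply/eqP; apply: Eminus_vanish => // q Dq.
apply/eqP/negPn/negP => fq; have : fun_support f q by apply: subset_closure.
by move=> /sf; apply; exact: subset_closure.
Qed.

Lemma JD_bound (G : V -> R) l (K : set V) : contH G -> compact K ->
  exists M : R, forall f, smooth f -> fun_support f `<=` K -> forall e : R, 0 <= e ->
    (forall a p, a \in l -> `|pderiv a.2 f p| <= e) -> `|JD (fun p => G p * ev l f p)| <= M * e.
Proof.
move=> cG /compact_bounded[M [_ hM]]; set N := `|M| + 1.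
have yN f : fun_support f `<=` K -> ybounded N f.
  move=> sK p pM; apply/eqP/negPn/negP => fp.
  have : `|p| <= N.
    apply: (hM N); first by rewrite (le_lt_trans (ler_norm _))// ltrDl.
    by apply: sK; apply: subset_closure.
  rewrite prod_normE/= ge_max => /andP[_]; apply/negP; rewrite -ltNge.
  by rewrite -normrN (lt_le_trans _ (ler_norm _))// ltrNr.
(* A continuous weight in y, at least 1 for y >= - N and 0 for y <= - N - 1, so that the majorant
   [Q] is integrable over the cone and independent of f. *)
pose cut (p : V) : R := ((p.2 + (N + 1)) + `|p.2 + (N + 1)|) / 2.
pose S (p : V) : R := \sum_(a <- l) `|a.1.1| * (- p.2) `^ a.1.2.
have ct : contH (fun p : V => p.2 + (N + 1)) by apply: contHD; [exact: contH_y|exact: contH_cst].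
have cn (F : V -> R) : contH F -> contH (fun p => `|F p|).
  by move=> cF; apply: (contH_comp (h := fun x : R => `|x|)) => //; exact: norm_continuous.
have cc : contH cut by apply: contHM; [apply: contHD => //; exact: cn|exact: contH_cst].
have cS : contH S.
  by apply: contH_sum => a; apply: contHM; [exact: contH_cst|exact: contH_ypow].
have S0 p : 0 <= S p by apply: sumr_ge0 => a _; rewrite mulr_ge0// powR_ge0.
have cut0 p : 0 <= cut p.
  by rewrite /cut; have := ler_norm (- (p.2 + (N + 1))); rewrite normrN => h; lra.
have cut1 p : - N <= p.2 -> 1 <= cut p.
  by move=> h; rewrite /cut ger0_norm; lra.
pose Q (p : V) : R := `|G p| * S p * cut p.
have cQ : contH Q by apply: contHM => //; apply: contHM => //; exact: cn.
have yQ : ybounded (N + 1) Q.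
  move=> p h; rewrite /Q (_ : cut p = 0) ?mulr0// /cut ltr0_norm ?subrr ?mul0r//; lra.
exists (JD Q) => f sf sK e e0 he.
have yf := yN f sK; have mD := @measurable_Dv R n b hb.
have cF : contH (fun p => G p * ev l f p) by apply: contHM => //; exact: contH_ev.
have yF : ybounded N (fun p => G p * ev l f p) by move=> p h; rewrite (ybounded_ev l yf) ?mulr0.
rewrite mulrC -(JD_scale hb e cQ yQ).
apply: le_trans (le_normr_Rintegral mD (Dv_integrable hb cF yF)) _.
apply: le_Rintegral => //.
- apply: (@Dv_integrable R n b hb (fun p => `|G p * ev l f p|) N); first exact: cn.
  by move=> p h; rewrite yF ?normr0.
- apply: (@Dv_integrable R n b hb (fun p => e * Q p) (N + 1)).
    by apply: contHM => //; exact: contH_cst.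
  by move=> p h; rewrite yQ ?mulr0.
- move=> w Dw; have p0 := Dneg Dw; have [h|h] := ltP (vpt w).2 (- N).
    have E0 : G (vpt w) * ev l f (vpt w) = 0 by exact: yF.
    rewrite /= E0 normr0; apply: mulr_ge0 => //.
    exact: (mulr_ge0 (mulr_ge0 (normr_ge0 _) (S0 _)) (cut0 _)).
  rewrite /= normrM /Q; apply: (@le_trans _ _ (`|G (vpt w)| * (S (vpt w) * e))).
    by rewrite ler_wpM2l//; apply: ev_le => // a al; exact: he.
  have c1 := cut1 _ h; have := mulr_ge0 (mulr_ge0 (normr_ge0 (G (vpt w))) (S0 (vpt w))) e0.
  move: (`|G _|) (S _) (cut _) c1 => x y z z1 h1; nra.
Qed.

(** The seminorm estimate of [distribution_on] restricted to nonnegative bounds, a form stable under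
    sums and complex multiples. *)
Definition bdd (K : set V) (E : (V -> R) -> C) := exists (N : nat) (M : R),
  forall f, test_function f -> fun_support f `<=` K -> forall e : R, 0 <= e ->
    (forall s p, (size s <= N)%N -> `|pderiv s f p| <= e) -> `|E f| <= (M * e)%:C.

Lemma bddD K E F : bdd K E -> bdd K F -> bdd K (fun f => E f + F f).
Proof.
move=> [N1 [M1 h1]] [N2 [M2 h2]]; exists (maxn N1 N2), (M1 + M2) => f tf sf e e0 he.
apply: (le_trans (ler_normD _ _)); rewrite mulrDl rmorphD /= lerD//.
  by apply: h1 => // s p sN; apply: he; rewrite leq_max sN.
by apply: h2 => // s p sN; apply: he; rewrite leq_max sN orbT.
Qed.

Lemma bddZ K c E : bdd K E -> bdd K (fun f => c * E f).
Proof.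
move=> [N [M h]]; exists N, (Normc.normc c * M) => f tf sf e e0 he.
by rewrite normrM -mulrA rmorphM /= ler_wpM2l//; exact: h.
Qed.

Lemma bdd_sum K k (E : nat -> (V -> R) -> C) : (forall j, bdd K (E j)) ->
  bdd K (fun f => \sum_(j < k) E j f).
Proof.
move=> h; elim: k => [|k [N [M ih]]].
  exists 0%N, 0 => f _ _ e _ _; by rewrite big_ord0 normr0 mul0r.
have [N' [M' hh]] := bddD (ex_intro _ N (ex_intro _ M ih)) (h k).
by exists N', M' => f tf sf e e0 he; rewrite big_ord_recr; exact: hh.
Qed.

Lemma normC_real (x : R) : `|x%:C| = (`|x|)%:C :> C.
Proof. by rewrite -normcR. Qed.

Lemma bdd_JD K G l : contH G -> compact K -> bdd K (fun f => (JD (fun p => G p * ev l f p))%:C).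
Proof.
move=> cG cK; have [M h] := JD_bound l cG cK.
exists (\max_(a <- l) size a.2), M => f [sf cf] sK e e0 he; rewrite normC_real lecR.
by apply: h => // a p al; apply: he; exact: leq_bigmax_seq.
Qed.

(** At - m + j the shift by [Nm] gives the natural exponent j + 2, so [Xf] is a constant times an
    integral against the continuous weight k^(j + 2). *)
Lemma bdd_Xf K j l : compact K -> bdd K (Xf (- m%:R + j%:R) l).
Proof.
move=> cK; rewrite /Xf; apply: bddZ.
pose G (p : V) := (kap * s32 p * zeta p) ^+ (j + 2).
have cG : contH G.
  apply: contHX; apply: contHM; last exact: contH_zeta.
  by apply: contHM; [exact: contH_cst|exact: contH_s32].
have [N [M h]] := bdd_JD (iter (Nm m) (@Sl R n) l) cG cK.
exists N, M => f tf sf e e0 he; have := h f tf sf e e0 he.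
have -> : - m%:R + j%:R + (Nm m)%:R = ((j + 2)%:R)%:C :> C.
  by rewrite rmorph_nat /Nm -(addn2 m) !natrD; ring.
rewrite (Ic_nat hb) (@eq_JD R n b (fun p => kfun b p ^+ (j + 2) * _) (fun p => G p * ev (iter (Nm m) (@Sl R n) l) f p))//.
by move=> p Dp; rewrite /kfun (ufunE hb (Dneg Dp)).
Qed.

Lemma distribution_Eminus : distribution_on (Eminus b m : (V -> R) -> C).
Proof.
split; first exact: Eminus_linear.
move=> K cK.
have : bdd K (fun f => AK%:C * (\sum_(j < m) (dcoef j)%:C * Xf (- m%:R + (j : nat)%:R) (mulp (pw j) one_t) f +
    (dcoef m)%:C * (reg one_t f)%:C)).
  apply: bddZ; apply: bddD.
    by apply: (@bdd_sum K m (fun j f => (dcoef j)%:C * Xf (- m%:R + j%:R) (mulp (pw j) one_t) f)) => j; apply: bddZ; exact: bdd_Xf.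
  apply: bddZ; apply: (@bdd_JD K (fun p => (- p.2) `^ (pw m) * Hc m (zeta p))) => //.
  by apply: contHM; [exact: contH_ypow|apply: contH_comp; [exact: continuous_Hc|exact: contH_zeta]].
move=> [N [M h]]; exists N, M => f tf sK e he; rewrite E_test//.
have -> : (dcoef m * reg one_t f)%:C = (dcoef m)%:C * (reg one_t f)%:C by rewrite rmorphM.
(* The bound is nonnegative because it dominates |f| at a point. *)
by apply: h => //; apply: le_trans (he [::] 0 isT); exact: normr_ge0.
Qed.

End representation.

Theorem theorem6p1 (R : realType) (m n : nat) (b : R) (hm : (1 <= m)%N)
    (hn : n = (2 * m + 1)%N) (hb : b < 0) :
  @fundamental_solution R n b (@Eminus R n b m) /\
  distribution_support (@Eminus R n b m) `<=` closure (@Dminus R n b).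
Proof.
split; last exact: support_Eminus.
by split; [exact: distribution_Eminus|move=> f tf; exact: Eminus_Tricomi].
Qed.
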